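(* Let $n,m\ge 1$ be integers, $q>0$, and let $\overline{B_q}\subset\mathbb{R}^m$ be the closed ball of radius $q$ centered at the origin. Let $W:\overline{B_q}\to[0,\infty)$ satisfy: (H1) $W\ge 0$ and $W(0)=0$; (H2) $W$ is lower semicontinuous and bounded on $\overline{B_q}$; (H3) $W(u)=W_{\mathrm{rad}}(|u|)+W_0(u)$ for all $u\in\overline{B_q}$, where $W_{\mathrm{rad}}:[0,q]\to[0,\infty)$ is a nondecreasing, lower semicontinuous function and $W_0:\overline{B_q}\to[0,\infty)$ is a function such that $W_0(r\xi)\le W_0(s\xi)$ for all $0\le r\le s\le q$ and all unit vectors $\xi\in\mathbb{R}^m$; (H4) $W_{\mathrm{rad}}(s)>0$ for all $s\in(0,q]$, and $I_q:=\int_0^q\frac{ds}{\sqrt{W_{\mathrm{rad}}(s)}}<\infty$. Let $\Omega\subset\mathbb{R}^n$ be open and let $u\in W^{1,2}_{\mathrm{loc}}(\Omega;\mathbb{R}^m)$ be such that $\|u\|_{L^\infty(\Omega;\mathbb{R}^m)}\le q$ and $u$ is a local minimizer of $E$ for perturbations bounded by $q$ (see context). Then $u(x)=0$ for every $x\in\Omega$ such that $d(x,\partial\Omega)\ge(4n+\sqrt2)\,I_q$.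
   Context: For open $\omega\subset\mathbb{R}^n$ and $v\in W^{1,2}(\omega;\mathbb{R}^m)$ with $|v|\le q$ a.e., $E_\omega(v):=\int_\omega\big[\frac12|\nabla v|^2+W(v)\big]\,dx$. Local minimizer for perturbations bounded by $q$: for every bounded open set $\omega$ with Lipschitz boundary such that $\overline\omega\subset\Omega$, and every $v=u+\xi$ with $\xi\in W^{1,2}_0(\omega;\mathbb{R}^m)$ and $\|v\|_{L^\infty(\omega;\mathbb{R}^m)}\le q$, one has $E_\omega(u)\le E_\omega(v)$. Such a $u$ has a continuous representative in $\Omega$, with which it is identified. $d(x,\partial\Omega)$ is the Euclidean distance from $x$ to $\partial\Omega$ (equal to $+\infty$ if $\partial\Omega=\emptyset$). *)

(* Defs.v *)
From HB Require Import structures.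
From mathcomp Require Import all_boot all_order all_algebra.
From mathcomp Require Import all_classical all_reals all_analysis.
Set Implicit Arguments.
Unset Strict Implicit.
Unset Printing Implicit Defensive.
Import Order.TTheory GRing.Theory Num.Theory.
Import numFieldNormedType.Exports.
Local Open Scope classical_set_scope.
Local Open Scope ring_scope.

(* The Borel sigma-algebra on matrices, as the product sigma-algebra: it is
   generated by the entries. *)
Definition mx_display : measure_display.
Proof. exact: default_measure_display. Qed.

Section measurable_matrix.
Context {R : realType} (m n : nat).

Definition mx_cylinder : set (set 'M[R]_(m, n)) :=
  [set A | exists i j, exists2 B : set R, measurable B &
     A = (fun M : 'M[R]_(m, n) => M i j) @^-1` B].

HB.instance Definition _ := @isMeasurable.Build mx_display 'M[R]_(m, n)
  <<s mx_cylinder >> (@sigma_algebra0 _ _ _) (@sigma_algebraC _ _)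
  (@sigma_algebra_bigcup _ _ _).

Lemma measurable_entry i j :
  measurable_fun [set: 'M[R]_(m, n)] (fun M : 'M[R]_(m, n) => M i j).
Proof.
by move=> _ B mB; rewrite setTI; apply: sub_sigma_algebra; exists i, j, B.
Qed.

Lemma measurable_fun_mx d (T : measurableType d) (f : T -> 'M[R]_(m, n)) :
  (forall i j, measurable_fun [set: T] (fun x => f x i j)) ->
  measurable_fun [set: T] f.
Proof.
move=> mf; apply: (@measurability _ _ _ _ _ _ mx_cylinder) => //.
move=> _ [_ [i [j [B mB ->]]] <-].
exact: mf.
Qed.

End measurable_matrix.

Section lebesgue_rV.
Context {R : realType}.

Definition rVcons n (p : R * 'rV[R]_n) : 'rV[R]_n.+1 :=
  \row_i oapp (p.2 ord0) p.1 (unlift ord0 i).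

Definition rVuncons n (v : 'rV[R]_n.+1) : R * 'rV[R]_n :=
  (v ord0 ord0, \row_i v ord0 (lift ord0 i)).

Lemma rVcons0 n p : @rVcons n p ord0 ord0 = p.1.
Proof.
by rewrite mxE unlift_none.
Qed.

Lemma rVconsS n p (i : 'I_n) : @rVcons n p ord0 (lift ord0 i) = p.2 ord0 i.
Proof.
by rewrite mxE liftK.
Qed.

Lemma rVconsK n : cancel (@rVcons n) (@rVuncons n).
Proof.
move=> [x v]; rewrite /rVuncons rVcons0; congr (_, _).
by apply/rowP => i; rewrite mxE rVconsS.
Qed.

Lemma measurable_rVcons n : measurable_fun [set: R * 'rV[R]_n] (@rVcons n).
Proof.
apply: measurable_fun_mx => i j; rewrite (ord1 i).
case: (unliftP ord0 j) => [k ->|->].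
  rewrite (_ : (fun _ => _) = (fun p : R * 'rV[R]_n => p.2 ord0 k)).
    apply: (measurableT_comp (measurable_entry ord0 k)); exact: measurable_snd.
  by apply/funext => p; rewrite rVconsS.
rewrite (_ : (fun _ => _) = fst); first exact: measurable_fst.
by apply/funext => p; rewrite rVcons0.
Qed.

Lemma measurable_rVuncons n : measurable_fun [set: 'rV[R]_n.+1] (@rVuncons n).
Proof.
apply/measurable_fun_pairP; split; first exact: measurable_entry.
apply: measurable_fun_mx => i j.
rewrite (_ : (fun _ => _) = (fun v : 'rV[R]_n.+1 => v ord0 (lift ord0 j))).
  exact: measurable_entry.
by apply/funext => v; rewrite mxE.
Qed.


(* One more dimension: the product of the Lebesgue measure of the line with the
   measure [mu], transported to row vectors by [rVcons]. *)
Section step.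
Local Open Scope ereal_scope.
Variables (n : nat) (mu : {sigma_finite_measure set 'rV[R]_n -> \bar R}).

Definition lebesgue_rVS (A : set 'rV[R]_n.+1) : \bar R :=
  (lebesgue_measure \x mu) (@rVcons n @^-1` A).

Let mpre A : measurable A -> measurable (@rVcons n @^-1` A).
Proof.
by move=> mA; rewrite -[X in measurable X]setTI; exact: measurable_rVcons.
Qed.

Let lebesgue_rVS0 : lebesgue_rVS set0 = 0.
Proof. by rewrite /lebesgue_rVS preimage_set0 measure0. Qed.

Let lebesgue_rVS_ge0 A : 0 <= lebesgue_rVS A.
Proof. exact: measure_ge0. Qed.

Let lebesgue_rVS_sigma_additive : semi_sigma_additive lebesgue_rVS.
Proof.
move=> F mF tF mUF; rewrite /lebesgue_rVS preimage_bigcup.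
apply: measure_semi_sigma_additive.
- by move=> i; exact: mpre.
- apply/trivIsetP => /= i j _ _ ij; rewrite -preimage_setI.
  by move/trivIsetP : tF => /(_ _ _ _ _ ij) ->//; rewrite preimage_set0.
- by rewrite -preimage_bigcup; exact: mpre.
Qed.

HB.instance Definition _ := isMeasure.Build _ _ _ lebesgue_rVS
  lebesgue_rVS0 lebesgue_rVS_ge0 lebesgue_rVS_sigma_additive.

Let lebesgue_rVS_sigma_finite : sigma_finite setT lebesgue_rVS.
Proof.
have /sigma_finiteP[F [TF ndF Foo]] :=
  sigma_finiteT (lebesgue_measure :
    {sigma_finite_measure set (measurableTypeR R) -> \bar R}).
have /sigma_finiteP[G [TG ndG Goo]] := sigma_finiteT mu.
exists (fun i => @rVuncons n @^-1` (F i `*` G i)).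
  rewrite -preimage_bigcup -(preimage_setT (@rVuncons n)); congr (_ @^-1` _).
  apply/esym; rewrite -subTset => -[x v] _.
  have [i _ Fx] : (\bigcup_i F i) x by rewrite -TF.
  have [j _ Gv] : (\bigcup_i G i) v by rewrite -TG.
  exists (maxn i j) => //; split.
    by move: x Fx; exact/subsetPset/ndF/leq_maxl.
  by move: v Gv; exact/subsetPset/ndG/leq_maxr.
move=> i; have [mF Fi] := Foo i; have [mG Gi] := Goo i; split.
  rewrite -[X in measurable X]setTI; apply: measurable_rVuncons => //.
  exact: measurableX.
rewrite /lebesgue_rVS -comp_preimage (_ : _ \o _ = id); last first.
  by apply/funext => p /=; rewrite rVconsK.
by rewrite preimage_id product_measure1E// lte_mul_pinfty// ge0_fin_numE.
Qed.

HB.instance Definition _ := Measure_isSigmaFinite.Build _ _ _ lebesgue_rVS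
  lebesgue_rVS_sigma_finite.

End step.

Fixpoint lebesgue_rV n : {sigma_finite_measure set 'rV[R]_n -> \bar R} :=
  if n is n'.+1 then lebesgue_rVS (lebesgue_rV n') else \d_(0 : 'rV[R]_0).

Lemma lebesgue_rV_box n (a b : 'rV[R]_n) : (forall i, a ord0 i <= b ord0 i)%R ->
  lebesgue_rV n [set x : 'rV[R]_n | forall i, (a ord0 i <= x ord0 i <= b ord0 i)%R] =
  (\prod_(i < n) (b ord0 i - a ord0 i))%:E.
Proof.
elim: n a b => [|n IHn] a b ab.
  by rewrite big_ord0 /= diracE mem_set// => -[].
pose a' : 'rV[R]_n := \row_i a ord0 (lift ord0 i); pose b' : 'rV[R]_n := \row_i b ord0 (lift ord0 i).
have -> : lebesgue_rV n.+1
    [set x : 'rV[R]_n.+1 | forall i, (a ord0 i <= x ord0 i <= b ord0 i)%R] =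
    (lebesgue_measure \x lebesgue_rV n)%E (`[a ord0 ord0, b ord0 ord0] `*`
    [set x : 'rV[R]_n | forall i, (a' ord0 i <= x ord0 i <= b' ord0 i)%R]).
  congr (product_measure1 _ _ _).
  apply/seteqP; split => -[x v] /=.
    move=> xv; split; first by have := xv ord0; rewrite rVcons0 in_itv.
    by move=> i; have := xv (lift ord0 i); rewrite rVconsS !mxE.
  move=> [xab vab] i; case: (unliftP ord0 i) => [j ->|->].
    by have := vab j; rewrite rVconsS !mxE.
  by move: xab; rewrite rVcons0 in_itv.
rewrite product_measure1E//; last first.
  rewrite (_ : mkset _ = \bigcap_(i in [set: 'I_n])
      ((fun v : 'rV[R]_n => v ord0 i) @^-1` `[a' ord0 i, b' ord0 i])).
    apply: fin_bigcap_measurable => // i _.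
    by rewrite -[X in measurable X]setTI; exact: measurable_entry.
  apply/seteqP; split => v /= vab i; first by move=> _; rewrite /= in_itv/=; exact: vab.
  by have := vab i Logic.I; rewrite /= in_itv.
rewrite /= lebesgue_measure_itv/= IHn; last by move=> i; rewrite !mxE.
rewrite big_ord_recl EFinM; congr (_ * _)%E; last first.
  by congr EFin; apply: eq_bigr => i _; rewrite !mxE.
rewrite lte_fin; case: ltgtP (ab ord0) => // -> _.
by rewrite subrr.
Qed.

End lebesgue_rV.

Section euclidean.
Context {R : realType}.

(* The norm [`|A|] of the library is the maximum norm. [enorm] is the Euclidean
   norm of a vector, and the Frobenius norm of a gradient. *)
Definition enorm m n (A : 'M[R]_(m, n)) : R :=
  Num.sqrt (\sum_i \sum_j A i j ^+ 2).

Definition dotrv n (x y : 'rV[R]_n) : R := \sum_i x ord0 i * y ord0 i.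

Definition cball0 m (q : R) : set 'rV[R]_m := [set z | enorm z <= q].

Definition boundary n (A : set 'rV[R]_n) : set 'rV[R]_n := closure A `\` interior A.

(* The infimum of the empty set is [+oo]. *)
Definition dist_boundary n (A : set 'rV[R]_n) (x : 'rV[R]_n) : \bar R :=
  ereal_inf [set (enorm (x - y))%:E | y in boundary A].

(* Near each boundary point, [A] is the strict epigraph of a Lipschitz function
   in some orthonormal coordinate system. The unit vector [e] is the last axis
   of that system, [dotrv x e] is the last coordinate of [x], and
   [x - dotrv x e *: e] stands for the other n - 1 coordinates; the values of
   [g] outside the hyperplane orthogonal to [e] play no role. *)
Definition lipschitz_boundary n (A : set 'rV[R]_n) : Prop :=
  forall x0, boundary A x0 ->
  exists (r L : R) (e : 'rV[R]_n) (g : 'rV[R]_n -> R),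
  [/\ 0 < r, enorm e = 1,
      forall y z, `|g y - g z| <= L * enorm (y - z) &
      forall x, enorm (x - x0) < r ->
        (A x <-> g (x - dotrv x e *: e) < dotrv x e)].

Definition lsc_on (X : topologicalType) (A : set X) (f : X -> R) : Prop :=
  lower_semicontinuous (EFin \o f : subspace A -> \bar R).

End euclidean.

Section sobolev.
Context {R : realType} (n : nat).
Local Notation mu := (lebesgue_rV n).
Implicit Types (w K : set 'rV[R]_n) (f : 'rV[R]_n -> R).

Definition partial (j : 'I_n) f : 'rV[R]_n -> R :=
  fun x => 'D_(delta_mx ord0 j) f x.

Fixpoint Ck (k : nat) f : Prop :=
  if k is k'.+1 then
    continuous f /\
    forall j, (forall x, derivable f x (delta_mx ord0 j)) /\
              Ck k' (partial j f)
  else continuous f.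

Definition test_function w f : Prop :=
  [/\ forall k, Ck k f, compact (closure [set x | f x != 0]) &
      closure [set x | f x != 0] `<=` w].

Definition L1loc w f : Prop := measurable_fun w f /\
  forall K, compact K -> K `<=` w -> (\int[mu]_(x in K) `|f x|%:E < +oo)%E.

Definition L2 w f : Prop := measurable_fun w f /\
  (\int[mu]_(x in w) (f x ^+ 2)%:E < +oo)%E.

Section vector_valued.
Variable m : nat.
Implicit Types (v : 'rV[R]_n -> 'rV[R]_m) (G : 'rV[R]_n -> 'M[R]_(m, n)).

Definition component (i : 'I_m) v : 'rV[R]_n -> R := fun x => v x ord0 i.

Definition entry (i : 'I_m) (j : 'I_n) G : 'rV[R]_n -> R := fun x => G x i j.

Definition gradient v : 'rV[R]_n -> 'M[R]_(m, n) :=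
  fun x => \matrix_(i, j) partial j (component i v) x.

(* [G] is the distributional gradient of [v] in [w]; it is unique up to
   almost everywhere equality in [w]. *)
Definition weak_gradient w v G : Prop := forall i j,
  [/\ L1loc w (component i v), L1loc w (entry i j G) &
      forall f, test_function w f ->
        \int[mu]_(x in w) (component i v x * partial j f x) =
        - \int[mu]_(x in w) (entry i j G x * f x)].

Definition W12_gradient w v G : Prop :=
  [/\ weak_gradient w v G, forall i, L2 w (component i v) &
      forall i j, L2 w (entry i j G)].

Definition W12 w v : Prop := exists G, W12_gradient w v G.

Definition W12loc (Omega : set 'rV[R]_n) v : Prop :=
  forall w, open w -> bounded_set w -> closure w `<=` Omega -> W12 w v.

(* The closure of the test functions in [W12 w]. *)
Definition W12_0 w v : Prop := exists2 G, W12_gradient w v G &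
  exists2 phi : nat -> 'rV[R]_n -> 'rV[R]_m,
    forall k i, test_function w (component i (phi k)) &
    (fun k => \int[mu]_(x in w)
       (enorm (phi k x - v x) ^+ 2 +
        enorm (gradient (phi k) x - G x) ^+ 2)%:E)%E @ \oo --> 0%E.

Definition ae_bounded w (q : R) v : Prop :=
  {ae mu, forall x, w x -> enorm (v x) <= q}.

(* The energy of [v] in [w], where [G] is the weak gradient of [v]. *)
Definition energy (W : 'rV[R]_m -> R) w v G : \bar R :=
  (\int[mu]_(x in w) (2^-1 * enorm (G x) ^+ 2 + W (v x))%:E)%E.

(* The energies do not depend on the choice of the weak gradients, nor, as the
   functions are bounded by [q] almost everywhere, on the values of [W] outside
   the closed ball of radius [q]. *)
Definition local_minimizer (W : 'rV[R]_m -> R) (q : R)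
    (Omega : set 'rV[R]_n) (u : 'rV[R]_n -> 'rV[R]_m) : Prop :=
  forall w, open w -> bounded_set w -> lipschitz_boundary w ->
    closure w `<=` Omega ->
  forall v xi, W12_0 w xi -> v = (fun x => u x + xi x) -> ae_bounded w q v ->
  forall Gu Gv, weak_gradient w u Gu -> weak_gradient w v Gv ->
  (energy W w u Gu <= energy W w v Gv)%E.

End vector_valued.
End sobolev.

Definition I_ {R : realType} (Wrad : R -> R) (q : R) : \bar R :=
  (\int[lebesgue_measure]_(s in `]0%R, q]) ((Num.sqrt (Wrad s))^-1)%:E)%E.

(* Main.v *)
Require Import Defs.
From HB Require Import structures.
From mathcomp Require Import all_boot all_order all_algebra.
From mathcomp Require Import all_classical all_reals all_analysis.
From mathcomp Require Import measurable_realfun ring lra.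
Set Implicit Arguments.
Unset Strict Implicit.
Unset Printing Implicit Defensive.
Import Order.TTheory GRing.Theory Num.Theory.
Import numFieldNormedType.Exports.
Local Open Scope classical_set_scope.
Local Open Scope ring_scope.

(** Put a = sqrt (2 Wrad), let Q be the primitive of a, and let H be the solution
    of H' = a(H) on the line that vanishes exactly on ]-oo, 0]. As I_q is finite,
    H exceeds q after the time T = I_q / sqrt 2.

    On a ball around x0 contained in Omega there is a field X = grad psi with
    |X| <= 1, such that psi exceeds T near the boundary of the ball, div X <= 0
    where psi > 0, and T div X <= (1 - |X|^2) / 2 where psi <= 0, with a strict
    inequality near x0. Let v be the radial truncation of u at the height H(psi),
    and let N be the positive part of Q(|u|) - Q(H(psi)). Young's inequality and
    Q(s) <= T a(s)^2 show that e(u) - e(v) - div (N X) is nonnegative, where e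
    is the energy density, and that near x0 it is at least a multiple of Wrad(|u|).
    Since v = u and N = 0 near the boundary, the divergence integrates to 0, and
    minimality makes the integral nonpositive: u vanishes at x0.

    For lack of smoothness, H, Q, the truncation and the positive part are
    replaced by C^1 functions depending on a parameter j, and j tends to infinity
    by Fatou's lemma, since the regularised integrands are bounded below by
    - C (1 + |grad u|^2). *)

(** * Lebesgue measure on row vectors *)

(** Write s = |u|, h = H(psi), g = grad |u|. Where s > h, truncation shrinks the part of grad u that
    does not contribute to g and replaces g by a(h) X. Young's inequality for a(s) g . X then leaves
    at least (1 - |X|^2) (a(s)^2 - a(h)^2) / 2, nonnegative since a is monotone, and the flux term
    only asks for div X <= 0. In the core h = 0, and a positive divergence is paid from the same
    surplus, since Q(s) <= s a(s) and s <= T a(s). So I_q enters twice: it fixes the height that psi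
    must climb and limits the divergence in the core; the radius results from balancing the two. Two
    obstacles shape the analysis. The speed a may jump, so Q and H are merely Lipschitz; they are
    replaced by averages over short intervals to the left, because lower semicontinuity of Wrad
    makes a left continuous. And the truncation must be past its transition as soon as |u| >=
    H(psi), so two scales are used: the barrier lags by a multiple of 1/j, while the transitions
    have width of order 1/j^2. *)

Section rV_topology.
Context {R : realType} (n : nat).
Implicit Types (x y : 'rV[R]_n) (A : set 'rV[R]_n).

Lemma nbhs_rVP x A :
  nbhs x A <->
  exists2 e, 0 < e & forall y, (forall i, `|y ord0 i - x ord0 i| < e) -> A y.
Proof.
split.
  move=> /nbhs_ballP[e /= e0 xA]; exists e => // y xy; apply: xA.
  by split=> // i j; rewrite (ord1 i) /ball/= distrC.
move=> [e e0 xA]; apply/nbhs_ballP; exists e => //= y [_ xy]; apply: xA => i.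
by have := xy ord0 i; rewrite /ball/= distrC.
Qed.

Lemma rV_norm_leP x (M : R) : 0 <= M ->
  (`|x| <= M) <-> (forall i, `|x ord0 i| <= M).
Proof.
move=> M0; rewrite [`|x|]/Num.norm/= mx_normrE; split.
  by move=> /bigmax_leP[_ xM] i; exact: (xM (ord0, i)).
by move=> xM; apply/bigmax_leP; split => // -[i j] _; rewrite (ord1 i)/=.
Qed.

Lemma rV_coord_le_norm x i : `|x ord0 i| <= `|x|.
Proof. by have /rV_norm_leP := lexx `|x|; apply. Qed.

Lemma coord_rV_continuous i : continuous (fun x => x ord0 i : R).
Proof. by move=> x; exact: coord_continuous. Qed.

(** The sigma-algebra is generated by the entries, so an open set has to be written as a countable
    union of boxes. Boxes with rational centre and a common rational radius suffice: a radius below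
    e / 2 and a centre within that radius keep the box inside the e-neighbourhood of the point. *)
Lemma open_measurable_rV A : open A -> measurable A.
Proof.
move=> oA.
pose box (p : 'rV[rat]_n * rat) : set 'rV[R]_n :=
  [set y | forall i, `|y ord0 i - ratr (p.1 ord0 i)| < ratr p.2].
pose F p := if asbool (box p `<=` A) then box p else set0.
have -> : A = \bigcup_p F p.
  apply/seteqP; split => [x Ax|x [p _]]; last first.
    by rewrite /F; case: asboolP => // pA; exact: pA.
  have /nbhs_rVP[e e0 xA] : nbhs x A by exact: open_nbhs_nbhs.
  have [r] := rat_in_itvoo (divr_gt0 e0 (ltr0Sn R 1)).
  rewrite in_itv/= => /andP[r0 re].
  have /choice[c cx] (i : 'I_n) : exists c : rat, `|x ord0 i - ratr c| < ratr r.
    have xr : x ord0 i < x ord0 i + ratr r by rewrite ltrDl.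
    have [c] := rat_in_itvoo xr; rewrite in_itv/= => /andP[xc cr].
    by exists c; rewrite distrC ger0_norm ?subr_ge0 1?ltW// ltrBlDl.
  exists (\row_i c i, r) => //; rewrite /F; case: asboolP => [_ i|].
    by rewrite mxE.
  case=> y yc; apply: xA => i.
  have := yc i; rewrite mxE/= => yci.
  rewrite (_ : _ - _ = (y ord0 i - ratr (c i)) - (x ord0 i - ratr (c i))); last by ring.
  by apply: le_lt_trans (ler_normB _ _) _; have := cx i; lra.
apply: countable_bigcupT_measurable => [|p]; first exact: countableP.
rewrite /F; case: asboolP => // _.
rewrite (_ : box p = \bigcap_(i in [set: 'I_n])
  ((fun v : 'rV[R]_n => v ord0 i) @^-1` ball (ratr (p.1 ord0 i) : R) (ratr p.2))).
  apply: fin_bigcap_measurable => // i _.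
  by rewrite -[X in measurable X]setTI; apply: measurable_entry => //; exact: measurable_ball.
by apply/seteqP; split => v /= vb i => [_|]; [have := vb i|have := vb i Logic.I];
  rewrite /ball/= distrC.
Qed.

Lemma closed_measurable_rV A : closed A -> measurable A.
Proof.
by move=> cA; rewrite -[A]setCK; apply: measurableC; apply: open_measurable_rV; exact: closed_openC.
Qed.

Lemma compact_measurable_rV A : compact A -> measurable A.
Proof.
move=> cA; apply: closed_measurable_rV; apply: compact_closed => //.
Qed.

Lemma open_continuous_measurable_rV A (f : 'rV[R]_n -> R) :
  open A -> {in A, continuous f} -> measurable_fun A f.
Proof.
move=> oA cf mA; apply: (measurability _ (RGenOpens.measurableE R)) => //.
move=> _ [_ [a [b ->] <-]]; apply: open_measurable_rV.
rewrite openE => x [Ax fx]; apply: filterI; first exact: open_nbhs_nbhs.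
apply: (cf x); first by rewrite inE.
by apply: open_nbhs_nbhs; split=> //; exact: interval_open.
Qed.

Lemma continuous_measurable_rV (f : 'rV[R]_n -> R) :
  continuous f -> measurable_fun setT f.
Proof.
by move=> cf; apply: open_continuous_measurable_rV; [exact: openT|move=> x _; exact: cf].
Qed.

End rV_topology.

(** * Tonelli and Fubini with the first coordinate split off *)

Section rV_integral.
Local Open Scope ereal_scope.
Context {R : realType}.
Local Notation leb := (@lebesgue_measure R : {sigma_finite_measure set (measurableTypeR R) -> \bar R}).

Let rVc n (p : measurableTypeR R * 'rV[R]_n) : 'rV[R]_n.+1 := rVcons p.

Let measurable_rVc n : measurable_fun setT (@rVc n).
Proof. exact: measurable_rVcons. Qed.

Lemma ge0_integral_lebesgue_rVS n (f : 'rV[R]_n.+1 -> \bar R) :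
  measurable_fun setT f -> (forall x, 0 <= f x) ->
  \int[lebesgue_rV n.+1]_x f x = \int[leb \x lebesgue_rV n]_p f (rVcons p).
Proof.
move=> mf f0.
by rewrite -(ge0_integral_pushforward (@measurable_rVc n) (leb \x lebesgue_rV n) measurableT mf).
Qed.

Lemma integral_lebesgue_rVS n (f : 'rV[R]_n.+1 -> \bar R) :
  (lebesgue_rV n.+1).-integrable setT f ->
  (leb \x lebesgue_rV n).-integrable setT (f \o @rVcons R n) /\
  \int[lebesgue_rV n.+1]_x f x = \int[leb \x lebesgue_rV n]_p f (rVcons p).
Proof.
move=> fi; have mf := measurable_int _ fi.
have ifc : (leb \x lebesgue_rV n).-integrable setT (f \o @rVcons R n).
  apply/integrableP; split; first exact: (measurableT_comp mf (@measurable_rVc n)).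
  move/integrableP : fi => [_]; rewrite ge0_integral_lebesgue_rVS//.
  exact: measurableT_comp.
split=> //.
exact: (@integral_pushforward _ _ _ _ R _ (@measurable_rVc n) (leb \x lebesgue_rV n) setT f mf ifc measurableT).
Qed.

Lemma tonelli_rV n (f : 'rV[R]_n.+1 -> \bar R) :
  measurable_fun setT f -> (forall x, 0 <= f x) ->
  \int[lebesgue_rV n.+1]_x f x =
  \int[leb]_s \int[lebesgue_rV n]_v f (rVcons (s, v)).
Proof.
move=> mf f0; rewrite ge0_integral_lebesgue_rVS//.
apply: (@fubini_tonelli1 _ _ _ _ _ leb (lebesgue_rV n) (f \o @rVc n)) => [|p]; last exact: f0.
exact: (measurableT_comp mf (@measurable_rVc n)).
Qed.

Lemma tonelli_rV' n (f : 'rV[R]_n.+1 -> \bar R) :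
  measurable_fun setT f -> (forall x, 0 <= f x) ->
  \int[lebesgue_rV n.+1]_x f x =
  \int[lebesgue_rV n]_v \int[leb]_s f (rVcons (s, v)).
Proof.
move=> mf f0; rewrite ge0_integral_lebesgue_rVS//.
apply: (@fubini_tonelli2 _ _ _ _ _ leb (lebesgue_rV n) (f \o @rVc n)) => [|p]; last exact: f0.
exact: (measurableT_comp mf (@measurable_rVc n)).
Qed.

Lemma fubini_rV n (f : 'rV[R]_n.+1 -> \bar R) :
  (lebesgue_rV n.+1).-integrable setT f ->
  \int[lebesgue_rV n.+1]_x f x =
  \int[leb]_s \int[lebesgue_rV n]_v f (rVcons (s, v)).
Proof.
move=> fi; have [ifc ->] := integral_lebesgue_rVS fi.
by rewrite -(integral12_prod_meas1 ifc).
Qed.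

Lemma fubini_rV' n (f : 'rV[R]_n.+1 -> \bar R) :
  (lebesgue_rV n.+1).-integrable setT f ->
  \int[lebesgue_rV n.+1]_x f x =
  \int[lebesgue_rV n]_v \int[leb]_s f (rVcons (s, v)).
Proof.
move=> fi; have [ifc ->] := integral_lebesgue_rVS fi.
by rewrite -(integral21_prod_meas1 ifc).
Qed.

End rV_integral.

Section rVcons_lemmas.
Context {R : realType} (n : nat).
Implicit Types (s t : R) (v w : 'rV[R]_n).

Lemma rVconsP (x : 'rV[R]_n.+1) : x = rVcons (rVuncons x).
Proof.
apply/rowP => i; case: (unliftP ord0 i) => [j ->|->].
  by rewrite rVconsS mxE.
by rewrite rVcons0.
Qed.

Lemma rVconsD s t v w : rVcons (s + t, v + w) = rVcons (s, v) + rVcons (t, w).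
Proof.
apply/rowP => i; rewrite [RHS]mxE; case: (unliftP ord0 i) => [j ->|->].
  by rewrite !rVconsS mxE.
by rewrite !rVcons0.
Qed.

Lemma rVcons_delta0 : rVcons (1, 0) = delta_mx ord0 ord0 :> 'rV[R]_n.+1.
Proof.
apply/rowP => i; rewrite [RHS]mxE eqxx/=; case: (unliftP ord0 i) => [j ->|->].
  by rewrite rVconsS mxE.
by rewrite rVcons0 eqxx.
Qed.

Lemma rVcons_deltaS (j : 'I_n) : rVcons (0, delta_mx ord0 j) = delta_mx ord0 (lift ord0 j) :> 'rV[R]_n.+1.
Proof.
apply/rowP => i; rewrite [RHS]mxE eqxx/=; case: (unliftP ord0 i) => [k ->|->].
  by rewrite rVconsS mxE eqxx/= (inj_eq lift_inj).
by rewrite rVcons0.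
Qed.

Lemma rVconsZ (c : R) s v : rVcons (c * s, c *: v) = c *: rVcons (s, v).
Proof.
apply/rowP => i; rewrite [RHS]mxE; case: (unliftP ord0 i) => [k ->|->].
  by rewrite !rVconsS mxE.
by rewrite !rVcons0.
Qed.

Lemma rVcons_continuous : continuous (@rVcons R n).
Proof.
move=> [s v] A /nbhs_rVP[e e0 xA].
exists ([set t : R | `|s - t| < e], [set w : 'rV[R]_n | forall i, `|w ord0 i - v ord0 i| < e]).
  split; first exact: (@nbhsx_ballx R R s e e0).
  by apply/nbhs_rVP; exists e.
move=> [t w] [/= st vw]; apply: xA => i; case: (unliftP ord0 i) => [k ->|->].
  by rewrite !rVconsS.
by rewrite !rVcons0/= distrC.
Qed.

Lemma rVcons_continuousl v : continuous (fun s => rVcons (s, v)).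
Proof.
move=> s; apply: (@continuous_comp _ _ _ (fun s => (s, v)) (@rVcons R n)).
  by apply: (@cvg_pair _ _ _ _ (nbhs s) (nbhs v)) => //; exact: cvg_cst.
exact: rVcons_continuous.
Qed.

Lemma rVcons_continuousr s : continuous (fun v : 'rV[R]_n => rVcons (s, v)).
Proof.
move=> v A /nbhs_rVP[e e0 xA]; apply/nbhs_rVP; exists e => // y yv.
apply: xA => i; case: (unliftP ord0 i) => [k ->|->].
  by rewrite !rVconsS.
by rewrite !rVcons0/= subrr normr0.
Qed.

Lemma norm_rVcons_gel s v : `|s| <= `|rVcons (s, v)|.
Proof. by have := rV_coord_le_norm (rVcons (s, v)) ord0; rewrite rVcons0. Qed.

Lemma norm_rVcons_ger s v : `|v| <= `|rVcons (s, v)|.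
Proof.
apply/rV_norm_leP => // i.
by have := rV_coord_le_norm (rVcons (s, v)) (lift ord0 i); rewrite rVconsS.
Qed.

End rVcons_lemmas.

(** * Translation invariance of the Lebesgue measure *)

Section translation.
Context {R : realType}.

Lemma ge0_integral_translate1 (f : R -> R) (a : R) : continuous f ->
  (forall x, 0 <= f x) ->
  (\int[lebesgue_measure]_x (f (x + a))%:E = \int[lebesgue_measure]_x (f x)%:E)%E.
Proof.
move=> cf f0; apply/esym.
have dF (x : R) : is_derive x 1 (fun y : R => y + a) 1.
  by apply: is_derive_eq; rewrite addr0.
have dE : derive1 (fun y : R => y + a) = cst 1.
  by apply/funext => x; rewrite derive1E; have [_ ->] := dF x.
rewrite (@increasing_ge0_integration_by_substitutionT _ (fun y => y + a))//.
- by apply: eq_integral => x _; rewrite fctE dE mulr1.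
- by move=> x y xy; rewrite ltrD2r.
- by rewrite dE; move=> x; exact: cvg_cst.
- by rewrite dE; exact: is_cvg_cst.
- by rewrite dE; exact: is_cvg_cst.
- apply/cvgrNyPle => M; near=> x; rewrite -lerBrDr; near: x.
  by apply: nbhs_ninfty_le; rewrite num_real.
- apply/cvgryPge => M; near=> x; rewrite -lerBlDr; near: x.
  by apply: nbhs_pinfty_ge; rewrite num_real.
Unshelve. all: by end_near. Qed.

Lemma continuous_translate n (f : 'rV[R]_n -> R) (a : 'rV[R]_n) :
  continuous f -> continuous (fun x : 'rV[R]_n => f (x + a)).
Proof.
move=> cf x A /cf /nbhs_rVP[e e0 xA]; apply/nbhs_rVP; exists e => // y xy.
by apply: xA => i; rewrite !mxE opprD addrACA subrr addr0.
Qed.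

(** Induction on the dimension. With the first coordinate outermost, the induction hypothesis
    removes the tail of [a]; after exchanging the order of integration, the one-dimensional case
    removes its head. *)
Lemma ge0_integral_translate n (f : 'rV[R]_n -> R) (a : 'rV[R]_n) : continuous f ->
  (forall x, 0 <= f x) ->
  (\int[lebesgue_rV n]_x (f (x + a))%:E = \int[lebesgue_rV n]_x (f x)%:E)%E.
Proof.
have cshift m := @continuous_translate m.
elim: n f a => [|n IHn] f a cf f0.
  by apply: eq_integral => x _; congr ((f _)%:E); apply/rowP => -[].
have mEf (g : 'rV[R]_n.+1 -> R) : continuous g ->
    measurable_fun setT (fun x => (g x)%:E).
  by move=> cg; apply/measurable_EFinP; exact: continuous_measurable_rV.
rewrite tonelli_rV//; [|by apply: mEf; exact: cshift|by move=> x; rewrite lee_fin].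
have ccons (g : 'rV[R]_n.+1 -> R) s : continuous g -> continuous (fun v => g (rVcons (s, v))).
  by move=> cg v; apply: (continuous_comp (@rVcons_continuousr R n s v)); exact: cg.
have cconsl (g : 'rV[R]_n.+1 -> R) v : continuous g -> continuous (fun s => g (rVcons (s, v))).
  by move=> cg s; apply: (continuous_comp (@rVcons_continuousl R n v s)); exact: cg.
set a0 := (rVuncons a).1; set a1 := (rVuncons a).2.
transitivity (\int[@lebesgue_measure R : {sigma_finite_measure set (measurableTypeR R) -> \bar R}]_s \int[lebesgue_rV n]_v (f (rVcons (s, v) + rVcons (a0, 0)))%:E)%E.
  apply: eq_integral => s _; rewrite -(IHn (fun v => f (rVcons (s, v) + rVcons (a0, 0))) a1).
  - by apply: eq_integral => v _; congr ((f _)%:E); rewrite -!rVconsD addr0 [a]rVconsP /a0 /a1; case: (rVuncons a) => b c; rewrite -rVconsD.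
  - by apply: (ccons (fun x => f (x + _))); exact: cshift.
  - by [].
rewrite -(@tonelli_rV _ _ (fun x => (f (x + rVcons (a0, 0)))%:E))//; last 2 first.
  by apply: mEf; exact: cshift.
  by move=> x; rewrite lee_fin.
rewrite (@tonelli_rV' _ _ (fun x => (f (x + rVcons (a0, 0)))%:E)); last 2 first.
  by apply: mEf; exact: cshift.
  by move=> x; rewrite lee_fin.
rewrite (@tonelli_rV' _ _ (fun x => (f x)%:E)); last 2 first.
  exact: mEf.
  by move=> x; rewrite lee_fin.
apply: eq_integral => v _.
rewrite -(@ge0_integral_translate1 (fun s => f (rVcons (s, v))) a0)//; last exact: cconsl.
by apply: eq_integral => s _; rewrite -rVconsD addr0.
Qed.

End translation.

Lemma derive_eq {R : numFieldType} {V W : normedModType R} (f : V -> W)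
    (x v : V) (df df' : W) :
  is_derive x v f df -> df = df' -> is_derive x v f df'.
Proof. by move=> ? <-. Qed.

(** Reduces directional derivatives to one real variable, where the chain rule and differentiation
    under the integral sign are applied. *)
Lemma is_derive_line {R : realType} {V : normedModType R} (f : V -> R) (x v : V) (d : R) :
  is_derive x v f d <-> is_derive (0 : R) 1 (fun h : R => f (h *: v + x)) d.
Proof.
have E : (fun h : R => h^-1 *: ((f \o shift x) (h *: v) - f x)) =
    (fun h => h^-1 *: (((fun h : R => f (h *: v + x)) \o shift 0) (h *: (1 : R)) - f (0 *: v + x))).
  by apply/funext => h /=; rewrite addr0 [h *: 1]mulr1 scale0r add0r.
split=> -[].
  by rewrite /derivable /derive E => h1 h2; split.
by rewrite /derivable /derive => h1 h2; split; rewrite /derivable /derive E.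
Qed.

(** * Differentiability of piecewise and of flat functions *)

Section one_variable.
Context {R : realType}.

(** Treats functions given by cases ([pos2], [pos3], [flat_exp] at 0) without one-sided derivatives:
    a quadratic remainder is checked by cases instead. *)
Lemma is_derive_quad (f : R -> R) (x d C r : R) : 0 < r ->
  (forall h, `|h| < r -> `|f (x + h) - f x - d * h| <= C * h ^+ 2) ->
  is_derive x 1 f d.
Proof.
move=> r0 fC.
have C0 : 0 <= C.
  have r2 : `|r / 2| < r by rewrite ger0_norm; lra.
  have := le_trans (normr_ge0 _) (fC _ r2).
  by rewrite pmulr_lge0// exprn_gt0//; lra.
have lim : h^-1 *: ((f \o shift x) (h *: (1 : R)) - f x) @[h --> 0^'] --> d.
  apply/cvgrPdist_le => e e0; near=> h.
  have h0 : h != 0 by near: h; exact: nbhs_dnbhs_neq.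
  have hr : `|h| < r.
    near: h; apply: dnbhs0_lt => //.
  have hC : `|h| <= e / (C + 1).
    near: h; apply: dnbhs0_le; rewrite divr_gt0//; lra.
  rewrite /= [h *: 1]mulr1 [h + x]addrC distrC.
  have -> : h^-1 *: (f (x + h) - f x) - d = h^-1 * (f (x + h) - f x - d * h).
    by rewrite [_ *: _](_ : _ = h^-1 * (f (x + h) - f x))//; field.
  rewrite normrM normfV ler_pdivrMl ?normr_gt0//.
  apply: le_trans (fC _ hr) _.
  rewrite -[h ^+ 2]ger0_norm ?sqr_ge0// normrX expr2 mulrA [leRHS]mulrC.
  rewrite ler_wpM2r//; apply: le_trans (_ : (C + 1) * `|h| <= _).
    by rewrite ler_wpM2r//; lra.
  by rewrite mulrC -ler_pdivlMr//; lra.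
by split; [apply/cvg_ex; exists d|exact: cvg_lim lim].
Unshelve. all: by end_near. Qed.

Definition pos2 (y : R) := Num.max y 0 ^+ 2.

Lemma is_derive_pos2 (y : R) : is_derive y 1 pos2 (2 * Num.max y 0).
Proof.
apply: (@is_derive_quad _ _ _ 1 1) => // h _; rewrite /pos2 mul1r.
by rewrite ler_norml; case: (leP (y + h) 0) => H1; case: (leP y 0) => H2; apply/andP; split; nra.
Qed.

(** All derivatives are given at once as a sequence, so that [Ck_comp] can go by induction on the
    order while moving along the sequence. *)
Definition smooth1 (g : R -> R) := exists2 gs : nat -> R -> R,
  gs 0%N = g & forall k (x : R), is_derive x 1 (gs k) (gs k.+1 x).

(* A family of functions stable under differentiation, which contains the bump
   profile [exp (- 1 / y)]. *)
Definition flat_exp (P : {poly R}) (y : R) :=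
  if 0 < y then P.[y^-1] * expR (- y^-1) else 0.

(** The exponential is cut into [M] equal factors, each at least [z / M], so that [expR z] dominates
    [(z / M) ^+ M]. Taking [M] two above the size of [P] leaves the decay [z ^- 2], which becomes
    the quadratic flatness of [flat_exp P] at 0. *)
Lemma poly_mul_expN_le (P : {poly R}) :
  exists C, forall z, 1 <= z -> `|P.[z] * expR (- z)| <= C / z ^+ 2.
Proof.
pose N := size P; pose A := \sum_(i < N) `|P`_i|; pose M := N.+2.
exists (A * M%:R ^+ M) => z z1.
have z0 : 0 < z by lra.
have PA : `|P.[z]| <= A * z ^+ N.
  rewrite horner_coef mulr_suml; apply: le_trans (ler_norm_sum _ _ _) _.
  apply: ler_sum => i _; rewrite normrM ler_wpM2l// ger0_norm ?exprn_ge0// ?(ltW z0)//.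
  by apply: ler_weXn2l => //; exact: ltnW (ltn_ord i).
have ez : (z / M%:R) ^+ M <= expR z.
  have -> : expR z = expR (z / M%:R) ^+ M.
    by rewrite -expRM_natl mulrC divfK// pnatr_eq0.
  rewrite lerXn2r ?nnegrE ?expR_ge0//; first by rewrite divr_ge0// ltW.
  by apply: le_trans (expR_ge1Dx _); lra.
rewrite normrM (ger0_norm (expR_ge0 _)) expRN.
have M0 : 0 < M%:R :> R by rewrite ltr0n.
apply: (@le_trans _ _ (A * z ^+ N * (M%:R / z) ^+ M)).
  apply: ler_pM; rewrite ?invr_ge0 ?expR_ge0//.
  rewrite -(invf_div z) exprVn lef_pV2 ?posrE ?expR_gt0//.
  by rewrite exprn_gt0// divr_gt0.
rewrite exprMn exprVn le_eqVlt; apply/orP; left; apply/eqP.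
rewrite /M -addn2 !exprD; field.
by rewrite expf_neq0 gt_eqF.
Qed.

Lemma flat_exp_quad (P : {poly R}) :
  exists C, forall y, `|y| <= 1 -> `|flat_exp P y| <= C * y ^+ 2.
Proof.
have [C PC] := poly_mul_expN_le P.
have C0 : 0 <= C.
  by have := le_trans (normr_ge0 _) (PC 1 (lexx _)); rewrite expr1n divr1.
exists C => y y1; rewrite /flat_exp; case: ltP => y0; last first.
  by rewrite normr0 mulr_ge0// sqr_ge0.
have := PC y^-1; rewrite -exprVn invrK; apply.
by rewrite invr_ge1 ?unitf_gt0 ?posrE//; move: y1; rewrite ger0_norm// ltW.
Qed.

Lemma is_derive_flat_exp (P : {poly R}) (y : R) :
  is_derive y 1 (flat_exp P) (flat_exp ('X^2 * (P - P^`())%R) y).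
Proof.
have [y0|y0|->] := ltgtP y 0.
- rewrite {2}/flat_exp ltNge (ltW y0)/=.
  apply: (@near_eq_is_derive _ _ _ (cst 0) _ y) => //.
  near=> z; rewrite /flat_exp/= ltNge (_ : z <= 0)//.
  by apply: ltW; near: z; exact: lt_nbhsl.
- rewrite {2}/flat_exp y0.
  apply: (@near_eq_is_derive R R R (fun y : R => P.[y^-1] * expR (- y^-1)) _ y).
    near=> z; rewrite /flat_exp (_ : 0 < z)//.
    by near: z; exact: lt_nbhsr.
  have yn0 : y != 0 by rewrite gt_eqF.
  have dV : is_derive y 1 (fun z : R => z^-1) (- y ^- 2).
    apply: (derive_eq (@is_deriveV R id y 1 1 yn0 (is_derive_id _ _))).
    by rewrite [_ *: _]mulr1.
  have dP := @is_derive1_comp R (fun z => P.[z]) (fun z : R => z^-1) y _ _ (is_derive_poly P _) dV.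
  have dN : is_derive y 1 (fun z : R => - z^-1) (y ^- 2).
    by have := is_deriveN dV; rewrite opprK.
  have dE := @is_derive1_comp R expR (fun z : R => - z^-1) y _ _ (is_derive_expR _) dN.
  apply: (derive_eq (is_deriveM dP dE)).
  rewrite /= !hornerE/= -exprVn /GRing.scale/=.
  by ring.
- have [C PC] := flat_exp_quad P.
  rewrite {2}/flat_exp ltxx.
  apply: (@is_derive_quad _ _ _ C 1) => // h h1.
  rewrite add0r mul0r subr0 {2}/flat_exp ltxx subr0.
  by apply: PC; exact: ltW.
Unshelve. all: by end_near. Qed.

Lemma smooth1_flat_exp : smooth1 (flat_exp 1).
Proof.
exists (fun k => flat_exp (iter k (fun P => 'X^2 * (P - P^`())%R) 1)) => //.
by move=> k x; exact: is_derive_flat_exp.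
Qed.

Lemma flat_exp1_gt0 (y : R) : 0 < y -> 0 < flat_exp 1 y.
Proof. by move=> y0; rewrite /flat_exp y0 hornerC mul1r expR_gt0. Qed.

Lemma flat_exp1_le0 (y : R) : y <= 0 -> flat_exp 1 y = 0.
Proof. by move=> y0; rewrite /flat_exp ltNge y0. Qed.

End one_variable.

(** * Functions of class C^k *)

Section Ck_theory.
Context {R : realType} (n : nat).
Implicit Types (f g : 'rV[R]_n -> R) (x v : 'rV[R]_n).
Local Notation e j := (delta_mx ord0 j : 'rV[R]_n).

Lemma is_derive_comp1 (g : R -> R) f x v (df dg : R) :
  is_derive x v f df -> is_derive (f x) 1 g dg ->
  is_derive x v (g \o f) (dg * df).
Proof.
move=> /is_derive_line df' dg'; apply/is_derive_line.
apply: (@is_derive1_comp _ g (fun h : R => f (h *: v + x))).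
by rewrite scale0r add0r.
Qed.

Lemma Ck0 k f : Ck k f -> continuous f.
Proof. by case: k => [//|k] []. Qed.

Arguments Ck0 {k f} _ _.

Lemma CkW k f : Ck k.+1 f -> Ck k f.
Proof.
elim: k f => [|k IHk] f /=; first by case.
by move=> [cf H]; split=> // j; have [dj /IHk] := H j.
Qed.

Lemma Ck_is_derive k f j x : Ck k.+1 f -> is_derive x (e j) f (partial j f x).
Proof. by move=> [_ /(_ j)[/(_ x)/derivableP]]. Qed.

Lemma CkS k f (F : 'I_n -> 'rV[R]_n -> R) : continuous f ->
  (forall j x, is_derive x (e j) f (F j x)) -> (forall j, Ck k (F j)) ->
  Ck k.+1 f.
Proof.
move=> cf df cF; split=> // j; split; first by move=> x; have [] := df j x.
rewrite (_ : partial j f = F j)//; apply/funext => x.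
by rewrite /partial; have [_ ->] := df j x.
Qed.

Lemma partialE f (d : R) j x : is_derive x (e j) f d -> partial j f x = d.
Proof. by case. Qed.

Lemma Ck_cst k (c : R) : Ck k (cst c : 'rV[R]_n -> R).
Proof.
elim: k c => [|k IHk] c; first exact: cst_continuous.
apply: (@CkS _ _ (fun j => cst 0)).
- exact: cst_continuous.
- by move=> j; apply: IHk.
Qed.

Lemma is_derive_coord i x v : is_derive x v (fun y => y ord0 i) (v ord0 i).
Proof.
apply/is_derive_line.
have -> : (fun h : R => (h *: v + x) ord0 i) = (fun h : R => h * v ord0 i + x ord0 i).
  by apply/funext => h; rewrite !mxE.
apply: (derive_eq (is_deriveD (is_deriveM (is_derive_id (0 : R) 1) (is_derive_cst (v ord0 i) (0 : R) 1)) (is_derive_cst (x ord0 i) (0 : R) 1))).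
by rewrite /= scaler0 add0r addr0 [_ *: _]mulr1.
Qed.

Lemma Ck_coord k i : Ck k (fun x => x ord0 i).
Proof.
case: k => [|k]; first exact: coord_rV_continuous.
apply: (@CkS _ _ (fun j x => (e j) ord0 i)) => [|j x|j].
- exact: coord_rV_continuous.
- exact: is_derive_coord.
- exact: Ck_cst.
Qed.

Lemma CkD k f g : Ck k f -> Ck k g -> Ck k (fun x => f x + g x).
Proof.
elim: k f g => [|k IHk] f g cf cg.
  by move=> x; exact: (continuousD (Ck0 cf x) (Ck0 cg x)).
apply: (@CkS _ _ (fun j x => partial j f x + partial j g x)) => [x|j x|j].
- exact: (continuousD (Ck0 cf x) (Ck0 cg x)).
- exact: (is_deriveD (Ck_is_derive j x cf) (Ck_is_derive j x cg)).
- by apply: IHk; [have [_ /(_ j)[]] := cf|have [_ /(_ j)[]] := cg].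
Qed.

Lemma CkM k f g : Ck k f -> Ck k g -> Ck k (fun x => f x * g x).
Proof.
elim: k f g => [|k IHk] f g cf cg.
  by move=> x; exact: (continuousM (Ck0 cf x) (Ck0 cg x)).
apply: (@CkS _ _ (fun j x => f x * partial j g x + g x * partial j f x)) => [x|j x|j].
- exact: (continuousM (Ck0 cf x) (Ck0 cg x)).
- exact: (is_deriveM (Ck_is_derive j x cf) (Ck_is_derive j x cg)).
- apply: CkD; apply: IHk.
  + exact: CkW.
  + by have [_ /(_ j)[]] := cg.
  + exact: CkW.
  + by have [_ /(_ j)[]] := cf.
Qed.

Lemma CkN k f : Ck k f -> Ck k (fun x => - f x).
Proof.
move=> cf; have := CkM (Ck_cst k (-1)) cf.
by under eq_fun do rewrite mulN1r.
Qed.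

Lemma CkB k f g : Ck k f -> Ck k g -> Ck k (fun x => f x - g x).
Proof. by move=> cf cg; apply: CkD => //; exact: CkN. Qed.

Lemma Ck_sum k (I : Type) (s : seq I) (F : I -> 'rV[R]_n -> R) :
  (forall i, Ck k (F i)) -> Ck k (fun x => \sum_(i <- s) F i x).
Proof.
move=> cF; elim: s => [|i s IHs].
  by under eq_fun do rewrite big_nil; exact: Ck_cst.
by under eq_fun do rewrite big_cons; exact: CkD.
Qed.

Lemma Ck_comp k (g : R -> R) f : smooth1 g -> Ck k f -> Ck k (g \o f).
Proof.
move=> [gs <- dgs]; have [N ->] : exists N, gs 0%N = gs N by exists 0%N.
elim: k f N => [|k IHk] f N cf.
  move=> x; apply: continuous_comp; first exact: cf.
  apply/differentiable_continuous/derivable1_diffP.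
  by have [] := dgs N (f x).
apply: (@CkS _ _ (fun j x => (gs N.+1 \o f) x * partial j f x)) => [x|j x|j].
- apply: continuous_comp; first exact: (Ck0 cf).
  apply/differentiable_continuous/derivable1_diffP.
  by have [] := dgs N (f x).
- exact: (is_derive_comp1 (Ck_is_derive j x cf) (dgs N (f x))).
- apply: CkM; first by apply: IHk; exact: CkW.
  by have [_ /(_ j)[]] := cf.
Qed.

(** The regularised profiles are only C^1, which [Ck_comp] does not cover; the explicit derivative
    is what [sob_comp] passes to the limit. *)
Lemma C1_comp (g g' : R -> R) f : (forall t : R, is_derive t 1 g (g' t)) ->
  continuous g' -> Ck 1 f ->
  Ck 1 (g \o f) /\ forall j x, partial j (g \o f) x = g' (f x) * partial j f x.
Proof.
move=> dg cg' cf.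
have cg : continuous g.
  by move=> t; apply/differentiable_continuous/derivable1_diffP; have [] := dg t.
have dgf j x : is_derive x (e j) (g \o f) (g' (f x) * partial j f x).
  exact: (is_derive_comp1 (Ck_is_derive j x cf) (dg (f x))).
split; last by move=> j x; exact: partialE.
apply: (@CkS _ _ (fun j x => (g' \o f) x * partial j f x)) => // [x|j].
  by apply: continuous_comp; [exact: (Ck0 cf)|exact: cg].
apply: CkM; last by have [_ /(_ j)[]] := cf.
by move=> x; apply: continuous_comp; [exact: (Ck0 cf)|exact: cg'].
Qed.

Lemma partialD f g j x : Ck 1 f -> Ck 1 g ->
  partial j (fun x => f x + g x) x = partial j f x + partial j g x.
Proof. by move=> cf cg; apply: partialE; exact: (is_deriveD (Ck_is_derive j x cf) (Ck_is_derive j x cg)). Qed.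

Lemma partialM f g j x : Ck 1 f -> Ck 1 g ->
  partial j (fun x => f x * g x) x = f x * partial j g x + g x * partial j f x.
Proof. by move=> cf cg; apply: partialE; exact: (is_deriveM (Ck_is_derive j x cf) (Ck_is_derive j x cg)). Qed.

Lemma partial_cst (c : R) j x : partial j (cst c : 'rV[R]_n -> R) x = 0.
Proof. by apply: partialE; exact: is_derive_cst. Qed.

Lemma partial_coord i j x : partial j (fun y => y ord0 i) x = (i == j)%:R.
Proof.
have := @is_derive_coord i x (e j); rewrite mxE eqxx/= => /partialE ->.
by rewrite eq_sym.
Qed.

End Ck_theory.

(** * Integrals of functions with bounded support *)

Section bounded_support.
Context {R : realType}.
Implicit Types n : nat.

Definition bsupp n (f : 'rV[R]_n -> R) := exists M : R, forall x, M < `|x| -> f x = 0.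

Lemma closed_le_norm n (M : R) : closed [set x : 'rV[R]_n | `|x| <= M].
Proof.
rewrite (_ : mkset _ = (@Num.norm R 'rV[R]_n) @^-1` [set y | y <= M])//.
by apply: preimage_closed; [move=> x _; exact: norm_continuous|exact: closed_le].
Qed.

Lemma compact_le_norm n (M : R) : compact [set x : 'rV[R]_n | `|x| <= M].
Proof.
apply: bounded_closed_compact; last exact: closed_le_norm.
exists M; split; first exact: num_real.
by move=> y My x /= /le_trans; apply; exact: ltW.
Qed.

Lemma measure_le_norm_lty n (M : R) :
  (lebesgue_rV n [set x : 'rV[R]_n | (`|x| <= M)%R] < +oo)%E.
Proof.
have [M0|M0] := leP 0 M; last first.
  rewrite (_ : mkset _ = set0) ?measure0// -subset0 => x /= xM.
  by have := le_lt_trans xM M0; rewrite normr_lt0.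
rewrite (_ : mkset _ = [set x : 'rV[R]_n | forall i, (const_mx (- M) : 'rV_n) ord0 i <= x ord0 i <= (const_mx M : 'rV_n) ord0 i]).
  by rewrite lebesgue_rV_box ?ltry// => i; rewrite !mxE; lra.
apply/seteqP; split => x /=.
  by move=> /(rV_norm_leP _ M0) xM i; rewrite !mxE -ler_norml.
by move=> xM; apply/(rV_norm_leP _ M0) => i; have := xM i; rewrite !mxE -ler_norml.
Qed.

Lemma compact_bounded_fun n (K : set 'rV[R]_n) (f : 'rV[R]_n -> R) :
  compact K -> {in K, continuous f} -> exists C, forall x, K x -> `|f x| <= C.
Proof.
move=> cK cf.
have : compact (f @` K).
  by apply: continuous_compact => //; apply: continuous_in_subspaceT.
move=> /compact_bounded[C [_ fC]]; exists (C + 1) => x Kx.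
by apply: (fC (C + 1)); [rewrite ltrDl|exists x].
Qed.

Lemma bsupp_bounded n (f : 'rV[R]_n -> R) : continuous f -> bsupp f ->
  exists C, forall x, `|f x| <= C.
Proof.
move=> cf [M fM].
have [C fC] := @compact_bounded_fun _ _ f (@compact_le_norm n M) (fun x _ => cf x).
exists (Num.max C 0) => x; rewrite le_max; have [xM|xM] := leP `|x| M.
  by rewrite fC.
by rewrite fM// normr0 lexx orbT.
Qed.

Lemma integrable_bsupp n (f : 'rV[R]_n -> R) : measurable_fun setT f ->
  (exists C, forall x, `|f x| <= C) -> bsupp f ->
  (lebesgue_rV n).-integrable setT (EFin \o f).
Proof.
move=> mf [C fC] [M fM].
have mD : measurable [set x : 'rV[R]_n | `|x| <= M].
  by apply: closed_measurable_rV; exact: closed_le_norm.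
have iD : (lebesgue_rV n).-integrable [set x : 'rV[R]_n | `|x| <= M] (EFin \o f).
  apply: measurable_bounded_integrable => //.
  - exact: measure_le_norm_lty.
  - exact: measurable_funTS.
  - exists C; split; first exact: num_real.
    by move=> y Cy x _; apply: le_trans (fC x) (ltW Cy).
have -> : EFin \o f = (EFin \o f) \_ [set x : 'rV[R]_n | `|x| <= M].
  apply/funext => x; rewrite /patch; case: ifPn => //.
  by rewrite notin_setE/= => /negP; rewrite -ltNge => /fM ->.
by rewrite -integrable_mkcond.
Qed.

Lemma continuous_integrable_bsupp n (f : 'rV[R]_n -> R) : continuous f -> bsupp f ->
  (lebesgue_rV n).-integrable setT (EFin \o f).
Proof.
move=> cf sf; apply: integrable_bsupp => //; first exact: continuous_measurable_rV.
exact: bsupp_bounded.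
Qed.

Lemma integral_derive_bsupp1 (g g' : R -> R) (M : R) :
  (forall s : R, is_derive s 1 g (g' s)) -> continuous g' ->
  (forall s, M < `|s| -> g s = 0) ->
  (\int[@lebesgue_measure R : {sigma_finite_measure set (measurableTypeR R) -> \bar R}]_s (g' s)%:E = 0)%E.
Proof.
move=> dg cg' gM.
have cg : continuous g.
  by move=> t; apply/differentiable_continuous/derivable1_diffP; have [] := dg t.
(* One more than [|M|], so that [g] vanishes at the endpoints [- N] and [N] of the fundamental
   theorem of calculus. *)
pose N := `|M| + 1.
have MN : M < N by rewrite /N; have := ler_norm M; lra.
have N0 : 0 < N by rewrite /N; have := normr_ge0 M; lra.
have g'0 s : M < `|s| -> g' s = 0.
  move=> Ms; have [_ <-] := dg s.
  apply: derive_val; apply: (@near_eq_is_derive R R R (cst 0)) => //.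
  near=> t; rewrite /cst gM//; near: t.
  by apply: (@cvgr_gt _ _ _ _ (fun t : R => `|t|) `|s|) => //; exact: norm_continuous.
have E : (fun s => (g' s)%:E) = (fun s => (g' s)%:E) \_ `[- N, N].
  apply/funext => s; rewrite /patch; case: ifPn => //.
  rewrite notin_setE/= in_itv/= -ler_norml => /negP; rewrite -ltNge => Ns.
  by rewrite g'0// (lt_trans MN).
rewrite E -integral_mkcond.
have NN : - N < N by lra.
rewrite (continuous_FTC2 NN (F := g)).
- by rewrite !gM ?subee// ?normrN gtr0_norm.
- by apply: continuous_subspaceT.
- split; first by move=> x _; have [] := dg x.
  + by apply: cvg_at_right_filter; exact: cg.
  + by apply: cvg_at_left_filter; exact: cg.
- by move=> x _; rewrite derive1E; have [_ ->] := dg x.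
Unshelve. all: by end_near. Qed.

Lemma bsupp_partial n (f : 'rV[R]_n -> R) j : bsupp f -> bsupp (partial j f).
Proof.
move=> [M fM]; exists M => x Mx.
apply: partialE; apply: (@near_eq_is_derive R _ R (cst 0)).
near=> t; rewrite /cst fM//; near: t.
by apply: (@cvgr_gt _ _ _ _ (fun t : 'rV[R]_n => `|t|) `|x|) => //; exact: norm_continuous.
Unshelve. all: by end_near. Qed.

(** Fubini in the order adapted to [j]: for the first coordinate the inner integral is that of a
    derivative on the line; otherwise the first coordinate is frozen and the induction hypothesis
    applies to the slice. *)
Lemma integral_partial_bsupp n (j : 'I_n) (f : 'rV[R]_n -> R) : Ck 1 f -> bsupp f ->
  (\int[lebesgue_rV n]_x (partial j f x)%:E = 0)%E.
Proof.
elim: n j f => [[]//|n IHn] j f cf sf.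
have cpf : continuous (partial j f) by have [_ /(_ j)[]] := cf.
have ipf := continuous_integrable_bsupp cpf (bsupp_partial j sf).
have [M fM] := sf.
case: (unliftP ord0 j) => [k jk|j0].
- rewrite (fubini_rV ipf) integral0_eq// => s _ /=.
  pose fs (v : 'rV[R]_n) := f (rVcons (s, v)).
  have dk k' v : is_derive v (delta_mx ord0 k' : 'rV_n) fs (partial (lift ord0 k') f (rVcons (s, v))).
    apply/is_derive_line; have /is_derive_line := Ck_is_derive (lift ord0 k') (rVcons (s, v)) cf.
    congr (is_derive _ _ _ _); apply/funext => h; congr f.
    by rewrite -rVcons_deltaS -rVconsZ -rVconsD mulr0 add0r.
  have cfs : continuous fs.
    by move=> v; apply: (continuous_comp (@rVcons_continuousr R n s v)); exact: (Ck0 cf).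
  have Cfs : Ck 1 fs.
    apply: (@CkS _ _ _ _ (fun k' v => partial (lift ord0 k') f (rVcons (s, v)))) => //.
    move=> k' v; apply: (continuous_comp (@rVcons_continuousr R n s v)).
    by have [_ /(_ (lift ord0 k'))[_]] := cf; exact.
  have sfs : bsupp fs.
    by exists M => v Mv; rewrite /fs fM//; apply: lt_le_trans Mv (norm_rVcons_ger s v).
  rewrite -[RHS](IHn k _ Cfs sfs); apply: eq_integral => v _.
  by rewrite (partialE (dk k v)) jk.
- rewrite (fubini_rV' ipf) integral0_eq// => v _ /=.
  apply: (@integral_derive_bsupp1 (fun s => f (rVcons (s, v))) _ M).
  + move=> s; apply/is_derive_line.
    have /is_derive_line := Ck_is_derive j (rVcons (s, v)) cf.
    congr (is_derive _ _ _ _); apply/funext => h; congr f.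
    by rewrite j0 -rVcons_delta0 -rVconsZ -rVconsD scaler0 add0r.
  + move=> s; apply: (continuous_comp (@rVcons_continuousl R n v s)).
    exact: cpf.
  + by move=> s Ms; rewrite fM//; apply: lt_le_trans Ms (norm_rVcons_gel s v).
Qed.

End bounded_support.

Section continuous_real.
Context {R : realType} (T : topologicalType).
Implicit Types f g : T -> R.

Lemma continuousDf f g : continuous f -> continuous g -> continuous (fun x => f x + g x).
Proof. by move=> cf cg x; exact: (continuousD (cf x) (cg x)). Qed.

Lemma continuousBf f g : continuous f -> continuous g -> continuous (fun x => f x - g x).
Proof. by move=> cf cg x; exact: (continuousB (cf x) (cg x)). Qed.

Lemma continuousMf f g : continuous f -> continuous g -> continuous (fun x => f x * g x).
Proof. by move=> cf cg x; exact: (continuousM (cf x) (cg x)). Qed.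

Lemma continuous_normf f : continuous f -> continuous (fun x => `|f x|).
Proof.
by move=> cf x; apply: (continuous_comp (cf x)); exact: norm_continuous.
Qed.

Lemma continuous_maxr f g : continuous f -> continuous g ->
  continuous (fun x => Num.max (f x) (g x)).
Proof.
move=> cf cg; have -> : (fun x => Num.max (f x) (g x)) =
    (fun x => 2^-1 * ((f x + g x) + `|f x - g x|)).
  by apply/funext => x; rewrite maxr_absE mulrC.
apply: continuousMf; first exact: cst_continuous.
apply: continuousDf; first exact: continuousDf.
by apply: continuous_normf; exact: continuousBf.
Qed.

Lemma continuous_minr f g : continuous f -> continuous g ->
  continuous (fun x => Num.min (f x) (g x)).
Proof.
move=> cf cg; have -> : (fun x => Num.min (f x) (g x)) =
    (fun x => f x + g x - Num.max (f x) (g x)).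
  by apply/funext => x; rewrite -(addr_max_min (f x) (g x)) addrAC subrr add0r.
by apply: continuousBf; [exact: continuousDf|exact: continuous_maxr].
Qed.

End continuous_real.

(** * Convergence in L^2 *)

Section square_integral.
Context {R : realType} d (T : measurableType d) (mu : {measure set T -> \bar R}).
Variables (D : set T) (mD : measurable D).
Implicit Types f g h : T -> R.

(** The square of the L^2 norm, so that no root is ever taken; the price is the factor 2 in [sqnD]
    and in [sqnB_triangle]. *)
Definition sqn f : \bar R := (\int[mu]_(x in D) (f x ^+ 2)%:E)%E.

Definition L2cvg (fk : nat -> T -> R) f := forall e : R, 0 < e ->
  exists N, forall k, (N <= k)%N -> (sqn (fun x => fk k x - f x)%R <= e%:E)%E.

Lemma measurable_sq f : measurable_fun D f -> measurable_fun D (fun x => (f x ^+ 2)%:E).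
Proof. by move=> mf; apply/measurable_EFinP; exact: measurable_funX. Qed.

Lemma sqn_ge0 f : (0 <= sqn f)%E.
Proof. by apply: integral_ge0 => x _; rewrite lee_fin sqr_ge0. Qed.

Lemma sqn_le f g (C : R) : measurable_fun D f -> measurable_fun D g -> 0 <= C ->
  (forall x, D x -> `|f x| <= C * `|g x|) -> (sqn f <= (C ^+ 2)%:E * sqn g)%E.
Proof.
move=> mf mg C0 fg; rewrite /sqn -ge0_integralZl//; last 3 first.
- exact: measurable_sq.
- by move=> x _; rewrite lee_fin sqr_ge0.
- by rewrite lee_fin sqr_ge0.
apply: ge0_le_integral => //.
- by move=> x _; rewrite lee_fin sqr_ge0.
- exact: measurable_sq.
- by apply/measurable_EFinP; apply: measurable_funM => //; exact: measurable_funX.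
- move=> x Dx; rewrite lee_fin -exprMn -[leLHS]ger0_norm ?sqr_ge0// normrX.
  rewrite -[leRHS]ger0_norm ?sqr_ge0// normrX normrM (ger0_norm C0).
  by rewrite lerXn2r ?nnegrE ?mulr_ge0// fg.
Qed.

Lemma sqnD f g : measurable_fun D f -> measurable_fun D g ->
  (sqn (fun x => f x + g x)%R <= 2%:E * (sqn f + sqn g))%E.
Proof.
move=> mf mg; rewrite /sqn -ge0_integralD//; last 4 first.
- by move=> x _; rewrite lee_fin sqr_ge0.
- exact: measurable_sq.
- by move=> x _; rewrite lee_fin sqr_ge0.
- exact: measurable_sq.
rewrite -ge0_integralZl//; last 2 first.
- by apply: emeasurable_funD; exact: measurable_sq.
- by move=> x _; rewrite -EFinD lee_fin addr_ge0// sqr_ge0.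
apply: ge0_le_integral => //.
- by move=> x _; rewrite lee_fin sqr_ge0.
- by apply: measurable_sq; exact: measurable_funD.
- apply: emeasurable_funM => //; apply: emeasurable_funD; exact: measurable_sq.
- move=> x Dx; rewrite -EFinD -EFinM lee_fin -subr_ge0.
  by rewrite (_ : _ - _ = (f x - g x) ^+ 2) ?sqr_ge0//; ring.
Qed.

Lemma sqnB_triangle f g h : measurable_fun D f -> measurable_fun D g -> measurable_fun D h ->
  (sqn (fun x => f x - h x)%R <=
   2%:E * (sqn (fun x => f x - g x)%R + sqn (fun x => g x - h x)%R))%E.
Proof.
move=> mf mg mh; apply: le_trans (sqnD _ _); last 2 first.
  exact: measurable_funB.
  exact: measurable_funB.
by rewrite le_eqVlt; apply/orP; left; apply/eqP; apply: eq_integral => x _; rewrite addrA subrK.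
Qed.

Lemma sqnBC f g : sqn (fun x => f x - g x) = sqn (fun x => g x - f x).
Proof. by apply: eq_integral => x _; rewrite -sqrrN opprB. Qed.

Lemma sqn_integrable f : measurable_fun D f -> (sqn f < +oo)%E ->
  mu.-integrable D (fun x => (f x ^+ 2)%:E).
Proof.
move=> mf fi; apply/integrableP; split; first exact: measurable_sq.
apply: le_lt_trans fi; rewrite /sqn le_eqVlt; apply/orP; left; apply/eqP.
by apply: eq_integral => x _; rewrite gee0_abs// lee_fin sqr_ge0.
Qed.

Lemma sqn_dominated (fk : nat -> T -> R) f g :
  (forall k, measurable_fun D (fk k)) -> measurable_fun D f -> measurable_fun D g ->
  (sqn g < +oo)%E ->
  (forall x, D x -> fk ^~ x @ \oo --> f x) ->
  (forall k x, D x -> `|fk k x - f x| <= g x) ->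
  L2cvg fk f.
Proof.
move=> mfk mf mg gi fkf fg e e0.
have [|||||_ _] := @dominated_convergence _ _ _ mu D mD
  (fun k x => ((fk k x - f x) ^+ 2)%:E) (cst 0%E) (fun x => (g x ^+ 2)%:E).
- by move=> k; apply: measurable_sq; exact: measurable_funB.
- exact: measurable_cst.
- apply: aeW => x Dx; apply/fine_cvgP; split; first exact: nearW.
  rewrite /comp/= (_ : 0 = (f x - f x) ^+ 2); last by rewrite subrr expr0n.
  under eq_fun do rewrite expr2; rewrite expr2.
  by apply: cvgM; (apply: cvgB; [exact: fkf|exact: cvg_cst]).
- exact: sqn_integrable.
- apply: aeW => x k Dx; rewrite gee0_abs ?lee_fin ?sqr_ge0//.
  rewrite -[leLHS]ger0_norm ?sqr_ge0// normrX.
  have := fg k x Dx; move: (normr_ge0 (fk k x - f x)).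
  by move=> ? ?; rewrite lerXn2r ?nnegrE//; lra.
rewrite integral0 => H.
have /fine_cvgP[[N' _ HN'] /cvgrPdist_le/(_ _ e0)[N _ HN]] := H.
exists (maxn N N') => k; rewrite geq_max => /andP[Nk N'k].
have := HN _ Nk; have := HN' _ N'k => fk_fin; rewrite sub0r normrN /= => ek.
have E := fineK fk_fin; rewrite /= in E.
by rewrite /sqn -E lee_fin; apply: le_trans (ler_norm _) ek.
Qed.

Lemma L2cvg_ext (fk fk' : nat -> T -> R) f f' : L2cvg fk f ->
  (forall k x, D x -> fk k x = fk' k x) -> (forall x, D x -> f x = f' x) -> L2cvg fk' f'.
Proof.
move=> H E E' e e0; have [N HN] := H e e0; exists N => k Nk.
rewrite (_ : sqn _ = sqn (fun x => fk k x - f x)); first exact: HN.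
by apply: eq_integral => x /set_mem Dx; rewrite E// E'.
Qed.

Lemma L2cvgD (fk gk : nat -> T -> R) f g :
  (forall k, measurable_fun D (fk k)) -> (forall k, measurable_fun D (gk k)) ->
  measurable_fun D f -> measurable_fun D g ->
  L2cvg fk f -> L2cvg gk g ->
  L2cvg (fun k x => fk k x + gk k x) (fun x => f x + g x).
Proof.
move=> mfk mgk mf mg cf cg e e0.
have e4 : 0 < e / 4 by rewrite divr_gt0.
have [N HN] := cf _ e4; have [N' HN'] := cg _ e4.
exists (maxn N N') => k; rewrite geq_max => /andP[Nk N'k].
have -> : sqn (fun x => fk k x + gk k x - (f x + g x)) =
  sqn (fun x => (fk k x - f x) + (gk k x - g x)).
  by apply: eq_integral => x _; congr ((_ ^+ 2)%:E); ring.
apply: (le_trans (sqnD _ _)); [exact: measurable_funB|exact: measurable_funB|].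
rewrite (_ : e%:E = (2%:E * ((e / 4)%:E + (e / 4)%:E))%E); last first.
  by rewrite -EFinD -EFinM; congr EFin; field.
by apply: lee_wpmul2l => //; apply: leeD; [exact: HN|exact: HN'].
Qed.

End square_integral.

Import HBNNSimple.

(** * Density of continuous functions in L^2 for a finite measure *)

Section density.
Context {R : realType} (n : nat).
Variables (mu : {measure set 'rV[R]_n -> \bar R}) (D : set 'rV[R]_n).
Hypotheses (mD : measurable D) (muD : (mu D < +oo)%E).
Implicit Types f g : 'rV[R]_n -> R.

Definition L2approx f := forall e : R, 0 < e ->
  exists2 g, continuous g & (sqn mu D (fun x => f x - g x)%R <= e%:E)%E.

Lemma L2approx_continuous f : continuous f -> L2approx f.
Proof.
move=> cf e e0; exists f => //; rewrite /sqn integral0_eq ?lee_fin ?ltW//.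
by move=> x _; rewrite subrr expr0n.
Qed.

Let cm f : continuous f -> measurable_fun D f.
Proof. by move=> cf; apply: measurable_funTS; exact: continuous_measurable_rV. Qed.

Lemma L2approx_cvg (fk : nat -> 'rV[R]_n -> R) f :
  (forall k, measurable_fun D (fk k)) -> measurable_fun D f ->
  (forall k, L2approx (fk k)) -> L2cvg mu D fk f -> L2approx f.
Proof.
move=> mfk mf afk fkf e e0.
have e4 : 0 < e / 4 by rewrite divr_gt0.
have [N HN] := fkf _ e4; have [g cg gN] := afk N _ e4.
exists g => //; apply: (le_trans (sqnB_triangle mu mD mf (mfk N) (cm cg))).
rewrite (_ : e%:E = (2%:E * ((e / 4)%:E + (e / 4)%:E))%E); last first.
  by rewrite -EFinD -EFinM; congr EFin; field.
by apply: lee_wpmul2l => //; apply: leeD => //; rewrite sqnBC; exact: HN.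
Qed.

Lemma L2approxD f g : measurable_fun D f -> measurable_fun D g ->
  L2approx f -> L2approx g -> L2approx (fun x => f x + g x).
Proof.
move=> mf mg af ag e e0.
have e4 : 0 < e / 4 by rewrite divr_gt0.
have [f' cf' ff'] := af _ e4; have [g' cg' gg'] := ag _ e4.
exists (fun x => f' x + g' x); first by move=> x; exact: (continuousD (cf' x) (cg' x)).
have -> : sqn mu D (fun x => f x + g x - (f' x + g' x)) =
  sqn mu D (fun x => (f x - f' x) + (g x - g' x)).
  by apply: eq_integral => x _; congr ((_ ^+ 2)%:E); ring.
apply: (le_trans (sqnD mu mD _ _)).
- by apply: measurable_funB => //; exact: cm.
- by apply: measurable_funB => //; exact: cm.
rewrite (_ : e%:E = (2%:E * ((e / 4)%:E + (e / 4)%:E))%E); last first.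
  by rewrite -EFinD -EFinM; congr EFin; field.
by apply: lee_wpmul2l => //; apply: leeD.
Qed.

Lemma L2approxZ (c : R) f : measurable_fun D f -> L2approx f -> L2approx (fun x => c * f x).
Proof.
move=> mf af e e0.
have c0 : 0 < (`|c| + 1) ^+ 2 by rewrite exprn_gt0//; have := normr_ge0 c; lra.
have [g cg fg] := af _ (divr_gt0 e0 c0).
exists (fun x => c * g x).
  by move=> x; exact: (continuousM (@cst_continuous _ _ c x) (cg x)).
have -> : sqn mu D (fun x => c * f x - c * g x) = sqn mu D (fun x => c * (f x - g x)).
  by apply: eq_integral => x _; congr ((_ ^+ 2)%:E); ring.
apply: (@le_trans _ _ (((`|c| + 1) ^+ 2)%:E * sqn mu D (fun x => f x - g x)%R)%E).
  apply: sqn_le => //.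
  - apply: measurable_funM => //; apply: measurable_funB => //; exact: cm.
  - by apply: measurable_funB => //; exact: cm.
  - by move=> x _; rewrite normrM ler_wpM2r//; lra.
have -> : e%:E = (((`|c| + 1) ^+ 2)%:E * (e / (`|c| + 1) ^+ 2)%:E)%E.
  by rewrite -EFinM mulrC divfK// gt_eqF.
by apply: lee_wpmul2l; rewrite ?lee_fin ?sqr_ge0.
Qed.

(** A pi-system made for the density argument: intersections correspond to products, and the
    indicator of [t != 0] is the limit of the continuous functions [Num.min 1 (k%:R * |t|)]. *)
Definition cozero : set (set 'rV[R]_n) :=
  [set A | exists2 t : 'rV[R]_n -> R, continuous t & A = [set x | t x != 0]].

Lemma measurable_sub_cozero : @measurable _ 'rV[R]_n `<=` <<s cozero >>.
Proof.
apply: smallest_sub; first exact: smallest_sigma_algebra.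
move=> _ [i [j [B mB ->]]].
have {}mB : <<s @measurable_realfun.RGenOpens.G R >> B.
  have E := RGenOpens.measurableE R; rewrite /measurable/= in E; rewrite -E.
  exact: mB.
have [sc0 scC scU] := smallest_sigma_algebra setT cozero.
suff : <<s @RGenOpens.G R >> `<=` [set B | <<s cozero >> ((fun M : 'rV[R]_n => M i j) @^-1` B)].
  by move=> /(_ _ mB).
apply: smallest_sub.
- split => /=.
  + by rewrite preimage_set0.
  + by move=> A /scC; rewrite !setTD preimage_setC.
  + by move=> F FA; rewrite preimage_bigcup; exact: scU.
- move=> _ [a [b ->]]; apply: sub_sigma_algebra.
  exists (fun x => Num.max 0 (Num.min (x i j - a) (b - x i j))).
    rewrite (ord1 i); apply: continuous_maxr; first exact: cst_continuous.
    apply: continuous_minr => x; apply: continuousB.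
    - exact: coord_rV_continuous.
    - exact: cst_continuous.
    - exact: cst_continuous.
    - exact: coord_rV_continuous.
  apply/seteqP; split => x /=; rewrite in_itv/=.
    by move=> /andP[ax xb]; rewrite gt_eqF// lt_max lt_min !subr_gt0 ax xb orbT.
  by case: (ltP 0 (Num.min (x i j - a) (b - x i j))); [rewrite lt_min !subr_gt0|rewrite eqxx].
Qed.

(** Dynkin's argument: the sets with approximable indicator form a lambda-system that contains the
    generating pi-system [cozero]. Finiteness of [mu D] makes the constant 1 a dominating function
    in both limits. *)
Lemma L2approx_indic A : measurable A -> L2approx (\1_A).
Proof.
have mI (B : set 'rV[R]_n) : measurable B -> measurable_fun D (\1_B : _ -> R).
  by move=> mB; exact: measurable_indic.
have sqn1 : (sqn mu D (cst 1%R) < +oo)%E.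
  by rewrite /sqn/= expr1n integral_cst// mul1e.
pose H := [set A : set 'rV[R]_n | measurable A /\ L2approx \1_A].
suff : <<s cozero >> `<=` H by move=> sub mA; have [] := sub _ (measurable_sub_cozero mA).
apply: lambda_system_subset.
- move=> A1 A2 [t1 ct1 ->] [t2 ct2 ->].
  exists (fun x => t1 x * t2 x); first by move=> x; exact: (continuousM (ct1 x) (ct2 x)).
  by apply/seteqP; split => x /=; rewrite mulf_eq0 negb_or => /andP.
- split => //.
  + split => //; rewrite indicT; apply: L2approx_continuous; exact: cst_continuous.
  + move=> B C CB [mB aB] [mC aC]; split; first exact: measurableD.
    have -> : \1_(B `\` C) = (fun x => \1_B x + (-1) * \1_C x) :> (_ -> R).
      apply/funext => x; rewrite !indicE in_setD.
      have [xC|xC] := boolP (x \in C); last by rewrite andbT mulr0 addr0.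
      by rewrite andbF (_ : x \in B) ?mulr1 ?addrN//; apply/mem_set/CB/set_mem.
    apply: (@L2approxD \1_B (fun x => (-1) * \1_C x)); [exact: mI| |by []|].
      by apply: measurable_funM => //; exact: mI.
    by apply: L2approxZ => //; exact: mI.
  + move=> F ndF FH; split; first by apply: bigcup_measurable => k _; have [] := FH k.
    apply: (@L2approx_cvg (fun k => \1_(F k))).
    * by move=> k; apply: mI; have [] := FH k.
    * by apply: mI; apply: bigcup_measurable => k _; have [] := FH k.
    * by move=> k; have [] := FH k.
    apply: (@sqn_dominated _ _ _ _ _ mD _ _ (cst 1)) => //.
    * by move=> k; apply: mI; have [] := FH k.
    * by apply: mI; apply: bigcup_measurable => k _; have [] := FH k.
    * move=> x _; have [[k _ Fkx]|nFx] := pselect ((\bigcup_k F k) x).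
        apply: cvg_near_cst; exists k => // l /= kl.
        rewrite !indicE mem_set ?(mem_set (A := \bigcup_k F k))//; first by exists k.
        by have /subsetPset := ndF _ _ kl; exact.
      apply: cvg_near_cst; exists 0%N => // l _.
      rewrite !indicE memNset ?(memNset (A := \bigcup_k F k))//.
      by move=> Flx; apply: nFx; exists l.
    * by move=> k x _; rewrite !indicE; do 2 case: (_ \in _); rewrite ?subrr ?subr0 ?sub0r ?normrN ?normr0 ?normr1.
- move=> _ [t ct ->]; split.
    apply: open_measurable_rV; rewrite (_ : mkset _ = t @^-1` [set y | y != 0])//.
    by apply: open_comp => [x _|]; [exact: ct|exact: open_neq].
  have cg k : continuous (fun x : 'rV[R]_n => Num.min 1 (k%:R * `|t x|)).
    apply: continuous_minr; first exact: cst_continuous.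
    by apply: continuousMf; [exact: cst_continuous|exact: continuous_normf].
  have mt : measurable [set x : 'rV[R]_n | t x != 0].
    apply: open_measurable_rV; rewrite (_ : mkset _ = t @^-1` [set y | y != 0])//.
    by apply: open_comp => [x _|]; [exact: ct|exact: open_neq].
  apply: (@L2approx_cvg (fun k x => Num.min 1 (k%:R * `|t x|))).
  + by move=> k; exact: cm.
  + exact: mI.
  + by move=> k; exact: L2approx_continuous.
  apply: (@sqn_dominated _ _ _ _ _ mD _ _ (cst 1)) => //.
  + by move=> k; exact: cm.
  + move=> x _; rewrite indicE; have [tx|tx] := eqVneq (t x) 0.
      rewrite memNset/= ?tx ?eqxx// normr0; under eq_fun do rewrite mulr0.
      by rewrite min_r//; exact: cvg_cst.
    rewrite mem_set//=; apply: cvg_near_cst.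
    near=> k; rewrite min_l// -ler_pdivrMr ?normr_gt0// mul1r.
    by near: k; exact: nbhs_infty_ger.
  + move=> k x _; rewrite indicE; case: (_ \in _).
      by rewrite distrC ger0_norm ?subr_ge0 ?ge_min ?lexx// gerBl le_min ler01/= mulr_ge0.
    by rewrite subr0 ger0_norm ?ge_min ?lexx// le_min ler01/= mulr_ge0.
- by [].
Unshelve. all: by end_near. Qed.

Lemma L2approx_nnsfun (f : {nnsfun 'rV[R]_n >-> R}) : L2approx (f : 'rV[R]_n -> R).
Proof.
have -> : (f : _ -> R) = (fun x => \sum_(y \in range f) (y * \1_(f @^-1` [set y]) x)).
  by apply/funext => x; exact: fimfunE.
rewrite (_ : (fun x => _) = (fun x => \sum_(y <- finmap.enum_fset (fset_set (range f))) (y * \1_(f @^-1` [set y]) x))).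
  elim: (finmap.enum_fset _) => [|y s IHs].
    under eq_fun do rewrite big_nil; apply: L2approx_continuous; exact: cst_continuous.
  under eq_fun do rewrite big_cons.
  have mI z : measurable_fun D (\1_(f @^-1` [set z]) : _ -> R).
    by apply: measurable_indic; exact: measurable_sfunP.
  apply: L2approxD => //.
  - exact: measurable_funM.
  - by apply: measurable_sum => z; exact: measurable_funM.
  - by apply: L2approxZ => //; apply: L2approx_indic; exact: measurable_sfunP.
by apply/funext => x; rewrite fsbig_finite.
Qed.

Lemma L2approx_L2 f : measurable_fun D f -> (sqn mu D f < +oo)%E -> L2approx f.
Proof.
have nn g : measurable_fun D g -> (forall x, 0 <= g x) -> (sqn mu D g < +oo)%E -> L2approx g.
  move=> mg g0 gi.
  have mEg : measurable_fun D (EFin \o g) by exact/measurable_EFinP.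
  pose gk := nnsfun_approx mD mEg.
  have gkg x : D x -> gk ^~ x @ \oo --> g x.
    move=> Dx; have gE y : D y -> (0 <= (EFin \o g) y)%E by move=> _; rewrite lee_fin.
    by have /fine_cvgP[_] := cvg_nnsfun_approx mD mEg gE Dx.
  apply: (@L2approx_cvg (fun k => gk k : _ -> R)) => //.
  - by move=> k; exact: measurable_funTS.
  - by move=> k; exact: L2approx_nnsfun.
  apply: (@sqn_dominated _ _ _ _ _ mD _ _ g) => //.
    by move=> k; exact: measurable_funTS.
  move=> k x Dx.
  have gkx : gk k x <= g x.
    rewrite -(cvg_lim (@norm_hausdorff _ R) (gkg x Dx)).
    apply: (@nondecreasing_cvgn_le R (fun k => gk k x)).
      by move=> a b ab; have /lefP := nd_nnsfun_approx mD mEg ab; exact.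
    by apply/cvg_ex; exists (g x); exact: gkg.
  rewrite distrC ger0_norm ?subr_ge0// lerBlDr lerDl; exact: fun_ge0.
move=> mf fi.
have -> : f = (fun x => Num.max (f x) 0 + (-1) * Num.max (- f x) 0).
  by apply/funext => x; rewrite mulN1r; case: (leP (f x) 0) => H1; case: (leP (- f x) 0) => H2; lra.
have mp : measurable_fun D (fun x => Num.max (f x) 0) by exact: measurable_maxr.
have mn : measurable_fun D (fun x => Num.max (- f x) 0).
  by apply: measurable_maxr => //; exact: measurable_funN.
have le1 (h : 'rV[R]_n -> R) : measurable_fun D h -> (forall x, `|h x| <= `|f x|) -> (sqn mu D h < +oo)%E.
  move=> mh hf; apply: le_lt_trans (_ : ((1 ^+ 2)%:E * sqn mu D f < +oo)%E).
    by apply: sqn_le => // x _; rewrite mul1r.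
  by rewrite expr1n mul1e.
apply: L2approxD => //.
- exact: measurable_funM.
- apply: nn => //; first by move=> x; rewrite le_max lexx orbT.
  apply: le1 => // x; case: (leP (f x) 0) => H1; rewrite ?normr0//.
- apply: L2approxZ => //; apply: nn => //; first by move=> x; rewrite le_max lexx orbT.
  apply: le1 => // x; case: (leP (- f x) 0) => H1; rewrite ?normr0 ?normrN//.
Qed.

End density.

(** * Mollification *)

Section mollifier.
Context {R : realType} (n : nat).
Local Notation mu := (lebesgue_rV n : {sigma_finite_measure set 'rV[R]_n -> \bar R}).
Implicit Types f g : 'rV[R]_n -> R.

Lemma bsupp_unif_continuous f : continuous f -> bsupp f -> forall e, 0 < e ->
  exists2 d, 0 < d & forall x y, `|y - x| < d -> `|f y - f x| < e.
Proof.
move=> cf [M fM] e e0.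
(* The compact ball is larger by 1 than the support and the modulus is kept at most 1: a point
   outside this ball, and every point that close to it, then lie outside the support. *)
have /compact_near_coveringP/(_ R (0^'+)) := @compact_le_norm R n (M + 1).
move=> /(_ (fun d x => forall y, `|y - x| < d -> `|f y - f x| < e)).
case.
- move=> x _.
  have /nbhs_ballP[r /= r0 xr] : nbhs x [set y | `|f x - f y| < e / 2].
    by have /cvgrPdist_lt/(_ _ (divr_gt0 e0 (ltr0Sn R 1))) := cf x.
  exists (ball x (r / 2), [set d : R | d < r / 2]) => /=.
    split; first by apply: nbhsx_ballx; rewrite divr_gt0.
    by apply: nbhs_right_lt; rewrite divr_gt0.
  move=> [x' d] [/= xx' dr] y yx'.
  have h1 : `|f x - f x'| < e / 2.
    by apply: xr; apply: le_ball xx'; lra.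
  have h2 : `|f x - f y| < e / 2.
    apply: xr; rewrite -ball_normE/=; move: xx'; rewrite -ball_normE/= => xx'.
    rewrite (_ : x - y = (x - x') - (y - x')); last by rewrite opprB addrA subrK.
    by apply: le_lt_trans (ler_normB _ _) _; lra.
  rewrite (_ : f y - f x' = (f x - f x') - (f x - f y)); last by ring.
  by apply: le_lt_trans (ler_normB _ _) _; lra.
- move=> d /= d0 H.
  pose d' := Num.min (d / 2) 1.
  exists d'; first by rewrite /d' lt_min ltr01 divr_gt0.
  move=> x y xy.
  have [xM|xM] := leP `|x| (M + 1).
    apply: (H (d / 2)) => //=.
    + by rewrite sub0r normrN gtr0_norm ?divr_gt0//; lra.
    + by rewrite divr_gt0.
    + by apply: lt_le_trans xy _; rewrite /d' ge_min lexx.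
  rewrite !fM ?subrr ?normr0//; first by lra.
  have : `|x| <= `|y| + `|y - x|.
    by have := ler_normB y (y - x); rewrite subKr.
  move: xy; rewrite /d' lt_min => /andP[_]; lra.
Qed.

Lemma measure_open_gt0 (A : set 'rV[R]_n) x : open A -> A x -> (0 < mu A)%E.
Proof.
move=> oA Ax; have /nbhs_rVP[e e0 xA] : nbhs x A by exact: open_nbhs_nbhs.
pose a : 'rV[R]_n := \row_i (x ord0 i - e / 2); pose b : 'rV[R]_n := \row_i (x ord0 i + e / 2).
apply: (@lt_le_trans _ _ (mu [set y : 'rV[R]_n | forall i, a ord0 i <= y ord0 i <= b ord0 i])).
  rewrite lebesgue_rV_box; last by move=> i; rewrite !mxE; lra.
  by rewrite lte_fin; apply: prodr_gt0 => i _; rewrite !mxE; lra.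
have sub : [set y : 'rV[R]_n | forall i, a ord0 i <= y ord0 i <= b ord0 i] `<=` A.
  move=> y /= yab; apply: xA => i; have := yab i; rewrite !mxE => /andP[? ?].
  by rewrite ltr_norml; apply/andP; split; lra.
apply: le_measure => //; rewrite inE; last exact: open_measurable_rV.
apply: closed_measurable_rV.
rewrite (_ : mkset _ = \bigcap_(i in [set: 'I_n]) ((fun y : 'rV[R]_n => y ord0 i) @^-1` `[a ord0 i, b ord0 i])).
  apply: closed_bigI => i _; apply: preimage_closed; last exact: interval_closed.
  by move=> y _; exact: coord_rV_continuous.
apply/seteqP; split => y /= yab i => [_|]; rewrite ?in_itv/=; first exact: yab.
by have := yab i Logic.I; rewrite /= in_itv.
Qed.

Lemma integral_continuous_gt0 f x0 : continuous f -> (forall x, 0 <= f x) -> 0 < f x0 ->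
  (0 < \int[mu]_x (f x)%:E)%E.
Proof.
move=> cf f0 fx0.
pose A := [set x : 'rV[R]_n | f x0 / 2 < f x].
have oA : open A.
  rewrite (_ : A = f @^-1` [set y | f x0 / 2 < y])//.
  by apply: open_comp => [x _|]; [exact: cf|exact: open_gt].
have mA := open_measurable_rV oA.
apply: (@lt_le_trans _ _ (\int[mu]_(x in A) (f x0 / 2)%:E)%E).
  rewrite integral_cst// mule_gt0 ?lte_fin ?divr_gt0//.
  by apply: (@measure_open_gt0 A x0) => //; rewrite /A/=; lra.
apply: (@le_trans _ _ (\int[mu]_(x in A) (f x)%:E)%E).
  apply: ge0_le_integral => //.
  - by move=> x _; rewrite lee_fin divr_ge0// ltW.
  - by apply/measurable_EFinP; apply: measurable_funTS; exact: continuous_measurable_rV.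
  - by move=> x Ax; rewrite lee_fin ltW.
apply: ge0_subset_integral => //.
- by apply/measurable_EFinP; exact: continuous_measurable_rV.
- by move=> x _; rewrite lee_fin.
Qed.

Definition smooth f := forall k, Ck k f.

(** Evenness makes [f (y - x)] have mass 1 in [x] as well as in [y], as Tonelli's theorem requires
    in [sqn_conv_le]. *)
Definition mollifier (d : R) f := [/\ smooth f, forall x, 0 <= f x,
  forall x, f (- x) = f x, forall x, d < `|x| -> f x = 0 &
  (\int[mu]_x (f x)%:E = 1)%E].

Lemma mollifier_bsupp d f : mollifier d f -> bsupp f.
Proof. by case=> _ _ _ fd _; exists d. Qed.

Lemma mollifier_continuous d f : mollifier d f -> continuous f.
Proof. by case=> /(_ 0%N). Qed.

Lemma smooth_sqnorm : smooth (fun x => \sum_i x ord0 i * x ord0 i).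
Proof. by move=> k; apply: Ck_sum => i; apply: CkM; exact: Ck_coord. Qed.

Lemma smoothM f g : smooth f -> smooth g -> smooth (fun x => f x * g x).
Proof. by move=> sf sg k; exact: CkM. Qed.

Lemma smooth_cst c : smooth (cst c).
Proof. by move=> k; exact: Ck_cst. Qed.

Lemma smooth_partial j f : smooth f -> smooth (partial j f).
Proof. by move=> sf k; have [_ /(_ j)[]] := sf k.+1. Qed.

Lemma mollifier_exists (d : R) : 0 < d -> exists f, mollifier d f.
Proof.
move=> d0.
pose h (x : 'rV[R]_n) := flat_exp 1 (d ^+ 2 - \sum_i x ord0 i * x ord0 i).
have sh : smooth h.
  move=> k; apply: (@Ck_comp _ _ _ (flat_exp 1)); first exact: smooth1_flat_exp.
  by apply: CkB; [exact: Ck_cst|exact: smooth_sqnorm].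
have h0 x : 0 <= h x.
  rewrite /h; case: (ltP 0 (d ^+ 2 - \sum_i x ord0 i * x ord0 i)) => H.
    by rewrite ltW// flat_exp1_gt0.
  by rewrite flat_exp1_le0.
have hd x : d < `|x| -> h x = 0.
  move=> dx; rewrite /h flat_exp1_le0// subr_le0.
  have [i xi] : exists i, d < `|x ord0 i|.
    apply: contrapT => /forallNP xd; move: dx; rewrite ltNge => /negP; apply.
    by apply/rV_norm_leP => [|i]; [exact: ltW|rewrite leNgt; apply/negP].
  rewrite (bigD1 i)//=; apply: (@le_trans _ _ (x ord0 i * x ord0 i)).
    by rewrite -expr2 -[leRHS]ger0_norm ?sqr_ge0// normrX lerXn2r ?nnegrE ?ltW// (lt_trans d0).
  by rewrite lerDl; apply: sumr_ge0 => k _; rewrite -expr2 sqr_ge0.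
have hN x : h (- x) = h x.
  by rewrite /h; congr (flat_exp _ (_ - _)); apply: eq_bigr => i _; rewrite !mxE mulrNN.
have ch : continuous h := sh 0%N.
have ih : mu.-integrable setT (EFin \o h).
  by apply: continuous_integrable_bsupp => //; exists d.
pose c := \int[mu]_x h x.
have cE : (\int[mu]_x (h x)%:E = c%:E)%E.
  by rewrite /c /Rintegral fineK//; exact: integrable_fin_num.
have c0 : 0 < c.
  rewrite -lte_fin -cE; apply: (@integral_continuous_gt0 _ 0) => //.
  rewrite /h flat_exp1_gt0// big1 ?subr0 ?exprn_gt0// => i _.
  by rewrite mxE mulr0.
exists (fun x => c^-1 * h x); split.
- by apply: smoothM => //; exact: smooth_cst.
- by move=> x; rewrite mulr_ge0// invr_ge0 ltW.
- by move=> x; rewrite hN.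
- by move=> x /hd ->; rewrite mulr0.
- under eq_integral do rewrite EFinM.
  by rewrite integralZl// cE -EFinM mulVf// gt_eqF.
Qed.

Lemma mollifier_integral_shift d f x : mollifier d f ->
  (\int[mu]_y (f (y - x))%:E = 1)%E.
Proof.
move=> mf; have [_ f0 _ _ f1] := mf; rewrite -f1.
by apply: ge0_integral_translate => //; exact: mollifier_continuous mf.
Qed.

Lemma mollifier_integral_shift' d f x : mollifier d f ->
  (\int[mu]_y (f (x - y))%:E = 1)%E.
Proof.
move=> mf; rewrite -(mollifier_integral_shift x mf); have [_ _ fN _ _] := mf.
by apply: eq_integral => y _; rewrite -fN opprB.
Qed.

(** With [y - x] instead of [x - y], the derivative in [x] is minus the derivative of [g] at
    [y - x], which is the form in which a weak gradient of [f] can be tested. *)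
Definition convol f g (x : 'rV[R]_n) : R := \int[mu]_y (f y * g (y - x)).

Lemma integrable_mul_bounded (D : set 'rV[R]_n) f g (C : R) : measurable D ->
  mu.-integrable D (EFin \o f) -> measurable_fun D g ->
  (forall x, D x -> `|g x| <= C) ->
  mu.-integrable D (fun x => (f x * g x)%:E).
Proof.
move=> mD fi mg gC.
have mf : measurable_fun D f by apply/measurable_EFinP; exact: measurable_int fi.
apply: (@le_integrable _ _ _ mu D mD _ (fun x => (C * f x)%:E)).
- by apply/measurable_EFinP; exact: measurable_funM.
- move=> x Dx; rewrite !abse_EFin lee_fin !normrM mulrC ler_wpM2r//.
  by apply: le_trans (gC x Dx) (ler_norm _).
- under eq_fun do rewrite EFinM.
  by apply: integrableZl.
Qed.

Section conv_smooth.
Variable f : 'rV[R]_n -> R.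
Hypothesis fi : mu.-integrable setT (EFin \o f).

Let sub_cont g x : continuous g -> continuous (fun y : 'rV[R]_n => g (y - x)).
Proof. exact: continuous_translate. Qed.

Lemma integrable_conv g x : continuous g -> bsupp g ->
  mu.-integrable setT (fun y => (f y * g (y - x))%:E).
Proof.
move=> cg sg; have [C gC] := bsupp_bounded cg sg.
apply: (@integrable_mul_bounded _ _ (fun y => g (y - x)) C) => //.
by apply: continuous_measurable_rV; exact: sub_cont.
Qed.

Lemma conv_continuous g : continuous g -> bsupp g -> continuous (convol f g).
Proof.
move=> cg sg x B /nbhs_ballP[e' /= e'0 xB].
pose e := e' / 2; have e0 : 0 < e by rewrite divr_gt0.
pose A := \int[mu]_y `|f y|.
have A0 : 0 <= A by apply: Rintegral_ge0.
have eA : 0 < e / (A + 1) by rewrite divr_gt0//; lra.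
have [d d0 H] := bsupp_unif_continuous cg sg eA.
have ai : mu.-integrable setT (fun y => (`|f y|)%:E).
  by have := integrable_abse fi.
apply/nbhs_ballP; exists d => //= z; rewrite -ball_normE/= => zd.
apply: xB; rewrite -ball_normE/=; apply: (@le_lt_trans _ _ e); last by rewrite /e; lra.
rewrite /convol -RintegralB//; last 2 first.
  exact: integrable_conv.
  exact: integrable_conv.
have iB : mu.-integrable setT (fun y => (f y * g (y - x) - f y * g (y - z))%:E).
  under eq_fun do rewrite EFinB.
  by apply: integrableB => //; exact: integrable_conv.
apply: (le_trans (le_normr_Rintegral _ _)) => //.
apply: (@le_trans _ _ (\int[mu]_y (`|f y| * (e / (A + 1))))).
  apply: le_Rintegral => //.
  - by have := integrable_abse iB.
  - by apply: (@integrable_mul_bounded _ (fun y => `|f y|) (cst (e / (A + 1))) `|e / (A + 1)|).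
  - move=> y _; rewrite -mulrBr normrM ler_wpM2l// ltW//.
    rewrite distrC -normrN opprB; rewrite distrC; apply: H.
    by rewrite (_ : y - z - (y - x) = x - z)//; apply/rowP => i; rewrite !mxE; ring.
rewrite RintegralZr// -/A mulrCA ger_pMr// ler_pdivrMr; last by lra.
by rewrite mul1r; lra.
Qed.

Lemma is_derive_conv g j x : Ck 1 g -> bsupp g ->
  is_derive x (delta_mx ord0 j) (convol f g) (convol f (fun y => - partial j g y) x).
Proof.
move=> cg sg; apply/is_derive_line.
have cpg : continuous (partial j g) by have [_ /(_ j)[]] := cg.
have spg := bsupp_partial j sg.
have [C gC] := bsupp_bounded cpg spg.
pose e : 'rV[R]_n := delta_mx ord0 j.
pose F (h : R) (y : 'rV[R]_n) := f y * g (y - (h *: e + x)).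
have dF (h : R) y : is_derive h 1 (F ^~ y) (f y * - partial j g (y - (h *: e + x))).
  have dg : is_derive h 1 (fun h : R => g (y - (h *: e + x))) (- partial j g (y - (h *: e + x))).
    apply/is_derive_line.
    have /is_derive_line dg0 := Ck_is_derive j (y - (h *: e + x)) cg.
    have dN : is_derive (0 : R) 1 (fun t : R => - t) (- 1).
      by apply: (derive_eq (is_deriveN (is_derive_id (0 : R) 1))).
    have := @is_derive1_comp R (fun t : R => g (t *: e + (y - (h *: e + x)))) (fun t : R => - t) 0 (partial j g (y - (h *: e + x))) (- 1).
    rewrite oppr0 => /(_ dg0 dN); rewrite mulrN1.
    congr (is_derive _ _ _ _); apply/funext => t /=; congr g.
    rewrite [t *: 1]mulr1 scaleNr scalerDl !opprD !addrA; congr (_ - _).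
    by rewrite [X in X - _ = _]addrC.
  apply: (derive_eq (is_deriveM (is_derive_cst (f y) h 1) dg)).
  by rewrite /= scaler0 addr0.
have Fi h : mu.-integrable setT (EFin \o F h) by apply: integrable_conv => //; exact: (Ck0 cg).
have itv0 : `](-1 : R), 1[%classic (0 : R) by rewrite /= in_itv/=; lra.
have Ci : mu.-integrable setT (EFin \o (fun y => `|f y| * `|C|)).
  apply: (@integrable_mul_bounded _ (fun y => `|f y|) (cst `|C|) `|C|) => //.
  - by have := integrable_abse fi.
  - by move=> y _ /=; rewrite normr_id.
have dom : forall h y, `](-1 : R), 1[%classic h -> setT y -> `|partial1of2 F h y| <= `|f y| * `|C|.
  move=> h y _ _; rewrite partial1of2E; have [_ ->] := dF h y.
  rewrite normrM normrN ler_wpM2l//; apply: le_trans (gC _) (ler_norm _).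
have C0 y : 0 <= `|f y| * `|C| by rewrite mulr_ge0.
have der (h : R) y : `](-1 : R), 1[%classic h -> setT y -> derivable (F ^~ y) h 1.
  by move=> _ _; have [] := dF h y.
have D1 := @derivable_under_integral R _ _ mu F setT measurableT 0 (-1) 1 itv0 (fun h _ => Fi h) der _ C0 Ci dom.
have D2 := @differentiation_under_integral R _ _ mu F setT measurableT 0 (-1) 1 itv0 (fun h _ => Fi h) der _ C0 Ci dom.
split; first exact: D1.
rewrite -derive1E [LHS]D2; apply: eq_Rintegral => y _.
rewrite partial1of2E; have [_ ->] := dF 0 y.
by rewrite scale0r add0r.
Qed.

Lemma conv_smooth g : smooth g -> bsupp g -> smooth (convol f g).
Proof.
move=> sg bg k; elim: k g sg bg => [|k IHk] g sg bg.
  by apply: conv_continuous => //; exact: sg 0%N.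
apply: (@CkS _ _ _ _ (fun j => convol f (fun y => - partial j g y))).
- by apply: conv_continuous => //; exact: sg 0%N.
- by move=> j x; exact: (is_derive_conv j x (sg 1%N)).
- move=> j; apply: IHk; first by move=> l; apply: CkN; exact: smooth_partial.
  have [M gM] := bsupp_partial j bg; exists M => y /gM ->; exact: oppr0.
Qed.

End conv_smooth.

Lemma partial_conv f g j x : mu.-integrable setT (EFin \o f) -> Ck 1 g -> bsupp g ->
  partial j (convol f g) x = convol f (fun y => - partial j g y) x.
Proof. by move=> fi cg sg; apply: partialE; exact: is_derive_conv. Qed.

Lemma conv_eq0 f g d x : (forall y, d < `|y| -> g y = 0) ->
  (forall y, `|y - x| <= d -> f y = 0) -> convol f g x = 0.
Proof.
move=> gd fd; rewrite /convol /Rintegral integral0_eq// => y _.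
by have [/fd ->|/gd ->] := leP `|y - x| d; rewrite ?mul0r ?mulr0.
Qed.

Lemma sqn_bsupp_integrable f : measurable_fun setT f -> bsupp f ->
  (sqn mu setT f < +oo)%E -> mu.-integrable setT (EFin \o f).
Proof.
move=> mf [M fM] fi.
have i1 : mu.-integrable setT (EFin \o (\1_[set x : 'rV[R]_n | `|x| <= M] : _ -> R)).
  apply: integrable_bsupp.
  - by apply: measurable_indic; apply: closed_measurable_rV; exact: closed_le_norm.
  - by exists 1 => x; rewrite indicE; case: (_ \in _); rewrite ?normr1 ?normr0.
  - by exists M => x Mx; rewrite indicE memNset//=; rewrite leNgt Mx.
apply: (@le_integrable _ _ _ mu setT measurableT _
  (fun x => (\1_[set x : 'rV[R]_n | `|x| <= M] x)%:E + (f x ^+ 2)%:E)%E).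
- exact/measurable_EFinP.
- move=> x _; rewrite -EFinD !abse_EFin lee_fin indicE.
  have [xM|xM] := leP `|x| M.
    rewrite mem_set//= [leRHS]ger0_norm; last by rewrite addr_ge0 ?sqr_ge0.
    by rewrite -[f x ^+ 2]ger0_norm ?sqr_ge0// normrX; nra.
  by rewrite (fM x xM) normr0.
- by apply: integrableD => //; exact: sqn_integrable.
Qed.

Section conv_L2.
Variables (d : R) (eta : 'rV[R]_n -> R).
Hypothesis meta : mollifier d eta.

Let ceta : continuous eta := mollifier_continuous meta.
Let seta : bsupp eta := mollifier_bsupp meta.
Let eta0 x : 0 <= eta x. Proof. by case: meta. Qed.

Let Reta x : \int[mu]_y (eta (y - x)) = 1.
Proof. by rewrite /Rintegral (mollifier_integral_shift x meta). Qed.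

Let ieta x : mu.-integrable setT (fun y => (eta (y - x))%:E).
Proof.
apply: (@continuous_integrable_bsupp _ _ (fun y => eta (y - x))).
  exact: continuous_translate.
have [M eM] := seta; exists (M + `|x|) => y My; apply: eM.
by have := lerB_normD y (- x); rewrite normrN; lra.
Qed.

(** Jensen's inequality for the probability density [eta (y - x)]: expand the integral of
    [(f y - c) ^+ 2] against it, where [c] is the mean of [f]. *)
Lemma conv_sq_le f x : mu.-integrable setT (EFin \o f) ->
  mu.-integrable setT (EFin \o (fun x => f x ^+ 2)) ->
  convol f eta x ^+ 2 <= convol (fun x => f x ^+ 2) eta x.
Proof.
move=> fi f2i; set c := convol f eta x.
have i1 := integrable_conv fi x ceta seta.
have i2 := integrable_conv f2i x ceta seta.
have : 0 <= \int[mu]_y (f y ^+ 2 * eta (y - x) - ((2 * c) * (f y * eta (y - x)) - c ^+ 2 * eta (y - x))).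
  apply: Rintegral_ge0 => y _.
  rewrite (_ : _ - _ = (f y - c) ^+ 2 * eta (y - x)); last by ring.
  by rewrite mulr_ge0// sqr_ge0.
have j1 : mu.-integrable setT (fun y => ((2 * c) * (f y * eta (y - x)))%:E).
  by under eq_fun do rewrite EFinM; exact: integrableZl.
have j2 : mu.-integrable setT (fun y => (c ^+ 2 * eta (y - x))%:E).
  by under eq_fun do rewrite EFinM; apply: integrableZl => //; exact: ieta.
rewrite RintegralB//; last by rewrite /comp; under eq_fun do rewrite EFinB; exact: integrableB.
rewrite RintegralB// RintegralZl// RintegralZl//; last exact: ieta.
by rewrite Reta -/(convol f eta x) -/c -/(convol (fun x => f x ^+ 2) eta x); lra.
Qed.

(** Jensen's inequality at each point, then Tonelli's theorem: the inner integral in [x] of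
    [eta (y - x)] is 1 because [eta] is even. *)
Lemma sqn_conv_le f : measurable_fun setT f -> bsupp f -> (sqn mu setT f < +oo)%E ->
  (sqn mu setT (convol f eta) <= sqn mu setT f)%E.
Proof.
move=> mf sf f2.
have fi := sqn_bsupp_integrable mf sf f2.
have f2i : mu.-integrable setT (EFin \o (fun x => f x ^+ 2)) by exact: sqn_integrable.
have cc : continuous (convol f eta) by exact: conv_continuous.
pose h (p : 'rV[R]_n * 'rV[R]_n) := (f p.2 ^+ 2 * eta (p.2 - p.1))%:E.
have mh : measurable_fun setT h.
  apply/measurable_EFinP; apply: measurable_funM.
    by apply: measurable_funX; exact: (measurableT_comp mf measurable_snd).
  apply: (measurableT_comp (continuous_measurable_rV ceta)).
  apply: measurable_fun_mx => i k; under eq_fun do rewrite !mxE.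
  apply: measurable_funB.
    exact: (measurableT_comp (measurable_entry i k) measurable_snd).
  exact: (measurableT_comp (measurable_entry i k) measurable_fst).
have h0 p : (0 <= h p)%E by rewrite lee_fin mulr_ge0// sqr_ge0.
apply: (@le_trans _ _ (\int[mu]_x \int[mu]_y h (x, y))%E).
  apply: ge0_le_integral => //.
  - by move=> x _; rewrite lee_fin sqr_ge0.
  - by apply: measurable_sq; exact: continuous_measurable_rV.
  - exact: (@measurable_fun_fubini_tonelli_F _ _ _ _ R mu h).
  - move=> x _; apply: (@le_trans _ _ (convol (fun x => f x ^+ 2) eta x)%:E).
      by rewrite lee_fin conv_sq_le.
    rewrite /convol /Rintegral fineK//; apply: integrable_fin_num => //.
    exact: (integrable_conv f2i x ceta seta).
rewrite (@fubini_tonelli _ _ _ _ R mu mu h mh h0).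
rewrite le_eqVlt; apply/orP; left; apply/eqP; apply: eq_integral => y _.
rewrite /h/=; under eq_integral do rewrite EFinM.
rewrite ge0_integralZl//.
- by rewrite (mollifier_integral_shift' y meta) mule1.
- apply/measurable_EFinP; apply: continuous_measurable_rV.
  have [_ _ eN _ _] := meta.
  rewrite (_ : (fun x => _) = (fun x => eta (x + - y))).
    exact: continuous_translate.
  by apply/funext => x; rewrite -eN opprB.
- by move=> x _; rewrite lee_fin.
- by rewrite lee_fin sqr_ge0.
Qed.

Lemma conv_unif_le f e x : continuous f -> bsupp f -> 0 <= e ->
  (forall y, `|y - x| <= d -> `|f y - f x| <= e) -> `|convol f eta x - f x| <= e.
Proof.
move=> cf sf e0 H.
have fi := continuous_integrable_bsupp cf sf.
have i1 := integrable_conv fi x ceta seta.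
have j1 : mu.-integrable setT (fun y => (f x * eta (y - x))%:E).
  by under eq_fun do rewrite EFinM; apply: integrableZl => //; exact: ieta.
have iB : mu.-integrable setT (fun y => (f y * eta (y - x) - f x * eta (y - x))%:E).
  by under eq_fun do rewrite EFinB; exact: integrableB.
have -> : convol f eta x - f x = \int[mu]_y (f y * eta (y - x) - f x * eta (y - x)).
  by rewrite RintegralB// RintegralZl ?Reta ?mulr1//; exact: ieta.
apply: (le_trans (le_normr_Rintegral _ _)) => //.
have -> : e = \int[mu]_y (e * eta (y - x)).
  by rewrite RintegralZl ?Reta ?mulr1//; exact: ieta.
apply: le_Rintegral => //.
- by have := integrable_abse iB.
- by rewrite /comp; under eq_fun do rewrite EFinM; apply: integrableZl => //; exact: ieta.
- move=> y _; rewrite -mulrBl normrM (ger0_norm (eta0 _)).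
  have [yx|yx] := leP `|y - x| d; first by rewrite ler_wpM2r// H.
  by have [_ _ _ /(_ _ yx) -> _] := meta; rewrite !mulr0.
Qed.

Lemma convB f g x : mu.-integrable setT (EFin \o f) -> mu.-integrable setT (EFin \o g) ->
  convol (fun y => f y - g y) eta x = convol f eta x - convol g eta x.
Proof.
move=> fi gi; rewrite /convol -RintegralB//; last 2 first.
  exact: integrable_conv.
  exact: integrable_conv.
by apply: eq_Rintegral => y _; rewrite mulrBl.
Qed.

End conv_L2.

Lemma L2approx_bsupp f e : measurable_fun setT f -> bsupp f -> (sqn mu setT f < +oo)%E ->
  0 < e -> exists g, [/\ continuous g, bsupp g &
    (sqn mu setT (fun x => f x - g x)%R <= e%:E)%E].
Proof.
move=> mf [M fM] f2 e0.
pose D := [set x : 'rV[R]_n | `|x| <= M + 1].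
have mD : measurable D by apply: closed_measurable_rV; exact: closed_le_norm.
have muD : (mu D < +oo)%E by exact: measure_le_norm_lty.
have [|g cg ge] := @L2approx_L2 R n mu D mD muD f (measurable_funTS mf) _ e e0.
  apply: le_lt_trans f2; apply: ge0_subset_integral => //.
  - exact: measurable_sq.
  - by move=> x _; rewrite lee_fin sqr_ge0.
pose chi (x : 'rV[R]_n) := Num.max 0 (Num.min 1 (M + 1 - `|x|)).
have cchi : continuous chi.
  apply: continuous_maxr; first exact: cst_continuous.
  apply: continuous_minr; first exact: cst_continuous.
  apply: continuousBf; first exact: cst_continuous.
  by move=> x; exact: norm_continuous.
have chi0 x : 0 <= chi x by rewrite /chi le_max lexx.
have chi1 x : chi x <= 1 by rewrite /chi ge_max ler01 ge_min lexx.
have chiD x : M + 1 < `|x| -> chi x = 0.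
  by move=> xM; rewrite /chi max_l// ge_min; apply/orP; right; lra.
have fchi x : f x = chi x * f x.
  have [xM|xM] := leP `|x| M; last by rewrite fM// mulr0.
  by rewrite /chi min_l ?max_r ?mul1r//; lra.
exists (fun x => chi x * g x); split.
- exact: continuousMf.
- by exists (M + 1) => x /chiD ->; rewrite mul0r.
apply: le_trans ge; rewrite /sqn [leRHS]integral_mkcond; apply: ge0_le_integral => //.
- by move=> x _; rewrite lee_fin sqr_ge0.
- apply: measurable_sq; apply: measurable_funB => //; apply: continuous_measurable_rV.
  exact: continuousMf.
- apply: (measurable_restrictT (fun x => ((f x - g x) ^+ 2)%:E) mD).1; apply: measurable_sq.
  by apply: measurable_funTS; apply: measurable_funB => //; exact: continuous_measurable_rV.
- move=> x _; rewrite /patch; case: ifPn => [_|].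
    rewrite lee_fin {1}fchi -mulrBr exprMn ler_piMl ?sqr_ge0//.
    by rewrite expr_le1.
  by rewrite notin_setE/= => /negP; rewrite -ltNge => xM; rewrite lee_fin chiD// mul0r fM ?subr0 ?expr0n//; lra.
Qed.

Lemma conv_cvg_L2 f e : measurable_fun setT f -> bsupp f -> (sqn mu setT f < +oo)%E ->
  0 < e -> exists2 d0, 0 < d0 & forall d eta, d < d0 -> mollifier d eta ->
    (sqn mu setT (fun x => convol f eta x - f x)%R <= e%:E)%E.
Proof.
move=> mf sf f2 e0.
(* The three errors are made at most [e / 16]; two uses of [sqnB_triangle] turn them into
   [2 (1 + 2 (1 + 1)) e / 16], below [e]. *)
have [g [cg sg ge]] := L2approx_bsupp mf sf f2 (divr_gt0 e0 (ltr0Sn R 15)).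
have [M gM] := sg.
pose D := [set x : 'rV[R]_n | `|x| <= M + 1].
have mD : measurable D by apply: closed_measurable_rV; exact: closed_le_norm.
have muD : (mu D < +oo)%E by exact: measure_le_norm_lty.
have muDE : mu D = (fine (mu D))%:E by rewrite fineK// ge0_fin_numE.
have V0 : 0 <= fine (mu D) by rewrite fine_ge0.
pose a := Num.min 1 (e / 16 / (fine (mu D) + 1)).
have a0 : 0 < a by rewrite /a lt_min ltr01/= !divr_gt0//; lra.
have aV : a ^+ 2 * fine (mu D) <= e / 16.
  have a1 : a <= 1 by rewrite /a ge_min lexx.
  have a2 : a <= e / 16 / (fine (mu D) + 1) by rewrite /a ge_min lexx orbT.
  apply: (@le_trans _ _ (a * fine (mu D))).
    by rewrite expr2 ler_wpM2r// ger_pMr.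
  apply: (@le_trans _ _ (e / 16 / (fine (mu D) + 1) * (fine (mu D) + 1))).
    by apply: ler_pM => //; [exact: ltW|lra].
  by rewrite divfK// gt_eqF// ltr_wpDl.
have [d1 d10 H] := bsupp_unif_continuous cg sg a0.
exists (Num.min d1 1); first by rewrite lt_min d10 ltr01.
move=> d eta; rewrite lt_min => /andP[dd1 dlt1] meta.
have ceta := mollifier_continuous meta; have seta := mollifier_bsupp meta.
have fi := sqn_bsupp_integrable mf sf f2.
have gi := continuous_integrable_bsupp cg sg.
have mg := continuous_measurable_rV cg.
have mcf := continuous_measurable_rV (conv_continuous fi ceta seta).
have mcg := continuous_measurable_rV (conv_continuous gi ceta seta).
have sB : bsupp (fun x => f x - g x).
  have [M' fM'] := sf; exists (Num.max M M') => x; rewrite gt_max => /andP[h1 h2].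
  by rewrite fM'// gM// subr0.
have e16 : (e / 16 = e / 15.+1%:R) by [].
have B2 : (sqn mu setT (fun x => f x - g x)%R < +oo)%E by apply: le_lt_trans ge _; rewrite ltry.
have E1 : (sqn mu setT (fun x => convol f eta x - convol g eta x)%R <= (e / 16)%:E)%E.
  apply: le_trans ge.
  rewrite (_ : sqn _ _ (fun x => convol f eta x - convol g eta x) = sqn mu setT (convol (fun x => f x - g x) eta)).
    apply: (sqn_conv_le meta) => //; exact: measurable_funB.
  by apply: eq_integral => x _; rewrite (convB meta).
have E2 : (sqn mu setT (fun x => convol g eta x - g x)%R <= (e / 16)%:E)%E.
  apply: (@le_trans _ _ (\int[mu]_(x in D) (a ^+ 2)%:E)%E).
    rewrite /sqn [leRHS]integral_mkcond; apply: ge0_le_integral => //.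
    - by move=> x _; rewrite lee_fin sqr_ge0.
    - by apply: measurable_sq; exact: measurable_funB.
    - by apply: (measurable_restrictT (fun=> (a ^+ 2)%:E) mD).1; exact: measurable_cst.
    - move=> x _; rewrite /patch; case: ifPn => [_|].
        rewrite lee_fin -[leLHS]ger0_norm ?sqr_ge0// normrX lerXn2r ?nnegrE ?(ltW a0)//.
          by apply: (conv_unif_le meta) => //; [exact: ltW|move=> y yx; apply/ltW/H; exact: le_lt_trans yx _].
      rewrite notin_setE/= => /negP; rewrite -ltNge => xM; rewrite lee_fin.
      have [_ _ _ ed _] := meta.
      rewrite gM; last by lra.
      rewrite (conv_eq0 ed) ?subrr ?expr0n// => y yx; apply: gM.
      by have := ler_normB y (y - x); rewrite subKr; lra.
  apply: (@le_trans _ _ (a ^+ 2 * fine (mu D))%:E); last by rewrite lee_fin.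
  by rewrite integral_cst// [X in (_ <= X)%E]EFinM fineK// ge0_fin_numE.
have E3 : (sqn mu setT (fun x => g x - f x)%R <= (e / 16)%:E)%E by rewrite sqnBC.
apply: (le_trans (sqnB_triangle mu measurableT mcf mcg mf)).
apply: (@le_trans _ _ (2%:E * ((e / 16)%:E + 2%:E * ((e / 16)%:E + (e / 16)%:E)))%E).
  apply: lee_wpmul2l => //; apply: leeD => //.
  apply: (le_trans (sqnB_triangle mu measurableT mcg mg mf)).
  by apply: lee_wpmul2l => //; apply: leeD.
by rewrite -!(EFinM, EFinD) lee_fin; lra.
Qed.

(** Testing the weak identity against the translates of the mollifier shows that its gradient passes
    onto [F]: the partial derivatives of the mollified [f] are the mollified [F j]. One sequence
    thus approximates the function and the gradient in L^2, and uniformly the function when it is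
    continuous. *)
Lemma mollification f (F : 'I_n -> 'rV[R]_n -> R) :
  measurable_fun setT f -> (forall j, measurable_fun setT (F j)) ->
  bsupp f -> (forall j, bsupp (F j)) ->
  (sqn mu setT f < +oo)%E -> (forall j, sqn mu setT (F j) < +oo)%E ->
  (forall g j, smooth g -> bsupp g ->
    \int[mu]_x (f x * partial j g x) = - \int[mu]_x (F j x * g x)) ->
  exists fk : nat -> 'rV[R]_n -> R,
  [/\ forall k, smooth (fk k),
      forall k x, (forall y, `|y - x| <= k.+1%:R^-1 -> f y = 0) -> fk k x = 0,
      L2cvg mu setT fk f,
      forall j, L2cvg mu setT (fun k => partial j (fk k)) (F j) &
      continuous f -> forall e, 0 < e -> exists N, forall k x, (N <= k)%N -> `|fk k x - f x| <= e].
Proof.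
move=> mf mF sf sF f2 F2 weak.
have /choice[eta meta] (k : nat) : exists g, mollifier (k.+1%:R^-1 : R) g.
  by apply: mollifier_exists; rewrite invr_gt0 ltr0Sn.
have fi := sqn_bsupp_integrable mf sf f2.
have ceta k := mollifier_continuous (meta k); have seta k := mollifier_bsupp (meta k).
have sm k : smooth (eta k) by have [] := meta k.
have small (d0 : R) : 0 < d0 -> exists N, forall k, (N <= k)%N -> k.+1%:R^-1 < d0.
  move=> d00; have := @cvg_harmonic R => /cvgrPdist_lt/(_ _ d00)[N _ HN].
  by exists N => k Nk; have := HN k Nk; rewrite /= sub0r normrN gtr0_norm// invr_gt0 ltr0Sn.
have pE k j x : partial j (convol f (eta k)) x = convol (F j) (eta k) x.
  rewrite (partial_conv j x fi (sm k 1%N) (seta k)).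
  have := weak (fun y => eta k (y - x)) j.
  have dsh (g : 'rV[R]_n -> R) l y : Ck 1 g -> is_derive y (delta_mx ord0 l) (fun y => g (y - x)) (partial l g (y - x)).
    move=> cg; apply/is_derive_line; have /is_derive_line := Ck_is_derive l (y - x) cg.
    by congr (is_derive _ _ _ _); apply/funext => h; rewrite addrA.
  have ssh : smooth (fun y => eta k (y - x)).
    move=> l; have : smooth (eta k) by [].
    elim: l (eta k) => [|l IHl] g sg.
      by apply: continuous_translate; exact: sg 0%N.
    apply: (@CkS _ _ _ _ (fun i y => partial i g (y - x))).
    + by apply: continuous_translate; exact: sg 0%N.
    + by move=> i y; apply: dsh; exact: sg 1%N.
    + by move=> i; apply: IHl; exact: smooth_partial.
  have bsh : bsupp (fun y => eta k (y - x)).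
    have [M eM] := seta k; exists (M + `|x|) => y My; apply: eM.
    by have := lerB_normD y (- x); rewrite normrN; lra.
  move=> /(_ ssh bsh) H.
  apply: (@oppr_inj R); rewrite -[RHS]H /convol.
  rewrite -mulN1r -RintegralZl//.
    apply: eq_Rintegral => y _; rewrite (partialE (dsh _ j y (sm k 1%N))).
    by rewrite mulrN mulN1r opprK.
  apply: (@integrable_conv f fi (fun y => - partial j (eta k) y)).
    by have := smooth_partial j (sm k) 0%N => c y; exact: (continuousN (c y)).
  by have [M eM] := bsupp_partial j (seta k); exists M => y /eM ->; exact: oppr0.
exists (fun k => convol f (eta k)); split.
- by move=> k; exact: conv_smooth.
- by move=> k x fx; have [_ _ _ ed _] := meta k; exact: conv_eq0 ed fx.
- move=> e e0; have [d0 d00 H] := conv_cvg_L2 mf sf f2 e0.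
  have [N HN] := small _ d00; exists N => k Nk.
  by apply: (H _ _ (HN k Nk)); exact: meta.
- move=> j e e0; have [d0 d00 H] := conv_cvg_L2 (mF j) (sF j) (F2 j) e0.
  have [N HN] := small _ d00; exists N => k Nk.
  rewrite (_ : sqn _ _ _ = sqn mu setT (fun x => convol (F j) (eta k) x - F j x)).
    by apply: (H _ _ (HN k Nk)); exact: meta.
  by apply: eq_integral => x _; rewrite pE.
- move=> cf e e0; have [d d0 H] := bsupp_unif_continuous cf sf e0.
  have [N HN] := small _ d0; exists N => k x Nk.
  apply: (conv_unif_le (meta k)) => //; first exact: ltW.
  by move=> y yx; apply/ltW/H; apply: le_lt_trans yx (HN k Nk).
Qed.

End mollifier.

(** * Sobolev functions *)

Section compact_nbhd.
Context {R : realType}.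

Lemma compact_unif_continuous (T : normedModType R) (K : set T) (f : T -> R) (e : R) :
  compact K -> {in K, continuous f} -> 0 < e ->
  exists2 d, 0 < d & forall x y, K x -> `|y - x| < d -> `|f y - f x| < e.
Proof.
move=> /compact_near_coveringP/(_ R (0^'+)) + cf e0.
move=> /(_ (fun d x => forall y, `|y - x| < d -> `|f y - f x| < e)).
case.
- move=> x Kx.
  have /nbhs_ballP[r /= r0 xr] : nbhs x [set y | `|f x - f y| < e / 2].
    by have /cvgrPdist_lt/(_ _ (divr_gt0 e0 (ltr0Sn R 1))) := cf x (mem_set Kx).
  exists (ball x (r / 2), [set d : R | d < r / 2]) => /=.
    split; first by apply: nbhsx_ballx; rewrite divr_gt0.
    by apply: nbhs_right_lt; rewrite divr_gt0.
  move=> [x' d] [/= xx' dr] y yx'.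
  have h1 : `|f x - f x'| < e / 2.
    by apply: xr; apply: le_ball xx'; lra.
  have h2 : `|f x - f y| < e / 2.
    apply: xr; rewrite -ball_normE/=; move: xx'; rewrite -ball_normE/= => xx'.
    rewrite (_ : x - y = (x - x') - (y - x')); last by rewrite opprB addrA subrK.
    by apply: le_lt_trans (ler_normB _ _) _; lra.
  rewrite (_ : f y - f x' = (f x - f x') - (f x - f y)); last by ring.
  by apply: le_lt_trans (ler_normB _ _) _; lra.
- move=> d /= d0 H; exists (d / 2); first by rewrite divr_gt0.
  move=> x y Kx xy; apply: (H (d / 2)) => //=.
  + by rewrite sub0r normrN gtr0_norm ?divr_gt0//; lra.
  + by rewrite divr_gt0.
Qed.

Lemma compact_open_nbhd (T : normedModType R) (K U : set T) :
  compact K -> open U -> K `<=` U ->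
  exists2 d : R, 0 < d & forall x y, K x -> `|y - x| < d -> U y.
Proof.
move=> /compact_near_coveringP/(_ R (0^'+)) + oU KU.
move=> /(_ (fun d x => forall y, `|y - x| < d -> U y)).
case.
- move=> x Kx.
  have /nbhs_ballP[r /= r0 xr] : nbhs x U by apply: open_nbhs_nbhs; split => //; exact: KU.
  exists (ball x (r / 2), [set d : R | d < r / 2]) => /=.
    split; first by apply: nbhsx_ballx; rewrite divr_gt0.
    by apply: nbhs_right_lt; rewrite divr_gt0.
  move=> [x' d] [/= xx' dr] y yx'.
  apply: xr; rewrite -ball_normE/=; move: xx'; rewrite -ball_normE/= => xx'.
  rewrite (_ : x - y = (x - x') - (y - x')); last by rewrite opprB addrA subrK.
  by apply: le_lt_trans (ler_normB _ _) _; lra.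
- move=> d /= d0 H; exists (d / 2); first by rewrite divr_gt0.
  move=> x y Kx xy; apply: (H (d / 2) _ _ _ Kx) => //=.
  + by rewrite sub0r normrN gtr0_norm ?divr_gt0//; lra.
  + by rewrite divr_gt0.
Qed.

Variable n : nat.
Local Notation mu := (lebesgue_rV n : {sigma_finite_measure set 'rV[R]_n -> \bar R}).
Implicit Types (K U w : set 'rV[R]_n) (f g : 'rV[R]_n -> R).

Lemma compact_le_bound K : compact K -> exists M, forall x, K x -> `|x| <= M.
Proof.
move=> /compact_bounded[M [_ KM]]; exists (M + 1) => x Kx.
by apply: (KM (M + 1)) => //; rewrite ltrDl.
Qed.

Lemma eq0_compact_bsupp K f : compact K -> (forall x, ~ K x -> f x = 0) -> bsupp f.
Proof.
move=> /compact_le_bound[M KM] fK; exists M => x Mx; apply: fK => Kx.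
by have := KM _ Kx; rewrite leNgt Mx.
Qed.

Lemma compact_closedrV K : compact K -> closed K.
Proof. by apply: compact_closed; exact: norm_hausdorff. Qed.

Lemma partial_eq_near j f g x : {near x, f =1 g} -> partial j f x = partial j g x.
Proof. by move=> fg; rewrite /partial; exact: near_eq_derive. Qed.

Lemma partial_eq0 K j f x : closed K -> (forall x, ~ K x -> f x = 0) -> ~ K x ->
  partial j f x = 0.
Proof.
move=> cK fK nKx; rewrite (@partial_eq_near _ _ (cst 0)) ?partial_cst//.
have : nbhs x (~` K) by apply: open_nbhs_nbhs; split => //; exact: closed_openC.
by apply: filterS => y /fK.
Qed.

(** The cut-off is the mollified indicator of the d/2-neighbourhood of [K], with a mollifier of
    radius d/8: it is 1 within d/8 of [K], since 1/8 + 1/8 < 1/2, and 0 beyond 3d/4, since 1/2 + 1/8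
    < 3/4. The witness for the distance in the conclusion is d/8. *)
Lemma cutoff_exists K U : compact K -> open U -> K `<=` U ->
  exists (chi : 'rV[R]_n -> R) (d : R) (K' : set 'rV[R]_n),
  [/\ 0 < d, smooth chi, forall x k, K k -> `|x - k| < d -> chi x = 1,
      compact K' /\ K' `<=` U & forall x, ~ K' x -> chi x = 0].
Proof.
move=> cK oU KU; have [d d0 KdU] := compact_open_nbhd cK oU KU.
pose A := \bigcup_(k in K) ball k (d / 2).
have oA : open A by apply: bigcup_open => k _; apply: ball_open; rewrite divr_gt0.
have [M KM] := compact_le_bound cK.
have Ale x : A x -> `|x| <= M + d / 2.
  move=> [k Kk]; rewrite -ball_normE/= => kx.
  by have := ler_normB k (k - x); rewrite subKr; have := KM k Kk; lra.
have iA : mu.-integrable setT (EFin \o (\1_A : _ -> R)).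
  apply: integrable_bsupp.
  - by apply: measurable_indic; exact: open_measurable_rV.
  - by exists 1 => x; rewrite indicE; case: (_ \in _); rewrite ?normr1 ?normr0.
  - exists (M + d / 2) => x Mx; rewrite indicE memNset// => /Ale.
    by rewrite leNgt Mx.
have d8 : 0 < d / 8 by rewrite divr_gt0.
have [eta meta] := @mollifier_exists R n (d / 8) d8.
have [seta eta0 _ etad eta1] := meta.
pose K' := [set p.1 + p.2 | p in K `*` [set v : 'rV[R]_n | `|v| <= 3 * d / 4]].
exists (convol \1_A eta), (d / 8), K'; split => //.
- by apply: conv_smooth => //; exact: mollifier_bsupp meta.
- move=> x k Kk xk; rewrite /convol.
  rewrite (_ : (fun y => _) = (fun y => eta (y - x))).
    by rewrite /Rintegral (mollifier_integral_shift x meta).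
  apply/funext => y; have [yx|yx] := leP `|y - x| (d / 8); last first.
    by rewrite etad ?mulr0.
  rewrite indicE mem_set ?mul1r//; exists k => //.
  rewrite -ball_normE/= -normrN opprB.
  rewrite (_ : y - k = (y - x) + (x - k)); last by rewrite addrA subrK.
  by apply: le_lt_trans (ler_normD _ _) _; lra.
- split.
    apply: continuous_compact.
      by apply: continuous_subspaceT => -[a b]; exact: add_continuous.
    by apply: compact_setX => //; exact: compact_le_norm.
  move=> _ [[k v] /= [Kk vd] <-]; apply: (KdU k) => //.
  by rewrite addrAC subrr add0r; lra.
- move=> x nKx; apply: (conv_eq0 etad) => y yx; rewrite indicE memNset// => -[k Kk].
  rewrite -ball_normE/= => ky; apply: nKx; exists (k, x - k) => /=.
    split => //; rewrite (_ : x - k = - (y - x) - (k - y)).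
      by apply: le_trans (ler_normB _ _) _; rewrite normrN; lra.
    by apply/rowP => i; rewrite !mxE; ring.
  by rewrite addrC subrK.
Qed.

Lemma test_functionP U f : test_function U f ->
  smooth f /\ exists K, [/\ compact K, K `<=` U & forall x, ~ K x -> f x = 0].
Proof.
move=> [sf cf fU]; split => //; exists (closure [set x | f x != 0]); split => //.
move=> x nx; apply/eqP; apply: contrapT => /negP fx0; apply: nx.
exact: subset_closure.
Qed.

Lemma smooth_test_function U K f : smooth f -> compact K -> K `<=` U ->
  (forall x, ~ K x -> f x = 0) -> test_function U f.
Proof.
move=> sf cK KU fK.
have sub : closure [set x | f x != 0] `<=` K.
  rewrite closureE; apply: smallest_sub; first exact: compact_closedrV.
  by move=> x /= fx; apply: contrapT => /fK fx0; rewrite fx0 eqxx in fx.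
split => //; last exact: subset_trans KU.
by apply: (subclosed_compact _ cK) => //; exact: closed_closure.
Qed.

End compact_nbhd.

Section sobolev_pairs.
Context {R : realType} (n : nat).
Local Notation mu := (lebesgue_rV n : {sigma_finite_measure set 'rV[R]_n -> \bar R}).
Variables (w : set 'rV[R]_n) (Mw : R).
Hypotheses (mw : measurable w) (wM : forall x, w x -> `|x| <= Mw).
Implicit Types (f g : 'rV[R]_n -> R) (F G : 'I_n -> 'rV[R]_n -> R).

Let muw : (mu w < +oo)%E.
Proof.
apply: le_lt_trans (measure_le_norm_lty n Mw); apply: le_measure; rewrite ?inE//.
by apply: closed_measurable_rV; exact: closed_le_norm.
Qed.

Definition unif_cvg (fk : nat -> 'rV[R]_n -> R) f := forall e : R, 0 < e ->
  exists N, forall k x, (N <= k)%N -> w x -> `|fk k x - f x| <= e.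

(* The bounded functions [f] with weak gradient [F] that are uniform limits of
   C^1 functions: the chain and product rules pass to the limit, so no general
   chain rule for weak gradients is needed. *)
Definition sob f F := [/\ exists C, forall x, w x -> `|f x| <= C,
  measurable_fun w f,
  forall j, measurable_fun w (F j) /\ (sqn mu w (F j) < +oo)%E &
  exists fk : nat -> 'rV[R]_n -> R, [/\ forall k, Ck 1 (fk k), unif_cvg fk f &
    forall j, L2cvg mu w (fun k => partial j (fk k)) (F j)]].

Let cont_meas f : continuous f -> measurable_fun w f.
Proof. by move=> cf; apply: measurable_funTS; exact: continuous_measurable_rV. Qed.

Let C1_meas j f : Ck 1 f -> measurable_fun w (partial j f).
Proof. by move=> [_ /(_ j)[_ /cont_meas]]. Qed.

Let bound_w f : continuous f -> exists C, forall x, w x -> `|f x| <= C.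
Proof.
move=> cf; have [C fC] := @compact_bounded_fun _ _ _ f (@compact_le_norm R n Mw) (fun x _ => cf x).
by exists C => x wx; apply: fC; exact: wM.
Qed.

Lemma sqn_bounded f C : measurable_fun w f -> (forall x, w x -> `|f x| <= C) ->
  (sqn mu w f < +oo)%E.
Proof.
move=> mf fC; apply: (@le_lt_trans _ _ ((C ^+ 2)%:E * mu w)%E); last first.
  by apply: lte_mul_pinfty => //; rewrite lee_fin sqr_ge0.
rewrite -integral_cst//; apply: ge0_le_integral => //.
- by move=> x _; rewrite lee_fin sqr_ge0.
- exact: measurable_sq.
- move=> x wx; rewrite lee_fin -[leLHS]ger0_norm ?sqr_ge0// normrX.
  by rewrite lerXn2r ?nnegrE ?fC// (le_trans (normr_ge0 (f x)))// fC.
Qed.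

Lemma sqnM_lty f g C : measurable_fun w f -> measurable_fun w g ->
  (forall x, w x -> `|f x| <= C) -> (sqn mu w g < +oo)%E ->
  (sqn mu w (fun x => f x * g x)%R < +oo)%E.
Proof.
move=> mf mg fC gi.
have [->|/set0P[x0 wx0]] := eqVneq w set0; first by rewrite /sqn integral_set0.
have C0 : 0 <= C by apply: le_trans (fC _ wx0).
apply: (@le_lt_trans _ _ ((C ^+ 2)%:E * sqn mu w g)%E).
  apply: sqn_le => //; first exact: measurable_funM.
  by move=> x wx; rewrite normrM ler_wpM2r// fC.
by apply: lte_mul_pinfty => //; rewrite lee_fin sqr_ge0.
Qed.

Lemma sqnD_lty f g : measurable_fun w f -> measurable_fun w g ->
  (sqn mu w f < +oo)%E -> (sqn mu w g < +oo)%E ->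
  (sqn mu w (fun x => f x + g x)%R < +oo)%E.
Proof.
move=> mf mg fi gi; apply: le_lt_trans (sqnD mu mw mf mg) _.
by apply: lte_mul_pinfty => //; rewrite lte_add_pinfty.
Qed.

Lemma sob_C1 f : Ck 1 f -> sob f (fun j => partial j f).
Proof.
move=> cf; split.
- exact: bound_w (Ck0 cf).
- exact: cont_meas (Ck0 cf).
- move=> j; have mj := C1_meas j cf; split => //.
  have [_ /(_ j)[_ /bound_w[C fC]]] := cf.
  exact: sqn_bounded fC.
exists (fun=> f); split => //.
- by move=> e e0; exists 0%N => k x _ _; rewrite subrr normr0 ltW.
- move=> j e e0; exists 0%N => k _; rewrite /sqn integral0_eq ?lee_fin ?ltW// => x _.
  by rewrite subrr expr0n.
Qed.

Lemma sob_ext f f' F F' : (forall x, w x -> f x = f' x) ->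
  (forall j x, w x -> F j x = F' j x) -> sob f F -> sob f' F'.
Proof.
move=> ff' FF' [[C fC] mf mF [fk [ck uk Lk]]]; split.
- by exists C => x wx; rewrite -ff'// fC.
- by apply: eq_measurable_fun mf => x /set_mem wx; exact: ff'.
- move=> j; have [mj ij] := mF j; split.
    by apply: eq_measurable_fun mj => x /set_mem wx; exact: FF'.
  rewrite (_ : sqn mu w (F' j) = sqn mu w (F j))//.
  by apply: eq_integral => x /set_mem wx; rewrite FF'.
- exists fk; split => //.
    move=> e e0; have [N HN] := uk e e0; exists N => k x Nk wx.
    by rewrite -ff'// HN.
  by move=> j; apply: L2cvg_ext (Lk j) _ _ => // x wx; exact: FF'.
Qed.

Lemma unif_cvgD (fk gk : nat -> 'rV[R]_n -> R) f g :
  unif_cvg fk f -> unif_cvg gk g -> unif_cvg (fun k x => fk k x + gk k x) (fun x => f x + g x).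
Proof.
move=> uf ug e e0; have e2 : 0 < e / 2 by rewrite divr_gt0.
have [N HN] := uf _ e2; have [N' HN'] := ug _ e2.
exists (maxn N N') => k x; rewrite geq_max => /andP[Nk N'k] wx.
rewrite (_ : _ - _ = (fk k x - f x) + (gk k x - g x)); last by ring.
apply: (le_trans (ler_normD _ _)).
by have := HN k x Nk wx; have := HN' k x N'k wx; lra.
Qed.

Lemma sobD f g F G : sob f F -> sob g G ->
  sob (fun x => f x + g x) (fun j x => F j x + G j x).
Proof.
move=> [[C fC] mf mF [fk [cf uf Lf]]] [[C' gC] mg mG [gk [cg ug Lg]]]; split.
- exists (C + C') => x wx; apply: (le_trans (ler_normD _ _)).
  by apply: lerD; [exact: fC|exact: gC].
- exact: measurable_funD.
- move=> j; have [mj ij] := mF j; have [mj' ij'] := mG j.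
  by split; [exact: measurable_funD|exact: sqnD_lty].
- exists (fun k x => fk k x + gk k x); split.
  + by move=> k; exact: CkD.
  + exact: unif_cvgD.
  + move=> j; apply: (@L2cvg_ext _ _ _ _ _ (fun k x => partial j (fk k) x + partial j (gk k) x) _ (fun x => F j x + G j x)) => //.
      apply: L2cvgD => //.
      * by move=> k; exact: C1_meas.
      * by move=> k; exact: C1_meas.
      * by have [] := mF j.
      * by have [] := mG j.
    by move=> k x _; rewrite partialD.
Qed.

(** The difference is [fk (Gk - G) + (fk - f) G]: the first factor is bounded by [|C| + 1] once the
    uniform error is at most 1, and the second product is uniformly small against a fixed L^2
    function. *)
Lemma L2cvgM (fk Gk : nat -> 'rV[R]_n -> R) f (G : 'rV[R]_n -> R) C :
  (forall k, measurable_fun w (fk k)) -> (forall k, measurable_fun w (Gk k)) ->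
  measurable_fun w f -> measurable_fun w G -> (sqn mu w G < +oo)%E ->
  (forall x, w x -> `|f x| <= C) -> unif_cvg fk f -> L2cvg mu w Gk G ->
  L2cvg mu w (fun k x => fk k x * Gk k x) (fun x => f x * G x).
Proof.
move=> mfk mGk mf mG iG fC uf LG e e0.
pose S := fine (sqn mu w G).
have SE : sqn mu w G = S%:E by rewrite /S fineK// ge0_fin_numE// sqn_ge0.
have S0 : 0 <= S by rewrite -lee_fin -SE sqn_ge0.
pose C1 := `|C| + 1.
have C10 : 0 < C1 by rewrite /C1; have := normr_ge0 C; lra.
pose a := Num.min 1 (e / 8 / (S + 1)).
have a0 : 0 < a by rewrite /a lt_min ltr01/= !divr_gt0//; lra.
have aS : a ^+ 2 * S <= e / 8.
  have a1 : a <= 1 by rewrite /a ge_min lexx.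
  have a2 : a <= e / 8 / (S + 1) by rewrite /a ge_min lexx orbT.
  apply: (@le_trans _ _ (a * S)); first by rewrite expr2 ler_wpM2r// ger_pMr.
  apply: (@le_trans _ _ (e / 8 / (S + 1) * (S + 1))).
    by apply: ler_pM => //; [exact: ltW|lra].
  by rewrite divfK// gt_eqF// ltr_wpDl.
have C12 : 0 < C1 ^+ 2 by rewrite exprn_gt0.
have b0 : 0 < e / 8 / C1 ^+ 2 by rewrite !divr_gt0.
have [N HN] := uf _ a0; have [N' HN'] := LG _ b0.
exists (maxn N N') => k; rewrite geq_max => /andP[Nk N'k].
have a1 : a <= 1 by rewrite /a ge_min lexx.
have -> : sqn mu w (fun x => fk k x * Gk k x - f x * G x) =
    sqn mu w (fun x => fk k x * (Gk k x - G x) + (fk k x - f x) * G x).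
  by apply: eq_integral => x _; congr ((_ ^+ 2)%:E); ring.
apply: (le_trans (sqnD mu mw _ _)).
- by apply: measurable_funM => //; exact: measurable_funB.
- by apply: measurable_funM => //; exact: measurable_funB.
apply: (@le_trans _ _ (2%:E * ((e / 8)%:E + (e / 8)%:E))%E); last first.
  by rewrite -EFinD -EFinM lee_fin; lra.
apply: lee_wpmul2l => //; apply: leeD.
  apply: (@le_trans _ _ ((C1 ^+ 2)%:E * sqn mu w (fun x => Gk k x - G x)%R)%E).
    apply: sqn_le => //.
    - by apply: measurable_funM => //; exact: measurable_funB.
    - exact: measurable_funB.
    - exact: ltW.
    - move=> x wx; rewrite normrM ler_wpM2r//.
      have := HN k x Nk wx; have := fC x wx; have := ler_norm C.
      have := ler_normD (fk k x - f x) (f x); rewrite subrK /C1; lra.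
  have -> : (e / 8)%:E = ((C1 ^+ 2)%:E * (e / 8 / C1 ^+ 2)%:E)%E.
    by rewrite -EFinM [in RHS]mulrC divfK// gt_eqF.
  by apply: lee_wpmul2l; [rewrite lee_fin sqr_ge0|exact: HN'].
apply: (@le_trans _ _ ((a ^+ 2)%:E * sqn mu w G)%E).
  apply: sqn_le => //.
  - by apply: measurable_funM => //; exact: measurable_funB.
  - exact: ltW.
  - by move=> x wx; rewrite normrM ler_wpM2r// HN.
by rewrite SE -[X in (X <= _)%E]EFinM lee_fin.
Qed.

Lemma unif_cvgM (fk gk : nat -> 'rV[R]_n -> R) f g C C' :
  (forall x, w x -> `|f x| <= C) -> (forall x, w x -> `|g x| <= C') ->
  unif_cvg fk f -> unif_cvg gk g -> unif_cvg (fun k x => fk k x * gk k x) (fun x => f x * g x).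
Proof.
move=> fC gC uf ug e e0.
pose D := `|C| + `|C'| + 1.
have D0 : 0 < D by rewrite /D; have := normr_ge0 C; have := normr_ge0 C'; lra.
pose a := Num.min 1 (e / (2 * D)).
have a0 : 0 < a by rewrite /a lt_min ltr01/= divr_gt0// mulr_gt0.
have aD : a * D <= e / 2.
  apply: (@le_trans _ _ (e / (2 * D) * D)).
    by rewrite ler_pM2r// /a ge_min lexx orbT.
  by rewrite invfM mulrA divfK// gt_eqF.
have a1 : a <= 1 by rewrite /a ge_min lexx.
have [N HN] := uf _ a0; have [N' HN'] := ug _ a0.
exists (maxn N N') => k x; rewrite geq_max => /andP[Nk N'k] wx.
have h1 := HN k x Nk wx; have h2 := HN' k x N'k wx.
rewrite (_ : _ - _ = (fk k x - f x) * gk k x + f x * (gk k x - g x)); last by ring.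
apply: (le_trans (ler_normD _ _)); rewrite !normrM.
have gk1 : `|gk k x| <= D.
  have := ler_normD (gk k x - g x) (g x); rewrite subrK /D.
  have := gC x wx; have := ler_norm C'; have := normr_ge0 C; lra.
have f1 : `|f x| <= D.
  by rewrite /D; have := fC x wx; have := ler_norm C; have := normr_ge0 C'; lra.
have : `|fk k x - f x| * `|gk k x| <= a * D by apply: ler_pM.
have : `|f x| * `|gk k x - g x| <= D * a by apply: ler_pM.
by rewrite [D * a]mulrC; lra.
Qed.

Lemma sobM f g F G : sob f F -> sob g G ->
  sob (fun x => f x * g x) (fun j x => f x * G j x + g x * F j x).
Proof.
move=> [[C fC] mf mF [fk [cf uf Lf]]] [[C' gC] mg mG [gk [cg ug Lg]]]; split.
- exists (C * C') => x wx; rewrite normrM; apply: ler_pM => //; [exact: fC|exact: gC].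
- exact: measurable_funM.
- move=> j; have [mj ij] := mF j; have [mj' ij'] := mG j; split.
    by apply: measurable_funD; exact: measurable_funM.
  apply: sqnD_lty; [exact: measurable_funM|exact: measurable_funM| |].
    exact: sqnM_lty fC _.
  exact: sqnM_lty gC _.
- exists (fun k x => fk k x * gk k x); split.
  + by move=> k; exact: CkM.
  + exact: unif_cvgM fC gC _ _.
  + move=> j; have [mj ij] := mF j; have [mj' ij'] := mG j.
    apply: (@L2cvg_ext _ _ _ _ _ (fun k x => fk k x * partial j (gk k) x + gk k x * partial j (fk k) x) _ (fun x => f x * G j x + g x * F j x)) => //; last first.
      by move=> k x _; rewrite partialM.
    have mfk k : measurable_fun w (fk k) by exact: cont_meas (Ck0 (cf k)).
    have mgk k : measurable_fun w (gk k) by exact: cont_meas (Ck0 (cg k)).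
    have mpf k : measurable_fun w (partial j (fk k)) by exact: C1_meas.
    have mpg k : measurable_fun w (partial j (gk k)) by exact: C1_meas.
    apply: L2cvgD => //.
    * by move=> k; exact: measurable_funM.
    * by move=> k; exact: measurable_funM.
    * exact: measurable_funM.
    * exact: measurable_funM.
    * exact: (L2cvgM mfk mpg mf mj' ij' fC).
    * exact: (L2cvgM mgk mpf mg mj ij gC).
Qed.

Lemma unif_cvg_comp (h : R -> R) (fk : nat -> 'rV[R]_n -> R) f C : continuous h ->
  (forall x, w x -> `|f x| <= C) -> unif_cvg fk f ->
  unif_cvg (fun k => h \o fk k) (h \o f).
Proof.
move=> ch fC uf e e0.
have [d d0 H] := @compact_unif_continuous R R `[- C, C] h e (@segment_compact _ _ _) (fun x _ => ch x) e0.
have d2 : 0 < d / 2 by rewrite divr_gt0.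
have [N HN] := uf _ d2; exists N => k x Nk wx /=.
apply/ltW/H; last by apply: le_lt_trans (HN k x Nk wx) _; lra.
by rewrite /= in_itv/= -ler_norml fC.
Qed.

(** On the range [[- C, C]] of [f] both [h] and [h'] are uniformly continuous, so they preserve
    uniform convergence; the gradients are products of a uniformly convergent factor and an L^2
    convergent one. This is why [sob] asks for boundedness and uniform limits. *)
Lemma sob_comp (h h' : R -> R) f F : (forall t : R, is_derive t 1 h (h' t)) ->
  continuous h' -> sob f F -> sob (h \o f) (fun j x => h' (f x) * F j x).
Proof.
move=> dh ch' [[C fC] mf mF [fk [cf uf Lf]]].
have ch : continuous h.
  by move=> t; apply/differentiable_continuous/derivable1_diffP; have [] := dh t.
have mh (g : R -> R) k : continuous g -> measurable_fun w k -> measurable_fun w (g \o k).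
  by move=> cg; apply: measurableT_comp; exact: continuous_measurable_fun.
have bh (g : R -> R) : continuous g -> exists C', forall x, w x -> `|g (f x)| <= C'.
  move=> cg; have : compact (g @` `[- C, C]).
    by apply: continuous_compact; [exact: continuous_subspaceT|exact: segment_compact].
  move=> /compact_bounded[D [_ HD]]; exists (D + 1) => x wx; apply: (HD (D + 1)).
    by rewrite ltrDl.
  by exists (f x) => //=; rewrite in_itv/= -ler_norml fC.
split.
- by have [C' hC'] := bh h ch; exists C'.
- exact: mh.
- move=> j; have [mj ij] := mF j; have [C' hC'] := bh h' ch'; split.
    by apply: measurable_funM => //; exact: mh.
  by apply: (@sqnM_lty (h' \o f) _ C') => //; exact: mh.
- exists (fun k => h \o fk k); split.
  + by move=> k; have [] := C1_comp dh ch' (cf k).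
  + exact: unif_cvg_comp fC _.
  + move=> j; have [mj ij] := mF j; have [C' hC'] := bh h' ch'.
    apply: (@L2cvg_ext _ _ _ _ _ (fun k x => (h' \o fk k) x * partial j (fk k) x) _ (fun x => (h' \o f) x * F j x)) => //; last first.
      by move=> k x _; have [_ ->] := C1_comp dh ch' (cf k).
    apply: (@L2cvgM _ _ _ _ C') => //.
    * by move=> k; apply: mh => //; exact: cont_meas (Ck0 (cf k)).
    * by move=> k; exact: C1_meas.
    * exact: mh.
    * exact: unif_cvg_comp fC _.
Qed.

Lemma sob_sum (I : Type) (s : seq I) (f : I -> 'rV[R]_n -> R) (F : I -> 'I_n -> 'rV[R]_n -> R) :
  (forall i, sob (f i) (F i)) ->
  sob (fun x => \sum_(i <- s) f i x) (fun j x => \sum_(i <- s) F i j x).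
Proof.
move=> sf; elim: s => [|i s IHs].
  apply: (@sob_ext (cst 0) _ (fun j => partial j (cst 0))).
  - by move=> x _; rewrite big_nil.
  - by move=> j x _; rewrite big_nil partial_cst.
  - by apply: sob_C1; exact: Ck_cst.
apply: (@sob_ext (fun x => f i x + \sum_(i <- s) f i x) _ (fun j x => F i j x + \sum_(i <- s) F i j x)).
- by move=> x _; rewrite big_cons.
- by move=> j x _; rewrite big_cons.
- exact: sobD.
Qed.

(** The pointwise inequality [|f| <= dl + f^2 / dl] replaces the Cauchy-Schwarz inequality: [dl] is
    free, so that a small [sqn] forces a small L^1 norm. *)
Lemma L1_le_sqn f (dl : R) : measurable_fun w f -> 0 < dl ->
  (\int[mu]_(x in w) `|f x|%:E <= dl%:E * mu w + dl^-1%:E * sqn mu w f)%E.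
Proof.
move=> mf d0.
rewrite -integral_cst// -ge0_integralZl//; last 3 first.
- exact: measurable_sq.
- by move=> x _; rewrite lee_fin sqr_ge0.
- by rewrite lee_fin invr_ge0 ltW.
rewrite -ge0_integralD//; last 3 first.
- by move=> x _; rewrite lee_fin ltW.
- by move=> x _; rewrite -EFinM lee_fin mulr_ge0 ?sqr_ge0// invr_ge0 ltW.
- by apply: measurable_funeM; exact: measurable_sq.
apply: ge0_le_integral => //.
- by apply/measurable_EFinP; exact: measurableT_comp.
- apply: emeasurable_funD => //; apply: measurable_funeM; exact: measurable_sq.
- move=> x _; rewrite -EFinM -EFinD lee_fin.
  rewrite -(ler_pM2l d0) mulrDr mulrA mulfV ?gt_eqF// mul1r.
  rewrite -[f x ^+ 2]ger0_norm ?sqr_ge0// normrX.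
  by have := sqr_ge0 (dl - `|f x|); have := sqr_ge0 `|f x|; have := sqr_ge0 dl; rewrite !expr2; nra.
Qed.

Lemma sqn_L1 f : measurable_fun w f -> (sqn mu w f < +oo)%E -> mu.-integrable w (EFin \o f).
Proof.
move=> mf fi; apply/integrableP; split; first exact/measurable_EFinP.
under eq_integral do rewrite abse_EFin.
apply: le_lt_trans (L1_le_sqn mf ltr01) _.
by rewrite invr1 !mul1e lte_add_pinfty.
Qed.

Lemma bounded_integrable f C : measurable_fun w f -> (forall x, w x -> `|f x| <= C) ->
  mu.-integrable w (EFin \o f).
Proof. by move=> mf fC; apply: sqn_L1 => //; exact: sqn_bounded fC. Qed.

Lemma L2cvg_Rintegral (Gk : nat -> 'rV[R]_n -> R) (G h : 'rV[R]_n -> R) C :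
  (forall k, measurable_fun w (Gk k)) -> measurable_fun w G ->
  (forall k, sqn mu w (Gk k) < +oo)%E -> (sqn mu w G < +oo)%E ->
  measurable_fun w h -> (forall x, w x -> `|h x| <= C) -> L2cvg mu w Gk G ->
  forall e, 0 < e -> exists N, forall k, (N <= k)%N ->
  `|\int[mu]_(x in w) (Gk k x * h x) - \int[mu]_(x in w) (G x * h x)| <= e.
Proof.
move=> mGk mG iGk iG mh hC LG e e0.
pose V := fine (mu w).
have VE : mu w = V%:E by rewrite /V fineK// ge0_fin_numE.
have V0 : 0 <= V by rewrite fine_ge0.
pose D := `|C| + 1.
have D0 : 0 < D by rewrite /D; have := normr_ge0 C; lra.
pose dl := e / (2 * D * (V + 1)).
have V1 : 0 < V + 1 by lra.
have dl0 : 0 < dl by rewrite /dl divr_gt0// !mulr_gt0.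
have b0 : 0 < dl * (e / (2 * D)) by rewrite mulr_gt0// divr_gt0// mulr_gt0.
have [N HN] := LG _ b0; exists N => k Nk.
have iM (H : 'rV[R]_n -> R) : measurable_fun w H -> (sqn mu w H < +oo)%E ->
    mu.-integrable w (EFin \o (fun x => H x * h x)).
  move=> mH iH; apply: (@integrable_mul_bounded _ _ _ H h C) => //; exact: sqn_L1.
rewrite -RintegralB//; last 2 first.
  exact: iM.
  exact: iM.
have mB : measurable_fun w (fun x => Gk k x - G x) by exact: measurable_funB.
have iB : (sqn mu w (fun x => Gk k x - G x)%R < +oo)%E.
  by apply: le_lt_trans (HN k Nk) _; rewrite ltry.
have iMB := iM _ mB iB.
under eq_Rintegral do rewrite -mulrBl.
apply: (le_trans (le_normr_Rintegral _ iMB)) => //.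
have iA : mu.-integrable w (fun x => (`|Gk k x - G x|)%:E).
  by have := integrable_abse (sqn_L1 mB iB).
apply: (@le_trans _ _ (\int[mu]_(x in w) (D * `|Gk k x - G x|))).
  apply: le_Rintegral => //.
  - by have := integrable_abse iMB.
  - by rewrite /comp; under eq_fun do rewrite EFinM; exact: integrableZl.
  - move=> x wx; rewrite normrM mulrC ler_wpM2r//.
    by have := hC x wx; have := ler_norm C; rewrite /D; lra.
rewrite RintegralZl//.
rewrite mulrC -ler_pdivlMr//.
rewrite -lee_fin /Rintegral fineK; last exact: integrable_fin_num.
apply: le_trans (L1_le_sqn mB dl0) _.
apply: (@le_trans _ _ (dl%:E * V%:E + dl^-1%:E * (dl * (e / (2 * D)))%:E)%E).
  rewrite VE; apply: leeD => //; apply: lee_wpmul2l; last exact: HN.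
  by rewrite lee_fin invr_ge0 ltW.
rewrite -!EFinM -EFinD lee_fin mulKf ?gt_eqF//.
have h1 : dl * V <= e / (2 * D).
  apply: (@le_trans _ _ (dl * (V + 1))); first by rewrite ler_wpM2l ?ltW//; lra.
  by rewrite /dl invfM mulrA divfK// gt_eqF.
have -> : e / D = e / (2 * D) + e / (2 * D) by field; rewrite gt_eqF.
by rewrite lerD2r.
Qed.

Lemma unif_L2cvg (fk : nat -> 'rV[R]_n -> R) f :
  (forall k, measurable_fun w (fk k)) -> measurable_fun w f ->
  unif_cvg fk f -> L2cvg mu w fk f.
Proof.
move=> mfk mf uf e e0.
pose V := fine (mu w).
have VE : mu w = V%:E by rewrite /V fineK// ge0_fin_numE.
have V0 : 0 <= V by rewrite fine_ge0.
pose a := Num.min 1 (e / (V + 1)).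
have a0 : 0 < a by rewrite /a lt_min ltr01/= divr_gt0//; lra.
have [N HN] := uf _ a0; exists N => k Nk.
apply: (@le_trans _ _ (\int[mu]_(x in w) (a ^+ 2)%:E)%E).
  apply: ge0_le_integral => //.
  - by move=> x _; rewrite lee_fin sqr_ge0.
  - by apply: measurable_sq; exact: measurable_funB.
  - move=> x wx; rewrite lee_fin -[leLHS]ger0_norm ?sqr_ge0// normrX.
    by rewrite lerXn2r ?nnegrE ?(ltW a0)// HN.
apply: (@le_trans _ _ (a ^+ 2 * V)%:E).
  by rewrite integral_cst// [X in (_ <= X)%E]EFinM /V fineK// ge0_fin_numE.
rewrite lee_fin.
have a1 : a <= 1 by rewrite /a ge_min lexx.
have a2 : a <= e / (V + 1) by rewrite /a ge_min lexx orbT.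
apply: (@le_trans _ _ (a * V)); first by rewrite expr2 ler_wpM2r// ger_pMr.
apply: (@le_trans _ _ (e / (V + 1) * (V + 1))).
  by apply: ler_pM => //; [exact: ltW|lra].
by rewrite divfK// gt_eqF// ltr_wpDl.
Qed.

Lemma Rintegral_supp K f : compact K -> K `<=` w -> (forall x, ~ K x -> f x = 0) ->
  \int[mu]_(x in w) f x = \int[mu]_x f x.
Proof.
move=> cK Kw fK; rewrite Rintegral_mkcond; congr (Rintegral _ _ _).
apply/funext => x; rewrite /patch; case: ifPn => //.
by rewrite notin_setE => nwx; rewrite fK// => /Kw.
Qed.

(** For each C^1 approximant this is the vanishing integral of a derivative of the product [fk g];
    both sides then converge. Since [g] need only be C^1, the calibration field, once cut off, is
    admissible. *)
Lemma sob_weak f F g j K : sob f F -> Ck 1 g -> compact K -> K `<=` w ->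
  (forall x, ~ K x -> g x = 0) ->
  \int[mu]_(x in w) (f x * partial j g x) = - \int[mu]_(x in w) (F j x * g x).
Proof.
move=> sfF cg cK Kw gK; have [[C fC] mf mF [fk [cf uf Lf]]] := sfF.
have pgK x : ~ K x -> partial j g x = 0 by apply: partial_eq0 => //; exact: compact_closedrV.
have mg : measurable_fun w g by exact: cont_meas (Ck0 cg).
have mpg : measurable_fun w (partial j g) by exact: C1_meas.
have [Cg gC] := bound_w (Ck0 cg).
have [Cp pC] : exists C, forall x, w x -> `|partial j g x| <= C.
  by have [_ /(_ j)[_ /bound_w]] := cg.
have mfk k : measurable_fun w (fk k) by exact: cont_meas (Ck0 (cf k)).
have mpf k : measurable_fun w (partial j (fk k)) by exact: C1_meas.
have ifk k : (sqn mu w (fk k) < +oo)%E.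
  by have [C' hC'] := bound_w (Ck0 (cf k)); exact: sqn_bounded hC'.
have ipf k : (sqn mu w (partial j (fk k)) < +oo)%E.
  have [C' hC'] : exists C, forall x, w x -> `|partial j (fk k) x| <= C.
    by have [_ /(_ j)[_ /bound_w]] := cf k.
  exact: sqn_bounded hC'.
have [mFj iFj] := mF j.
have iff : (sqn mu w f < +oo)%E by exact: sqn_bounded fC.
have base k : \int[mu]_(x in w) (fk k x * partial j g x) = - \int[mu]_(x in w) (partial j (fk k) x * g x).
  have i1 : mu.-integrable w (EFin \o (fun x => fk k x * partial j g x)).
    by apply: (@integrable_mul_bounded _ _ _ (fk k) _ Cp) => //; exact: sqn_L1.
  have i2 : mu.-integrable w (EFin \o (fun x => partial j (fk k) x * g x)).
    by apply: (@integrable_mul_bounded _ _ _ (partial j (fk k)) _ Cg) => //; exact: sqn_L1.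
  apply/eqP; rewrite -subr_eq0 opprK -RintegralD//.
  rewrite (@Rintegral_supp K) => [|//|//|x nKx]; last by rewrite gK// pgK// !mulr0 addr0.
  apply/eqP; rewrite /Rintegral.
  under eq_integral do rewrite [partial _ _ _ * _]mulrC -(partialM j _ (cf k) cg).
  rewrite integral_partial_bsupp//.
    exact: CkM.
  by apply: (@eq0_compact_bsupp _ _ K) => // x nKx; rewrite gK// mulr0.
apply/eqP; rewrite -subr_eq0 opprK -normr_le0; apply/ler_addgt0Pl => e e0; rewrite addr0.
have e2 : 0 < e / 2 by rewrite divr_gt0.
have [N HN] := L2cvg_Rintegral mfk mf ifk iff mpg pC (unif_L2cvg mfk mf uf) e2.
have [N' HN'] := L2cvg_Rintegral mpf mFj ipf iFj mg gC (Lf j) e2.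
have := HN _ (leq_maxl N N'); have := HN' _ (leq_maxr N N'); rewrite (base (maxn N N')).
set a := \int[mu]_(x in w) (partial j _ x * g x); set b := \int[mu]_(x in w) (F j x * g x).
set c := \int[mu]_(x in w) (f x * partial j g x) => h1 h2.
rewrite (_ : c + b = - ((- a - c) + (a - b))); last by ring.
by rewrite normrN; apply: (le_trans (ler_normD _ _)); lra.
Qed.

End sobolev_pairs.

(** * From weak gradients to approximating sequences, and the space [W12_0] *)

Section approximation.
Context {R : realType} (n : nat).
Local Notation mu := (lebesgue_rV n : {sigma_finite_measure set 'rV[R]_n -> \bar R}).
Implicit Types (f g : 'rV[R]_n -> R) (F : 'I_n -> 'rV[R]_n -> R) (w B K : set 'rV[R]_n).

Lemma sqn_patch w f : measurable w -> sqn mu setT (f \_ w) = sqn mu w f.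
Proof.
move=> mw; rewrite /sqn [RHS]integral_mkcond; apply: eq_integral => x _.
by rewrite /patch; case: ifPn => // _; rewrite expr0n.
Qed.

Lemma sqn_subset w B f : measurable w -> measurable B -> w `<=` B -> measurable_fun B f ->
  (sqn mu w f <= sqn mu B f)%E.
Proof.
move=> mw mB wB mf; apply: ge0_subset_integral => //; first exact: measurable_sq.
by move=> x _; rewrite lee_fin sqr_ge0.
Qed.

Lemma eq0_Rintegral B K f : (forall x, ~ K x -> f x = 0) -> K `<=` B ->
  \int[mu]_x f x = \int[mu]_(x in B) f x.
Proof.
move=> fK KB; rewrite [RHS]Rintegral_mkcond; congr (Rintegral _ _ _).
apply/funext => x; rewrite /patch; case: ifPn => //.
by rewrite notin_setE => nBx; rewrite fK// => /KB.
Qed.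

Lemma continuous_mul_supp B K f g : open B -> closed K -> K `<=` B ->
  {in B, continuous f} -> continuous g -> (forall x, ~ K x -> g x = 0) ->
  continuous (fun x => g x * f x).
Proof.
move=> oB cK KB cf cg gK x; have [Bx|nBx] := pselect (B x).
  exact: (continuousM (cg x) (cf x (mem_set Bx))).
have nKx : ~ K x by move=> /KB.
have nx : nbhs x (~` K) by apply: open_nbhs_nbhs; split => //; exact: closed_openC.
rewrite /continuous_at (gK x nKx) mul0r => A /nbhs_singleton A0.
by apply: filterS nx => y nKy /=; rewrite gK// mul0r.
Qed.

(** Brings the minimizer into [sob]. A cut-off [chi], equal to 1 near [K], turns [f] into a function
    on the whole space whose weak gradient is given by the product rule, because testing it against
    [g] amounts to testing [f] against [chi g]; this function can be mollified. *)
Lemma weak_sob w B K f F MB Cf : open B -> measurable w -> (forall x, B x -> `|x| <= MB) ->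
  w `<=` K -> compact K -> K `<=` B ->
  {in B, continuous f} -> (forall x, B x -> `|f x| <= Cf) ->
  (forall j, measurable_fun B (F j) /\ (sqn mu B (F j) < +oo)%E) ->
  (forall g j, test_function B g ->
    \int[mu]_(x in B) (f x * partial j g x) = - \int[mu]_(x in B) (F j x * g x)) ->
  sob w f F.
Proof.
move=> oB mw BM wK cK KB cf fC mF weak.
have mB := open_measurable_rV oB.
have mf : measurable_fun B f by exact: open_continuous_measurable_rV.
have [chi [d [K' [d0 schi chi1 [cK' K'B] chi0]]]] := cutoff_exists cK oB KB.
have clK' := compact_closedrV cK'.
have cchi : continuous chi := schi 0%N.
have pchi0 j x : ~ K' x -> partial j chi x = 0 by exact: partial_eq0.
have cpchi j : continuous (partial j chi) := smooth_partial j schi 0%N.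
have wchi x : w x -> {near x, chi =1 cst 1}.
  move=> wx; near=> y; apply: (chi1 y x); first exact: wK.
  have : ball x d y by near: y; exact: nbhsx_ballx.
  by rewrite -ball_normE/= -normrN opprB.
pose g0 x := chi x * f x.
pose H j x := partial j chi x * f x.
(* [F] is set to 0 outside [B]: it is unknown there, and [chi] vanishes anyway. *)
pose G j x := chi x * (F j \_ B) x + H j x.
have cg0 : continuous g0 by exact: (continuous_mul_supp oB clK' K'B).
have cH j : continuous (H j) := @continuous_mul_supp B K' f (partial j chi) oB clK' K'B cf (cpchi j) (pchi0 j).
have g0K x : ~ K' x -> g0 x = 0 by move=> nK; rewrite /g0 chi0// mul0r.
have HK j x : ~ K' x -> H j x = 0 by move=> nK; rewrite /H pchi0// mul0r.
have GK j x : ~ K' x -> G j x = 0 by move=> nK; rewrite /G chi0// HK// mul0r addr0.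
have mFB j : measurable_fun setT (F j \_ B).
  by apply: (measurable_restrictT (F j) mB).1; have [] := mF j.
have mG j : measurable_fun setT (G j).
  apply: measurable_funD; last exact: continuous_measurable_rV.
  by apply: measurable_funM => //; exact: continuous_measurable_rV.
have [Cchi hCchi] := bsupp_bounded cchi (eq0_compact_bsupp cK' chi0).
have Hb j : exists C, forall x, `|H j x| <= C.
  by apply: bsupp_bounded => //; exact: (eq0_compact_bsupp cK' (HK j)).
have sg0 : (sqn mu setT g0 < +oo)%E.
  have ig := continuous_integrable_bsupp (continuousMf cg0 cg0) (eq0_compact_bsupp (f := fun x => g0 x * g0 x) cK' _).
  have /integrableP[_] : mu.-integrable setT (EFin \o (fun x => g0 x * g0 x)).
    by apply: ig => x nK; rewrite g0K// mul0r.
  apply: le_lt_trans; apply: ge0_le_integral => //.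
  - by move=> x _; rewrite lee_fin sqr_ge0.
  - by apply: measurable_sq; exact: continuous_measurable_rV.
  - apply: measurableT_comp => //; apply/measurable_EFinP; apply: continuous_measurable_rV.
    exact: continuousMf.
  - by move=> x _; rewrite abse_EFin lee_fin expr2 ler_norm.
have GB j x : B x -> G j x = chi x * F j x + H j x.
  by move=> Bx; rewrite /G /patch mem_set.
have sG j : (sqn mu setT (G j) < +oo)%E.
  have -> : G j = (fun x => chi x * F j x + H j x) \_ B.
    apply/funext => x; rewrite [RHS]/patch; case: ifPn => [/set_mem|]; first exact: GB.
    by rewrite notin_setE => nBx; rewrite GK// => /K'B.
  rewrite sqn_patch//; have [mFj iFj] := mF j; have [C hC] := Hb j.
  have mHj : measurable_fun B (H j) by apply: measurable_funTS; exact: continuous_measurable_rV.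
  have mchi : measurable_fun B chi by apply: measurable_funTS; exact: continuous_measurable_rV.
  apply: (@sqnD_lty _ _ B mB) => //.
  - exact: measurable_funM.
  - by apply: (@sqnM_lty _ _ B mB chi (F j) Cchi).
  - exact: (sqn_bounded mB BM mHj (fun x _ => hC x)).
have wk (g : 'rV[R]_n -> R) j : smooth g -> bsupp g ->
    \int[mu]_x (g0 x * partial j g x) = - \int[mu]_x (G j x * g x).
  move=> sg bg.
  have cg : continuous g := sg 0%N.
  have [Cg gC] := bsupp_bounded cg bg.
  have schig : smooth (fun x => chi x * g x) by exact: smoothM.
  have chigK x : ~ K' x -> chi x * g x = 0 by move=> nK; rewrite chi0// mul0r.
  rewrite (@eq0_Rintegral B K'); [|by move=> x nK; rewrite g0K// mul0r|by []].
  rewrite (@eq0_Rintegral B K' (fun x => G j x * g x)); [|by move=> x nK; rewrite GK// mul0r|by []].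
  have tchig : test_function B (fun x => chi x * g x).
    exact: (smooth_test_function schig cK' K'B chigK).
  have [mFj iFj] := mF j.
  have mcB (h : 'rV[R]_n -> R) : continuous h -> measurable_fun B h.
    by move=> ch; apply: measurable_funTS; exact: continuous_measurable_rV.
  have cpchig : continuous (partial j (fun x => chi x * g x)) := smooth_partial j schig 0%N.
  have [C1 hC1] : exists C, forall x, `|partial j (fun x => chi x * g x) x| <= C.
    apply: bsupp_bounded => //; apply: bsupp_partial; exact: eq0_compact_bsupp chigK.
  have [C2 hC2] := Hb j.
  have fi : mu.-integrable B (EFin \o f) by exact: (bounded_integrable mB BM mf fC).
  have i1 : mu.-integrable B (EFin \o (fun x => f x * partial j (fun x => chi x * g x) x)).
    by apply: (integrable_mul_bounded mB fi (mcB _ cpchig) (fun x _ => hC1 x)).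
  have i2 : mu.-integrable B (EFin \o (fun x => H j x * g x)).
    have Hi : mu.-integrable B (EFin \o H j) by exact: (bounded_integrable mB BM (mcB _ (cH j)) (fun x _ => hC2 x)).
    exact: (integrable_mul_bounded mB Hi (mcB _ cg) (fun x _ => gC x)).
  have i3 : mu.-integrable B (EFin \o (fun x => F j x * (chi x * g x))).
    have Fi : mu.-integrable B (EFin \o F j) by exact: (sqn_L1 mB BM).
    apply: (integrable_mul_bounded mB Fi (mcB _ (continuousMf cchi cg)) (C := Cchi * Cg)) => x _.
    by rewrite normrM; apply: ler_pM.
  have -> : \int[mu]_(x in B) (g0 x * partial j g x) =
      \int[mu]_(x in B) (f x * partial j (fun x => chi x * g x) x - H j x * g x).
    apply: eq_Rintegral => x _; rewrite (partialM j x (schi 1%N) (sg 1%N)) /g0 /H.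
    by ring.
  rewrite RintegralB// weak//.
  have -> : \int[mu]_(x in B) (G j x * g x) =
      \int[mu]_(x in B) (F j x * (chi x * g x) + H j x * g x).
    by apply: eq_Rintegral => x /set_mem Bx; rewrite GB//; ring.
  by rewrite RintegralD// opprD.
have [fk [sfk _ _ Lj uf]] := mollification (continuous_measurable_rV cg0) mG
  (eq0_compact_bsupp cK' g0K) (fun j => eq0_compact_bsupp cK' (GK j)) sg0 sG wk.
have wB : w `<=` B by move=> x /wK/KB.
have g0w x : w x -> g0 x = f x.
  by move=> wx; have /nbhs_singleton := wchi x wx; rewrite /g0 => ->; rewrite mul1r.
have Gw j x : w x -> G j x = F j x.
  move=> wx; rewrite GB; last exact: wB.
  have /nbhs_singleton -> := wchi x wx; rewrite mul1r /H.
  by rewrite (@partial_eq_near _ _ _ _ _ _ (wchi x wx)) partial_cst mul0r addr0.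
split.
- by exists Cf => x /wB; exact: fC.
- exact: measurable_funS mf.
- move=> j; have [mFj iFj] := mF j; split; first exact: measurable_funS mFj.
  by apply: le_lt_trans iFj; exact: sqn_subset.
exists fk; split.
- by move=> k; exact: sfk.
- move=> e e0; have [N HN] := uf cg0 e e0; exists N => k x Nk wx.
  by rewrite -g0w// HN.
- move=> j e e0; have [N HN] := Lj j e e0; exists N => k Nk.
  apply: le_trans (HN k Nk).
  rewrite (_ : sqn mu w _ = sqn mu w (fun x => partial j (fk k) x - G j x)).
    apply: sqn_subset => //; apply: measurable_funB => //.
    by apply: continuous_measurable_rV; exact: (@smooth_partial R n j (fk k) (sfk k) 0%N).
  by apply: eq_integral => x /set_mem wx; rewrite Gw.
Unshelve. all: by end_near. Qed.

(** The extension by 0 has the extended [F] as weak gradient on the whole space, so it can be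
    mollified. The first [N] terms are dropped to keep the supports in a closed neighbourhood of [K]
    of radius [dw / 2], which is inside [w]. *)
Lemma sob_test_approx w K f F Mw : open w -> (forall x, w x -> `|x| <= Mw) ->
  compact K -> K `<=` w -> sob w f F ->
  (forall x, w x -> ~ K x -> f x = 0) -> (forall j x, w x -> ~ K x -> F j x = 0) ->
  exists fk : nat -> 'rV[R]_n -> R,
  [/\ forall k, test_function w (fk k), L2cvg mu w fk f &
      forall j, L2cvg mu w (fun k => partial j (fk k)) (F j)].
Proof.
move=> ow wM cK Kw sf f0 F0; have mw := open_measurable_rV ow.
have [[C fC] mf mF _] := sf.
have [chi [d [K' [d0 schi chi1 [cK' K'w] chi0]]]] := cutoff_exists cK ow Kw.
pose f' := f \_ w; pose F' j := F j \_ w.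
have f'K x : ~ K x -> f' x = 0.
  by move=> nK; rewrite /f' /patch; case: ifPn => // /set_mem wx; exact: f0.
have Kchi x : K x -> {near x, chi =1 cst 1}.
  move=> Kx; apply/nbhs_ballP; exists d => //= y; rewrite -ball_normE/= => xy.
  by apply: (chi1 y x) => //; rewrite -normrN opprB.
have F'K j x : ~ K x -> F' j x = 0.
  by move=> nK; rewrite /F' /patch; case: ifPn => // /set_mem wx; exact: F0.
have wk (g : 'rV[R]_n -> R) j : smooth g -> bsupp g ->
    \int[mu]_x (f' x * partial j g x) = - \int[mu]_x (F' j x * g x).
  move=> sg bg.
  rewrite (@eq0_Rintegral w K); [|by move=> x nK; rewrite f'K// mul0r|by []].
  rewrite (@eq0_Rintegral w K (fun x => F' j x * g x)); [|by move=> x nK; rewrite F'K// mul0r|by []].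
  have f'E x : w x -> f' x = f x by move=> wx; rewrite /f' /patch mem_set.
  have F'E x : w x -> F' j x = F j x by move=> wx; rewrite /F' /patch mem_set.
  have := @sob_weak _ _ w Mw mw wM f F (fun x => chi x * g x) j K' sf (smoothM schi sg 1%N) cK' K'w.
  have chigK x : ~ K' x -> chi x * g x = 0 by move=> nK; rewrite chi0// mul0r.
  move=> /(_ chigK) H.
  have -> : \int[mu]_(x in w) (f' x * partial j g x) =
      \int[mu]_(x in w) (f x * partial j (fun x => chi x * g x) x).
    apply: eq_Rintegral => x /set_mem wx; rewrite f'E//.
    have [Kx|nKx] := pselect (K x); last by rewrite f0// !mul0r.
    congr (_ * _); apply: partial_eq_near.
    by apply: filterS (Kchi x Kx) => y /= ->; rewrite mul1r.
  rewrite H; congr (- _); apply: eq_Rintegral => x /set_mem wx; rewrite F'E//.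
  have [Kx|nKx] := pselect (K x); last by rewrite F0// !mul0r.
  by have /nbhs_singleton -> := Kchi x Kx; rewrite mul1r.
have mf' : measurable_fun setT f' by exact: (measurable_restrictT f mw).1.
have mF' j : measurable_fun setT (F' j).
  by apply: (measurable_restrictT (F j) mw).1; have [] := mF j.
have i' : (sqn mu setT f' < +oo)%E.
  by rewrite sqn_patch//; exact: (sqn_bounded mw wM mf fC).
have I' j : (sqn mu setT (F' j) < +oo)%E by rewrite sqn_patch//; have [] := mF j.
have [fk [sfk fk0 L0 Lj _]] := mollification mf' mF' (eq0_compact_bsupp cK f'K)
  (fun j => eq0_compact_bsupp cK (F'K j)) i' I' wk.
have [dw dw0 KdU] := compact_open_nbhd cK ow Kw.
pose K'' := [set p.1 + p.2 | p in K `*` [set v : 'rV[R]_n | `|v| <= dw / 2]].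
have cK'' : compact K''.
  apply: continuous_compact.
    by apply: continuous_subspaceT => -[a b]; exact: add_continuous.
  by apply: compact_setX => //; exact: compact_le_norm.
have K''w : K'' `<=` w.
  move=> _ [[k v] /= [Kk vd] <-]; apply: (KdU k) => //.
  by rewrite addrAC subrr add0r; lra.
have [N HN] : exists N, forall k, (N <= k)%N -> k.+1%:R^-1 <= dw / 2.
  have dw2 : 0 < dw / 2 by rewrite divr_gt0.
  have := @cvg_harmonic R => /cvgrPdist_lt/(_ _ dw2)[N _ HN].
  exists N => k Nk; have := HN k Nk.
  by rewrite /= sub0r normrN gtr0_norm ?invr_gt0 ?ltr0Sn// => /ltW.
have fkK k x : (N <= k)%N -> ~ K'' x -> fk k x = 0.
  move=> Nk nK; apply: fk0 => y yx; apply: f'K => Ky; apply: nK.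
  exists (y, x - y) => /=; last by rewrite addrC subrK.
  by split => //; rewrite -normrN opprB; apply: le_trans yx (HN k Nk).
have shift (hk : nat -> 'rV[R]_n -> R) h h' : (forall k, measurable_fun setT (hk k)) ->
    measurable_fun setT h' ->
    (forall x, w x -> h' x = h x) -> L2cvg mu setT hk h' -> L2cvg mu w (fun k => hk (k + N)%N) h.
  move=> mhk mh' hh' Lh e e0; have [N' HN'] := Lh e e0; exists N' => k N'k.
  apply: le_trans (HN' (k + N)%N (leq_trans N'k (leq_addr _ _))).
  rewrite (_ : sqn mu w _ = sqn mu w (fun x => hk (k + N)%N x - h' x)).
    by apply: sqn_subset => //; apply: measurable_funB => //.
  by apply: eq_integral => x /set_mem wx; rewrite hh'.
exists (fun k => fk (k + N)%N); split.
- move=> k; apply: (smooth_test_function (sfk _) cK'' K''w) => x nK.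
  by apply: fkK => //; exact: leq_addl.
- apply: (shift _ _ f') => //.
    by move=> k; apply: continuous_measurable_rV; exact: sfk k 0%N.
  by move=> x wx; rewrite /f' /patch mem_set.
- move=> j; apply: (shift (fun k => partial j (fk k)) _ (F' j)) => //.
    by move=> k; apply: continuous_measurable_rV; exact: (@smooth_partial R n j (fk k) (sfk k) 0%N).
  by move=> x wx; rewrite /F' /patch mem_set.
Unshelve. all: by end_near. Qed.

Lemma L2cvg_cvg w (fk : nat -> 'rV[R]_n -> R) f : L2cvg mu w fk f ->
  (fun k => sqn mu w (fun x => fk k x - f x)) @ \oo --> 0%E.
Proof.
move=> H; apply/fine_cvgP; split.
  have [N HN] := H 1 ltr01; exists N => // k /= Nk.
  rewrite ge0_fin_numE ?sqn_ge0//; apply: le_lt_trans (HN k Nk) _; exact: ltry.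
apply/cvgrPdist_le => e e0; have [N HN] := H e e0; exists N => // k /= Nk.
rewrite sub0r normrN ger0_norm ?fine_ge0 ?sqn_ge0// -lee_fin fineK ?HN//.
by rewrite ge0_fin_numE ?sqn_ge0//; apply: le_lt_trans (HN k Nk) _; exact: ltry.
Qed.

Section vector.
Variable m : nat.
Implicit Types (v : 'rV[R]_n -> 'rV[R]_m) (G : 'rV[R]_n -> 'M[R]_(m, n)).

Lemma enorm_sq k l (A : 'M[R]_(k, l)) : enorm A ^+ 2 = \sum_i \sum_j A i j ^+ 2.
Proof.
rewrite sqr_sqrtr//; apply: sumr_ge0 => i _; apply: sumr_ge0 => j _; exact: sqr_ge0.
Qed.

Lemma sob_W12_gradient w v G Mw : open w -> (forall x, w x -> `|x| <= Mw) ->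
  (forall i, sob w (component i v) (fun j => entry i j G)) -> W12_gradient w v G.
Proof.
move=> ow wM sv; have mw := open_measurable_rV ow.
have L2L1 f : measurable_fun w f -> (sqn mu w f < +oo)%E -> L1loc w f.
  move=> mf fi; split => // K cK Kw.
  apply: (@le_lt_trans _ _ (\int[mu]_(x in w) `|f x|%:E)%E).
    apply: ge0_subset_integral => //; first exact: compact_measurable_rV.
    by apply/measurable_EFinP; exact: measurableT_comp.
  by have /integrableP[_] := sqn_L1 mw wM mf fi.
have cfin i : (sqn mu w (component i v) < +oo)%E.
  by have [[C vC] mv _ _] := sv i; exact: (sqn_bounded mw wM mv vC).
split.
- move=> i j; have [[C vC] mv mG _] := sv i; have [mGj iGj] := mG j; split.
  + exact: L2L1.
  + exact: L2L1.
  + move=> f /test_functionP[sf [K [cK Kw fK]]].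
    exact: (@sob_weak _ _ w Mw mw wM _ _ f j K (sv i) (sf 1%N) cK Kw fK).
- by move=> i; have [_ mv _ _] := sv i; split => //; exact: cfin.
- by move=> i j; have [_ _ /(_ j)[mGj iGj] _] := sv i; split.
Qed.

Lemma sob_W12_0 w v G K Mw : open w -> (forall x, w x -> `|x| <= Mw) ->
  compact K -> K `<=` w ->
  (forall i, sob w (component i v) (fun j => entry i j G)) ->
  (forall x, w x -> ~ K x -> v x = 0 /\ G x = 0) -> W12_0 w v.
Proof.
move=> ow wM cK Kw sv v0; have mw := open_measurable_rV ow.
exists G; first exact: sob_W12_gradient wM sv.
have /choice[fk Hfk] (i : 'I_m) : exists fk : nat -> 'rV[R]_n -> R,
  [/\ forall k, test_function w (fk k), L2cvg mu w fk (component i v) &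
      forall j, L2cvg mu w (fun k => partial j (fk k)) (entry i j G)].
  apply: (sob_test_approx ow wM cK Kw (sv i)).
    by move=> x wx nK; have [vx _] := v0 x wx nK; rewrite /component vx mxE.
  by move=> j x wx nK; have [_ Gx] := v0 x wx nK; rewrite /entry Gx mxE.
pose phi k x : 'rV[R]_m := \row_i fk i k x.
have phiE k i : component i (phi k) = fk i k.
  by apply/funext => x; rewrite /component mxE.
exists phi; first by move=> k i; rewrite phiE; have [] := Hfk i.
have mfk i k : measurable_fun w (fk i k).
  have [/(_ k)[sf _ _] _ _] := Hfk i.
  by apply: measurable_funTS; apply: continuous_measurable_rV; exact: sf 0%N.
have mpfk i j k : measurable_fun w (partial j (fk i k)).
  have [/(_ k)[sf _ _] _ _] := Hfk i.
  by apply: measurable_funTS; apply: continuous_measurable_rV; exact: (@smooth_partial R n j (fk i k) sf 0%N).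
have mv i : measurable_fun w (component i v) by have [] := sv i.
have mG i j : measurable_fun w (entry i j G) by have [_ _ /(_ j)[]] := sv i.
rewrite (_ : (fun k => _) = (fun k => \sum_(i < m) (sqn mu w (fun x => fk i k x - component i v x)%R +
   \sum_(j < n) sqn mu w (fun x => partial j (fk i k) x - entry i j G x)%R)%E)); last first.
  apply/funext => k.
  transitivity (\int[mu]_(x in w) (\sum_(i < m) (((fk i k x - component i v x) ^+ 2)%:E +
      \sum_(j < n) ((partial j (fk i k) x - entry i j G x) ^+ 2)%:E)))%E.
    apply: eq_integral => x _; rewrite !enorm_sq big_ord1.
    under [X in _ = X]eq_bigr do rewrite sumEFin -EFinD.
    rewrite sumEFin big_split/=; congr ((_ + _)%:E).
      by apply: eq_bigr => i _; rewrite !mxE.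
    by apply: eq_bigr => i _; apply: eq_bigr => j _; rewrite !mxE phiE.
  have msq i : measurable_fun w (fun x => ((fk i k x - component i v x) ^+ 2)%:E).
    by apply: measurable_sq; exact: measurable_funB.
  have msp i j : measurable_fun w (fun x => ((partial j (fk i k) x - entry i j G x) ^+ 2)%:E).
    by apply: measurable_sq; exact: measurable_funB.
  have s0 i x : (0 <= \sum_(j < n) ((partial j (fk i k) x - entry i j G x) ^+ 2)%:E)%E.
    by apply: sume_ge0 => j _; rewrite lee_fin sqr_ge0.
  rewrite ge0_integral_sum//; last 2 first.
  - by move=> i; apply: emeasurable_funD => //; exact: emeasurable_sum.
  - by move=> i x _; rewrite adde_ge0// lee_fin sqr_ge0.
  apply: eq_bigr => i _; rewrite ge0_integralD//; last exact: emeasurable_sum.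
  congr (_ + _)%E; rewrite ge0_integral_sum// => j x _; rewrite lee_fin sqr_ge0//.
  by move=> x _; rewrite lee_fin sqr_ge0.
have sum0 (I : finType) (h : I -> nat -> \bar R) : (forall i k, 0 <= h i k)%E ->
    (forall i, h i @ \oo --> 0%E) -> (fun k => \sum_(i : I) h i k)%E @ \oo --> 0%E.
  move=> h0 hi; rewrite -[X in _ --> X](_ : (\sum_(i : I) (0 : \bar R))%E = 0%E); last by rewrite big1.
  apply: (@cvg_nnesum _ _ _ _ _ (index_enum I) h (fun=> 0%E) predT).
    by move=> i' _; apply: nearW => k; exact: h0.
  by move=> i' _; exact: hi.
apply: (sum0 'I_m) => [i k|i].
  by apply: adde_ge0; [exact: sqn_ge0|apply: sume_ge0 => j _; exact: sqn_ge0].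
have [_ Li Lij] := Hfk i.
rewrite -[X in _ --> X](adde0 0%E).
apply: cvgeD => //; first exact: L2cvg_cvg.
by apply: (sum0 'I_n) => [j k|j]; [exact: sqn_ge0|exact: L2cvg_cvg].
Qed.

End vector.

End approximation.

(** * Euclidean balls *)

Section euclidean_norm.
Context {R : realType} (n : nat).
Implicit Types (x y z : 'rV[R]_n) (r : R).

Lemma dotrvC x y : dotrv x y = dotrv y x.
Proof. by apply: eq_bigr => i _; rewrite mulrC. Qed.

Lemma dotrvDl x y z : dotrv (x + y) z = dotrv x z + dotrv y z.
Proof. by rewrite -big_split; apply: eq_bigr => i _; rewrite mxE mulrDl. Qed.

Lemma dotrvZl r x y : dotrv (r *: x) y = r * dotrv x y.
Proof. by rewrite mulr_sumr; apply: eq_bigr => i _; rewrite mxE mulrA. Qed.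

Lemma dotrvDr x y z : dotrv z (x + y) = dotrv z x + dotrv z y.
Proof. by rewrite dotrvC dotrvDl !(dotrvC z). Qed.

Lemma dotrvZr r x y : dotrv y (r *: x) = r * dotrv y x.
Proof. by rewrite dotrvC dotrvZl dotrvC. Qed.

Lemma dotrvNl x y : dotrv (- x) y = - dotrv x y.
Proof. by rewrite -scaleN1r dotrvZl mulN1r. Qed.

Lemma dotrvNr x y : dotrv y (- x) = - dotrv y x.
Proof. by rewrite dotrvC dotrvNl dotrvC. Qed.

Lemma enorm_sqE x : enorm x ^+ 2 = dotrv x x.
Proof. by rewrite enorm_sq big_ord1; apply: eq_bigr => i _; rewrite expr2. Qed.

Lemma dotrv_ge0 x : 0 <= dotrv x x.
Proof. by rewrite -enorm_sqE sqr_ge0. Qed.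

Lemma enorm_ge0 k l (A : 'M[R]_(k, l)) : 0 <= enorm A.
Proof. exact: sqrtr_ge0. Qed.

Lemma dotrv_eq0 x : dotrv x x = 0 -> x = 0.
Proof.
move=> /eqP; rewrite psumr_eq0; last by move=> i _; rewrite -expr2 sqr_ge0.
move=> /allP x0; apply/rowP => i; rewrite mxE; apply/eqP.
by have := x0 i (mem_index_enum _); rewrite /= mulf_eq0 orbb.
Qed.

Lemma enorm_eq0 x : enorm x = 0 -> x = 0.
Proof. by move=> x0; apply: dotrv_eq0; rewrite -enorm_sqE x0 expr0n. Qed.

Lemma enormZ r x : 0 <= r -> enorm (r *: x) = r * enorm x.
Proof.
move=> r0; apply/eqP; rewrite -(eqrXn2 (ltn0Sn 1)) ?mulr_ge0 ?enorm_ge0//.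
by rewrite exprMn !enorm_sqE dotrvZl dotrvZr mulrA -expr2.
Qed.

Lemma enormN x : enorm (- x) = enorm x.
Proof.
apply/eqP; rewrite -(eqrXn2 (ltn0Sn 1)) ?enorm_ge0//.
by rewrite !enorm_sqE dotrvNl dotrvNr opprK.
Qed.

Lemma enormB x y : enorm (x - y) = enorm (y - x).
Proof. by rewrite -enormN opprB. Qed.

Lemma cauchy_schwarz x y : dotrv x y ^+ 2 <= dotrv x x * dotrv y y.
Proof.
have [y0|y0] := eqVneq (dotrv y y) 0.
  by rewrite y0 mulr0 (dotrv_eq0 y0) -(scale0r (0 : 'rV[R]_n)) dotrvZr mul0r expr0n.
have yp : 0 < dotrv y y by rewrite lt_neqAle eq_sym y0 dotrv_ge0.
have := dotrv_ge0 (dotrv y y *: x - dotrv x y *: y).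
rewrite dotrvDl !dotrvDr !dotrvNl !dotrvNr !dotrvZl !dotrvZr (dotrvC y x) => H.
rewrite -subr_ge0 -(pmulr_rge0 _ yp).
apply: le_trans H _; rewrite le_eqVlt; apply/orP; left; apply/eqP; ring.
Qed.

Lemma dotrv_le x y : `|dotrv x y| <= enorm x * enorm y.
Proof.
rewrite -ler_sqr ?nnegrE ?mulr_ge0 ?enorm_ge0//.
by rewrite -normrX ger0_norm ?sqr_ge0// exprMn !enorm_sqE cauchy_schwarz.
Qed.

Lemma enormD x y : enorm (x + y) <= enorm x + enorm y.
Proof.
rewrite -ler_sqr ?nnegrE ?addr_ge0 ?enorm_ge0//.
have := le_trans (ler_norm _) (dotrv_le x y).
rewrite sqrrD !enorm_sqE dotrvDl !dotrvDr (dotrvC y x).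
by lra.
Qed.

Lemma enorm_dist x y : `|enorm x - enorm y| <= enorm (x - y).
Proof.
have := enormD (x - y) y; have := enormD (y - x) x; rewrite !subrK enormB.
by rewrite ler_norml => H1 H2; apply/andP; split; lra.
Qed.

Lemma coord_le_enorm x i : `|x ord0 i| <= enorm x.
Proof.
rewrite -ler_sqr ?nnegrE ?enorm_ge0//.
rewrite -normrX ger0_norm ?sqr_ge0// enorm_sqE /dotrv (bigD1 i)//= -expr2.
by rewrite lerDl sumr_ge0// => j _; rewrite -expr2 sqr_ge0.
Qed.

Lemma norm_le_enorm x : `|x| <= enorm x.
Proof. by apply/rV_norm_leP => [|i]; [exact: enorm_ge0|exact: coord_le_enorm]. Qed.

Lemma Ck_sqdist k y : Ck k (fun x => dotrv (x - y) (x - y)).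
Proof.
have -> : (fun x => dotrv (x - y) (x - y)) =
  (fun x => \sum_i (x ord0 i - y ord0 i) * (x ord0 i - y ord0 i)).
  by apply/funext => x; apply: eq_bigr => i _; rewrite !mxE.
have C i : Ck k (fun x : 'rV[R]_n => x ord0 i - y ord0 i).
  by apply: CkB; [exact: Ck_coord|exact: Ck_cst].
by apply: Ck_sum => i; exact: CkM.
Qed.

Lemma partial_sqdist y j x :
  partial j (fun x => dotrv (x - y) (x - y)) x = 2 * (x ord0 j - y ord0 j).
Proof.
have -> : (fun x => dotrv (x - y) (x - y)) =
  (fun x => \sum_i (x ord0 i - y ord0 i) * (x ord0 i - y ord0 i)).
  by apply/funext => x'; apply: eq_bigr => i _; rewrite !mxE.
apply: partialE.
have D i : is_derive x (delta_mx ord0 j : 'rV[R]_n) (fun x : 'rV[R]_n => (x ord0 i - y ord0 i) * (x ord0 i - y ord0 i))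
    (2 * (x ord0 i - y ord0 i) * (i == j)%:R).
  have d : is_derive x (delta_mx ord0 j : 'rV[R]_n) (fun x : 'rV[R]_n => x ord0 i - y ord0 i) (i == j)%:R.
    apply: (derive_eq (is_deriveB (is_derive_coord i x _) (is_derive_cst _ _ _))).
    by rewrite mxE eqxx subr0.
  apply: (derive_eq (is_deriveM d d)); rewrite /GRing.scale/=; ring.
have := is_derive_sum (fun i => D i).
rewrite (_ : \sum_(i < n) _ = fun x : 'rV[R]_n => \sum_i (x ord0 i - y ord0 i) * (x ord0 i - y ord0 i)); last first.
  by apply/funext => z; rewrite fct_sumE.
move=> /derive_eq; apply.
rewrite (bigD1 j)//= eqxx mulr1 big1 ?addr0// => i /negbTE->.
by rewrite mulr0.
Qed.

Lemma continuous_enorm_dist y : continuous (fun x => enorm (x - y)).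
Proof.
have -> : (fun x => enorm (x - y)) = Num.sqrt \o (fun x => dotrv (x - y) (x - y)).
  apply/funext => x /=; rewrite -enorm_sqE sqrtr_sqr ger0_norm//; exact: enorm_ge0.
move=> x; apply: continuous_comp; first exact: Ck_sqdist 0%N y x.
exact: sqrt_continuous.
Qed.

End euclidean_norm.

Section balls.
Context {R : realType} (n : nat).
Variables (x0 : 'rV[R]_n).

Definition eball (r : R) := [set x : 'rV[R]_n | enorm (x - x0) < r].

Definition ecball (r : R) := [set x : 'rV[R]_n | enorm (x - x0) <= r].

Lemma eball_sqE r x : 0 <= r -> eball r x <-> dotrv (x - x0) (x - x0) < r ^+ 2.
Proof. by move=> r0; rewrite -enorm_sqE ltr_sqr ?nnegrE ?enorm_ge0. Qed.

Lemma open_eball r : open (eball r).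
Proof.
have := open_comp (fun x _ => @continuous_enorm_dist _ _ x0 x) (@open_lt R r).
by apply.
Qed.

Lemma closed_ecball r : closed (ecball r).
Proof.
have := closed_comp (fun x _ => @continuous_enorm_dist _ _ x0 x) (@closed_le R r).
by apply.
Qed.

Lemma ecball_norm r x : ecball r x -> `|x| <= `|x0| + r.
Proof.
move=> xr; rewrite -[x](subrK x0) addrC; apply: le_trans (ler_normD _ _) _.
by rewrite lerD2l; apply: le_trans xr; exact: norm_le_enorm.
Qed.

Lemma compact_ecball r : compact (ecball r).
Proof.
apply: (subclosed_compact (@closed_ecball r) (@compact_le_norm R n (`|x0| + r))).
by move=> x; exact: ecball_norm.
Qed.

Lemma eballW r : eball r `<=` ecball r.
Proof. by move=> x; exact: ltW. Qed.

Lemma closure_eball r : closure (eball r) `<=` ecball r.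
Proof.
rewrite closureE; apply: smallest_sub; [exact: closed_ecball|exact: eballW].
Qed.

Lemma bounded_eball r : bounded_set (eball r).
Proof.
exists (`|x0| + r); split; first exact: num_real.
by move=> M rM x /eballW/ecball_norm xr; apply: le_trans xr (ltW rM).
Qed.

(** With [e] the inner normal at [x1], the sphere near [x1] is the graph of [- cap] over the
    tangential distance. The upper hemisphere is out of reach within [r / 2] of [x1], and freezing
    [cap] beyond tangential distance [r / 2] keeps it at least [r / 2]; hence the Lipschitz constant
    1. *)
Lemma lipschitz_boundary_eball r : 0 < r -> lipschitz_boundary (eball r).
Proof.
move=> r0 x1 [cx1 nx1].
have x1r : enorm (x1 - x0) = r.
  apply/eqP; rewrite eq_le; apply/andP; split; first exact: closure_eball.
  rewrite leNgt; apply/negP => x1w; apply: nx1.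
  by have /interior_id -> := open_eball (r := r).
pose e := - (r^-1 *: (x1 - x0)).
have e1 : enorm e = 1.
  by rewrite /e enormN enormZ ?invr_ge0 ?(ltW r0)// x1r mulVf// gt_eqF.
have ee : dotrv e e = 1 by rewrite -enorm_sqE e1 expr1n.
have x1e : x1 - x0 = - r *: e by rewrite /e scalerN scalerA mulNr mulfV ?gt_eqF// scaleN1r opprK.
clearbody e.
pose p x := x - dotrv x e *: e.
pose cap (s : R) := Num.sqrt (r ^+ 2 - Num.min s (r / 2) ^+ 2).
pose g y := dotrv x0 e - cap (enorm (y - p x0)).
exists (r / 2), 1, e, g.
have r2 : 0 < r / 2 by rewrite divr_gt0.
have cap_ge s : 0 <= s -> r / 2 <= cap s /\ cap s ^+ 2 = r ^+ 2 - Num.min s (r / 2) ^+ 2.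
  move=> s0; have m1 : 0 <= Num.min s (r / 2) by rewrite le_min s0 ltW.
  have m2 : Num.min s (r / 2) <= r / 2 by rewrite ge_min lexx orbT.
  have rm : 0 <= r ^+ 2 - Num.min s (r / 2) ^+ 2 by nra.
  rewrite /cap sqr_sqrtr//; split => //.
  rewrite -[leLHS](ger0_norm (ltW r2)) -sqrtr_sqr ler_sqrt//.
  by nra.
split => //.
- move=> y z; rewrite mul1r (_ : g y - g z = cap (enorm (z - p x0)) - cap (enorm (y - p x0))); last by rewrite /g; ring.
  set s := enorm (z - p x0); set t := enorm (y - p x0).
  have st : `|s - t| <= enorm (y - z).
    have aux (a b c : 'rV[R]_n) : a - c - (b - c) = a - b by rewrite opprB addrA subrK.
    by apply: le_trans (enorm_dist _ _) _; rewrite aux enormB.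
  apply: le_trans st.
  have [s1 s2] := cap_ge s (enorm_ge0 _); have [t1 t2] := cap_ge t (enorm_ge0 _).
  have s0 : 0 <= s by exact: enorm_ge0.
  have t0 : 0 <= t by exact: enorm_ge0.
  set cs := cap s in s1 s2 *; set ct := cap t in t1 t2 *.
  have H : (cs - ct) * (cs + ct) = Num.min t (r / 2) ^+ 2 - Num.min s (r / 2) ^+ 2.
    by rewrite -subr_sqr s2 t2; ring.
  have mm : `|Num.min t (r / 2) - Num.min s (r / 2)| <= `|s - t|.
    have N1 := ler_norm (s - t); have N2 := ler_norm (t - s); rewrite distrC in N2.
    rewrite ler_norml; move: N1 N2; set N := `|s - t| => N1 N2.
    by case: (leP s (r / 2)) => hs; case: (leP t (r / 2)) => ht; apply/andP; split; lra.
  have ms : 0 <= Num.min s (r / 2) <= r / 2 by rewrite le_min s0 (ltW r2) ge_min lexx orbT.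
  have mt : 0 <= Num.min t (r / 2) <= r / 2 by rewrite le_min t0 (ltW r2) ge_min lexx orbT.
  have : `|cs - ct| * (cs + ct) = `|Num.min t (r / 2) - Num.min s (r / 2)| * (Num.min t (r / 2) + Num.min s (r / 2)).
    rewrite -[cs + ct]ger0_norm; last by lra.
    rewrite -normrM H subr_sqr normrM [X in _ * X]ger0_norm//; lra.
  move: mm ms mt; set A := `|_ - Num.min s _|; set B := `|s - t|; set C := `|cs - ct|.
  move: (Num.min s _) (Num.min t _) (normr_ge0 _ : 0 <= A) (normr_ge0 _ : 0 <= C) => a b A0 C0 AB /andP[a0 ar] /andP[b0 br] E.
  rewrite -(ler_pM2r r0); nra.
- move=> x xx1; have hx : enorm (p x - p x0) < r / 2 /\ dotrv (x - x0) e < 0 /\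
    dotrv (x - x0) (x - x0) = dotrv (x - x0) e ^+ 2 + enorm (p x - p x0) ^+ 2.
    have P z : dotrv z z = dotrv z e ^+ 2 + enorm (p z) ^+ 2.
      rewrite enorm_sqE /p dotrvDl !dotrvDr !dotrvNl !dotrvNr !dotrvZl !dotrvZr ee (dotrvC e z).
      by ring.
    have pB y z : p y - p z = p (y - z).
      by rewrite /p dotrvDl dotrvNl; apply/rowP => i; rewrite !mxE; ring.
    have pe : p e = 0 by rewrite /p ee scale1r subrr.
    have pZ c z : p (c *: z) = c *: p z by rewrite /p dotrvZl scalerBr scalerA.
    have xE : x - x0 = (x - x1) + (- r *: e) by rewrite -x1e addrA subrK.
    have pE : p x - p x0 = p (x - x1).
      have /eqP := pB x1 x0; rewrite x1e pZ pe scaler0 subr_eq0 => /eqP <-; exact: pB.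
    split.
      rewrite pE; apply: le_lt_trans xx1.
      rewrite -ler_sqr ?nnegrE ?enorm_ge0// [leRHS]enorm_sqE P.
      by rewrite lerDr sqr_ge0.
    split; last by rewrite P pB.
    rewrite xE dotrvDl dotrvZl ee mulr1.
    have := le_trans (ler_norm _) (dotrv_le (x - x1) e); rewrite e1 mulr1 => H.
    by lra.
  move: hx => [h1 [h2 h3]].
  have [h4 h5] := cap_ge (enorm (p x - p x0)) (enorm_ge0 _).
  rewrite (min_idPl _) ?(ltW h1)// in h5.
  have -> : (eball r x <-> dotrv (x - x0) (x - x0) < r ^+ 2).
    exact: (eball_sqE _ (ltW r0)).
  have dE : dotrv (x - x0) e = dotrv x e - dotrv x0 e by rewrite dotrvDl dotrvNl.
  rewrite h3 -/(p x) /g.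
  move: h2 h4 h5 dE; set d := dotrv (x - x0) e; set c := cap _ => h2 h4 h5 dE.
  split => H; nra.
Qed.

(** The distance is taken to the boundary and not to the complement, so a point [y] of the ball
    outside [A] must be traced back to a boundary point: the first exit point of the segment from
    [x0] to [y], which is at distance less than [r]. *)
Lemma dist_boundary_eball (A : set 'rV[R]_n) r : open A -> A x0 ->
  (r%:E <= dist_boundary A x0)%E -> eball r `<=` A.
Proof.
move=> oA Ax0 rA y yr; apply: contrapT => nAy.
pose f (s : R) := x0 + s *: (y - x0).
have cf : continuous f.
  move=> s; apply: cvgD; first exact: cvg_cst.
  by apply: cvgZr_tmp; exact: cvg_id.
pose S := [set s : R | 0 <= s <= 1 /\ forall t, 0 <= t <= s -> A (f t)].
have S0 : S 0.
  split; first by rewrite lexx ler01.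
  by move=> t /le_anti <-; rewrite /f scale0r addr0.
have hS : has_sup S.
  split; first by exists 0.
  by exists 1 => s [/andP[]].
pose s := sup S.
have s0 : 0 <= s by apply: ub_le_sup => //; case: hS.
have s1 : s <= 1 by apply: ge_sup; [exists 0|move=> t [/andP[]]].
have below t : 0 <= t < s -> A (f t).
  move=> /andP[t0 ts]; have [u Su tu] := sup_adherent (eps := s - t) ltac:(by rewrite subr_gt0) hS.
  move: Su => [_ H]; apply: H; rewrite t0/=; move: tu; rewrite -/s; lra.
have nfs : ~ A (f s).
  move=> Afs.
  have /nbhs_ballP[d /= d0 dA] : nbhs s (f @^-1` A).
    by apply: cf; exact: open_nbhs_nbhs.
  have [s1' |s1'] := ltP s 1; last first.
    have sE : s = 1 by lra.
    by apply: nAy; move: Afs; rewrite /f sE scale1r addrC subrK.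
  pose u := Num.min 1 (s + d / 2).
  have us : s < u by rewrite lt_min s1'/= ltrDl divr_gt0.
  have : u <= s.
    apply: ub_le_sup; first by case: hS.
    split; first by rewrite (le_trans s0 (ltW us))/= ge_min lexx.
    move=> t /andP[t0 tu]; have [ts|st] := ltP t s; first by apply: below; rewrite t0.
    apply: dA; rewrite -ball_normE/=.
    have : t <= s + d / 2 by apply: le_trans tu _; rewrite ge_min lexx orbT.
    by rewrite distrC ger0_norm ?subr_ge0//; lra.
  by rewrite leNgt us.
have sp : 0 < s.
  rewrite lt_neqAle s0 andbT; apply/eqP => sE.
  by apply: nfs; rewrite -sE /f scale0r addr0.
have bd : boundary A (f s).
  split; last by move=> /interior_subset.
  move=> B /cf /nbhs_ballP[d /= d0 dB].
  pose t := Num.max 0 (s - d / 2).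
  have ts : t < s by rewrite gt_max sp/= ltrBlDr ltrDl divr_gt0.
  have t0 : 0 <= t by rewrite le_max lexx.
  exists (f t); split; first by apply: below; rewrite t0.
  apply: dB; rewrite -ball_normE/= ger0_norm ?subr_ge0 ?(ltW ts)//.
  have : s - d / 2 <= t by rewrite le_max lexx orbT.
  by lra.
have : (dist_boundary A x0 <= (enorm (x0 - f s))%:E)%E.
  by apply: ereal_inf_lbound; exists (f s).
move=> /(le_trans rA); rewrite lee_fin /f opprD addrA subrr add0r enormN enormZ//.
have := enorm_ge0 (y - x0); move: yr; rewrite /eball/= => h1 h2.
by rewrite leNgt (le_lt_trans _ h1)// ler_piMl.
Qed.

End balls.

(** * Primitives of monotone functions and their averages *)

Section one_variable.
Context {R : realType}.
Implicit Types (f F a : R -> R) (s t : R).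

(* A substitute for [F' = f] that allows jumps of [f]. *)
Definition monotone_primitive f F := forall s t, s <= t ->
  (t - s) * f s <= F t - F s <= (t - s) * f t.

Let mu := (@lebesgue_measure R : {sigma_finite_measure set (measurableTypeR R) -> \bar R}).

Let mu_oc s t : s <= t -> lebesgue_measure (`]s, t]%classic : set (measurableTypeR R)) = (t - s)%:E.
Proof.
move=> st; rewrite lebesgue_measure_itv/= lte_fin.
by case: ltgtP st => // -> _; rewrite subrr.
Qed.

Let icst c s t : mu.-integrable `]s, t] (EFin \o (fun=> c : R)).
Proof.
apply: measurable_bounded_integrable => //.
  by rewrite /mu [ltLHS]lebesgue_measure_itv/=; case: ifP; rewrite ?ltry.
by exists `|c|; split; [exact: num_real|move=> M cM x _; exact: ltW].
Qed.

Let Rcst c s t : s <= t -> \int[mu]_(x in `]s, t]) c = (t - s) * c.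
Proof. by move=> st; rewrite Rintegral_cst// /mu [X in fine X]mu_oc// mulrC. Qed.

Lemma Rintegral_oc_ge f (l : R) s t : s <= t -> mu.-integrable `]s, t] (EFin \o f) ->
  (forall x, s < x <= t -> l <= f x) -> (t - s) * l <= \int[mu]_(x in `]s, t]) f x.
Proof.
move=> st fi lf; rewrite -Rcst//; by apply: le_Rintegral => // x; rewrite /= in_itv/= => /lf.
Qed.

Lemma Rintegral_oc_le f (u : R) s t : s <= t -> mu.-integrable `]s, t] (EFin \o f) ->
  (forall x, s < x <= t -> f x <= u) -> \int[mu]_(x in `]s, t]) f x <= (t - s) * u.
Proof.
move=> st fi lf; rewrite -Rcst//; by apply: le_Rintegral => // x; rewrite /= in_itv/= => /lf.
Qed.

Lemma nondecreasing_primitive f : {homo f : s t / s <= t} ->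
  (forall s, s <= 0 -> f s = 0) ->
  exists2 F, monotone_primitive f F & forall s, s <= 0 -> F s = 0.
Proof.
move=> fnd f0; pose F s := \int[mu]_(x in `]0, s]) f x.
have F0 s : s <= 0 -> F s = 0.
  by move=> s0; rewrite /F set_itv_ge ?Rintegral_set0// bnd_simp -leNgt.
have fi s t : mu.-integrable `]s, t] (EFin \o f).
  have mf : measurable_fun (`]s, t]%classic : set (measurableTypeR R)) f by exact: nondecreasing_measurable.
  apply: measurable_bounded_integrable => //.
    by rewrite /mu [ltLHS]lebesgue_measure_itv/=; case: ifP; rewrite ?ltry.
  exists (`|f s| + `|f t|); split; first exact: num_real.
  move=> M fM x /=; rewrite in_itv/= => /andP[sx xt].
  have H1 := fnd _ _ (ltW sx); have H2 := fnd _ _ xt.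
  have := ler_norm (f t); have := ler_norm (- f s); rewrite normrN.
  by rewrite ler_norml => H3 H4; apply/andP; split; have := normr_ge0 (f s); have := normr_ge0 (f t); lra.
exists F => // s t st.
have [t0|t0] := leP t 0.
  by rewrite !F0 ?(le_trans st)// !f0 ?(le_trans st)// !mulr0 subrr lexx.
have ft : 0 <= f t by rewrite -(f0 0 (lexx _)); apply: fnd; exact: ltW.
have [s0|s0] := leP s 0.
  rewrite (F0 s)// (f0 s)// mulr0 subr0.
  have f0x x : 0 < x <= t -> 0 <= f x by move=> /andP[x0 _]; rewrite -(f0 0 (lexx _)) fnd// ltW.
  have H1 := Rintegral_oc_ge (ltW t0) (fi _ _) f0x.
  have H2 : F t <= (t - 0) * f t.
    by apply: Rintegral_oc_le (ltW t0) (fi _ _) _ => x /andP[x0 xt]; exact: fnd.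
  rewrite mulr0 in H1; rewrite H1/=; apply: (le_trans H2); apply: ler_wpM2r => //; lra.
have -> : F t - F s = \int[mu]_(x in `]s, t]) f x.
  by rewrite /F /mu Rintegral_itvB// bnd_simp ltW.
apply/andP; split.
  by apply: Rintegral_oc_ge => // x /andP[sx xt]; rewrite fnd// ltW.
by apply: Rintegral_oc_le => // x /andP[sx xt]; exact: fnd.
Qed.

Lemma is_derive_monotone_primitive f F s : monotone_primitive f F ->
  {for s, continuous f} -> is_derive s 1 F (f s).
Proof.
move=> fF cf.
have lim : h^-1 *: ((F \o shift s) (h *: (1 : R)) - F s) @[h --> 0^'] --> f s.
  apply/cvgrPdist_le => e e0.
  have /cvgrPdist_le/(_ e e0) := cf; move=> /nbhs_ballP[d /= d0 dH].
  near=> h.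
  have h0 : h != 0 by near: h; exact: nbhs_dnbhs_neq.
  have hr : `|h| < d by near: h; apply: dnbhs0_lt => //.
  have fh : `|f s - f (h + s)| <= e.
    by apply: dH; rewrite -ball_normE/= opprD addrCA subrr addr0 normrN.
  rewrite /= [h *: 1]mulr1 distrC.
  rewrite [_ *: _](_ : _ = h^-1 * (F (h + s) - F s))//.
  move: fh; rewrite ler_norml => /andP[fh1 fh2].
  have [hp|hn] : 0 < h \/ h < 0 by case: (ltgtP 0 h) h0 => // H _; [left|right].
    have /(fF _ _)/andP[H1 H2] : s <= h + s by lra.
    rewrite ler_norml; apply/andP; split.
      by rewrite lerBrDr ler_pdivlMl//; nra.
    by rewrite lerBlDr ler_pdivrMl//; nra.
  have /(fF _ _)/andP[H1 H2] : h + s <= s by lra.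
  rewrite ler_norml; apply/andP; split.
    by rewrite lerBrDr ler_ndivlMl//; nra.
  by rewrite lerBlDr ler_ndivrMl//; nra.
by split; [apply/cvg_ex; exists (f s)|exact: cvg_lim lim].
Unshelve. all: by end_near. Qed.

(** For a primitive [F] of [f] this is the mean of [f] over the interval of length 1/j to the left
    of [s]. It is C^1 when [f] is continuous, and it looks to the left because the speed [a] is only
    left continuous. *)
Definition left_avg (j : R) F s := j * (F s - F (s - j^-1)).

Lemma is_derive_left_avg (j : R) f F s : monotone_primitive f F -> continuous f ->
  is_derive s 1 (left_avg j F) (left_avg j f s).
Proof.
move=> fF cf; have dF t : is_derive t 1 F (f t) by exact: (is_derive_monotone_primitive fF (cf t)).
have dS : is_derive s 1 (fun t : R => t - j^-1) 1.
  by apply: (derive_eq (is_deriveB (is_derive_id _ _) (is_derive_cst _ _ _))); rewrite subr0.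
have dFS := @is_derive1_comp R F (fun t : R => t - j^-1) s _ _ (dF _) dS.
apply: (derive_eq (is_deriveZ j (is_deriveB (dF s) dFS))).
by rewrite mulr1.
Qed.

Lemma left_avg_bounds (j : R) f F s : 0 < j -> monotone_primitive f F ->
  f (s - j^-1) <= left_avg j F s <= f s.
Proof.
move=> j0 fF; have jV : 0 < j^-1 by rewrite invr_gt0.
have /(fF _ _) : s - j^-1 <= s by lra.
rewrite opprB addrC subrK /left_avg => /andP[H1 H2].
by rewrite -ler_pdivrMl// H1 /= mulrC -ler_pdivlMr// mulrC H2.
Qed.

Lemma continuous_left_avg (j : R) f : continuous f -> continuous (left_avg j f).
Proof.
move=> cf; have cS : continuous (fun t : R => t - j^-1).
  by move=> t; apply: cvgB; [exact: cvg_id|exact: cvg_cst].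
have cfS : continuous (fun t : R => f (t - j^-1)).
  by move=> t; apply: (continuous_comp (cS t)); exact: cf.
by move=> s; apply: cvgM; [exact: cvg_cst|apply: cvgB; [exact: cf|exact: cfS]].
Qed.

Lemma monotone_primitive_homo f F : monotone_primitive f F -> (forall s, 0 <= f s) ->
  {homo F : s t / s <= t}.
Proof.
move=> fF f0 s t st; have /andP[H _] := fF _ _ st.
by rewrite -subr_ge0 (le_trans _ H)// mulr_ge0// subr_ge0.
Qed.

Lemma monotone_primitive_lip f F A : monotone_primitive f F -> (forall s, 0 <= f s <= A) ->
  forall s t, s <= t -> 0 <= F t - F s <= A * (t - s).
Proof.
move=> fF fA s t st; have /andP[H1 H2] := fF _ _ st.
have /andP[fs _] := fA s; have /andP[_ ft] := fA t.
apply/andP; split; first by rewrite (le_trans _ H1)// mulr_ge0// subr_ge0.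
by rewrite (le_trans H2)// mulrC ler_wpM2r// subr_ge0.
Qed.

Lemma lip_continuous F A : (forall s t, s <= t -> 0 <= F t - F s <= A * (t - s)) ->
  continuous F.
Proof.
move=> FA s; apply/cvgrPdist_le => e e0; near=> t.
have A1 : 0 < `|A| + 1 by rewrite ltr_wpDl.
have tst : `|s - t| <= e / (`|A| + 1).
  near: t; apply/nbhs_ballP; exists (e / (`|A| + 1)); rewrite /= ?divr_gt0// => t; exact: ltW.
rewrite ler_pdivlMr// in tst; have AA := ler_norm A.
have [st|ts] := leP s t.
  have /andP[H1 H2] := FA _ _ st.
  rewrite distrC ger0_norm//; apply: le_trans H2 (le_trans _ tst).
  rewrite distrC ger0_norm ?subr_ge0//; have := subr_ge0 s t; rewrite st; nra.
have /andP[H1 H2] := FA _ _ (ltW ts).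
rewrite ger0_norm//; apply: le_trans H2 (le_trans _ tst).
rewrite ger0_norm ?subr_ge0 ?(ltW ts)//; have := subr_ge0 t s; rewrite (ltW ts); nra.
Unshelve. all: by end_near. Qed.

Lemma lsc_onE (X : topologicalType) (A : set X) (f : X -> R) x (e : R) : lsc_on A f -> A x -> 0 < e ->
  exists2 V, nbhs x V & forall y, V y -> A y -> f x - e < f y.
Proof.
move=> lf Ax e0; have := lf x (f x - e).
rewrite /= lte_fin ltrBlDr ltrDl => /(_ e0)[V].
move=> /(nbhs_subspace_ex _ Ax)[B xB VB] fV; exists B => // y By Ay.
have : (V `&` A) y by rewrite VB.
by move=> [/fV]; rewrite lte_fin.
Qed.

End one_variable.

(** * The one-dimensional barrier *)

Section calibration_profile.
Context {R : realType}.
Variables (a : R -> R) (q : R).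
Hypotheses (q0 : 0 < q) (a_nd : {homo a : s t / s <= t})
  (a_le0 : forall s, s <= 0 -> a s = 0) (a_gt0 : forall s, 0 < s -> 0 < a s)
  (a_q : forall s, q <= s -> a s = a q).
Let mu := (@lebesgue_measure R : {sigma_finite_measure set (measurableTypeR R) -> \bar R}).
Hypothesis a_int : mu.-integrable `]0, q] (EFin \o (fun s => (a s)^-1)).

Let P s := \int[mu]_(x in `[0, s]) (a x)^-1.

Let a_ge0 s : 0 <= a s.
Proof. by have [/a_le0->//|/a_gt0/ltW] := leP s 0. Qed.

Let V s := (a s)^-1.

Let Vi b : mu.-integrable `[0, b] (EFin \o V).
Proof.
have i1 : mu.-integrable setT ((EFin \o V) \_ `]0, q]).
  by apply/integrable_restrict => //; rewrite setTI.
have i2 : mu.-integrable setT ((EFin \o cst (a q)^-1) \_ `]q, b]).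
  apply/integrable_restrict => //; rewrite setTI.
  apply: measurable_bounded_integrable => //.
    by rewrite /mu [ltLHS]lebesgue_measure_itv/=; case: ifP; rewrite ?ltry.
  by exists `|(a q)^-1|; split; [exact: num_real|move=> M cM x _; exact: ltW].
have i3 : mu.-integrable `[0, b] (((EFin \o V) \_ `]0, q]) \+ ((EFin \o cst (a q)^-1) \_ `]q, b])).
  by apply: integrableS (integrableD measurableT i1 i2).
apply: eq_integrable i3 => // x; rewrite inE/= in_itv/= => /andP[x0 xb].
rewrite /patch !mem_setE !in_itv/= xb andbT.
have [xq|qx] := leP x q; last by rewrite andbF add0e /V (a_q (ltW qx)).
(* At the endpoint 0 the default value [0^-1 = 0] agrees with the restriction to the half-open
   interval. *)
rewrite andbT adde0; case: ltgtP x0 => // <- _.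
by rewrite /V a_le0// invr0.
Qed.

Let V_ge0 s : 0 <= V s. Proof. by rewrite invr_ge0. Qed.

Let P_oc s t : 0 <= s -> s <= t -> P t - P s = \int[mu]_(x in `]s, t]) V x.
Proof. by move=> s0 st; rewrite /P /mu Rintegral_itvB//; exact: Vi. Qed.

Let P0 : P 0 = 0. Proof. by rewrite /P set_itv1 Rintegral_set1. Qed.

Let Voc s t : 0 <= s -> mu.-integrable `]s, t] (EFin \o V).
Proof.
move=> s0; apply: integrableS (Vi t) => // x /=; rewrite !in_itv/= => /andP[sx ->].
by rewrite andbT ltW// (le_lt_trans s0).
Qed.

Let P_ge s t : 0 <= s -> s <= t -> (t - s) * (a t)^-1 <= P t - P s.
Proof.
move=> s0 st; rewrite P_oc//; apply: Rintegral_oc_ge => //; first exact: Voc.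
move=> x /andP[sx xt]; have x0 := le_lt_trans s0 sx.
by rewrite /V lef_pV2 ?posrE ?a_gt0 ?(lt_le_trans x0)//; exact: a_nd.
Qed.

Let P_le s t : 0 < s -> s <= t -> P t - P s <= (t - s) * (a s)^-1.
Proof.
move=> s0 st; rewrite P_oc// ?(ltW s0)//; apply: Rintegral_oc_le => //; first exact/Voc/ltW.
move=> x /andP[sx xt].
have x0 := lt_trans s0 sx.
by rewrite /V lef_pV2 ?posrE ?a_gt0//; apply: a_nd; exact: ltW.
Qed.

Let P_homo s t : 0 <= s -> s <= t -> P s <= P t.
Proof.
move=> s0 st; rewrite -subr_ge0; apply: le_trans (P_ge s0 st).
by rewrite mulr_ge0 ?subr_ge0// V_ge0.
Qed.

Let P_lt s t : 0 <= s -> s < t -> P s < P t.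
Proof.
move=> s0 st; rewrite -subr_gt0; apply: lt_le_trans (P_ge s0 (ltW st)).
by rewrite mulr_gt0 ?subr_gt0// invr_gt0 a_gt0// (le_lt_trans s0).
Qed.

Let P_surj t : exists s, (0 < t -> 0 < s /\ P s = t) /\ (t <= 0 -> s = 0).
Proof.
have [t0|t0] := leP t 0; first by exists 0.
(* Beyond [q] the integrand is the constant [(a q)^-1], so [P] gains exactly [t] between [q] and
   [b]; the intermediate value theorem then reaches [t]. *)
pose b := q + t * a q.
have b0 : 0 <= b by rewrite addr_ge0 ?(ltW q0)// mulr_ge0// ltW.
have qb : q <= b by rewrite lerDl mulr_ge0// ltW.
have Pb : t <= P b.
  have Pq : 0 <= P q by rewrite -P0; apply: P_homo => //; exact: ltW.
  have := P_ge (ltW q0) qb; rewrite (a_q qb) /b addrC addKr mulfK ?gt_eqF ?a_gt0//.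
  by lra.
have cP : {within `[0, b], continuous P} by exact: (parameterized_integral_continuous b0 (Vi b)).
have [|s] := IVT b0 cP (v := t).
  by rewrite P0 ge_min (ltW t0)/= le_max Pb orbT.
rewrite in_itv/= => /andP[s0 sb] Ps; exists s; split => [_|//].
split => //; rewrite lt_neqAle s0 andbT; apply/eqP => sE.
by move: Ps; rewrite -sE P0 => tE; rewrite -tE ltxx in t0.
Qed.

(* [H] is the inverse function of [fun s => \int_0^s 1 / a]. *)
Lemma calibration_profile : exists H : R -> R,
  [/\ monotone_primitive (a \o H) H, forall t, t <= 0 -> H t = 0,
      forall t, 0 < t -> 0 < H t,
      forall t, \int[mu]_(s in `]0, q]) (a s)^-1 < t -> q < H t &
      forall s, 0 <= s <= q -> s <= \int[mu]_(s in `]0, q]) (a s)^-1 * a s].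
Proof.
have TE : \int[mu]_(s in `]0, q]) (a s)^-1 = P q.
  by have := P_oc (lexx 0) (ltW q0); rewrite P0 subr0 => ->.
have [H HP] := choice P_surj.
have H0 t : t <= 0 -> H t = 0 by have [_] := HP t.
have Hp t : 0 < t -> 0 < H t by have [h _] := HP t => /h[].
have PH t : 0 < t -> P (H t) = t by have [h _] := HP t => /h[].
have Hge t : 0 <= H t by have [/H0->//|/Hp/ltW] := leP t 0.
exists H; rewrite TE; split => //.
- move=> s t st /=; have [t0|t0] := leP t 0.
    by rewrite !H0 ?(le_trans st)// a_le0// !mulr0 subrr lexx.
  have [s0|s0] := leP s 0.
    rewrite (H0 s)// subr0 a_le0// mulr0 Hge/=.
    have := P_ge (lexx 0) (Hge t); rewrite P0 PH// !subr0 ler_pdivrMr ?a_gt0 ?Hp// => h.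
    apply: (le_trans h); rewrite ler_wpM2r//; lra.
  have Hst : H s <= H t.
    by rewrite leNgt; apply/negP => /(P_lt (Hge t)); rewrite !PH// ltNge st.
  (* The increment of [P] between [H s] and [H t] is [t - s]; its two bounds, solved for
     [H t - H s], are those of [monotone_primitive]. *)
  have := P_ge (Hge s) Hst; have := P_le (Hp _ s0) Hst.
  by rewrite !PH// ler_pdivlMr ?a_gt0 ?Hp// ler_pdivrMr ?a_gt0 ?Hp// => -> ->.
- move=> t Tt; have t0 : 0 < t.
    by apply: le_lt_trans Tt; rewrite -P0; apply: P_homo => //; exact: ltW.
  by rewrite ltNge; apply/negP => /(P_homo (Hge t)); rewrite PH// leNgt Tt.
- move=> s /andP[s0 sq]; move: s0; rewrite le_eqVlt => /predU1P[<-|s0].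
    by rewrite a_le0// mulr0.
  (* As [1 / a] is nonincreasing on positive arguments, [s / a s <= P s <= P q]. *)
  rewrite -ler_pdivrMr ?a_gt0//; apply: le_trans (P_homo (ltW s0) sq).
  by have := P_ge (lexx 0) (ltW s0); rewrite P0 !subr0.
Qed.

End calibration_profile.

(** * Regularised profiles *)

Section steps.
Context {R : realType}.
Implicit Types (e y t : R).

(* A C^1 ramp: [0] on the left of [0] and [y - e / 2] on the right of [e]. *)
Definition ramp e y := (pos2 y - pos2 (y - e)) / (2 * e).
Definition dramp e y := (Num.max y 0 - Num.max (y - e) 0) / e.

Lemma continuous_dramp e : continuous (dramp e).
Proof.
have ci : continuous (fun y : R => y) by move=> y; exact: cvg_id.
have ce (c : R) : continuous (fun y : R => c) by move=> y; exact: cvg_cst.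
apply: (@continuousMf _ _ _ (fun=> e^-1)) => //; apply: continuousBf.
  exact: continuous_maxr.
by apply: continuous_maxr => //; exact: continuousBf.
Qed.

Lemma is_derive_ramp e y : 0 < e -> is_derive y 1 (ramp e) (dramp e y).
Proof.
move=> e0; have dS : is_derive y 1 (fun t : R => t - e) 1.
  by apply: (derive_eq (is_deriveB (is_derive_id _ _) (is_derive_cst _ _ _))); rewrite subr0.
have d2 := @is_derive1_comp R pos2 (fun t : R => t - e) y _ _ (is_derive_pos2 _) dS.
apply: (derive_eq (is_deriveM (is_deriveB (is_derive_pos2 y) d2) (is_derive_cst (2 * e)^-1 _ _))).
rewrite /dramp /GRing.scale/= mulr0 add0r; field.
by rewrite gt_eqF.
Qed.

Lemma dramp_bounds e y : 0 < e -> 0 <= dramp e y <= 1.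
Proof.
move=> e0; rewrite /dramp ler_pdivrMr// mul1r divr_ge0 ?(ltW e0)//=.
  by case: (leP y 0) => h1; case: (leP (y - e) 0) => h2; lra.
by case: (leP y 0) => h1; case: (leP (y - e) 0) => h2; lra.
Qed.

Lemma dramp_le0 e y : 0 < e -> y <= 0 -> dramp e y = 0.
Proof.
move=> e0 y0; rewrite /dramp !(max_idPr _) ?subrr ?mul0r//; lra.
Qed.

Lemma dramp_ge e y : 0 < e -> e <= y -> dramp e y = 1.
Proof.
move=> e0 ey; rewrite /dramp !(max_idPl _); [|lra|lra].
by rewrite opprB addrC subrK divff// gt_eqF.
Qed.

Lemma ramp_le0 e y : 0 < e -> y <= 0 -> ramp e y = 0.
Proof.
move=> e0 y0; rewrite /ramp /pos2 !(max_idPr _) ?subrr ?mul0r//; lra.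
Qed.

Lemma ramp_ge e y : 0 < e -> e <= y -> ramp e y = y - e / 2.
Proof.
move=> e0 ey; rewrite /ramp /pos2 !(max_idPl _); [|lra|lra].
by field; rewrite gt_eqF.
Qed.

Lemma ramp_bounds e y : 0 < e -> [/\ 0 <= ramp e y, y - e / 2 <= ramp e y & ramp e y <= Num.max y 0].
Proof.
move=> e0; have e2 : 0 < 2 * e by lra.
rewrite /ramp /pos2 !ler_pdivlMr// ler_pdivrMr// mul0r.
by case: (leP y 0) => h1; case: (leP (y - e) 0) => h2; split => //; nra.
Qed.

(* A C^1 step from [0] (on the left of [0]) to [1] (on the right of [1]). *)
Definition step y := 2 * pos2 y - 4 * pos2 (y - 2^-1) + 2 * pos2 (y - 1).
Definition dstep y := 4 * Num.max y 0 - 8 * Num.max (y - 2^-1) 0 + 4 * Num.max (y - 1) 0.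

Lemma continuous_dstep : continuous dstep.
Proof.
have ci : continuous (fun y : R => y) by move=> y; exact: cvg_id.
have ce (c : R) : continuous (fun y : R => c) by move=> y; exact: cvg_cst.
have cm (c b : R) : continuous (fun y : R => c * Num.max (y - b) 0).
  by apply: continuousMf => //; apply: continuous_maxr => //; exact: continuousBf.
apply: continuousDf => //; apply: continuousBf => //.
by apply: continuousMf => //; exact: continuous_maxr.
Qed.

Lemma is_derive_step y : is_derive y 1 step (dstep y).
Proof.
have d2 (c b : R) : is_derive y 1 (fun t : R => c * pos2 (t - b)) (c * (2 * Num.max (y - b) 0)).
  have dS : is_derive y 1 (fun t : R => t - b) 1.
    by apply: (derive_eq (is_deriveB (is_derive_id _ _) (is_derive_cst _ _ _))); rewrite subr0.
  have d := @is_derive1_comp R pos2 (fun t : R => t - b) y _ _ (is_derive_pos2 _) dS.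
  by apply: (derive_eq (is_deriveZ c d)); rewrite mulr1.
have d0 : is_derive y 1 (fun t : R => 2 * pos2 t) (2 * (2 * Num.max y 0)).
  by have := d2 2 0; under eq_fun do rewrite subr0; rewrite subr0.
apply: (derive_eq (is_deriveD (is_deriveB d0 (d2 4 2^-1)) (d2 2 1))).
by rewrite /dstep; ring.
Qed.

Lemma step_le0 y : y <= 0 -> step y = 0 /\ dstep y = 0.
Proof.
by move=> y0; rewrite /step /dstep /pos2 !(max_idPr _) ?expr0n ?mulr0 ?subrr ?addr0//; lra.
Qed.

Lemma step_ge1 y : 1 <= y -> step y = 1 /\ dstep y = 0.
Proof.
by move=> y1; rewrite /step /dstep /pos2 !(max_idPl _); [split; field|lra|lra|lra].
Qed.

Lemma step_bounds y : 0 <= step y <= 1 /\ 0 <= dstep y <= 2.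
Proof.
rewrite /step /dstep /pos2.
by case: (leP y 0) => h1; case: (leP (y - 2^-1) 0) => h2; case: (leP (y - 1) 0) => h3;
  split; apply/andP; split; nra.
Qed.

(** A C^1 version of [Num.max 1 t], exact outside the interval from [1 - e] to [1 + e]. *)
Definition trunc_den e t := 1 + ramp (2 * e) (t - 1 + e).

(* For small [e], [trunc e t] approximates [min 1 (1 / sqrt t)]. *)
Definition trunc e t := (Num.sqrt (trunc_den e t))^-1.
Definition dtrunc e t := - 2^-1 * dramp (2 * e) (t - 1 + e) / (trunc_den e t * Num.sqrt (trunc_den e t)).

Lemma trunc_den_bounds e t : 0 < e -> 1 <= trunc_den e t /\ t <= trunc_den e t.
Proof.
move=> e0; have e2 : 0 < 2 * e by lra.
have [h1 h2 _] := ramp_bounds (t - 1 + e) e2; rewrite /trunc_den; split; lra.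
Qed.

Lemma trunc_den_le e t : 0 < e -> t <= 1 - e -> trunc_den e t = 1 /\ dtrunc e t = 0.
Proof.
move=> e0 te; have e2 : 0 < 2 * e by lra.
by rewrite /dtrunc /trunc_den ramp_le0 ?dramp_le0 ?addr0 ?mulr0 ?mul0r//; lra.
Qed.

Lemma trunc_den_ge e t : 0 < e -> 1 + e <= t ->
  trunc_den e t = t /\ dtrunc e t = - 2^-1 / (t * Num.sqrt t).
Proof.
move=> e0 te; have e2 : 0 < 2 * e by lra.
rewrite /dtrunc /trunc_den ramp_ge ?dramp_ge; [|lra..].
have -> : 1 + (t - 1 + e - 2 * e / 2) = t by field.
by rewrite mulr1.
Qed.

Lemma is_derive_trunc e t : 0 < e -> is_derive t 1 (trunc e) (dtrunc e t).
Proof.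
move=> e0; have e2 : 0 < 2 * e by lra.
have [D1 _] := trunc_den_bounds t e0; have D0 : 0 < trunc_den e t by lra.
have dS : is_derive t 1 (fun y : R => y - 1 + e) 1.
  have -> : (fun y : R => y - 1 + e) = (fun y : R => y + (e - 1)) by apply/funext => y; ring.
  by apply: (derive_eq (is_deriveD (is_derive_id _ _) (is_derive_cst _ _ _))); rewrite addr0.
have dR := @is_derive1_comp R (ramp (2 * e)) (fun y : R => y - 1 + e) t _ _ (is_derive_ramp _ e2) dS.
have dD : is_derive t 1 (trunc_den e) (dramp (2 * e) (t - 1 + e)).
  by apply: (derive_eq (is_deriveD (is_derive_cst _ _ _) dR)); rewrite mulr1 add0r.
have dQ := @is_derive1_comp R Num.sqrt (trunc_den e) t _ _ (is_derive1_sqrt D0) dD.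
have s0 : Num.sqrt (trunc_den e t) != 0 by rewrite gt_eqF// sqrtr_gt0.
have sE : trunc_den e t = Num.sqrt (trunc_den e t) * Num.sqrt (trunc_den e t).
  by rewrite -expr2 sqr_sqrtr// ltW.
have dV := @is_deriveV R (Num.sqrt \o trunc_den e) t _ 1 s0 dQ.
apply: (derive_eq dV).
rewrite /dtrunc /= {3}sE /GRing.scale/=; field.
by rewrite s0.
Qed.

Lemma continuous_dtrunc e : 0 < e -> continuous (dtrunc e).
Proof.
move=> e0 t; have e2 : 0 < 2 * e by lra.
have [D1 _] := trunc_den_bounds t e0; have D0 : 0 < trunc_den e t by lra.
have ci : continuous (fun y : R => y) by move=> y; exact: cvg_id.
have ce (c : R) : continuous (fun y : R => c) by move=> y; exact: cvg_cst.
have cS : continuous (fun y : R => y - 1 + e) by apply: continuousDf => //; exact: continuousBf.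
have cr : continuous (ramp (2 * e)).
  move=> y; apply/differentiable_continuous/derivable1_diffP.
  by have [] := is_derive_ramp y e2.
have cD : continuous (trunc_den e).
  apply: continuousDf => // y; apply: (continuous_comp (cS y)); exact: cr.
have cQ : continuous (fun y => Num.sqrt (trunc_den e y)).
  by move=> y; apply: (continuous_comp (cD y)); exact: sqrt_continuous.
have cd : continuous (fun y => dramp (2 * e) (y - 1 + e)).
  by move=> y; apply: (continuous_comp (cS y)); exact: continuous_dramp.
apply: cvgM; first by apply: cvgM; [exact: cvg_cst|exact: cd].
apply: cvgV; last by apply: cvgM; [exact: cD|exact: cQ].
by rewrite mulf_neq0// gt_eqF// sqrtr_gt0.
Qed.

(** The bounds do not depend on [e]. For [t = |u|^2 / phi^2] they control [|u| trunc / phi] and the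
    two terms, of weights [t] and [t^(3/2)], that the chain rule produces in [dscal]. *)
Lemma trunc_bounds e t : 0 < e -> 0 <= t ->
  [/\ 0 <= trunc e t <= 1, t * trunc e t ^+ 2 <= 1,
      t * `|dtrunc e t| <= 2^-1 & t * Num.sqrt t * `|dtrunc e t| <= 2^-1].
Proof.
move=> e0 t0; have e2 : 0 < 2 * e by lra.
have [D1 Dt] := trunc_den_bounds t e0; have D0 : 0 < trunc_den e t by lra.
have s1 : 1 <= Num.sqrt (trunc_den e t) by rewrite -sqrtr1 ler_wsqrtr.
have st : Num.sqrt t <= Num.sqrt (trunc_den e t) by rewrite ler_wsqrtr.
have st0 := sqrtr_ge0 t.
have /andP[d0 d1] := dramp_bounds (t - 1 + e) e2.
have sE : Num.sqrt (trunc_den e t) ^+ 2 = trunc_den e t by rewrite sqr_sqrtr// ltW.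
have nE : `|dtrunc e t| = 2^-1 * dramp (2 * e) (t - 1 + e) / (trunc_den e t * Num.sqrt (trunc_den e t)).
  rewrite /dtrunc !mulNr normrN ger0_norm//.
  apply: mulr_ge0; first by apply: mulr_ge0 => //; rewrite invr_ge0.
  by rewrite invr_ge0 mulr_ge0 ?(ltW D0)// sqrtr_ge0.
have p0 : 0 < trunc_den e t * Num.sqrt (trunc_den e t) by rewrite mulr_gt0//; lra.
rewrite nE.
set D := trunc_den e t in D1 Dt D0 s1 st sE p0 *; set S := Num.sqrt D in s1 st sE p0 *.
set d := dramp _ _ in d0 d1 *; set r := Num.sqrt t in st st0 *.
split.
- rewrite /trunc invr_ge0 sqrtr_ge0/= invf_le1//; exact: lt_le_trans s1.
- by rewrite /trunc exprVn sqr_sqrtr ?(ltW D0)// ler_pdivrMr// mul1r.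
- rewrite mulrA ler_pdivrMr//; have : t <= D * S by nra.
  nra.
- rewrite mulrA ler_pdivrMr//; have : t * r <= D * S by nra.
  have := mulr_ge0 t0 st0; nra.
Qed.

End steps.

(** * Estimates and limits of the regularised profiles *)

Section profile.
Context {R : realType}.
Variables (a Q H QP HP : R -> R) (A : R).
Hypotheses (a_nd : {homo a : s t / s <= t}) (a_le0 : forall s, s <= 0 -> a s = 0)
  (a_gt0 : forall s, 0 < s -> 0 < a s) (aA : forall s, a s <= A)
  (a_lc : forall s e, 0 < s -> 0 < e -> exists2 d, 0 < d & forall t, s - d < t -> t <= s -> a s - e <= a t)
  (QF : monotone_primitive a Q) (Q_le0 : forall s, s <= 0 -> Q s = 0)
  (HF : monotone_primitive (a \o H) H) (H_le0 : forall s, s <= 0 -> H s = 0)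
  (H_gt0 : forall s, 0 < s -> 0 < H s)
  (QPF : monotone_primitive (Q \o Num.sqrt) QP) (HPF : monotone_primitive H HP).
Implicit Types (j s t y e : R).

(* Positive C^1 approximations of [H], and C^1 approximations of [Q \o sqrt]. *)
Definition phi j y := (j ^+ 2)^-1 + left_avg j HP (y - j^-1).
Definition dphi j y := left_avg j H (y - j^-1).
Definition qreg j := left_avg j QP.
Definition dqreg j := left_avg j (Q \o Num.sqrt).

Let a_ge0 s : 0 <= a s.
Proof. by have [/a_le0->//|/a_gt0/ltW] := leP s 0. Qed.

Let A0 : 0 <= A. Proof. exact: le_trans (a_ge0 0) (aA 0). Qed.

Lemma Q_homo : {homo Q : s t / s <= t}. Proof. exact: monotone_primitive_homo QF a_ge0. Qed.

Lemma Q_ge0 s : 0 <= Q s.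
Proof. by have [/Q_le0->//|/ltW/Q_homo] := leP s 0; rewrite (Q_le0 (lexx 0)). Qed.

Lemma H_homo : {homo H : s t / s <= t}.
Proof. by apply: (monotone_primitive_homo HF) => s; exact: a_ge0. Qed.

Lemma H_ge0 s : 0 <= H s. Proof. by have [/H_le0->//|/H_gt0/ltW] := leP s 0. Qed.

Lemma H_lip s t : s <= t -> H t - H s <= A * (t - s).
Proof.
move=> st; have aHA u : 0 <= (a \o H) u <= A by rewrite /= a_ge0 aA.
by have /andP[] := monotone_primitive_lip HF aHA st.
Qed.

Lemma continuous_H : continuous H.
Proof.
apply: (@lip_continuous _ H A); apply: (monotone_primitive_lip HF) => s.
by rewrite /= a_ge0 aA.
Qed.

Lemma continuous_Q : continuous Q.
Proof.
apply: (@lip_continuous _ Q A); apply: (monotone_primitive_lip QF) => s.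
by rewrite a_ge0 aA.
Qed.

Lemma continuous_Qsqrt : continuous (Q \o Num.sqrt).
Proof. by move=> s; apply: continuous_comp; [exact: sqrt_continuous|exact: continuous_Q]. Qed.

Lemma is_derive_phi j y : is_derive y 1 (phi j) (dphi j y).
Proof.
have dS : is_derive y 1 (fun t : R => t - j^-1) 1.
  by apply: (derive_eq (is_deriveB (is_derive_id _ _) (is_derive_cst _ _ _))); rewrite subr0.
have dH := @is_derive_left_avg R j H HP (y - j^-1) HPF continuous_H.
have dc := @is_derive1_comp R (left_avg j HP) (fun t : R => t - j^-1) y _ _ dH dS.
by apply: (derive_eq (is_deriveD (is_derive_cst _ _ _) dc)); rewrite mulr1 add0r.
Qed.

Lemma continuous_dphi j : continuous (dphi j).
Proof.
have cS : continuous (fun t : R => t - j^-1).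
  by move=> t; apply: cvgB; [exact: cvg_id|exact: cvg_cst].
by move=> y; apply: (continuous_comp (cS y)); apply: continuous_left_avg; exact: continuous_H.
Qed.

Lemma is_derive_qreg j t : is_derive t 1 (qreg j) (dqreg j t).
Proof. exact: is_derive_left_avg QPF continuous_Qsqrt. Qed.

Lemma continuous_dqreg j : continuous (dqreg j).
Proof. by apply: continuous_left_avg; exact: continuous_Qsqrt. Qed.

Lemma phi_bounds j y : 0 < j -> H (y - 2 / j) <= phi j y - (j ^+ 2)^-1 <= H (y - j^-1).
Proof.
move=> j0; have := @left_avg_bounds _ j H HP (y - j^-1) j0 HPF.
rewrite (_ : y - j^-1 - j^-1 = y - 2 / j); last by ring.
by rewrite (_ : phi j y - (j ^+ 2)^-1 = left_avg j HP (y - j^-1))// /phi; ring.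
Qed.

Lemma phi_ge j y : 0 < j -> (j ^+ 2)^-1 <= phi j y.
Proof.
by move=> j0; have /andP[h _] := phi_bounds y j0; rewrite -subr_ge0 (le_trans _ h)// H_ge0.
Qed.

Lemma phi_gt0 j y : 0 < j -> 0 < phi j y.
Proof. by move=> j0; apply: lt_le_trans (phi_ge y j0); rewrite invr_gt0 exprn_gt0. Qed.

Lemma dphi_bounds j y : 0 < j -> a (H (y - 2 / j)) <= dphi j y <= a (H (y - j^-1)).
Proof.
move=> j0; have := @left_avg_bounds _ j _ H (y - j^-1) j0 HF.
by rewrite /= (_ : y - j^-1 - j^-1 = y - 2 / j)//; ring.
Qed.

Lemma dphi_ge0 j y : 0 < j -> 0 <= dphi j y <= A.
Proof.
move=> j0; have /andP[h1 h2] := dphi_bounds y j0.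
by rewrite (le_trans (a_ge0 _) h1) (le_trans h2).
Qed.

(** Effect of the shift by 1/j in [phi]: the barrier starts to rise only where [step (j * y)] has
    already reached 1, so the two transitions do not interact. *)
Lemma phi_le j y : 0 < j -> y <= j^-1 -> phi j y = (j ^+ 2)^-1 /\ dphi j y = 0.
Proof.
move=> j0 yj; have jV : 0 < j^-1 by rewrite invr_gt0.
have /andP[h1 h2] := phi_bounds y j0; have /andP[h3 h4] := dphi_bounds y j0.
rewrite (H_le0 (s := y - j^-1)) in h2 h4; last by lra.
rewrite (a_le0 (lexx 0)) in h4.
have := H_ge0 (y - 2 / j); have := a_ge0 (H (y - 2 / j)).
by split; lra.
Qed.

Lemma qreg_bounds j t : 0 < j -> Q (Num.sqrt (t - j^-1)) <= qreg j t <= Q (Num.sqrt t).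
Proof. by move=> j0; exact: left_avg_bounds QPF. Qed.

Lemma qreg_homo j : 0 < j -> {homo qreg j : s t / s <= t}.
Proof.
move=> j0 s t st; rewrite /qreg /left_avg ler_pM2l//.
have jV : 0 < j^-1 by rewrite invr_gt0.
have fh u v : u <= v -> (Q \o Num.sqrt) u <= (Q \o Num.sqrt) v.
  by move=> uv; apply: Q_homo; exact: ler_wsqrtr.
(* Either the averaging intervals are disjoint and the means compare directly, or the overlap
   cancels and the increments over [[s, t]] and over its translate by [- j^-1] are compared. *)
have [sd|ds] := leP s (t - j^-1).
  have /andP[_ h1] := QPF (s := s - j^-1) (t := s) ltac:(lra).
  have /andP[h2 _] := QPF (s := t - j^-1) (t := t) ltac:(lra).
  have := fh _ _ sd; nra.
have /andP[h1 _] := QPF st.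
have /andP[_ h2] := QPF (s := s - j^-1) (t := t - j^-1) ltac:(lra).
have := fh _ _ (ltW ds); nra.
Qed.

Lemma dqreg_ge0 j t : 0 < j -> 0 <= dqreg j t.
Proof.
move=> j0; rewrite /dqreg /left_avg mulr_ge0 ?(ltW j0)// subr_ge0.
by apply/Q_homo/ler_wsqrtr; rewrite gerBl invr_ge0 ltW.
Qed.

Lemma sqrt_lower j s : 0 < j -> 0 < s -> j^-1 <= s ^+ 2 ->
  s - (j * s)^-1 <= Num.sqrt (s ^+ 2 - j^-1).
Proof.
move=> j0 s0 js; have js0 : 0 < j * s by rewrite mulr_gt0.
have E : (j * s)^-1 * s = j^-1 by field; rewrite !gt_eqF.
have V0 : 0 < (j * s)^-1 by rewrite invr_gt0.
have Vs : (j * s)^-1 <= s.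
  by rewrite -(ler_pM2r s0) E -expr2.
have r0 : 0 <= s - (j * s)^-1 by lra.
rewrite -[leLHS](ger0_norm r0) -sqrtr_sqr ler_wsqrtr//; nra.
Qed.

(** With r the root of [s ^+ 2 - j^-1], one has [j (s - r) (s + r) = 1]; so the product is the
    difference quotient of [Q] between r and [s], a mean of [a]. *)
Let dq_sum j s : 0 < j -> 0 < s -> j^-1 <= s ^+ 2 ->
  a (Num.sqrt (s ^+ 2 - j^-1)) <= dqreg j (s ^+ 2) * (s + Num.sqrt (s ^+ 2 - j^-1)) <= a s.
Proof.
move=> j0 s0 js; rewrite /dqreg /left_avg /= sqrtr_sqr (ger0_norm (ltW s0)).
have rE : Num.sqrt (s ^+ 2 - j^-1) ^+ 2 = s ^+ 2 - j^-1 by rewrite sqr_sqrtr// subr_ge0.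
have r0 := sqrtr_ge0 (s ^+ 2 - j^-1).
set r := Num.sqrt _ in rE r0 *.
have rs : r <= s.
  rewrite -ler_sqr ?nnegrE ?(ltW s0)// rE gerBl invr_ge0; exact: ltW.
have E : j * (s - r) * (s + r) = 1.
  rewrite -mulrA -subr_sqr rE opprB addrC subrK mulfV//; exact: lt0r_neq0.
have /andP[h1 h2] := QF rs.
have sr : 0 < s + r by lra.
have {}h1 : j * (s + r) * ((s - r) * a r) <= j * (s + r) * (Q s - Q r) by rewrite ler_wpM2l// mulr_ge0// ltW.
have {}h2 : j * (s + r) * (Q s - Q r) <= j * (s + r) * ((s - r) * a s) by rewrite ler_wpM2l// mulr_ge0// ltW.
have E1 c : j * (s + r) * ((s - r) * c) = c by rewrite -[RHS]mul1r -E; ring.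
rewrite !E1 in h1 h2.
have -> : j * (Q s - Q r) * (s + r) = j * (s + r) * (Q s - Q r) by ring.
by rewrite h1 h2.
Qed.

Lemma dqreg_le j s : 0 < j -> 0 <= s -> s * dqreg j (s ^+ 2) <= a s.
Proof.
move=> j0; rewrite le_eqVlt => /predU1P[<-|s0]; first by rewrite mul0r.
have d0 := dqreg_ge0 (s ^+ 2) j0.
have [js|js] := leP j^-1 (s ^+ 2).
  have /andP[_ h] := dq_sum j0 s0 js; apply: le_trans h.
  by have := sqrtr_ge0 (s ^+ 2 - j^-1); nra.
(* Here [s ^+ 2 - j^-1] is negative and its root is 0 by default, so the average is [j * Q s]. *)
rewrite /dqreg /left_avg /= sqrtr_sqr (ger0_norm (ltW s0)).
rewrite ler0_sqrtr; last by lra.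
rewrite (Q_le0 (lexx 0)) subr0.
have /andP[_ h] := QF (ltW s0); rewrite (Q_le0 (lexx 0)) !subr0 in h.
have h2 : j * s ^+ 2 <= 1 by rewrite -ler_pdivlMl// mulr1 ltW.
have as0 := a_ge0 s.
have : s * (j * Q s) <= s * (j * (s * a s)) by rewrite !ler_wpM2l// ltW.
have -> : s * (j * (s * a s)) = j * s ^+ 2 * a s by ring.
by move=> /le_trans; apply; nra.
Qed.

Lemma dqreg_lower j s : 0 < j -> 0 < s -> j^-1 <= s ^+ 2 ->
  a (Num.sqrt (s ^+ 2 - j^-1)) <= 2 * s * dqreg j (s ^+ 2).
Proof.
move=> j0 s0 js; have /andP[h _] := dq_sum j0 s0 js; apply: le_trans h _.
have rs : Num.sqrt (s ^+ 2 - j^-1) <= s.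
  rewrite -[leRHS](ger0_norm (ltW s0)) -sqrtr_sqr ler_wsqrtr// gerBl invr_ge0; exact: ltW.
by have := dqreg_ge0 (s ^+ 2) j0; nra.
Qed.

Lemma dqreg_upper j s : 0 < j -> 0 < s -> j^-1 <= s ^+ 2 ->
  2 * s * dqreg j (s ^+ 2) <= a s + a s / (j * s ^+ 2).
Proof.
move=> j0 s0 js; have /andP[_ h] := dq_sum j0 s0 js.
have h1 := dqreg_le j0 (ltW s0); have h2 := sqrt_lower j0 s0 js.
have d0 := dqreg_ge0 (s ^+ 2) j0.
set r := Num.sqrt _ in h h2.
have js0 : 0 < j * s by rewrite mulr_gt0.
have V0 : 0 < (j * s)^-1 by rewrite invr_gt0.
have E : a s / (j * s ^+ 2) = (j * s)^-1 * (a s / s) by field; rewrite !gt_eqF.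
have h3 : dqreg j (s ^+ 2) <= a s / s by rewrite ler_pdivlMr// mulrC.
have h4 : dqreg j (s ^+ 2) * (s - r) <= (j * s)^-1 * (a s / s).
  apply: (@le_trans _ _ (dqreg j (s ^+ 2) * (j * s)^-1)); first by rewrite ler_wpM2l//; lra.
  by rewrite mulrC ler_wpM2l// ltW.
rewrite E; apply: le_trans (lerD h h4); rewrite le_eqVlt; apply/orP; left; apply/eqP; ring.
Qed.

Lemma eventually_inv e : 0 < e -> exists2 J, 1 <= J & forall j, J <= j -> j^-1 <= e.
Proof.
move=> e0; exists (Num.max 1 e^-1); first by rewrite le_max lexx.
move=> j; rewrite ge_max => /andP[j1 ej].
by rewrite -[e]invrK lef_pV2// posrE ?invr_gt0//; lra.
Qed.

Lemma inv_sq_le j : 1 <= j -> (j ^+ 2)^-1 <= j^-1.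
Proof. by move=> j1; rewrite lef_pV2 ?posrE ?exprn_gt0//; nra. Qed.

(** The quantity is the derivative in [s] of [qreg j (s ^+ 2)], hence close to the derivative [a] of
    [Q]. The mean runs over an interval ending at [s], so left continuity of [a] is enough. *)
Lemma dqreg_cvg s e : 0 < s -> 0 < e -> exists2 J, 1 <= J &
  forall j, J <= j -> a s - e <= 2 * s * dqreg j (s ^+ 2) <= a s + e.
Proof.
move=> s0 e0; have [d d0 ad] := a_lc s0 e0.
have s20 : 0 < s ^+ 2 by rewrite exprn_gt0.
have as0 : 0 < a s by exact: a_gt0.
have [J1 J11 HJ1] := eventually_inv s20.
have [J2 J21 HJ2] := @eventually_inv (d * s / 2) ltac:(by rewrite divr_gt0 ?mulr_gt0).
have [J3 J31 HJ3] := @eventually_inv (e * s ^+ 2 / a s) ltac:(by rewrite divr_gt0 ?mulr_gt0).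
exists (Num.max J1 (Num.max J2 J3)); first by rewrite le_max J11.
move=> j; rewrite !ge_max => /and3P[/[dup] jJ /HJ1 j1 /HJ2 j2 /HJ3 j3].
have j0 : 0 < j by lra.
have jV : 0 < j^-1 by rewrite invr_gt0.
apply/andP; split.
  apply: le_trans (dqreg_lower j0 s0 j1); apply: ad.
    apply: lt_le_trans (sqrt_lower j0 s0 j1).
    rewrite ltrD2l ltrN2 invfM ltr_pdivrMr//; apply: le_lt_trans j2 _; nra.
  rewrite -[leRHS](ger0_norm (ltW s0)) -sqrtr_sqr ler_wsqrtr//; lra.
apply: le_trans (dqreg_upper j0 s0 j1) _; rewrite lerD2l.
rewrite invfM mulrA ler_pdivrMr// -ler_pdivlMl// mulrC.
exact: j3.
Qed.

(** The margin [al / j] is the point: the shift lowers the barrier by at least [2 al / j], of which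
    the added [j ^- 2] takes back at most half. It places every [|u| >= H y] beyond the transition
    of [trunc], whose width is of order [j ^- 2]. *)
Lemma phi_cvg y : 0 < y -> exists2 al, 0 < al & exists2 J, 1 <= J &
  forall j, J <= j -> H y - 2 * A / j <= phi j y <= H y - al / j.
Proof.
move=> y0; exists (a (H (y / 2)) / 2); first by rewrite divr_gt0// a_gt0// H_gt0// divr_gt0.
set al := a (H (y / 2)) / 2; have al0 : 0 < al by rewrite divr_gt0// a_gt0// H_gt0// divr_gt0.
have [J1 J11 HJ1] := @eventually_inv (y / 2) ltac:(by rewrite divr_gt0).
have [J2 J21 HJ2] := eventually_inv al0.
exists (Num.max J1 J2); first by rewrite le_max J11.
move=> j; rewrite ge_max => /andP[/[dup] jJ /HJ1 j1 /HJ2 j2].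
have j0 : 0 < j by lra.
have jV : 0 < j^-1 by rewrite invr_gt0.
have /andP[h1 h2] := phi_bounds y j0.
have h3 : H y - H (y - 2 / j) <= A * (2 / j).
  have := @H_lip (y - 2 / j) y; rewrite (_ : y - (y - 2 / j) = 2 / j); last by ring.
  by apply; lra.
have /andP[h4 _] := HF (s := y - j^-1) (t := y) ltac:(lra).
rewrite /= opprB addrC subrK in h4.
have h5 : a (H (y / 2)) <= a (H (y - j^-1)) by apply/a_nd/H_homo; lra.
have h6 : (j ^+ 2)^-1 <= al / j by rewrite expr2 invfM ler_wpM2r// ltW.
have h7 : 0 <= (j ^+ 2)^-1 by rewrite invr_ge0 sqr_ge0.
have h8 : al / j = j^-1 * a (H (y / 2)) / 2 by rewrite /al; ring.
have h9 : j^-1 * a (H (y / 2)) <= j^-1 * a (H (y - j^-1)) by rewrite ler_wpM2l// ltW.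
have h10 : A * (2 / j) = 2 * A / j by ring.
apply/andP; split; lra.
Qed.

Lemma dphi_cvg y e : 0 < y -> 0 < e -> exists2 J, 1 <= J &
  forall j, J <= j -> a (H y) - e <= dphi j y <= a (H y).
Proof.
move=> y0 e0; have [d d0 ad] := a_lc (H_gt0 y0) e0; have A0' := A0.
have [J1 J11 HJ1] := @eventually_inv (d / (2 * A + 1)) ltac:(by rewrite divr_gt0//; lra).
exists J1 => // j jJ; have j0 : 0 < j by lra.
have jV : 0 < j^-1 by rewrite invr_gt0.
have /andP[h1 h2] := dphi_bounds y j0.
apply/andP; split; last by apply: le_trans h2 _; apply/a_nd/H_homo; lra.
apply: le_trans h1; apply: ad; last by apply/H_homo; lra.
have h3 : H y - H (y - 2 / j) <= A * (2 / j).
  have := @H_lip (y - 2 / j) y; rewrite (_ : y - (y - 2 / j) = 2 / j); last by ring.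
  by apply; lra.
have := HJ1 _ jJ; rewrite ler_pdivlMr; last by lra.
by nra.
Qed.

Lemma dqreg_phi_cvg y e : 0 < y -> 0 < e -> exists2 J, 1 <= J &
  forall j, J <= j -> a (H y) - e <= 2 * phi j y * dqreg j (phi j y ^+ 2).
Proof.
move=> y0 e0; have s0 := H_gt0 y0; set s := H y in s0 *.
have [d d0 ad] := a_lc s0 e0; have A0' := A0.
have [al al0 [J1 J11 HJ1]] := phi_cvg y0.
have A1 : 0 < 2 * A + 1 by lra.
have [J2 J21 HJ2] := @eventually_inv (s / 2 / (2 * A + 1)) ltac:(by rewrite !divr_gt0).
have [J3 J31 HJ3] := @eventually_inv ((s / 2) ^+ 2) ltac:(by rewrite exprn_gt0// divr_gt0).
have [J4 J41 HJ4] := @eventually_inv (d / 2 / (2 * A + 1)) ltac:(by rewrite !divr_gt0).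
have [J5 J51 HJ5] := @eventually_inv (d * s / 8) ltac:(by rewrite !divr_gt0 ?mulr_gt0).
exists (Num.max J1 (Num.max J2 (Num.max J3 (Num.max J4 J5)))); first by rewrite le_max J11.
move=> j; rewrite !ge_max => /and5P[/[dup] jJ /HJ1 /andP[p1 p2] /HJ2 j2 /HJ3 j3 /HJ4 j4 /HJ5 j5].
have j0 : 0 < j by lra.
have jV : 0 < j^-1 by rewrite invr_gt0.
rewrite ler_pdivlMr// in j2; rewrite ler_pdivlMr// in j4.
rewrite -/s in p1 p2.
set p := phi j y in p1 p2 *.
have alj : 0 < al / j by rewrite divr_gt0.
have ps : s / 2 <= p by nra.
have p0 : 0 < p by lra.
have jp : j^-1 <= p ^+ 2 by apply: le_trans j3 _; nra.
apply: le_trans (dqreg_lower j0 p0 jp); apply: ad.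
  apply: lt_le_trans (sqrt_lower j0 p0 jp).
  have : (j * p)^-1 <= d / 4.
    by rewrite invfM ler_pdivrMr//; nra.
  nra.
apply: (@le_trans _ _ p); last by lra.
rewrite -[leRHS](ger0_norm (ltW p0)) -sqrtr_sqr ler_wsqrtr//; lra.
Qed.

(* Where [u] stays below the barrier, the competitor is [u] itself. *)
Lemma inactive (r r1 : R) : 0 <= r -> r < r1 -> exists2 J, 1 <= J &
  forall j p s, J <= j -> r1 <= p -> 0 <= s <= r ->
    s ^+ 2 / p ^+ 2 <= 1 - (j ^+ 2)^-1 /\ qreg j (s ^+ 2) - qreg j (p ^+ 2) + (j ^+ 2)^-1 <= 0.
Proof.
move=> r0 rr1; have r10 : 0 < r1 by lra.
(* The gap between [r2] and [r1] absorbs the lag [j^-1] under the root in [qreg]; the gap between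
   [r3] and [r2], where [a] is at least [a r3], yields a strict increase of [Q] that absorbs the
   offset [j ^- 2]. *)
pose r2 := (r + r1) / 2; pose r3 := (r + r2) / 2.
have h23 : 0 < r3 /\ r < r3 /\ r3 < r2 /\ r2 < r1 by rewrite /r3 /r2; lra.
have [r30 [rr3 [r32 r21]]] := h23.
have c1 : 0 < 1 - r ^+ 2 / r1 ^+ 2.
  by rewrite subr_gt0 ltr_pdivrMr ?exprn_gt0// mul1r ltr_sqr ?nnegrE// ltW.
have c2 : 0 < (r2 - r3) * a r3 by rewrite mulr_gt0 ?a_gt0//; lra.
have c3 : 0 < r1 ^+ 2 - r2 ^+ 2 by nra.
have [J1 J11 HJ1] := eventually_inv c1.
have [J2 J21 HJ2] := eventually_inv c2.
have [J3 J31 HJ3] := eventually_inv c3.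
exists (Num.max J1 (Num.max J2 J3)); first by rewrite le_max J11.
move=> j p s; rewrite !ge_max => /and3P[/[dup] jJ /HJ1 j1 /HJ2 j2 /HJ3 j3] r1p /andP[s0 sr].
have j1' : 1 <= j by lra.
have j0 : 0 < j by lra.
have sq := inv_sq_le j1'; have p0 : 0 < p by lra.
split.
  have : s ^+ 2 / p ^+ 2 <= r ^+ 2 / r1 ^+ 2.
    by apply: ler_pM; rewrite ?sqr_ge0 ?invr_ge0 ?sqr_ge0// ?lef_pV2 ?posrE ?exprn_gt0// ler_sqr ?nnegrE// ltW.
  lra.
have /andP[_ h1] := qreg_bounds (s ^+ 2) j0; rewrite sqrtr_sqr (ger0_norm s0) in h1.
have /andP[h2 _] := qreg_bounds (p ^+ 2) j0.
have h3 : Q r2 <= Q (Num.sqrt (p ^+ 2 - j^-1)).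
  apply: Q_homo; have r20 : 0 <= r2 by lra.
  rewrite -[leLHS](ger0_norm r20) -sqrtr_sqr ler_wsqrtr//; nra.
have h4 : Q s <= Q r3 by apply: Q_homo; lra.
have /andP[h5 _] := QF (ltW r32).
lra.
Qed.

End profile.

(** The arithmetic of [gain_above]. Here [s], [h], [p] are the speeds at |u|, at H(psi) and at phi;
    [l], [b], [K] approximate [s], [h], [h] within [e1], each on the sides required; [gg] is |grad
    |u||^2, [T1] the tangential part of the competitor and [x] the product of X with grad |u|.
    Without errors the bound is [(1 - X2) (s^2 - h^2) / 2]. *)
Lemma above_arith {R : realFieldType} (s h p A e1 e l b K X2 gg E2 T1 x Wu Wc df : R) :
  h <= s -> 0 <= h -> s <= A -> 0 <= e1 -> e1 <= 1 -> e1 <= h / 2 -> e1 * (3 * A + 1) <= e ->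
  0 <= l -> l <= s + e1 -> h - e1 <= b -> h - e1 <= K -> K <= h -> 0 <= X2 -> X2 <= 1 ->
  T1 <= E2 - gg -> l * x <= (gg + l ^+ 2 * X2) / 2 -> p ^+ 2 <= h ^+ 2 ->
  (s ^+ 2 - p ^+ 2) / 2 <= Wu - Wc -> df <= 0 ->
  - e <= 2^-1 * E2 + Wu - (2^-1 * (T1 + K ^+ 2 * X2) + Wc) - (l * x - b * K * X2) - df.
Proof.
move=> hs h0 sA e10 e11 e12 e1A l0 l2 b1 K1 K2 X0 X1 h1 h2 ph Wd df0.
have h3 : l ^+ 2 <= s ^+ 2 + e1 * (2 * A + 1).
  have : l ^+ 2 <= (s + e1) ^+ 2 by rewrite ler_sqr ?nnegrE; lra.
  have : e1 * s <= e1 * A by rewrite ler_wpM2l.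
  have : e1 * e1 <= e1 * 1 by rewrite ler_wpM2l.
  by rewrite sqrrD !expr2; lra.
have h4 : h ^+ 2 - 3 * e1 * A <= 2 * b * K - K ^+ 2.
  have k1 : (h - e1) * (h - 2 * e1) <= K * (2 * b - K) by apply: ler_pM; lra.
  have : e1 * h <= e1 * A by rewrite ler_wpM2l//; lra.
  have := sqr_ge0 e1; rewrite !expr2 in k1 *; lra.
have h5 : l ^+ 2 * X2 <= (s ^+ 2 + e1 * (2 * A + 1)) * X2 by rewrite ler_wpM2r.
have h6 : (h ^+ 2 - 3 * e1 * A) * X2 <= (2 * b * K - K ^+ 2) * X2 by rewrite ler_wpM2r.
have h7 : (1 - X2) * (h ^+ 2) <= (1 - X2) * s ^+ 2.
  by rewrite ler_wpM2l ?subr_ge0// ler_sqr ?nnegrE//; lra.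
have h8 : e1 * (5 * A + 1) * X2 <= e1 * (5 * A + 1) by rewrite ler_piMr// mulr_ge0//; lra.
have h9 : 0 <= e1 * A by rewrite mulr_ge0//; lra.
lra.
Qed.

(** * Pointwise lower bounds for the gain *)

Section pointwise.
Context {R : realType} (n m : nat).
Variables (a Q H QP HP : R -> R) (A : R).
Hypotheses (a_nd : {homo a : s t / s <= t}) (a_le0 : forall s, s <= 0 -> a s = 0)
  (a_gt0 : forall s, 0 < s -> 0 < a s) (aA : forall s, a s <= A)
  (a_lc : forall s e, 0 < s -> 0 < e -> exists2 d, 0 < d & forall t, s - d < t -> t <= s -> a s - e <= a t)
  (QF : monotone_primitive a Q) (Q_le0 : forall s, s <= 0 -> Q s = 0)
  (HF : monotone_primitive (a \o H) H) (H_le0 : forall s, s <= 0 -> H s = 0)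
  (H_gt0 : forall s, 0 < s -> 0 < H s)
  (QPF : monotone_primitive (Q \o Num.sqrt) QP) (HPF : monotone_primitive H HP).
Variables (W : 'rV[R]_m -> R) (q M : R).
Hypotheses (q0 : 0 <= q) (W0 : W 0 = 0) (W_bounds : forall z, enorm z <= q -> 0 <= W z <= M)
  (W_drop : forall z c, enorm z <= q -> 0 <= c <= 1 ->
    (a (enorm z) ^+ 2 - a (c * enorm z) ^+ 2) / 2 <= W z - W (c *: z)).
Implicit Types (j s t y e d : R) (u : 'rV[R]_m) (G : 'M[R]_(m, n)) (X : 'rV[R]_n).

Notation phi := (phi HP).
Notation dphi := (dphi H).
Notation qreg := (qreg QP).
Notation dqreg := (dqreg Q).

(* [scal j y (|u|^2)] is a C^1 version of [min 1 (H y / |u|)], so that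
   [scal *: u] is the radial truncation of [u] at the height [H y]; it vanishes
   where [y <= 0]. *)
Definition scal j y s2 := step (j * y) * trunc (j ^+ 2)^-1 (s2 / phi j y ^+ 2).

(** The gradient of [scal] along [u] and [psi], by the chain rule, when [G] is the gradient of [u]
    and [X] that of [psi]: the first term differentiates [step], the second differentiates [trunc]
    through |u|^2 and through [phi]. *)
Definition dscal j y u G X : 'rV[R]_n :=
  (dstep (j * y) * j * trunc (j ^+ 2)^-1 (dotrv u u / phi j y ^+ 2)) *: X +
  (step (j * y) * dtrunc (j ^+ 2)^-1 (dotrv u u / phi j y ^+ 2)) *:
    ((2 / phi j y ^+ 2) *: (u *m G) - (2 * dotrv u u * dphi j y / phi j y ^+ 3) *: X).

Definition gradcomp j y u G X : 'M[R]_(m, n) :=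
  scal j y (dotrv u u) *: G + u^T *m dscal j y u G X.

(* [flux j y (|u|^2)] is a C^1 version of the positive part of [Q |u| - Q (H y)]. *)
Definition flux_arg j y s2 := qreg j s2 - qreg j (phi j y ^+ 2) + (j ^+ 2)^-1.

Definition flux j y s2 := ramp (j ^+ 2)^-1 (flux_arg j y s2).

Definition dflux j y u G X : 'rV[R]_n := dramp (j ^+ 2)^-1 (flux_arg j y (dotrv u u)) *:
  ((2 * dqreg j (dotrv u u)) *: (u *m G) -
   (2 * phi j y * dqreg j (phi j y ^+ 2) * dphi j y) *: X).

(* With [y = psi x], [X = grad psi] and [d = div X], this is the energy density of
   [u] minus that of the competitor minus the divergence of [flux *: X]. *)
Definition gain j y u G X d :=
  2^-1 * enorm G ^+ 2 + W u -
  (2^-1 * enorm (gradcomp j y u G X) ^+ 2 + W (scal j y (dotrv u u) *: u)) -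
  dotrv X (dflux j y u G X) - d * flux j y (dotrv u u).

Lemma enorm0 k l : enorm (0 : 'M[R]_(k, l)) = 0.
Proof.
by rewrite /enorm big1 ?sqrtr0// => i _; rewrite big1// => i' _; rewrite mxE expr0n.
Qed.

Lemma row_mulmx_le u G l : `|(u *m G) ord0 l| <= enorm u * enorm G.
Proof.
rewrite -ler_sqr ?nnegrE ?mulr_ge0 ?enorm_ge0// -normrX ger0_norm ?sqr_ge0//.
rewrite exprMn enorm_sqE enorm_sq.
have -> : (u *m G) ord0 l = dotrv u (\row_i G i l).
  by rewrite mxE; apply: eq_bigr => i _; rewrite mxE.
apply: le_trans (cauchy_schwarz _ _) _; apply: ler_wpM2l; first exact: dotrv_ge0.
apply: ler_sum => i _; rewrite mxE -expr2 (bigD1 l)//= lerDl.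
by apply: sumr_ge0 => k _; exact: sqr_ge0.
Qed.

Lemma mulmx_norm_le u G : dotrv (u *m G) (u *m G) <= dotrv u u * enorm G ^+ 2.
Proof.
rewrite enorm_sq exchange_big/= mulr_sumr; apply: ler_sum => l _.
have -> : (u *m G) ord0 l = dotrv u (\row_i G i l).
  by rewrite mxE; apply: eq_bigr => i _; rewrite mxE.
rewrite -expr2; apply: le_trans (cauchy_schwarz _ _) _.
rewrite le_eqVlt; apply/orP; left; apply/eqP; congr (_ * _).
by apply: eq_bigr => i _; rewrite mxE expr2.
Qed.

Let Q0 := Q_ge0 a_le0 a_gt0 QF Q_le0.
Let dqge0 := @dqreg_ge0 R a Q a_le0 a_gt0 QF.

Lemma scal_bounds j y s : 0 < j -> 0 <= scal j y (s ^+ 2) <= 1.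
Proof.
move=> j0; have /andP[s1 s2] := (step_bounds (j * y)).1.
have k0 : 0 < (j ^+ 2)^-1 by rewrite invr_gt0 exprn_gt0.
have t0 : 0 <= s ^+ 2 / phi j y ^+ 2 by rewrite divr_ge0 ?sqr_ge0.
have [/andP[t1 t2] _ _ _] := trunc_bounds k0 t0.
by rewrite /scal mulr_ge0//= mulr_ile1.
Qed.

Lemma flux_bounds j y s : 1 <= j -> 0 <= s -> 0 <= flux j y (s ^+ 2) <= Q s + (j ^+ 2)^-1.
Proof.
move=> j1 s0; have j0 : 0 < j by lra.
have k0 : 0 < (j ^+ 2)^-1 by rewrite invr_gt0 exprn_gt0.
have [h1 _ h2] := ramp_bounds (flux_arg j y (s ^+ 2)) k0.
rewrite /flux h1/=; apply: le_trans h2 _.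
have /andP[_ h3] := @qreg_bounds R Q QP QPF j (s ^+ 2) j0.
have /andP[h4 _] := @qreg_bounds R Q QP QPF j (phi j y ^+ 2) j0.
rewrite sqrtr_sqr (ger0_norm s0) in h3.
have h5 := Q0 (Num.sqrt (phi j y ^+ 2 - j^-1)); have h6 := Q0 s.
by rewrite ge_max /flux_arg; apply/andP; split; lra.
Qed.

Let dscal_aux s c1 z dT c3 g c4 x : 0 <= s -> 0 <= c1 -> 0 <= z -> z <= 1 -> 0 <= c3 -> 0 <= c4 ->
  `|x| <= 1 -> s * `|c1 * x + z * dT * (c3 * g - c4 * x)| <= s * c1 + s * c3 * `|dT| * `|g| + s * c4 * `|dT|.
Proof.
move=> s0 c10 z0 z1 c30 c40 x1.
have h1 : `|c1 * x| <= c1 by rewrite normrM (ger0_norm c10) ler_piMr.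
have h2 : `|c3 * g - c4 * x| <= c3 * `|g| + c4.
  apply: le_trans (ler_normB _ _) _; rewrite !normrM (ger0_norm c30) (ger0_norm c40).
  by rewrite lerD2l ler_piMr.
have h3 : `|z * dT * (c3 * g - c4 * x)| <= `|dT| * (c3 * `|g| + c4).
  by rewrite !normrM (ger0_norm z0); apply: ler_pM => //; rewrite ?mulr_ge0// ler_piMl.
have h4 := le_trans (ler_normD _ _) (lerD h1 h3).
apply: le_trans (ler_wpM2l s0 h4) _.
by rewrite le_eqVlt; apply/orP; left; apply/eqP; ring.
Qed.

(** The bound is uniform in [j]. The factor [j] from the derivative of [step] is harmless: where
    that derivative is nonzero, |u| times [trunc] is at most [phi = j ^- 2]. The other terms are
    covered by [trunc_bounds]. *)
Lemma dscal_le j y u G X l : 1 <= j -> enorm X <= 1 ->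
  enorm u * `|dscal j y u G X ord0 l| <= 2 + enorm G + A.
Proof.
move=> j1 X1; have j0 : 0 < j by lra.
have k0 : 0 < (j ^+ 2)^-1 by rewrite invr_gt0 exprn_gt0.
have p0 : 0 < phi j y by exact: (phi_gt0 H_le0 H_gt0 HPF).
have /andP[K0 KA] : 0 <= dphi j y <= A by exact: (dphi_ge0 a_le0 a_gt0 aA HF).
have /andP[z0 z1] := (step_bounds (j * y)).1.
have /andP[dz0 dz1] := (step_bounds (j * y)).2.
have s0 := enorm_ge0 u; have E0 := enorm_ge0 G.
have Xl : `|X ord0 l| <= 1 by apply: le_trans (coord_le_enorm X l) X1.
have gl := row_mulmx_le u G l.
have t0 : 0 <= enorm u ^+ 2 / phi j y ^+ 2 by rewrite divr_ge0 ?sqr_ge0.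
have [/andP[t1 t2] t3 t4 t5] := trunc_bounds k0 t0.
have tE : Num.sqrt (enorm u ^+ 2 / phi j y ^+ 2) = enorm u / phi j y.
  by rewrite -expr_div_n sqrtr_sqr ger0_norm// divr_ge0// ltW.
rewrite tE in t5.
have h1 : enorm u * (dstep (j * y) * j * trunc (j ^+ 2)^-1 (enorm u ^+ 2 / phi j y ^+ 2)) <= 2.
  have [jy|jy] := leP 1 (j * y); first by rewrite (step_ge1 jy).2 !mul0r mulr0.
  have yj : y <= j^-1 by rewrite -[leRHS]mulr1 ler_pdivlMl// ltW.
  have [pE _] := phi_le a_le0 a_gt0 HF H_le0 H_gt0 HPF j0 yj.
  set T := trunc _ _ in t1 t2 t3 *.
  have sT : enorm u * T <= phi j y.
    rewrite -ler_sqr ?nnegrE ?mulr_ge0 ?(ltW p0)// exprMn -[leRHS]mul1r -ler_pdivrMr ?exprn_gt0//.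
    by rewrite mulrAC.
  have jp : j * phi j y <= 1 by rewrite pE expr2 invfM mulrA mulfV ?gt_eqF// mul1r invf_le1.
  have -> : enorm u * (dstep (j * y) * j * T) = dstep (j * y) * (j * (enorm u * T)) by ring.
  apply: (@le_trans _ _ (2 * 1)); last by rewrite mulr1.
  apply: ler_pM => //; first by rewrite !mulr_ge0// ltW.
  by apply: le_trans jp; rewrite ler_wpM2l// ltW.
set dT := dtrunc _ _ in t4 t5; set c1 := dstep _ * j * _ in h1.
have c10 : 0 <= c1 by rewrite /c1 !mulr_ge0// ltW.
have p2 : 0 < phi j y ^+ 2 by rewrite exprn_gt0.
have p3 : 0 < phi j y ^+ 3 by rewrite exprn_gt0.
have c30 : 0 <= 2 / phi j y ^+ 2 by rewrite divr_ge0// ltW.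
have c40 : 0 <= 2 * enorm u ^+ 2 * dphi j y / phi j y ^+ 3.
  have u2 := sqr_ge0 (enorm u).
  by apply: divr_ge0; [apply: mulr_ge0 => //; exact: mulr_ge0|exact: ltW].
rewrite /dscal -enorm_sqE -/dT -/c1.
have -> (k1 k2 k3 k4 : R) (v : 'rV[R]_n) : (k1 *: X + k2 *: (k3 *: v - k4 *: X)) ord0 l =
    k1 * X ord0 l + k2 * (k3 * v ord0 l - k4 * X ord0 l) by rewrite !mxE.
apply: le_trans (dscal_aux _ _ s0 c10 z0 z1 c30 c40 Xl) _.
apply: lerD; first apply: lerD => //.
- apply: (@le_trans _ _ (enorm u * (2 / phi j y ^+ 2) * `|dT| * (enorm u * enorm G))).
    by apply: ler_wpM2l => //; apply: mulr_ge0 => //; exact: mulr_ge0.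
  have -> : enorm u * (2 / phi j y ^+ 2) * `|dT| * (enorm u * enorm G) =
     2 * (enorm u ^+ 2 / phi j y ^+ 2 * `|dT|) * enorm G by ring.
  by rewrite ler_piMl//; lra.
- have -> : enorm u * (2 * enorm u ^+ 2 * dphi j y / phi j y ^+ 3) * `|dT| =
     2 * (enorm u ^+ 2 / phi j y ^+ 2 * (enorm u / phi j y) * `|dT|) * dphi j y.
    by field; rewrite gt_eqF.
  by apply: le_trans KA; rewrite ler_piMl//; lra.
Qed.

Lemma enorm_addmx c G u (v : 'rV[R]_n) : enorm (c *: G + u^T *m v) ^+ 2 =
  c ^+ 2 * enorm G ^+ 2 + 2 * c * dotrv (u *m G) v + dotrv u u * dotrv v v.
Proof.
have E i l : (c *: G + u^T *m v) i l = c * G i l + u ord0 i * v ord0 l.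
  by rewrite !mxE big_ord1 !mxE.
rewrite !enorm_sq.
have -> : dotrv (u *m G) v = \sum_i \sum_l u ord0 i * G i l * v ord0 l.
  rewrite exchange_big/=; apply: eq_bigr => l _; rewrite mxE mulr_suml.
  by apply: eq_bigr.
rewrite [dotrv u u]/dotrv mulr_suml !mulr_sumr -!big_split/=; apply: eq_bigr => i _.
rewrite [dotrv v v]/dotrv !mulr_sumr -!big_split/=; apply: eq_bigr => l _.
by rewrite E; ring.
Qed.

Lemma enorm_mx_le (B : 'M[R]_(m, n)) c : (forall i l, `|B i l| <= c) ->
  enorm B ^+ 2 <= (m * n)%:R * c ^+ 2.
Proof.
move=> Bc; rewrite enorm_sq; apply: (@le_trans _ _ (\sum_(i < m) \sum_(l < n) c ^+ 2)).
  apply: ler_sum => i _; apply: ler_sum => l _.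
  have := Bc i l; rewrite ler_norml => /andP[h1 h2]; nra.
by rewrite sumr_const card_ord sumr_const card_ord -mulrnA mulnC mulr_natl.
Qed.

(** Provides the integrable minorant for the limit in [j]. All terms are bounded or at most
    quadratic in [G], with constants free of [j]. *)
Lemma gain_ge D : 0 <= D -> exists2 C, 0 <= C & forall j y u G X d, 1 <= j -> enorm u <= q ->
  enorm X <= 1 -> `|d| <= D -> - (C * (1 + enorm G ^+ 2)) <= gain j y u G X d.
Proof.
move=> D0; have A0 : 0 <= A by exact: le_trans (ltW (a_gt0 ltr01)) (aA 1).
have Qq := Q0 q.
have M0 : 0 <= M by have /W_bounds/andP[h1 h2] : enorm (0 : 'rV[R]_m) <= q; [by rewrite enorm0|exact: le_trans h2].
pose C1 := (m * n)%:R * (8 + 2 * (2 + A) ^+ 2).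
pose C2 := 2 * A + 2 * A ^+ 2.
have C10 : 0 <= C1 by rewrite mulr_ge0//; nra.
have C20 : 0 <= C2 by rewrite /C2; nra.
exists (C1 + C2 + M + D * (Q q + 1)) => [|j y u G X d j1 uq X1 dD].
  have DQ : 0 <= D * (Q q + 1) by apply: mulr_ge0 => //; lra.
  by lra.
have j0 : 0 < j by lra.
have s0 := enorm_ge0 u; have E0 := enorm_ge0 G; set E := enorm G in E0 *.
have /andP[th0 th1] := scal_bounds y (enorm u) j0.
rewrite enorm_sqE in th0 th1.
have h1 : 2^-1 * enorm (gradcomp j y u G X) ^+ 2 <= C1 * (1 + E ^+ 2).
  have : enorm (gradcomp j y u G X) ^+ 2 <= (m * n)%:R * (2 * E + (2 + A)) ^+ 2.
    apply: enorm_mx_le => i l; rewrite !mxE big_ord1 !mxE.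
    apply: le_trans (ler_normD _ _) _.
    have gE : `|G i l| <= E.
      rewrite -ler_sqr ?nnegrE// -normrX ger0_norm ?sqr_ge0// /E enorm_sq (bigD1 i)//= (bigD1 l)//=.
      rewrite -addrA lerDl addr_ge0//; first by apply: sumr_ge0 => k _; exact: sqr_ge0.
      by apply: sumr_ge0 => k _; apply: sumr_ge0 => k' _; exact: sqr_ge0.
    have h2 : `|scal j y (dotrv u u) * G i l| <= E.
      by rewrite normrM (ger0_norm th0); apply: le_trans gE; rewrite ler_piMl.
    have h3 := dscal_le y u G l j1 X1.
    have h4 : `|u ord0 i * dscal j y u G X ord0 l| <= 2 + E + A.
      by rewrite normrM; apply: le_trans h3; rewrite ler_wpM2r//; exact: coord_le_enorm.
    by move: h4; rewrite !mxE => h4; apply: le_trans (lerD h2 h4) _; lra.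
  move=> /(ler_wpM2l (_ : 0 <= 2^-1)) h; apply: le_trans (h _) _; first by rewrite invr_ge0.
  have h6 : 2^-1 * (2 * E + (2 + A)) ^+ 2 <= (8 + 2 * (2 + A) ^+ 2) * (1 + E ^+ 2).
    have := sqr_ge0 (2 * E - (2 + A)); have := sqr_ge0 ((2 + A) * E); nra.
  by rewrite [leLHS]mulrCA /C1 -mulrA; apply: ler_wpM2l h6.
have h2 : 0 <= W u by have /andP[] := W_bounds uq.
have h3 : W (scal j y (dotrv u u) *: u) <= M.
  have : enorm (scal j y (dotrv u u) *: u) <= q by rewrite enormZ//; apply: le_trans uq; rewrite ler_piMl.
  by move=> /W_bounds/andP[].
have h4 : dotrv X (dflux j y u G X) <= C2 * (1 + E ^+ 2).
  have k0 : 0 < (j ^+ 2)^-1 by rewrite invr_gt0 exprn_gt0.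
  have p0 : 0 < phi j y by exact: (phi_gt0 H_le0 H_gt0 HPF).
  have /andP[K0 KA] : 0 <= dphi j y <= A by exact: (dphi_ge0 a_le0 a_gt0 aA HF).
  have /andP[r0 r1] := dramp_bounds (flux_arg j y (enorm u ^+ 2)) k0.
  have B1 := le_trans (dqreg_le a_le0 a_gt0 QF Q_le0 j0 s0) (aA _).
  have B2 := le_trans (dqreg_le a_le0 a_gt0 QF Q_le0 j0 (ltW p0)) (aA _).
  have B10 := dqge0 (enorm u ^+ 2) j0.
  have B20 := dqge0 (phi j y ^+ 2) j0.
  rewrite /dflux dotrvZr dotrvDr dotrvNr !dotrvZr -enorm_sqE.
  have g1 : `|dotrv X (u *m G)| <= enorm u * E.
    apply: le_trans (dotrv_le _ _) _; apply: le_trans (ler_piMl (enorm_ge0 _) X1) _.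
    rewrite -ler_sqr ?nnegrE ?mulr_ge0 ?enorm_ge0// exprMn !enorm_sqE; exact: mulmx_norm_le.
  have XX : 0 <= dotrv X X <= 1 by rewrite dotrv_ge0 -enorm_sqE expr_le1// enorm_ge0.
  set r := dramp _ _ in r0 r1 *; set b1 := dqreg j _ in B1 B10 *; set b2 := dqreg j (phi j y ^+ 2) in B2 B20 *.
  set x := dotrv X _ in g1 *; set k := dphi j y in K0 KA *; set p := phi j y in B2 p0 *.
  have e1 : 2 * b1 * x <= A * (1 + E ^+ 2).
    apply: (@le_trans _ _ (2 * (enorm u * b1) * E)).
      have g2 := ler_wpM2l B10 (le_trans (ler_norm _) g1); lra.
    apply: (@le_trans _ _ (2 * A * E)); first by rewrite ler_wpM2r// ler_wpM2l.
    have := mulr_ge0 A0 (sqr_ge0 (E - 1)); nra.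
  have e2 : - (2 * p * b2 * k * dotrv X X) <= 0.
    have p0' := ltW p0; have XX0 := dotrv_ge0 X.
    by rewrite oppr_le0; apply: mulr_ge0 => //; apply: mulr_ge0 => //; apply: mulr_ge0 => //; exact: mulr_ge0.
  have e3 : 0 <= A * (1 + E ^+ 2) by rewrite mulr_ge0//; nra.
  apply: (@le_trans _ _ (A * (1 + E ^+ 2))); last by rewrite ler_wpM2r// /C2; nra.
  apply: (@le_trans _ _ (r * (A * (1 + E ^+ 2)))); last by rewrite ler_piMl.
  by rewrite ler_wpM2l//; lra.
have h5 : d * flux j y (dotrv u u) <= D * (Q q + 1).
  have /andP[f0 f1] := flux_bounds y j1 s0; rewrite enorm_sqE in f0 f1.
  apply: (@le_trans _ _ (`|d| * flux j y (dotrv u u))); first by rewrite ler_wpM2r// ler_norm.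
  apply: ler_pM => //; apply: le_trans f1 _; apply: lerD.
    by apply: (Q_homo a_le0 a_gt0 QF).
  by rewrite invf_le1 ?exprn_gt0//; nra.
rewrite /gain; have E2 : 0 <= E ^+ 2 by rewrite sqr_ge0.
have DQ : 0 <= D * (Q q + 1) by rewrite mulr_ge0//; lra.
nra.
Qed.

(** Used twice: near the boundary of the ball, where it makes the competitor coincide with [u], and
    at points where |u| < H(psi). *)
Lemma gain_inactive j y u G X d : 1 <= j -> 1 <= j * y ->
  dotrv u u / phi j y ^+ 2 <= 1 - (j ^+ 2)^-1 -> flux_arg j y (dotrv u u) <= 0 ->
  [/\ scal j y (dotrv u u) = 1, dscal j y u G X = 0, flux j y (dotrv u u) = 0,
      dflux j y u G X = 0 & gain j y u G X d = 0].
Proof.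
move=> j1 jy ut fa; have j0 : 0 < j by lra.
have k0 : 0 < (j ^+ 2)^-1 by rewrite invr_gt0 exprn_gt0.
have [z1 dz0] := step_ge1 jy.
have [D1 D0] := trunc_den_le k0 ut.
have E1 : scal j y (dotrv u u) = 1 by rewrite /scal z1 /trunc D1 sqrtr1 invr1 mulr1.
have E2 : dscal j y u G X = 0 by rewrite /dscal dz0 D0 !mul0r mulr0 !scale0r addr0.
have E3 : flux j y (dotrv u u) = 0 by rewrite /flux ramp_le0.
have E4 : dflux j y u G X = 0 by rewrite /dflux dramp_le0// scale0r.
split => //; rewrite /gain E3 E4 /gradcomp E1 E2 mulmx0 !scale1r addr0 subrr sub0r mulr0 subr0.
by rewrite -(scale0r X) dotrvZr mul0r oppr0.
Qed.

Lemma gain_below y u e : 0 < y -> enorm u < H y -> 0 < e -> exists2 J, 1 <= J &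
  forall j G X d, J <= j -> - e <= gain j y u G X d.
Proof.
move=> y0 uH e0; have A0 : 0 <= A by exact: le_trans (ltW (a_gt0 ltr01)) (aA 1).
pose r1 := (enorm u + H y) / 2.
have ur1 : enorm u < r1 by rewrite /r1; lra.
have [J1 J11 HJ1] := inactive a_le0 a_gt0 QF QPF (enorm_ge0 u) ur1.
have [al al0 [J2 J21 HJ2]] := phi_cvg a_nd a_le0 a_gt0 aA HF H_gt0 HPF y0.
have [J3 J31 HJ3] := @eventually_inv R ((H y - r1) / (2 * A + 1)) ltac:(by rewrite divr_gt0 /r1//; lra).
have [J4 J41 HJ4] := eventually_inv y0.
exists (Num.max J1 (Num.max J2 (Num.max J3 J4))); first by rewrite le_max J11.
move=> j G X d; rewrite !ge_max => /and4P[/[dup] jJ1 jJ /HJ2/andP[p1 _] /HJ3 j3 /HJ4 j4].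
have j1 : 1 <= j by lra.
have j0 : 0 < j by lra.
have jV : 0 < j^-1 by rewrite invr_gt0.
rewrite ler_pdivlMr in j3; last by lra.
have p : r1 <= phi j y by lra.
have jy : 1 <= j * y by rewrite -ler_pdivrMl// mulr1.
have uu : 0 <= enorm u <= enorm u by rewrite enorm_ge0 lexx.
have [h1 h2] := HJ1 j (phi j y) (enorm u) jJ1 p uu.
rewrite enorm_sqE in h1 h2.
have [_ _ _ _ ->] := gain_inactive G X d j1 jy h1 h2.
by rewrite oppr_le0 ltW.
Qed.

Let quad_le (v X : 'rV[R]_n) l : l * dotrv X v <= (dotrv v v + l ^+ 2 * dotrv X X) / 2.
Proof.
have := dotrv_ge0 (v - l *: X).
rewrite dotrvDl !dotrvDr !dotrvNl !dotrvNr !dotrvZl !dotrvZr (dotrvC v X); lra.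
Qed.

(** For [y <= 0] the competitor is 0, so the whole of [W u >= a^2 / 2] is gained, [W_drop] being
    used with the factor 0. Young's inequality with the vector [|u|^-1 u G], of length at most |G|,
    absorbs the gradient term of the flux. *)
Lemma gain_core y u X d e : y <= 0 -> enorm u <= q -> enorm X <= 1 -> 0 < e ->
  exists2 J, 1 <= J & forall j G, J <= j ->
    (1 - enorm X ^+ 2) * (a (enorm u) ^+ 2 / 2) - Num.max d 0 * Q (enorm u) - e <= gain j y u G X d.
Proof.
move=> y0 uq X1 e0; have A0 : 0 <= A by exact: le_trans (ltW (a_gt0 ltr01)) (aA 1).
have s0 := enorm_ge0 u; set s := enorm u in uq s0 *.
have gainE j G : 1 <= j -> gain j y u G X d = 2^-1 * enorm G ^+ 2 + W u -
    dramp (j ^+ 2)^-1 (flux_arg j y (s ^+ 2)) * (2 * dqreg j (s ^+ 2)) * dotrv X (u *m G) - d * flux j y (s ^+ 2).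
  move=> j1; have j0 : 0 < j by lra.
  have jy : j * y <= 0 by rewrite pmulr_rle0.
  have [z0 dz0] := step_le0 jy.
  have yj : y <= j^-1 by apply: le_trans y0 _; rewrite invr_ge0 ltW.
  have [_ K0] := phi_le a_le0 a_gt0 HF H_le0 H_gt0 HPF j0 yj.
  rewrite /gain /gradcomp /dscal /scal z0 dz0 !mul0r !scale0r addr0 mulmx0 addr0 W0.
  rewrite enorm0 /dflux K0 mulr0 scale0r subr0 dotrvZr dotrvZr -enorm_sqE -/s.
  by ring.
have Wu : a s ^+ 2 / 2 <= W u.
  have := @W_drop u 0 uq; rewrite scale0r mul0r W0 (a_le0 (lexx 0)) subr0 lexx ler01 => /(_ isT).
  by rewrite expr0n/= !subr0.
have d0 : 0 <= Num.max d 0 by rewrite le_max lexx orbT.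
have dm : d <= Num.max d 0 by rewrite le_max lexx.
set D := Num.max d 0 in d0 dm *.
have [J1 J11 HJ1] := @eventually_inv R (e / 2 / (D + 1)) ltac:(by rewrite !divr_gt0//; lra).
have fluxD j : 1 <= j -> J1 <= j -> d * flux j y (s ^+ 2) <= D * Q s + e / 2.
  move=> j1 jJ; have j0 : 0 < j by lra.
  have /andP[f0 f1] := flux_bounds y j1 s0.
  have := HJ1 _ jJ; rewrite ler_pdivlMr; last by lra.
  have := inv_sq_le j1; have jV : 0 < j^-1 by rewrite invr_gt0.
  have k0 : 0 < (j ^+ 2)^-1 by rewrite invr_gt0 exprn_gt0.
  nra.
have XX := enorm_sqE X.
have XX1 : enorm X ^+ 2 <= 1 by rewrite expr_le1// enorm_ge0.
(* Young's inequality divides by |u|; at [u = 0] the product [u *m G] vanishes instead. *)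
have [s00|sn0] := eqVneq s 0.
  have u0 : u = 0 by apply: enorm_eq0.
  exists J1 => // j G jJ; have j1 : 1 <= j by lra.
  rewrite gainE//; have := fluxD j j1 jJ.
  have -> : dotrv X (u *m G) = 0 by rewrite u0 mul0mx -(scale0r X) dotrvZr mul0r.
  have := sqr_ge0 (enorm G); rewrite s00 (a_le0 (lexx 0)) expr0n/= mul0r mulr0 mulr0 sub0r in Wu *.
  lra.
have sp : 0 < s by rewrite lt_neqAle eq_sym sn0.
have as0 := ltW (a_gt0 sp).
pose e1 := Num.min 1 (e / (2 * (A + 1))).
have e10 : 0 < e1 by rewrite lt_min ltr01 divr_gt0//; lra.
have e11 : e1 <= 1 by rewrite ge_min lexx.
have e1A : e1 * (A + 1) <= e / 2.
  have : e1 <= e / (2 * (A + 1)) by rewrite ge_min lexx orbT.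
  rewrite ler_pdivlMr; last by lra.
  lra.
have [J2 J21 HJ2] := dqreg_cvg a_le0 a_gt0 a_lc QF Q_le0 sp e10.
have [J3 J31 HJ3] := eventually_inv sp.
exists (Num.max J1 (Num.max J2 J3)); first by rewrite le_max J11.
move=> j G; rewrite !ge_max => /and3P[jJ1 /HJ2/andP[l1 l2] /HJ3 j3].
have j1 : 1 <= j by lra.
have j0 : 0 < j by lra.
have k0 : 0 < (j ^+ 2)^-1 by rewrite invr_gt0 exprn_gt0.
have yj : y <= j^-1 by apply: le_trans y0 _; rewrite invr_ge0 ltW.
have [pE _] := phi_le a_le0 a_gt0 HF H_le0 H_gt0 HPF j0 yj.
rewrite gainE//; have := fluxD j j1 jJ1.
have ps : phi j y <= s by rewrite pE; apply: le_trans (inv_sq_le j1) j3.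
(* The offset in [flux_arg] equals the width of the ramp, so the ramp is saturated as soon as |u| >=
   phi. *)
have -> : dramp (j ^+ 2)^-1 (flux_arg j y (s ^+ 2)) = 1.
  apply: dramp_ge => //; rewrite /flux_arg lerDr subr_ge0.
  by apply: (qreg_homo a_le0 a_gt0 QF QPF) => //; rewrite ler_sqr ?nnegrE// pE ltW.
rewrite mul1r.
have := quad_le (s^-1 *: (u *m G)) X (2 * s * dqreg j (s ^+ 2)).
have := mulmx_norm_le u G.
rewrite !dotrvZr dotrvZl -!enorm_sqE -/s.
set l := 2 * s * _ in l1 l2 *; set g := enorm (u *m G) ^+ 2; set x := dotrv X _ => gs.
have -> : l * (s^-1 * x) = 2 * dqreg j (s ^+ 2) * x by rewrite /l; field.
have : s^-1 * (s^-1 * g) <= enorm G ^+ 2.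
  by rewrite mulrA -invfM -expr2 ler_pdivrMl// exprn_gt0.
have : l ^+ 2 * enorm X ^+ 2 <= (a s ^+ 2 + 2 * e1 * (A + 1)) * enorm X ^+ 2.
  apply: ler_wpM2r; first exact: sqr_ge0.
  have l0 : 0 <= l by apply: mulr_ge0; [exact: mulr_ge0|exact: dqge0].
  have := aA s; nra.
have := sqr_ge0 (enorm X).
set X2 := enorm X ^+ 2 in XX1 *; nra.
Qed.

(** All transitions are over, so [scal] is exactly [phi / |u|] and the energy of the competitor
    splits into a tangential part, reduced by the factor [(phi / |u|) ^+ 2], and the radial part
    [dphi^2 |X|^2]. What remains to be approximated are the speeds. *)
Lemma gain_above y u X d e : 0 < y -> H y <= enorm u -> enorm u <= q -> enorm X <= 1 ->
  d <= 0 -> 0 < e -> exists2 J, 1 <= J & forall j G, J <= j -> - e <= gain j y u G X d.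
Proof.
move=> y0 Hu uq X1 d0 e0; have A0 : 0 <= A by exact: le_trans (ltW (a_gt0 ltr01)) (aA 1).
have h0 := H_gt0 y0; set h := H y in Hu h0 *.
set s := enorm u in Hu uq *; have sp : 0 < s by lra.
have ah := a_gt0 h0; have as0 := a_gt0 sp; have ahs : a h <= a s by exact: a_nd.
have XX := enorm_sqE X.
have XX1 : enorm X ^+ 2 <= 1 by rewrite expr_le1// enorm_ge0.
pose e1 := Num.min 1 (Num.min (a h / 2) (e / (3 * A + 1))).
have e10 : 0 < e1 by rewrite !lt_min ltr01 !divr_gt0//; lra.
have e11 : e1 <= 1 by rewrite ge_min lexx.
have e12 : e1 <= a h / 2 by rewrite !ge_min lexx orbT.
have e1A : e1 * (3 * A + 1) <= e.
  have : e1 <= e / (3 * A + 1) by rewrite !ge_min lexx !orbT.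
  rewrite ler_pdivlMr; last by lra.
  lra.
have [J1 J11 HJ1] := dqreg_cvg a_le0 a_gt0 a_lc QF Q_le0 sp e10.
have [al al0 [J2 J21 HJ2]] := phi_cvg a_nd a_le0 a_gt0 aA HF H_gt0 HPF y0.
have [J3 J31 HJ3] := dphi_cvg a_nd a_le0 a_gt0 aA a_lc HF H_gt0 y0 e10.
have [J4 J41 HJ4] := dqreg_phi_cvg a_nd a_le0 a_gt0 aA a_lc QF HF H_gt0 HPF y0 e10.
have [J5 J51 HJ5] := eventually_inv y0.
have [J6 J61 HJ6] := @eventually_inv R (2 * al / h) ltac:(by rewrite divr_gt0//; lra).
exists (Num.max (Num.max J1 J2) (Num.max (Num.max J3 J4) (Num.max J5 J6))); first by rewrite !le_max J11.
move=> j G; rewrite !ge_max => /and3P[/andP[/[dup] jJ /HJ1/andP[l1 l2] /HJ2/andP[p1 p2]]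
  /andP[/HJ3/andP[K1 K2] /HJ4 b1] /andP[/HJ5 j5 /HJ6 j6]].
have j1 : 1 <= j by lra.
have j0 : 0 < j by lra.
have k0 : 0 < (j ^+ 2)^-1 by rewrite invr_gt0 exprn_gt0.
have jV : 0 < j^-1 by rewrite invr_gt0.
have jy : 1 <= j * y by rewrite -ler_pdivrMl// mulr1.
have p0 : 0 < phi j y by exact: (phi_gt0 H_le0 H_gt0 HPF).
have [z1 dz0] := step_ge1 jy.
rewrite -/h in p1 p2 K1 K2 b1.
set p := phi j y in p0 p1 p2 b1.
have alj : 0 < al / j by rewrite divr_gt0.
have ps : p < s by lra.
have pn0 : p != 0 by rewrite gt_eqF.
have sn0 : s != 0 by rewrite gt_eqF.
(* From [s >= p + al / j] the quotient is at least [1 + 2 al / (j p)], and [p <= h]; for large [j]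
   this excess is above [j ^- 2]. *)
have ut : 1 + (j ^+ 2)^-1 <= s ^+ 2 / p ^+ 2.
  rewrite ler_pdivlMr ?exprn_gt0// mulrDl mul1r.
  have k1 : (j ^+ 2)^-1 <= 2 * al / h / j by rewrite expr2 invfM ler_wpM2r// ltW.
  have k2 : (j ^+ 2)^-1 * p ^+ 2 <= 2 * al / h / j * p ^+ 2 by rewrite ler_wpM2r// sqr_ge0.
  have k3 : 2 * al / h / j * p ^+ 2 = 2 * (al / j) * p * (p / h) by field; rewrite !gt_eqF.
  have k4 : p / h <= 1 by rewrite ler_pdivrMr// mul1r; lra.
  have k5 : 2 * (al / j) * p * (p / h) <= 2 * (al / j) * p by rewrite ler_piMr// !mulr_ge0// ltW.
  have k6 : (p + al / j) ^+ 2 <= s ^+ 2.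
    have k6' : p + al / j <= s by rewrite -lerBrDr; apply: le_trans p2 _; rewrite lerD2r.
    by rewrite ler_sqr// nnegrE; [apply: addr_ge0; exact: ltW|exact: ltW].
  have k7 : (p + al / j) ^+ 2 = p ^+ 2 + (2 * (al / j) * p + (al / j) ^+ 2) by ring.
  rewrite k3 in k2; have k8 := le_trans k2 k5.
  apply: le_trans k6; rewrite k7 lerD2l; apply: le_trans k8 _.
  by rewrite lerDl sqr_ge0.
have [D1 D2] := trunc_den_ge k0 ut.
have tE : Num.sqrt (s ^+ 2 / p ^+ 2) = s / p.
  by rewrite -expr_div_n sqrtr_sqr ger0_norm// divr_ge0// ltW.
rewrite tE in D2.
have scE : scal j y (dotrv u u) = p / s.
  by rewrite /scal -enorm_sqE -/s -/p z1 mul1r /trunc D1 tE invf_div.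
have fa : (j ^+ 2)^-1 <= flux_arg j y (s ^+ 2).
  rewrite /flux_arg lerDr subr_ge0.
  by apply: (qreg_homo a_le0 a_gt0 QF QPF) => //; rewrite ler_sqr ?nnegrE -/p ltW.
set K := dphi j y in K1 K2.
(* [g] stands for the gradient of |u|. *)
have [g ugE] : exists g, u *m G = s *: g.
  by exists (s^-1 *: (u *m G)); rewrite scalerA mulfV// scale1r.
have dsE : dscal j y u G X = s^-1 *: (K *: X - (p / s) *: g).
  rewrite /dscal dz0 z1 !mul0r scale0r add0r mul1r -enorm_sqE -/s -/p D2 -/K.
  rewrite ugE; apply/rowP => l; rewrite !mxE; field.
  by rewrite sn0 pn0.
have dfE : dotrv X (dflux j y u G X) = 2 * s * dqreg j (s ^+ 2) * dotrv X g -
    2 * p * dqreg j (p ^+ 2) * K * enorm X ^+ 2.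
  rewrite /dflux -enorm_sqE -/s dramp_ge// scale1r dotrvDr dotrvNr ugE !dotrvZr -XX -/p -/K.
  by ring.
have dcE : enorm (gradcomp j y u G X) ^+ 2 = (p / s) ^+ 2 * (enorm G ^+ 2 - dotrv g g) + K ^+ 2 * enorm X ^+ 2.
  rewrite /gradcomp enorm_addmx scE dsE.
  rewrite ugE !dotrvZl !dotrvZr -enorm_sqE -/s XX.
  rewrite dotrvDl !dotrvDr !dotrvNl !dotrvNr !dotrvZl !dotrvZr (dotrvC g X).
  by field.
have gG : dotrv g g <= enorm G ^+ 2.
  have := mulmx_norm_le u G; rewrite ugE dotrvZl dotrvZr mulrA -expr2 -!enorm_sqE -/s.
  by rewrite ler_pM2l// exprn_gt0.
have ps1 : 0 <= p / s <= 1.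
  by rewrite divr_ge0 ?(ltW p0) ?(ltW sp)//= ler_pdivrMr// mul1r ltW.
have Wd := W_drop uq ps1.
rewrite -/s divfK// in Wd.
have ap : a p <= a h by apply: a_nd; apply: le_trans p2 _; rewrite gerBl ltW.
have f0 : 0 <= flux j y (dotrv u u).
  by rewrite -enorm_sqE; have /andP[] := flux_bounds y j1 (ltW sp).
rewrite /gain dfE dcE scE.
have dfl : d * flux j y (dotrv u u) <= 0 by rewrite mulr_le0_ge0.
have h1 : (p / s) ^+ 2 * (enorm G ^+ 2 - dotrv g g) <= enorm G ^+ 2 - dotrv g g.
  by apply: ler_piMl; [rewrite subr_ge0|rewrite expr_le1//; case/andP: ps1].
have h2 := quad_le g X (2 * s * dqreg j (s ^+ 2)).
rewrite -XX in h2.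
have ap0 : 0 <= a p by rewrite ltW// a_gt0.
have ap2 : a p ^+ 2 <= a h ^+ 2 by rewrite ler_sqr ?nnegrE// ltW.
have l0 : 0 <= 2 * s * dqreg j (s ^+ 2).
  by apply: mulr_ge0; [apply: mulr_ge0 => //; exact: ltW|exact: dqge0].
exact: (above_arith ahs (ltW ah) (aA s) (ltW e10) e11 e12 e1A l0 l2 b1 K1 K2 (sqr_ge0 _) XX1 h1 h2 ap2 Wd dfl).
Qed.

End pointwise.

(** * The calibration field *)

Section cube.
Context {R : realType}.
Implicit Types (y s t e : R).

Definition pos3 y := Num.max y 0 ^+ 3.

Lemma is_derive_pos3 y : is_derive y 1 pos3 (3 * pos2 y).
Proof.
apply: (@is_derive_quad _ _ _ _ (3 * `|y| + 1) 1) => // h h1.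
have {}h1 : h <= 1 /\ -1 <= h by move: h1; rewrite ltr_norml => /andP[? ?]; lra.
have [h2 h3] := h1; have y1 := ler_norm y; have y2 := ler_norm (- y); rewrite normrN in y2.
rewrite /pos3 /pos2 ler_norml; set Y := `|y| in y1 y2 *.
have hh := sqr_ge0 h.
have H1 : 0 <= h ^+ 2 * (1 - h) by rewrite mulr_ge0// subr_ge0.
have H2 : 0 <= h ^+ 2 * (1 + h) by rewrite mulr_ge0//; lra.
have H3 : 0 <= h ^+ 2 * (Y - y) by rewrite mulr_ge0//; lra.
have H4 : 0 <= h ^+ 2 * (Y + y) by rewrite mulr_ge0//; lra.
case: (leP (y + h) 0) => k1; case: (leP y 0) => k2.
- by apply/andP; split; nra.
- have y0 : 0 <= y by exact: ltW.
  have hy : 0 <= - h - y by lra.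
  have K1 : 0 <= y ^+ 2 * (- h - y) by rewrite mulr_ge0 ?sqr_ge0.
  have K2 : 0 <= y * (- h) * (- h - y) by rewrite !mulr_ge0//; lra.
  have K3 : 0 <= y ^+ 2 * y by rewrite mulr_ge0 ?sqr_ge0.
  by apply/andP; split; nra.
- have : 0 <= y + h <= h by lra.
  move=> /andP[K1 K2]; have K3 : (y + h) ^+ 2 <= h ^+ 2 by nra.
  have : 0 <= (y + h) ^+ 2 by nra.
  move=> K4; apply/andP; split.
    have K5 : 0 <= (y + h) * (y + h) ^+ 2 by apply: mulr_ge0.
    have -> : (y + h) ^+ 3 - 0 ^+ 3 - 3 * 0 ^+ 2 * h = (y + h) * (y + h) ^+ 2 by ring.
    by nra.
  have : (y + h) * (y + h) ^+ 2 <= h * h ^+ 2 by apply: ler_pM.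
  nra.
- by apply/andP; split; nra.
Qed.

Lemma pos3_convex s t : s <= t -> pos3 t - pos3 s <= (t - s) * (3 * pos2 t).
Proof.
move=> st; rewrite /pos3 /pos2; case: (leP t 0) => t0; case: (leP s 0) => s0.
- by rewrite !expr0n/=; lra.
- lra.
- rewrite !expr0n/= subr0; have : 0 <= t ^+ 2 by exact: sqr_ge0.
  rewrite exprS; nra.
- have : 0 <= (t - s) ^+ 2 * (2 * t + s) by rewrite mulr_ge0 ?sqr_ge0//; lra.
  nra.
Qed.

Definition ramp_primitive e y := (pos3 y - pos3 (y - e)) / (6 * e).

Lemma is_derive_ramp_primitive e y : 0 < e -> is_derive y 1 (ramp_primitive e) (ramp e y).
Proof.
move=> e0; have dS : is_derive y 1 (fun t : R => t - e) 1.
  by apply: (derive_eq (is_deriveB (is_derive_id _ _) (is_derive_cst _ _ _))); rewrite subr0.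
have d2 := @is_derive1_comp R pos3 (fun t : R => t - e) y _ _ (is_derive_pos3 _) dS.
apply: (derive_eq (is_deriveM (is_deriveB (is_derive_pos3 y) d2) (is_derive_cst (6 * e)^-1 _ _))).
rewrite /ramp /GRing.scale/= mulr0 add0r; field.
by rewrite gt_eqF.
Qed.

(** Convexity of the cube of the positive part: [e / 2] is the slope [ramp e e] at [e]. *)
Lemma ramp_primitive_le e y : 0 < e -> y <= e ->
  ramp_primitive e e - ramp_primitive e y <= (e - y) * (e / 2).
Proof.
move=> e0 ye; rewrite /ramp_primitive -mulrBl ler_pdivrMr; last by lra.
have -> : pos3 (y - e) = 0 by rewrite /pos3 (max_idPr _) ?expr0n//; lra.
have -> : pos3 (e - e) = 0 by rewrite subrr /pos3 maxxx expr0n.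
have := pos3_convex ye; rewrite /pos2 (max_idPl (ltW e0)) !subr0 => /le_trans; apply.
by rewrite le_eqVlt; apply/orP; left; apply/eqP; field.
Qed.

Lemma ramp_primitive_ge e y : 0 < e -> e <= y ->
  ramp_primitive e y = y ^+ 2 / 2 - y * e / 2 + e ^+ 2 / 6.
Proof.
move=> e0 ey; rewrite /ramp_primitive /pos3 !(max_idPl _); [|lra..].
by field; rewrite gt_eqF.
Qed.

End cube.

Section field.
Context {R : realType} (n : nat).
Variables (x0 : 'rV[R]_n) (I : R).
Hypotheses (n0 : (0 < n)%N) (I0 : 0 < I).

Let N : R := n%:R.
Let N1 : 1 <= N. Proof. by rewrite ler1n. Qed.
Let N0 : 0 < N. Proof. by rewrite ltr0n. Qed.

Let eps : R := (8 * N)^-1.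
(** [b] and [c] meet three competing demands: the radius below [(4 N + sqrt 2) I] in
    [cal_radius_lt], a potential above [I / sqrt 2] in [cal_edge], and a small divergence [N c],
    with [N c I = 11 / 56], in [cal_core]. The product [c b = 11 / 20] is the length of the field at
    distance [b]. *)
Let b : R := 14 / 5 * N * I.
Let c : R := 11 / 20 / b.
Let eps0 : 0 < eps. Proof. by rewrite invr_gt0 mulr_gt0. Qed.
Let epsN : eps * N = 8^-1. Proof. by rewrite /eps; field; rewrite gt_eqF. Qed.
Let b0 : 0 < b. Proof. by rewrite !mulr_gt0. Qed.
Let c0 : 0 < c. Proof. by rewrite divr_gt0. Qed.
Let cb : c * b = 11 / 20. Proof. by rewrite /c; field; rewrite gt_eqF. Qed.

Let sq (x : 'rV[R]_n) := dotrv (x - x0) (x - x0).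
Let Y x := sq x / b ^+ 2 - 1.
(** The divergence is [N c] times [p - dramp (1 + Y)]. With the slope [N / 2] past the transition,
    the radial derivative of [p] compensates the term [N c] of the linear field, up to the smoothing
    of the corner. [G] is a primitive of [p]. *)
Let p y := 1 - N / 2 * ramp eps y.
Let G y := y - N / 2 * ramp_primitive eps y.

(* [X = c p(Y) (x - x0)] with [Y = |x - x0|^2 / b^2 - 1]: the field is linear in
   the ball of radius [b], and outside of it [p] decreases just fast enough for
   the divergence to be nonpositive beyond a thin shell. The numbers in [b], [c]
   and [eps] are chosen so that the potential still exceeds [I / sqrt 2] at
   distance [cal_radius < (4 n + sqrt 2) I]. *)
Definition cal_pot x := c * b ^+ 2 / 2 * (G (Y x) - G eps).
Definition cal_field x : 'rV[R]_n := (c * p (Y x)) *: (x - x0).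
Definition cal_div x := N * (c * p (Y x)) - c * N * dramp eps (Y x) * (sq x / b ^+ 2).

Let CkY : Ck 1 Y.
Proof.
apply: CkB; last exact: Ck_cst.
by apply: CkM; [exact: Ck_sqdist|exact: Ck_cst].
Qed.

Let partialY l x : partial l Y x = 2 * (x ord0 l - x0 ord0 l) / b ^+ 2.
Proof.
have c1 := Ck_sqdist 1 x0; have c2 : Ck 1 (fun x => sq x / b ^+ 2).
  by apply: CkM => //; exact: Ck_cst.
rewrite (partialD l x c2 (Ck_cst _ 1 (- 1))) partial_cst addr0.
rewrite (partialM l x c1 (Ck_cst _ 1 (b ^+ 2)^-1)) partial_cst mulr0 add0r partial_sqdist.
by rewrite mulrC.
Qed.

Let dG (y : R) : is_derive y 1 G (p y).
Proof.
apply: (derive_eq (is_deriveB (is_derive_id _ _) (is_deriveZ (N / 2) (is_derive_ramp_primitive y eps0)))).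
by [].
Qed.

Let cramp : continuous (ramp eps).
Proof.
move=> y; apply/differentiable_continuous/derivable1_diffP.
by have [] := is_derive_ramp y eps0.
Qed.

Let cp : continuous p.
Proof.
have ce (k : R) : continuous (fun y : R => k) by move=> y; exact: cvg_cst.
by apply: continuousBf => //; exact: continuousMf.
Qed.

Let dp (y : R) : is_derive y 1 p (- (N / 2 * dramp eps y)).
Proof.
apply: (derive_eq (is_deriveB (is_derive_cst _ _ _) (is_deriveZ (N / 2) (is_derive_ramp y eps0)))).
by rewrite sub0r.
Qed.

Let cdp : continuous (fun y => - (N / 2 * dramp eps y)).
Proof.
have ce (k : R) : continuous (fun y : R => k) by move=> y; exact: cvg_cst.
move=> y; apply: cvgN; apply: cvgM; [exact: cvg_cst|exact: continuous_dramp].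
Qed.

Lemma Ck_cal_pot : Ck 1 cal_pot /\ forall l x, partial l cal_pot x = cal_field x ord0 l.
Proof.
have [cGY pGY] := C1_comp dG cp CkY.
have cGB : Ck 1 (fun x => (G \o Y) x - G eps) by apply: CkB => //; exact: Ck_cst.
split; first by apply: CkM => //; exact: Ck_cst.
move=> l x; rewrite (partialM l x (Ck_cst _ 1 (c * b ^+ 2 / 2)) cGB) partial_cst.
rewrite (partialD l x cGY (Ck_cst _ 1 (- G eps))) partial_cst pGY partialY !mxE mulr0 !addr0 /=.
by field; rewrite gt_eqF.
Qed.

Lemma Ck_cal_field : (forall l, Ck 1 (fun x => cal_field x ord0 l)) /\
  forall x, \sum_l partial l (fun x => cal_field x ord0 l) x = cal_div x.
Proof.
have [cpY ppY] := C1_comp dp cdp CkY.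
have cX l : Ck 1 (fun x : 'rV[R]_n => x ord0 l - x0 ord0 l).
  by apply: CkB; [exact: Ck_coord|exact: Ck_cst].
have pX l x : partial l (fun x : 'rV[R]_n => x ord0 l - x0 ord0 l) x = 1.
  by rewrite (partialD l x (Ck_coord 1 l) (Ck_cst _ 1 (- x0 ord0 l))) partial_cst partial_coord eqxx addr0.
have cc : Ck 1 (fun x => c * (p \o Y) x) by apply: CkM => //; exact: Ck_cst.
have E l : (fun x => cal_field x ord0 l) = (fun x => c * (p \o Y) x * (x ord0 l - x0 ord0 l)).
  by apply/funext => x; rewrite !mxE.
split=> [l|x]; first by rewrite E; exact: CkM.
rewrite /cal_div /sq /dotrv mulr_suml mulr_sumr.
rewrite (_ : N * (c * p (Y x)) = \sum_(l < n) (c * p (Y x))); last first.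
  by rewrite sumr_const card_ord mulr_natl.
rewrite -sumrB; apply: eq_bigr => l _; rewrite E (partialM l x cc (cX l)) pX mulr1.
rewrite (partialM l x (Ck_cst _ 1 c) cpY) partial_cst ppY partialY !mxE /=.
by field; rewrite gt_eqF.
Qed.

Let sq_ge0 x : 0 <= sq x. Proof. exact: dotrv_ge0. Qed.

Let Ysq x : sq x / b ^+ 2 = 1 + Y x. Proof. by rewrite /Y; ring. Qed.

Let Yge x : -1 <= Y x.
Proof. by rewrite /Y lerBrDl subrr divr_ge0 ?sqr_ge0. Qed.

Let field_sq x : enorm (cal_field x) ^+ 2 = (11 / 20) ^+ 2 * p (Y x) ^+ 2 * (1 + Y x).
Proof.
rewrite enorm_sqE /cal_field dotrvZl dotrvZr -/(sq x).
have -> : sq x = b ^+ 2 * (1 + Y x) by rewrite -Ysq; field; rewrite gt_eqF.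
by rewrite -cb; ring.
Qed.

(** [33 / 16 / N] is [2 / N + eps / 2], the zero of [p]: up to there the potential increases
    outwards, and going further would not raise it. *)
Definition cal_radius := b * Num.sqrt (1 + 33 / 16 / N).

Let rad x : eball x0 cal_radius x -> Y x <= 33 / 16 / N.
Proof.
have r0 : 0 <= 1 + 33 / 16 / N by rewrite addr_ge0// !divr_ge0// ltW.
move=> /eball_sqE; rewrite mulr_ge0 ?sqrtr_ge0 ?(ltW b0)// => /(_ isT).
by rewrite exprMn sqr_sqrtr// -ltr_pdivrMl ?exprn_gt0// mulrC => /ltW; rewrite -/(sq x) Ysq; lra.
Qed.

Let p_bounds y : y <= 33 / 16 / N -> -1 <= p y <= 1.
Proof.
move=> yN; have [r0 _ r1] := ramp_bounds y eps0.
have : N / 2 * ramp eps y <= 33 / 32.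
  apply: (@le_trans _ _ (N / 2 * (33 / 16 / N))).
    rewrite ler_wpM2l ?divr_ge0 ?(ltW N0)//; apply: le_trans r1 _.
    by rewrite ge_max yN !divr_ge0// ltW.
  by rewrite le_eqVlt; apply/orP; left; apply/eqP; field; rewrite gt_eqF.
have : 0 <= N / 2 * ramp eps y by rewrite mulr_ge0// divr_ge0// ltW.
by rewrite /p => h1 h2; apply/andP; split; lra.
Qed.

Lemma cal_radius_gt0 : 0 < cal_radius.
Proof. by rewrite mulr_gt0// sqrtr_gt0 addr_gt0// !divr_gt0. Qed.

Lemma cal_radius_lt : cal_radius < (4 * N + Num.sqrt 2) * I.
Proof.
have s2 := sqr_sqrtr (ler0n R 2); have s0 := sqrtr_ge0 (2 : R).
set s := Num.sqrt 2 in s2 s0 *.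
have s1 : 7 / 5 <= s by rewrite -ler_sqr ?nnegrE//; lra.
have r0 : 0 <= 1 + 33 / 16 / N by rewrite addr_ge0// !divr_ge0// ltW.
have N1' := N1; have NN : 0 <= N * (N - 1) by rewrite mulr_ge0// subr_ge0.
have k0 : 0 <= (4 * N + s) * I by rewrite mulr_ge0 ?(ltW I0)//; lra.
rewrite -ltr_sqr ?nnegrE ?(ltW cal_radius_gt0)// exprMn sqr_sqrtr//.
have -> : b ^+ 2 * (1 + 33 / 16 / N) = (196 / 25 * N ^+ 2 + 1617 / 100 * N) * I ^+ 2.
  by rewrite /b; field; rewrite gt_eqF.
rewrite exprMn ltr_pM2r ?exprn_gt0//.
have : N * (7 / 5) <= N * s by rewrite ler_wpM2l// ltW.
by nra.
Qed.

Lemma cal_field_le1 x : eball x0 cal_radius x -> enorm (cal_field x) <= 1.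
Proof.
move=> /rad yN; have /andP[p1 p2] := p_bounds yN.
rewrite -ler_sqr ?nnegrE ?enorm_ge0// expr1n field_sq.
have h1 : p (Y x) ^+ 2 <= 1 by nra.
(* The worst case is [N = 1]; the length of the field is then at most [11 / 20] times [7 / 4], below
   1. *)
have h2 : 1 + Y x <= 49 / 16.
  have : 33 / 16 / N <= 33 / 16 by rewrite ler_pdivrMr// ler_peMr//; lra.
  lra.
have := Yge x; have := sqr_ge0 (p (Y x)).
have : p (Y x) ^+ 2 * (1 + Y x) <= 1 * (49 / 16) by apply: ler_pM => //; [exact: sqr_ge0|have := Yge x; lra].
lra.
Qed.

Lemma cal_div_bounded : exists D, forall x, eball x0 cal_radius x -> `|cal_div x| <= D.
Proof.
exists (5 * (N * c)) => x /rad yN; have /andP[p1 p2] := p_bounds yN.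
have /andP[d0 d1] := dramp_bounds (Y x) eps0; have Yx := Yge x.
have Nc : 0 <= N * c by rewrite mulr_ge0 ?(ltW N0) ?(ltW c0).
have N1' := N1; have Y1 : 1 + Y x <= 4.
  have : 33 / 16 / N <= 33 / 16 by rewrite ler_pdivrMr ?(ltW N0)// ler_peMr//.
  lra.
have dY : 0 <= dramp eps (Y x) * (1 + Y x) <= 4.
  rewrite mulr_ge0//=; last by lra.
  by rewrite -[leRHS]mul1r; apply: ler_pM => //; lra.
rewrite /cal_div Ysq (_ : _ - _ = N * c * (p (Y x) - dramp eps (Y x) * (1 + Y x))); last by ring.
rewrite normrM (ger0_norm Nc) mulrC ler_wpM2r//.
by move: dY => /andP[? ?]; rewrite ler_norml; apply/andP; split; lra.
Qed.

(** The potential is normalised to vanish at [Y = eps], where the transition of [dramp] ends, and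
    below [eps] it is not positive. Past [eps] the divergence is explicit and each of its terms has
    the right sign. *)
Lemma cal_div_above x : eball x0 cal_radius x -> 0 < cal_pot x -> cal_div x <= 0.
Proof.
move=> xr; rewrite /cal_pot pmulr_rgt0; last by rewrite divr_gt0// mulr_gt0// exprn_gt0.
rewrite subr_gt0 => GY.
have ey : eps <= Y x.
  rewrite leNgt; apply/negP => /ltW ye.
  move: GY; apply/negP; rewrite -leNgt /G.
  have := ramp_primitive_le eps0 ye.
  have : N / 2 * (ramp_primitive eps eps - ramp_primitive eps (Y x)) <= N / 2 * ((eps - Y x) * (eps / 2)).
    by rewrite ler_wpM2l ?divr_ge0 ?(ltW N0)//; exact: ramp_primitive_le.
  have -> : N / 2 * ((eps - Y x) * (eps / 2)) = (eps - Y x) * (eps * N) / 4 by field.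
  by rewrite epsN; lra.
rewrite /cal_div dramp_ge// /p ramp_ge// Ysq.
have -> : N * (c * (1 - N / 2 * (Y x - eps / 2))) - c * N * 1 * (1 + Y x) =
   - (N * c * (Y x + N / 2 * (Y x - eps / 2))) by ring.
have e0 := eps0; have Nc : 0 <= N * c by rewrite mulr_ge0 ?(ltW N0) ?(ltW c0).
rewrite oppr_le0; apply: mulr_ge0 => //; apply: addr_ge0; first by lra.
by apply: mulr_ge0; [rewrite divr_ge0 ?(ltW N0)|lra].
Qed.

(** For [Y <= eps] it is a numerical check: |X|^2 is at most [(11 / 20)^2 (9 / 8) < 0.341], and
    [T div X] at most [(3 / 4) (11 / 56) < 0.148]. For [Y > eps] the divergence is nonpositive and
    |X| <= 1 suffices. *)
Lemma cal_core x T : 0 <= T -> T <= 3 / 4 * I -> eball x0 cal_radius x -> cal_pot x <= 0 ->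
  0 <= (1 - enorm (cal_field x) ^+ 2) / 2 - Num.max (cal_div x) 0 * T /\
  (Y x <= eps -> 1 / 10 <= (1 - enorm (cal_field x) ^+ 2) / 2 - Num.max (cal_div x) 0 * T).
Proof.
move=> T0 TI xr px.
have F1 : enorm (cal_field x) ^+ 2 <= 1 by rewrite expr_le1 ?enorm_ge0// cal_field_le1.
have core : Y x <= eps -> 1 / 10 <= (1 - enorm (cal_field x) ^+ 2) / 2 - Num.max (cal_div x) 0 * T.
  move=> ye; have /andP[p1 p2] := p_bounds (rad xr).
  have e0 := eps0; have I0' := I0; have Yx := Yge x; have N1' := N1.
  have /andP[d0 d1] := dramp_bounds (Y x) eps0.
  have eN : eps <= 8^-1 by rewrite /eps lef_pV2 ?posrE ?mulr_gt0//; lra.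
  have h1 : enorm (cal_field x) ^+ 2 <= (11 / 20) ^+ 2 * (9 / 8).
    rewrite field_sq -mulrA ler_wpM2l ?sqr_ge0//.
    have : p (Y x) ^+ 2 <= 1 by nra.
    have := sqr_ge0 (p (Y x)); nra.
  have NcI : N * c * I = 11 / 56 by rewrite /c /b; field; rewrite !gt_eqF.
  have Nc : 0 <= N * c by rewrite mulr_ge0 ?(ltW N0) ?(ltW c0).
  have dY : 0 <= dramp eps (Y x) * (1 + Y x) by rewrite mulr_ge0//; lra.
  have h2 : cal_div x <= N * c.
    rewrite /cal_div Ysq (_ : _ - _ = N * c * (p (Y x) - dramp eps (Y x) * (1 + Y x))); last by ring.
    by rewrite ler_piMr//; lra.
  have h3 : Num.max (cal_div x) 0 * T <= N * c * (3 / 4 * I).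
    by apply: ler_pM => //; [rewrite le_max lexx orbT|rewrite ge_max h2].
  have -> : 1 / 10 = 1 / 10 :> R by [].
  by move: h3; rewrite mulrCA NcI; lra.
split => //; have [/core|ey] := leP (Y x) eps; first by lra.
have : cal_div x <= 0.
  rewrite /cal_div dramp_ge ?(ltW ey)// /p ramp_ge ?(ltW ey)// Ysq.
  have -> : N * (c * (1 - N / 2 * (Y x - eps / 2))) - c * N * 1 * (1 + Y x) =
     - (N * c * (Y x + N / 2 * (Y x - eps / 2))) by ring.
  have e0 := eps0; have Nc : 0 <= N * c by rewrite mulr_ge0 ?(ltW N0) ?(ltW c0).
  rewrite oppr_le0; apply: mulr_ge0 => //; apply: addr_ge0; first by lra.
  by apply: mulr_ge0; [rewrite divr_ge0 ?(ltW N0)|lra].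
by move=> d0; rewrite (max_idPr d0) mul0r subr0; lra.
Qed.

Lemma cal_center : exists2 d, 0 < d & forall x, eball x0 d x ->
  [/\ eball x0 cal_radius x, cal_pot x <= 0 & Y x <= eps].
Proof.
exists (b / 2) => [|x]; first by rewrite divr_gt0.
move=> /eball_sqE; rewrite divr_ge0 ?(ltW b0)// => /(_ isT) xb.
have Y0 : Y x <= - (1 / 2).
  have : sq x / b ^+ 2 <= 1 / 4.
    rewrite ler_pdivrMr ?exprn_gt0//; apply: le_trans (ltW xb) _.
    by rewrite le_eqVlt; apply/orP; left; apply/eqP; field.
  by rewrite Ysq; lra.
have e0 := eps0; have b0' := b0.
have r0 : 0 <= 1 + 33 / 16 / N by rewrite addr_ge0// !divr_ge0// ltW.
split; last by lra.
  apply/eball_sqE; first exact: ltW cal_radius_gt0.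
  have rE : cal_radius ^+ 2 = b ^+ 2 * (1 + 33 / 16 / N) by rewrite /cal_radius exprMn sqr_sqrtr.
  apply: lt_le_trans xb _; rewrite rE exprMn.
  rewrite ler_wpM2l ?sqr_ge0//; have : 0 <= 33 / 16 / N by rewrite !divr_ge0 ?(ltW N0).
  by rewrite exprVn; lra.
rewrite /cal_pot pmulr_rle0; last by rewrite divr_gt0// mulr_gt0// exprn_gt0.
rewrite subr_le0 /G; have ye : Y x <= eps by lra.
have : N / 2 * (ramp_primitive eps eps - ramp_primitive eps (Y x)) <= N / 2 * ((eps - Y x) * (eps / 2)).
  by rewrite ler_wpM2l ?divr_ge0 ?(ltW N0)//; exact: ramp_primitive_le.
have -> : N / 2 * ((eps - Y x) * (eps / 2)) = (eps - Y x) * (eps * N) / 4 by field.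
by rewrite epsN; lra.
Qed.

(** In the variable [z = N Y] the potential is [77 / 100 * I] times a polynomial free of [N], at
    least [14 / 15] on the last shell because its maximum is at the edge. The margin is thin:
    [(77 / 100) (14 / 15) > 0.7186], against [17 / 24 + 1 / 100 < 0.7184], where [17 / 24] is just
    above [1 / sqrt 2]. *)
Lemma cal_edge T : 0 <= T -> T ^+ 2 <= I ^+ 2 / 2 -> exists2 r, r < cal_radius &
  forall x, eball x0 cal_radius x -> ~ ecball x0 r x -> T + I / 100 <= cal_pot x.
Proof.
move=> T0 TI; pose w := 33 / 16 / N - 1 / 10 / N.
have N1' := N1; have I0' := I0.
have wE : w = 157 / 80 / N by rewrite /w; field; rewrite gt_eqF.
have w0 : 0 < w by rewrite wE !divr_gt0.
have wN : w < 33 / 16 / N by rewrite /w gtrBl !divr_gt0.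
exists (b * Num.sqrt (1 + w)).
  rewrite /cal_radius ltr_pM2l// ltr_sqrt; lra.
move=> x xr nx; have yN := rad xr.
have wY : w <= Y x.
  rewrite leNgt; apply/negP => Yw; apply: nx; rewrite /ecball/=.
  have s0 : 0 <= b * Num.sqrt (1 + w) by rewrite mulr_ge0 ?sqrtr_ge0 ?(ltW b0).
  rewrite -ler_sqr ?nnegrE ?enorm_ge0// enorm_sqE exprMn sqr_sqrtr; last by lra.
  by rewrite -ler_pdivrMl ?exprn_gt0// mulrC -/(sq x) Ysq; lra.
have ey : eps <= Y x.
  apply: le_trans wY; rewrite wE.
  by rewrite /eps invfM ler_wpM2r ?invr_ge0 ?(ltW N0)//; lra.
have kE : c * b ^+ 2 / 2 = 77 / 100 * N * I by rewrite /c /b; field; rewrite !gt_eqF.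
rewrite /cal_pot kE /G (ramp_primitive_ge eps0 ey) (ramp_primitive_ge eps0 (lexx _)).
pose z := N * Y x.
have YE : Y x = z / N by rewrite /z; field; rewrite gt_eqF.
have z1 : 157 / 80 <= z.
  by move: wY; rewrite wE ler_pdivrMr// /z [N * _]mulrC.
have z2 : z <= 33 / 16 by move: yN; rewrite ler_pdivlMr// mulrC.
have -> : 77 / 100 * N * I * (Y x - N / 2 * (Y x ^+ 2 / 2 - Y x * eps / 2 + eps ^+ 2 / 6) -
    (eps - N / 2 * (eps ^+ 2 / 2 - eps * eps / 2 + eps ^+ 2 / 6))) =
    77 / 100 * I * (z - 8^-1 - (z ^+ 2 / 4 - z / 32)).
  by rewrite YE /eps; field; rewrite gt_eqF.
have h1 : 14 / 15 <= z - 8^-1 - (z ^+ 2 / 4 - z / 32) by nra.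
have h2 : T <= 17 / 24 * I.
  have k0 : 0 <= 17 / 24 * I by rewrite mulr_ge0 ?(ltW I0).
  rewrite -ler_sqr ?nnegrE// (_ : (17 / 24 * I) ^+ 2 = 289 / 576 * I ^+ 2); last by field.
  have := sqr_ge0 I; lra.
have : 77 / 100 * I * (14 / 15) <= 77 / 100 * I * (z - 8^-1 - (z ^+ 2 / 4 - z / 32)).
  by rewrite ler_wpM2l// mulr_ge0 ?(ltW I0)//; lra.
by lra.
Qed.

End field.

(** * Integrals and null sets without measurability *)

Section null_sets.
Import HBNNSimple.
Context d (T : measurableType d) (R : realType) (mu : {measure set T -> \bar R}).
Implicit Types (f g : T -> \bar R) (D N : set T).
Local Open Scope ereal_scope.

(** No measurability of [f] and [g] is available: [W] is arbitrary outside the ball. The integral is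
    a supremum over simple functions below, and each of these may be set to 0 on [N] without
    changing its integral. *)
Let ge0_null_le f g N : (forall x, 0 <= f x) -> (forall x, 0 <= g x) ->
  measurable N -> mu N = 0 -> (forall x, ~ N x -> f x = g x) -> \int[mu]_x f x <= \int[mu]_x g x.
Proof.
move=> f0 g0 mN N0 fg; rewrite !ge0_integralTE//.
apply: ge_ereal_sup => _ [h hf <-]; apply: ereal_sup_ubound.
pose h' := mul_nnsfun h (indic_nnsfun R (measurableC mN)).
have h'E x : h' x = (h x * \1_(~` N) x)%R by [].
exists h' => [x|].
  rewrite h'E indicE; have [Nx|nNx] := pselect (N x).
    by rewrite memNset ?mulr0//; exact.
  by rewrite mem_set// mulr1 -fg.
rewrite -!integralT_nnsfun; apply: ae_eq_integral => //; try exact/measurable_EFinP.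
exists N; split => // x /= nx; apply: contrapT => nNx; apply: nx => _.
by rewrite [LHS](_ : _ = (h x * \1_(~` N) x)%:E)// indicE mem_set// mulr1.
Qed.

Lemma null_integral f g D N : measurable N -> mu N = 0 ->
  (forall x, D x -> ~ N x -> f x = g x) -> \int[mu]_(x in D) f x = \int[mu]_(x in D) g x.
Proof.
move=> mN N0 fg; rewrite [LHS]integral_mkcond [RHS]integral_mkcond integralE [RHS]integralE.
have fgD x : ~ N x -> (f \_ D) x = (g \_ D) x.
  by move=> nNx; rewrite /patch; case: ifPn => // /set_mem Dx; exact: fg.
have pe (h h' : T -> \bar R) : (forall x, 0 <= h x) -> (forall x, 0 <= h' x) ->
    (forall x, ~ N x -> h x = h' x) -> \int[mu]_x h x = \int[mu]_x h' x.
  move=> h0 h'0 hh'; apply/eqP; rewrite eq_le; apply/andP; split; apply: (ge0_null_le _ _ mN N0) => //.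
  by move=> x nN; rewrite hh'.
congr (_ - _); apply: pe => // x nNx.
  by rewrite !funeposE fgD.
by rewrite !funenegE fgD.
Qed.

Lemma null_Rintegral (f g : T -> R) D N : measurable N -> mu N = 0 ->
  (forall x, D x -> ~ N x -> f x = g x) -> (\int[mu]_(x in D) f x)%R = (\int[mu]_(x in D) g x)%R.
Proof.
move=> mN N0 fg; congr fine; apply: (null_integral mN N0) => x Dx nNx.
by rewrite (fg x Dx nNx).
Qed.

Lemma ae_null (D : set T) (P : T -> Prop) : {ae mu, forall x, D x -> P x} ->
  exists N, [/\ measurable N, mu N = 0 & forall x, D x -> ~ N x -> P x].
Proof.
move=> [N [mN N0 PN]]; exists N; split => // x Dx nNx.
by apply: contrapT => nP; apply: nNx; apply: PN => /= H; apply: nP; exact: H.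
Qed.

End null_sets.

(** * Passage to the limit under the integral *)

Section liminf.
Context d (T : measurableType d) (R : realType) (mu : {measure set T -> \bar R}).

(* Dominated convergence for [min (f k) c], which converges to [c]. *)
Lemma liminf_integral_le0 (D : set T) (f : nat -> T -> R) (g c : T -> R) : measurable D ->
  (forall k, mu.-integrable D (EFin \o f k)) -> mu.-integrable D (EFin \o g) ->
  mu.-integrable D (EFin \o c) -> (forall x, D x -> 0 <= c x) ->
  (forall k x, D x -> - g x <= f k x) ->
  (forall x e, D x -> 0 < e -> exists K, forall k, (K <= k)%N -> c x - e <= f k x) ->
  (forall k, \int[mu]_(x in D) f k x <= 0) -> \int[mu]_(x in D) c x <= 0.
Proof.
move=> mD fi gi ci c0 gf cf f0.
pose h k x := Num.min (f k x) (c x).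
have mf k : measurable_fun D (f k) by apply/measurable_EFinP; exact: measurable_int (fi k).
have mc : measurable_fun D c by apply/measurable_EFinP; exact: measurable_int ci.
have mh k : measurable_fun D (h k) by exact: measurable_minr.
have hle k x : D x -> `|h k x| <= `|g x| + `|c x|.
  move=> Dx; have := gf k x Dx; have := c0 x Dx; rewrite /h => C0 G.
  have := ler_norm (g x); have := normr_ge0 (g x); rewrite (ger0_norm C0) ler_norml.
  by case: (leP (f k x) (c x)) => fc k1 k2; apply/andP; split; lra.
have Gi : mu.-integrable D (fun x => (`|g x| + `|c x|)%:E).
  exact: (integrableD mD (integrable_abse gi) (integrable_abse ci)).
have hi k : mu.-integrable D (EFin \o h k).
  apply: (le_integrable mD _ _ Gi); first exact/measurable_EFinP.
  by move=> x Dx; rewrite /= lee_fin [leRHS]ger0_norm ?addr_ge0// hle.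
have hc : (fun k => \int[mu]_(x in D) (h k x)%:E)%E @ \oo --> (\int[mu]_(x in D) (c x)%:E)%E.
  apply: (dominated_cvg mD (f_ := fun k x => (h k x)%:E) (g := fun x => (`|g x| + `|c x|)%:E)) => //.
  - by move=> k; exact/measurable_EFinP.
  - move=> x Dx; apply: cvg_EFin; first by exists 0%N.
    apply/cvgrPdist_le => e e0; have [K HK] := cf x e Dx e0; exists K => // k /= Kk.
    have := HK k Kk; rewrite /h; case: (leP (f k x) (c x)) => fc hk.
      by rewrite ger0_norm ?subr_ge0//; lra.
    by rewrite subrr normr0 ltW.
rewrite /Rintegral; apply: fine_le0.
rewrite -(cvg_lim _ hc)//; apply: lime_le; first by apply/cvg_ex; eexists; exact: hc.
apply: nearW => k; apply: (@le_trans _ _ (\int[mu]_(x in D) (f k x)%:E)%E).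
  by apply: (le_integral mD (hi k) (fi k)) => x _; rewrite lee_fin /h ge_min lexx.
by have := f0 k; rewrite /Rintegral -lee_fin fineK//; exact: integrable_fin_num (fi k).
Qed.

End liminf.

(** * Borel measurability and change of representative *)

Section borel.
Context {R : realType} (n m : nat).
Local Notation mu := (lebesgue_rV n : {sigma_finite_measure set 'rV[R]_n -> \bar R}).
Implicit Types (w D : set 'rV[R]_n) (v : 'rV[R]_n -> 'rV[R]_m) (G : 'rV[R]_n -> 'M[R]_(m, n)).

Lemma measurable_fun_rV D v : measurable D -> (forall i, measurable_fun D (component i v)) -> measurable_fun D v.
Proof.
move=> mD mv; apply: (@measurability _ _ _ _ _ _ (@mx_cylinder R 1 m)) => //.
move=> _ [_ [i [j [B mB ->]]] <-].
by rewrite (ord1 i); exact: (mv j mD B mB).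
Qed.

(* Cutting off the junk values of [W] outside the ball makes it Borel. *)
Definition cutball (q : R) (W : 'rV[R]_m -> R) z := if enorm z <= q then W z else 0.

Lemma continuous_enorm : continuous (fun z : 'rV[R]_m => enorm z).
Proof.
have := @continuous_enorm_dist R m 0.
by under eq_fun do rewrite subr0.
Qed.

(** For [r >= 0] the superlevel set lies in the closed ball and, by semicontinuity relative to the
    ball, is the trace of an open set; for [r < 0] it is the whole space. *)
Lemma measurable_cutball (q : R) (W : 'rV[R]_m -> R) :
  (forall z, cball0 q z -> 0 <= W z) -> lsc_on (cball0 q) W -> measurable_fun setT (cutball q W).
Proof.
move=> W0 lW; apply: (measurability (@RGenOInfty.G R)) => [|/= _ [_] [r] -> <-].
  exact: RGenOInfty.measurableE.
rewrite setTI; have [r0|r0] := ltP r 0.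
  rewrite (_ : _ @^-1` _ = setT)//; apply/seteqP; split => // z _ /=.
  rewrite in_itv/= andbT /cutball; case: ifPn => [zq|_] //.
  exact: lt_le_trans r0 (W0 _ zq).
have mB : measurable [set z : 'rV[R]_m | enorm z <= q].
  apply: closed_measurable_rV.
  by have := closed_comp (fun x _ => @continuous_enorm x) (@closed_le R q); apply.
pose V := [set z | exists2 U, open U & U z /\ (forall y, U y -> cball0 q y -> r < W y)].
have oV : open V.
  rewrite openE => z [U oU [Uz HU]]; rewrite /interior.
  have : nbhs z U by exact: open_nbhs_nbhs.
  by apply: filterS => y Uy; exists U.
rewrite (_ : _ @^-1` _ = [set z : 'rV[R]_m | enorm z <= q] `&` V).
  by apply: measurableI => //; exact: open_measurable_rV.
apply/seteqP; split => z /=; rewrite in_itv/= andbT /cutball.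
  case: ifPn => [zq rW|_]; last by rewrite ltNge r0.
  have rW' : 0 < W z - r by rewrite subr_gt0.
  split => //; have [U zU HU] := lsc_onE lW zq rW'.
  exists U°; first exact: open_interior.
  split; first exact: nbhs_singleton (nbhs_interior zU).
  by move=> y /interior_subset Uy By; have := HU y Uy By; rewrite opprB addrC subrK.
by move=> [zq [U oU [Uz HU]]]; rewrite zq; exact: HU.
Qed.

(** Allows the exchange of [u] with its continuous representative. Measurability of the new function
    is a separate hypothesis because the sigma-algebra is not completed. *)
Lemma weak_gradient_ae w v v' G : measurable w ->
  {ae mu, forall x, w x -> v x = v' x} -> (forall i, measurable_fun w (component i v')) ->
  weak_gradient w v G -> weak_gradient w v' G.
Proof.
move=> mw /ae_null[N [mN N0 vN]] mv wv i j; have [[mvi Lv] LG wk] := wv i j.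
have cN x : w x -> ~ N x -> component i v x = component i v' x by move=> wx nNx; rewrite /component vN.
split => //.
- split => // K cK Kw; rewrite (@null_integral _ _ _ mu _ (fun x => `|component i v x|%:E) K N)//.
    exact: Lv.
  by move=> x Kx nNx; rewrite cN//; exact: Kw.
- move=> f tf; rewrite -wk//; apply: (null_Rintegral mN N0) => x wx nNx.
  by rewrite cN.
Qed.

Lemma W12_gradient_ae w v v' G : measurable w ->
  {ae mu, forall x, w x -> v x = v' x} -> (forall i, measurable_fun w (component i v')) ->
  W12_gradient w v G -> W12_gradient w v' G.
Proof.
move=> mw vv' mv [wv Lv LG]; split => //; first exact: weak_gradient_ae wv.
have [N [mN N0 vN]] := ae_null vv'.
move=> i; split => //; have [_] := Lv i.
rewrite (@null_integral _ _ _ mu (fun x => (component i v x ^+ 2)%:E) (fun x => (component i v' x ^+ 2)%:E) w N)//.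
by move=> x wx nNx; rewrite /component vN.
Qed.

Lemma energy_ae (W W' : 'rV[R]_m -> R) w v v' G :
  {ae mu, forall x, w x -> W (v x) = W' (v' x)} -> energy W w v G = energy W' w v' G.
Proof.
move=> /ae_null[N [mN N0 vN]]; apply: (null_integral mN N0) => x wx nNx.
by rewrite vN.
Qed.

End borel.

(** * The competitor and the divergence theorem *)

Section competitor.
Context {R : realType} (n m : nat).
Local Notation mu := (lebesgue_rV n : {sigma_finite_measure set 'rV[R]_n -> \bar R}).
Variables (a Q H QP HP : R -> R) (A : R).
Hypotheses (a_nd : {homo a : s t / s <= t}) (a_le0 : forall s, s <= 0 -> a s = 0)
  (a_gt0 : forall s, 0 < s -> 0 < a s) (aA : forall s, a s <= A)
  (QF : monotone_primitive a Q) (Q_le0 : forall s, s <= 0 -> Q s = 0)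
  (HF : monotone_primitive (a \o H) H) (H_le0 : forall s, s <= 0 -> H s = 0)
  (H_gt0 : forall s, 0 < s -> 0 < H s)
  (QPF : monotone_primitive (Q \o Num.sqrt) QP) (HPF : monotone_primitive H HP).
Variables (w : set 'rV[R]_n) (Mw : R).
Hypotheses (mw : measurable w) (wM : forall x, w x -> `|x| <= Mw).
Variables (psi : 'rV[R]_n -> R) (X : 'rV[R]_n -> 'rV[R]_n).
Hypotheses (cpsi : Ck 1 psi) (ppsi : forall l x, partial l psi x = X x ord0 l).
Variables (u : 'rV[R]_n -> 'rV[R]_m) (G : 'rV[R]_n -> 'M[R]_(m, n)).
Hypothesis su : forall i, sob w (component i u) (fun l => entry i l G).
Variable j : R.
Hypothesis j0 : 0 < j.

Let k0 : 0 < (j ^+ 2)^-1. Proof. by rewrite invr_gt0 exprn_gt0. Qed.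

Let spsi : sob w psi (fun l x => X x ord0 l).
Proof.
by apply: (sob_ext _ _ (sob_C1 mw wM cpsi)) => // l x _; exact: ppsi.
Qed.

Let ci : continuous (fun y : R => y). Proof. by move=> y; exact: cvg_id. Qed.
Let ce (c : R) : continuous (fun y : R => c). Proof. by move=> y; exact: cvg_cst. Qed.

Lemma sob_sqnorm : sob w (fun x => dotrv (u x) (u x)) (fun l x => 2 * (u x *m G x) ord0 l).
Proof.
have h := sob_sum mw wM (index_enum 'I_m) (fun i => sobM mw (su i) (su i)).
apply: (sob_ext _ _ h) => // l x _; rewrite !mxE mulr_sumr.
by apply: eq_bigr => i _; rewrite /component /entry; ring.
Qed.

Let phi_n0 y : phi HP j y != 0.
Proof. by rewrite gt_eqF//; exact: (phi_gt0 H_le0 H_gt0 HPF). Qed.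

Let dphi2 (y : R) : is_derive y 1 (fun y => phi HP j y ^+ 2) (2 * phi HP j y * dphi H j y).
Proof.
have d := is_derive_phi a_le0 a_gt0 aA HF HPF j y.
by apply: (derive_eq (is_deriveM d d)); rewrite /GRing.scale/=; ring.
Qed.

Let dphiV (y : R) : is_derive y 1 (fun y => (phi HP j y ^+ 2)^-1) (- 2 * dphi H j y / phi HP j y ^+ 3).
Proof.
have p2 : phi HP j y ^+ 2 != 0 by rewrite expf_neq0.
apply: (derive_eq (@is_deriveV R (fun y => phi HP j y ^+ 2) y _ 1 p2 (dphi2 y))).
by rewrite /GRing.scale/=; field.
Qed.

Let cphi : continuous (phi HP j).
Proof.
move=> y; apply/differentiable_continuous/derivable1_diffP.
by have [] := is_derive_phi a_le0 a_gt0 aA HF HPF j y.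
Qed.

Let cdphi : continuous (dphi H j).
Proof. exact: (continuous_dphi a_le0 a_gt0 aA HF). Qed.

Let cdphiV : continuous (fun y => - 2 * dphi H j y / phi HP j y ^+ 3).
Proof.
move=> y; apply: cvgM; first by apply: cvgM; [exact: cvg_cst|exact: cdphi].
apply: cvgV; first by rewrite expf_neq0.
have c2 : continuous (fun y => phi HP j y * (phi HP j y * phi HP j y)).
  by apply: continuousMf => //; exact: continuousMf.
exact: c2.
Qed.

Let sstep : sob w (fun x => step (j * psi x)) (fun l x => dstep (j * psi x) * j * X x ord0 l).
Proof.
have d (y : R) : is_derive y 1 (fun y => step (j * y)) (dstep (j * y) * j).
  have dm : is_derive y 1 (fun y : R => j * y) j.
    have d1 := is_deriveZ j (is_derive_id (y : R) (1 : R)).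
    by apply: (derive_eq d1); rewrite [LHS]mulr1.
  exact: (@is_derive1_comp R step (fun y : R => j * y) y _ _ (is_derive_step _) dm).
have cj : continuous (fun y : R => j * y) by exact: continuousMf.
have c : continuous (fun y => dstep (j * y) * j).
  apply: continuousMf => // y; apply: (continuous_comp (cj y)); exact: continuous_dstep.
exact: (sob_comp mw d c spsi).
Qed.

Lemma sob_scal : sob w (fun x => scal HP j (psi x) (dotrv (u x) (u x)))
  (fun l x => dscal H HP j (psi x) (u x) (G x) (X x) ord0 l).
Proof.
have sV := sob_comp mw dphiV cdphiV spsi.
have st := sobM mw sob_sqnorm sV.
have strunc := sob_comp mw (fun t => is_derive_trunc t k0) (continuous_dtrunc k0) st.
have sp := sobM mw sstep strunc.
apply: (sob_ext _ _ sp) => // l x _.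
rewrite /dscal.
have -> (k1 k2 k3 k4 : R) (v : 'rV[R]_n) : (k1 *: X x + k2 *: (k3 *: v - k4 *: X x)) ord0 l =
    k1 * X x ord0 l + k2 * (k3 * v ord0 l - k4 * X x ord0 l) by rewrite !mxE.
by rewrite /=; field.
Qed.

Lemma sob_gradcomp i : sob w (component i (fun x : 'rV[R]_n => scal HP j (psi x) (dotrv (u x) (u x)) *: u x))
  (fun l => entry i l (fun x : 'rV[R]_n => gradcomp H HP j (psi x) (u x) (G x) (X x))).
Proof.
apply: (sob_ext _ _ (sobM mw sob_scal (su i))) => [x _|l x _].
  by rewrite /component mxE.
have E c (B : 'M[R]_(m, n)) (v : 'rV[R]_n) (z : 'rV[R]_m) :
    (c *: B + z^T *m v) i l = c * B i l + z ord0 i * v ord0 l by rewrite !mxE big_ord1 !mxE.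
by rewrite /entry /component /gradcomp E.
Qed.

Lemma sob_flux : sob w (fun x => flux QP HP j (psi x) (dotrv (u x) (u x)))
  (fun l x => dflux Q H QP HP j (psi x) (u x) (G x) (X x) ord0 l).
Proof.
have dq (t : R) : is_derive t 1 (qreg QP j) (dqreg Q j t).
  exact: (is_derive_qreg a_le0 a_gt0 aA QF QPF).
have cdq : continuous (dqreg Q j) by exact: (continuous_dqreg a_le0 a_gt0 aA QF).
have s1 := sob_comp mw dq cdq sob_sqnorm.
have d2 (y : R) : is_derive y 1 (fun y => - qreg QP j (phi HP j y ^+ 2) + (j ^+ 2)^-1)
    (- (dqreg Q j (phi HP j y ^+ 2) * (2 * phi HP j y * dphi H j y))).
  have d := @is_derive1_comp R (qreg QP j) (fun y => phi HP j y ^+ 2) y _ _ (dq _) (dphi2 y).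
  by apply: (derive_eq (is_deriveD (is_deriveN d) (is_derive_cst _ _ _))); rewrite addr0.
have c2 : continuous (fun y => - (dqreg Q j (phi HP j y ^+ 2) * (2 * phi HP j y * dphi H j y))).
  have cp2 : continuous (fun y => phi HP j y ^+ 2) by exact: continuousMf.
  have cdp : continuous (fun y => dqreg Q j (phi HP j y ^+ 2)).
    by move=> y; apply: (continuous_comp (cp2 y)); exact: cdq.
  have cpp : continuous (fun y => 2 * phi HP j y * dphi H j y).
    by apply: continuousMf => //; exact: continuousMf.
  by move=> y; apply: cvgN; exact: (continuousMf cdp cpp).
have s2 := sob_comp mw d2 c2 spsi.
have s3 := sob_comp mw (fun t => is_derive_ramp t k0) (@continuous_dramp R _) (sobD mw s1 s2).
apply: (sob_ext _ _ s3) => [x _|l x _].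
  by rewrite /flux /flux_arg /= addrA.
rewrite /dflux.
have -> (k1 k2 k3 : R) (v : 'rV[R]_n) : (k1 *: (k2 *: v - k3 *: X x)) ord0 l =
    k1 * (k2 * v ord0 l - k3 * X x ord0 l) by rewrite !mxE.
by rewrite /flux_arg /= addrA; ring.
Qed.

End competitor.

Section divergence.
Context {R : realType} (n : nat).
Local Notation mu := (lebesgue_rV n : {sigma_finite_measure set 'rV[R]_n -> \bar R}).
Variables (w : set 'rV[R]_n) (Mw : R).
Hypotheses (ow : open w) (wM : forall x, w x -> `|x| <= Mw).

Let mw := open_measurable_rV ow.

Lemma integrable_enorm_sq m (G : 'rV[R]_n -> 'M[R]_(m, n)) :
  (forall i l, measurable_fun w (entry i l G) /\ (sqn mu w (entry i l G) < +oo)%E) ->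
  mu.-integrable w (fun x => (enorm (G x) ^+ 2)%:E).
Proof.
move=> mG; apply: (@eq_integrable _ _ _ mu _ mw (fun x => \sum_(i < m) \sum_(l < n) (entry i l G x ^+ 2)%:E)%E).
  by move=> x _; rewrite enorm_sq -sumEFin; apply: eq_bigr => i _; rewrite -sumEFin.
apply: integrable_sum => // i _; apply: integrable_sum => // l _.
have [ml il] := mG i l; apply/integrableP; split; first exact: measurable_sq.
by apply: le_lt_trans il; rewrite le_eqVlt; apply/orP; left; apply/eqP;
  apply: eq_integral => x _; rewrite abse_EFin ger0_norm// sqr_ge0.
Qed.

Variables (X : 'rV[R]_n -> 'rV[R]_n) (N : 'rV[R]_n -> R) (dN : 'rV[R]_n -> 'rV[R]_n).
Hypotheses (cX : forall l, Ck 1 (fun x => X x ord0 l)) (sN : sob w N (fun l x => dN x ord0 l)).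

Let integrable_dN l : mu.-integrable w (EFin \o (fun x => dN x ord0 l)).
Proof. by have [_ _ /(_ l)[ml il] _] := sN; exact: (sqn_L1 mw wM ml il). Qed.

Let bounded_cont (f : 'rV[R]_n -> R) : continuous f -> exists C, forall x, w x -> `|f x| <= C.
Proof.
move=> cf; have [C fC] := @compact_bounded_fun _ _ _ f (@compact_le_norm R n Mw) (fun x _ => cf x).
by exists C => x wx; apply: fC; exact: wM.
Qed.

Let meas_cont (f : 'rV[R]_n -> R) : continuous f -> measurable_fun w f.
Proof. by move=> cf; apply: measurable_funTS; exact: continuous_measurable_rV. Qed.

Let cpX l : continuous (partial l (fun x => X x ord0 l)).
Proof. by have [_ /(_ l)[_ c]] := cX l. Qed.

Let integrable_term l : mu.-integrable w (fun x => (dN x ord0 l * X x ord0 l)%:E).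
Proof.
have [C XC] := bounded_cont (Ck0 (cX l)).
exact: (integrable_mul_bounded mw (integrable_dN l) (meas_cont (Ck0 (cX l))) XC).
Qed.

Let integrable_N : mu.-integrable w (EFin \o N).
Proof. by have [[C NC] mN _ _] := sN; exact: (bounded_integrable mw wM mN NC). Qed.

Let integrable_term' l : mu.-integrable w (fun x => (N x * partial l (fun x => X x ord0 l) x)%:E).
Proof.
have [C XC] := bounded_cont (@cpX l).
exact: (integrable_mul_bounded mw integrable_N (meas_cont (@cpX l)) XC).
Qed.

Lemma integrable_divergence :
  mu.-integrable w (fun x => (dotrv (X x) (dN x) + (\sum_l partial l (fun x => X x ord0 l) x) * N x)%:E).
Proof.
apply: (@eq_integrable _ _ _ mu _ mw (fun x => \sum_(l < n) ((dN x ord0 l * X x ord0 l)%:E +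
   (N x * partial l (fun x => X x ord0 l) x)%:E))%E).
  move=> x _; rewrite /dotrv mulr_suml -big_split/= -sumEFin; apply: eq_bigr => l _.
  by rewrite -EFinD; congr EFin; ring.
by apply: integrable_sum => // l _; apply: integrableD.
Qed.

(** Each component of [X], times a cut-off equal to 1 near [K], is a C^1 test function for the weak
    gradient of [N]; the cut-off disappears from the result because [N] and [dN] vanish off [K]. *)
Lemma integral_divergence_eq0 K : compact K -> K `<=` w ->
  (forall x, w x -> ~ K x -> N x = 0 /\ dN x = 0) ->
  \int[mu]_(x in w) (dotrv (X x) (dN x) + (\sum_l partial l (fun x => X x ord0 l) x) * N x) = 0.
Proof.
move=> cK Kw N0.
have [chi [d [K' [d0 schi chi1 [cK' K'w] chi0]]]] := cutoff_exists cK ow Kw.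
have Kchi x : K x -> {near x, chi =1 cst 1}.
  move=> Kx; apply/nbhs_ballP; exists d => //= y; rewrite -ball_normE/= => xy.
  by apply: (chi1 y x) => //; rewrite -normrN opprB.
have term l : \int[mu]_(x in w) (dN x ord0 l * X x ord0 l + N x * partial l (fun x => X x ord0 l) x) = 0.
  have cg : Ck 1 (fun x => chi x * X x ord0 l) by apply: CkM => //; exact: schi.
  have gK x : ~ K' x -> chi x * X x ord0 l = 0 by move=> nK; rewrite chi0// mul0r.
  have := sob_weak mw wM l sN cg cK' K'w gK.
  have -> : \int[mu]_(x in w) (N x * partial l (fun x => chi x * X x ord0 l) x) =
     \int[mu]_(x in w) (N x * partial l (fun x => X x ord0 l) x).
    apply: eq_Rintegral => x /set_mem wx; have [Kx|nKx] := pselect (K x); last first.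
      by have [-> _] := N0 x wx nKx; rewrite !mul0r.
    congr (_ * _); apply: partial_eq_near; apply: filterS (Kchi x Kx) => y /= ->.
    by rewrite mul1r.
  have -> : \int[mu]_(x in w) (dN x ord0 l * (chi x * X x ord0 l)) = \int[mu]_(x in w) (dN x ord0 l * X x ord0 l).
    apply: eq_Rintegral => x /set_mem wx; have [Kx|nKx] := pselect (K x); last first.
      by have [_ ->] := N0 x wx nKx; rewrite mxE !mul0r.
    by have /nbhs_singleton -> := Kchi x Kx; rewrite mul1r.
  move=> E; have D := RintegralD mw (integrable_term l) (integrable_term' l).
  by apply: etrans D _; rewrite addrC; apply/eqP; rewrite addr_eq0; apply/eqP; exact: E.
transitivity (\int[mu]_(x in w) (\sum_(l < n) (dN x ord0 l * X x ord0 l + N x * partial l (fun x => X x ord0 l) x))).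
  apply: eq_Rintegral => x _; rewrite /dotrv mulr_suml -big_split/=; apply: eq_bigr => l _; ring.
rewrite /Rintegral; under eq_integral do rewrite -sumEFin.
rewrite integral_sum//; last by move=> l; under eq_fun do rewrite EFinD; exact: integrableD.
rewrite big1// => l _; rewrite -[LHS]fineK; first by rewrite [X in X%:E](term l).
apply: integrable_fin_num => //.
by under eq_fun do rewrite EFinD; exact: integrableD.
Qed.

End divergence.

(** * Minimality tested with the truncated competitor *)

Section comparison.
Context {R : realType} (n m : nat).
Local Notation mu := (lebesgue_rV n : {sigma_finite_measure set 'rV[R]_n -> \bar R}).
Variables (a Q H QP HP : R -> R) (A : R).
Hypotheses (a_nd : {homo a : s t / s <= t}) (a_le0 : forall s, s <= 0 -> a s = 0)
  (a_gt0 : forall s, 0 < s -> 0 < a s) (aA : forall s, a s <= A)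
  (QF : monotone_primitive a Q) (Q_le0 : forall s, s <= 0 -> Q s = 0)
  (HF : monotone_primitive (a \o H) H) (H_le0 : forall s, s <= 0 -> H s = 0)
  (H_gt0 : forall s, 0 < s -> 0 < H s)
  (QPF : monotone_primitive (Q \o Num.sqrt) QP) (HPF : monotone_primitive H HP).
Variables (W : 'rV[R]_m -> R) (q M : R).
Hypotheses (W_bounds : forall z, enorm z <= q -> 0 <= W z <= M) (mW : measurable_fun setT W).
Variables (w : set 'rV[R]_n) (Mw : R).
Hypotheses (ow : open w) (wM : forall x, w x -> `|x| <= Mw).
Variables (psi : 'rV[R]_n -> R) (X : 'rV[R]_n -> 'rV[R]_n) (d : 'rV[R]_n -> R) (D : R).
Hypotheses (cpsi : Ck 1 psi) (ppsi : forall l x, partial l psi x = X x ord0 l)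
  (cX : forall l, Ck 1 (fun x => X x ord0 l))
  (dX : forall x, \sum_l partial l (fun x => X x ord0 l) x = d x).
Variables (u : 'rV[R]_n -> 'rV[R]_m) (G : 'rV[R]_n -> 'M[R]_(m, n)).
Hypotheses (su : forall i, sob w (component i u) (fun l => entry i l G))
  (uq : forall x, w x -> enorm (u x) <= q)
  (min : forall xi, W12_0 w xi -> (forall x, w x -> enorm (u x + xi x) <= q) ->
    forall Gv, weak_gradient w (fun x => u x + xi x) Gv ->
    (energy W w u G <= energy W w (fun x => (u x + xi x)%R) Gv)%E).
Variables (K : set 'rV[R]_n) (j : R).
Hypotheses (j1 : 1 <= j) (cK : compact K) (Kw : K `<=` w)
  (offK : forall x, w x -> ~ K x -> [/\ 1 <= j * psi x,
     dotrv (u x) (u x) / phi HP j (psi x) ^+ 2 <= 1 - (j ^+ 2)^-1 &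
     flux_arg QP HP j (psi x) (dotrv (u x) (u x)) <= 0]).

Let mw := open_measurable_rV ow.
Let j0 : 0 < j. Proof. exact: lt_le_trans j1. Qed.

Let th x := scal HP j (psi x) (dotrv (u x) (u x)).
Let Gv x := gradcomp H HP j (psi x) (u x) (G x) (X x).
Let N x := flux QP HP j (psi x) (dotrv (u x) (u x)).
Let dN x := dflux Q H QP HP j (psi x) (u x) (G x) (X x).

Let th01 x : 0 <= th x <= 1.
Proof. by rewrite /th -enorm_sqE; exact: scal_bounds. Qed.

Let thq x : w x -> enorm (th x *: u x) <= q.
Proof.
move=> /uq uxq; have /andP[t0 t1] := th01 x.
by rewrite enormZ//; apply: le_trans uxq; rewrite ler_piMl// enorm_ge0.
Qed.

Let sth i : sob w (component i (fun x => th x *: u x)) (fun l => entry i l Gv).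
Proof. exact: (sob_gradcomp a_le0 a_gt0 aA HF H_le0 H_gt0 HPF mw wM cpsi ppsi su j0). Qed.

Let sN : sob w N (fun l x => dN x ord0 l).
Proof. exact: (sob_flux a_le0 a_gt0 aA QF HF QPF HPF mw wM cpsi ppsi su j0). Qed.

Let off x : w x -> ~ K x -> [/\ th x = 1, Gv x = G x, N x = 0 & dN x = 0].
Proof.
move=> wx nKx; have [h1 h2 h3] := offK wx nKx.
have [E1 E2 E3 E4 _] := gain_inactive Q H W (G x) (X x) 0 j1 h1 h2 h3.
by split => //; rewrite /Gv /gradcomp E1 E2 mulmx0 addr0 scale1r.
Qed.

Let mcomp (v : 'rV[R]_n -> 'rV[R]_m) (B : 'rV[R]_n -> 'M[R]_(m, n)) :
  (forall i, sob w (component i v) (fun l => entry i l B)) -> forall i, measurable_fun w (component i v).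
Proof. by move=> sv i; have [] := sv i. Qed.

Let integrable_energy (v : 'rV[R]_n -> 'rV[R]_m) (B : 'rV[R]_n -> 'M[R]_(m, n)) :
  (forall i, sob w (component i v) (fun l => entry i l B)) -> (forall x, w x -> enorm (v x) <= q) ->
  mu.-integrable w (fun x => (2^-1 * enorm (B x) ^+ 2 + W (v x))%:E).
Proof.
move=> sv vq; under eq_fun do rewrite EFinD; apply: integrableD => //.
  under eq_fun do rewrite EFinM; apply: integrableZl => //; apply: (integrable_enorm_sq ow).
  by move=> i l; have [_ _ /(_ l)] := sv i.
have mWv : measurable_fun w (fun x => W (v x)).
  by apply: (measurableT_comp mW); apply: measurable_fun_rV => //; exact: (mcomp sv).
apply: (@bounded_integrable _ _ w Mw mw wM _ M mWv) => x wx.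
by have /andP[h1 h2] := W_bounds (vq x wx); rewrite ger0_norm.
Qed.

Let E1 x := 2^-1 * enorm (G x) ^+ 2 + W (u x).
Let E2 x := 2^-1 * enorm (Gv x) ^+ 2 + W (th x *: u x).
Let F x := dotrv (X x) (dN x) + (\sum_l partial l (fun x => X x ord0 l) x) * N x.

Let iE1 : mu.-integrable w (EFin \o E1). Proof. exact: integrable_energy. Qed.
Let iE2 : mu.-integrable w (EFin \o E2). Proof. exact: (integrable_energy sth thq). Qed.
Let iF : mu.-integrable w (EFin \o F). Proof. exact: (integrable_divergence ow wM cX sN). Qed.

Let gainE x : gain Q H QP HP W j (psi x) (u x) (G x) (X x) (d x) = E1 x - E2 x - F x.
Proof.
rewrite /F dX; have aux (p r s t : R) : p - s - r - t = p - s - (r + t) by ring.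
exact: aux.
Qed.

Lemma integrable_gain :
  mu.-integrable w (EFin \o (fun x => gain Q H QP HP W j (psi x) (u x) (G x) (X x) (d x))).
Proof.
apply: (@eq_integrable _ _ _ mu _ mw (fun x => ((EFin \o E1) x - (EFin \o E2) x - (EFin \o F) x)%E)).
  by move=> x _; rewrite /= gainE.
by apply: integrableB => //; exact: integrableB.
Qed.

Let xi x := (th x - 1) *: u x.

Let u_xi x : u x + xi x = th x *: u x.
Proof. by rewrite /xi scalerBl scale1r addrC subrK. Qed.

(** Off the compact set [K] the competitor equals [u] exactly, so the perturbation has compact
    support and no trace argument is needed. *)
Let W120 : W12_0 w xi.
Proof.
have sxi i : sob w (component i xi) (fun l => entry i l (fun x => Gv x - G x)).
  have sc : sob w (fun x => -1 : R) (fun l x => 0).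
    apply: (sob_ext _ _ (sob_C1 mw wM (Ck_cst n 1 (-1 : R)))) => // l x _.
    by rewrite partial_cst.
  have := sobD mw (sth i) (sobM mw sc (su i)); apply: sob_ext => [x _|l x _].
    by rewrite /component !mxE; ring.
  by rewrite /entry /component !mxE; ring.
apply: (sob_W12_0 ow wM cK Kw sxi) => x wx nKx.
have [h1 h2 _ _] := off wx nKx.
by rewrite /xi h1 h2 !subrr scale0r.
Qed.

Lemma integral_gain_le0 :
  \int[mu]_(x in w) gain Q H QP HP W j (psi x) (u x) (G x) (X x) (d x) <= 0.
Proof.
have E12 : \int[mu]_(x in w) E1 x <= \int[mu]_(x in w) E2 x.
  have := min W120 _ (Gv := Gv); rewrite /energy => le12.
  apply: fine_le; [exact: integrable_fin_num|exact: integrable_fin_num|].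
  have -> : (\int[mu]_(x in w) (EFin \o E2) x = \int[mu]_(x in w) (2^-1 * enorm (Gv x) ^+ 2 + W (u x + xi x)%R)%:E)%E.
    by apply: eq_integral => x _; rewrite /= u_xi.
  apply: le12 => [x wx|]; first by rewrite u_xi; exact: thq.
  have -> : (fun x => u x + xi x) = (fun x => th x *: u x) by apply/funext => x; exact: u_xi.
  by have [] := sob_W12_gradient ow wM sth.
have F0 : \int[mu]_(x in w) F x = 0.
  by apply: (integral_divergence_eq0 ow wM cX sN cK Kw) => x wx nKx; have [_ _] := off wx nKx.
have -> : \int[mu]_(x in w) gain Q H QP HP W j (psi x) (u x) (G x) (X x) (d x) =
    \int[mu]_(x in w) (E1 x - E2 x - F x).
  by apply: eq_Rintegral => x _; exact: gainE.
have iE : mu.-integrable w (EFin \o (fun x => E1 x - E2 x)).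
  have := integrableB mw iE1 iE2; apply: eq_integrable => //.
rewrite RintegralB// RintegralB// F0 subr0 subr_le0.
exact: E12.
Qed.

End comparison.

(** * Vanishing at the centre of the ball *)

Section vanishing.
Context {R : realType} (n m : nat).
Local Notation mu := (lebesgue_rV n : {sigma_finite_measure set 'rV[R]_n -> \bar R}).
Variables (a Q H QP HP : R -> R) (A : R).
Hypotheses (a_nd : {homo a : s t / s <= t}) (a_le0 : forall s, s <= 0 -> a s = 0)
  (a_gt0 : forall s, 0 < s -> 0 < a s) (aA : forall s, a s <= A)
  (a_lc : forall s e, 0 < s -> 0 < e -> exists2 d, 0 < d & forall t, s - d < t -> t <= s -> a s - e <= a t)
  (QF : monotone_primitive a Q) (Q_le0 : forall s, s <= 0 -> Q s = 0)
  (HF : monotone_primitive (a \o H) H) (H_le0 : forall s, s <= 0 -> H s = 0)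
  (H_gt0 : forall s, 0 < s -> 0 < H s)
  (QPF : monotone_primitive (Q \o Num.sqrt) QP) (HPF : monotone_primitive H HP).
Variables (W : 'rV[R]_m -> R) (q M : R).
Hypotheses (q0 : 0 <= q) (W0 : W 0 = 0)
  (W_bounds : forall z, enorm z <= q -> 0 <= W z <= M) (mW : measurable_fun setT W)
  (W_drop : forall z c, enorm z <= q -> 0 <= c <= 1 ->
    (a (enorm z) ^+ 2 - a (c * enorm z) ^+ 2) / 2 <= W z - W (c *: z)).
Variables (x0 : 'rV[R]_n) (I T : R).
Hypotheses (n0 : (0 < n)%N) (I0 : 0 < I) (T0 : 0 <= T) (TI : T ^+ 2 <= I ^+ 2 / 2)
  (HT : forall t, T < t -> q < H t) (aT : forall s, 0 <= s <= q -> s <= T * a s).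
Let w := eball x0 (cal_radius n I).
Variables (u : 'rV[R]_n -> 'rV[R]_m) (G : 'rV[R]_n -> 'M[R]_(m, n)).
Hypotheses (cu : forall x, w x -> {for x, continuous u})
  (su : forall i, sob w (component i u) (fun l => entry i l G))
  (uq : forall x, w x -> enorm (u x) <= q)
  (min : forall xi, W12_0 w xi -> (forall x, w x -> enorm (u x + xi x) <= q) ->
    forall Gv, weak_gradient w (fun x => u x + xi x) Gv ->
    (energy W w u G <= energy W w (fun x => (u x + xi x)%R) Gv)%E).

Let psi := cal_pot x0 I.
Let X := cal_field x0 I.
Let d := cal_div x0 I.

Let ow : open w. Proof. exact: open_eball. Qed.
Let mw : measurable w. Proof. exact: open_measurable_rV. Qed.
Let wM x : w x -> `|x| <= `|x0| + cal_radius n I.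
Proof. by move=> /eballW; exact: ecball_norm. Qed.

(** On the last shell [psi] exceeds [T] by [eta = I / 100]. Half of this margin absorbs the lag
    [2 / j] of [phi], the other half gives [H (T + eta / 2) > q >= |u|], the strict gap that
    [inactive] requires. *)
Let edge : exists2 K, compact K /\ K `<=` w & exists2 J, 1 <= J & forall j, J <= j ->
  forall x, w x -> ~ K x -> [/\ 1 <= j * psi x,
     dotrv (u x) (u x) / phi HP j (psi x) ^+ 2 <= 1 - (j ^+ 2)^-1 &
     flux_arg QP HP j (psi x) (dotrv (u x) (u x)) <= 0].
Proof.
have [r rr psiK] := cal_edge x0 n0 I0 T0 TI.
exists (ecball x0 r).
  split; first exact: compact_ecball.
  by move=> x xr; exact: le_lt_trans rr.
pose eta := I / 100; have eta0 : 0 < eta by rewrite divr_gt0.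
have qr1 : q < H (T + eta / 2) by apply: HT; rewrite ltrDl divr_gt0.
have [J1 J11 HJ1] := inactive a_le0 a_gt0 QF QPF q0 qr1.
have [J2 J21 HJ2] := @eventually_inv R (eta / 4) ltac:(by rewrite divr_gt0).
exists (Num.max J1 J2); first by rewrite le_max J11.
move=> j; rewrite ge_max => /andP[jJ1 /HJ2 j2] x wx nKx.
have j1 : 1 <= j by exact: le_trans J11 jJ1.
have j0 : 0 < j by exact: lt_le_trans j1.
have px : T + eta <= psi x by exact: psiK.
have jpsi : 1 <= j * psi x.
  rewrite -ler_pdivrMl// mulr1; apply: (le_trans j2).
  by apply: le_trans px; move: T0 eta0; lra.
have r1p : H (T + eta / 2) <= phi HP j (psi x).
  have /andP[h _] := phi_bounds HPF (psi x) j0.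
  have : H (T + eta / 2) <= H (psi x - 2 / j).
    by apply: (H_homo a_le0 a_gt0 HF); move: px j2; lra.
  have k : 0 <= (j ^+ 2)^-1 :> R by rewrite invr_ge0 sqr_ge0.
  by lra.
have uu : 0 <= enorm (u x) <= q by rewrite enorm_ge0 uq.
have [h1 h2] := HJ1 j _ _ jJ1 r1p uu.
by rewrite enorm_sqE in h1 h2.
Qed.

Let TI34 : T <= 3 / 4 * I.
Proof.
rewrite -ler_sqr ?nnegrE ?mulr_ge0 ?(ltW I0)//; apply: le_trans TI _.
have -> : (3 / 4 * I) ^+ 2 = 9 / 16 * I ^+ 2 by field.
by have := sqr_ge0 I; lra.
Qed.

Let gn j x := gain Q H QP HP W j (psi x) (u x) (G x) (X x) (d x).

Let QT s : 0 <= s <= q -> Q s <= T * a s ^+ 2.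
Proof.
move=> sq; have /andP[s0 _] := sq; have /andP[_ h] := QF s0.
rewrite (Q_le0 (lexx 0)) !subr0 in h; apply: le_trans h _.
rewrite expr2 mulrA ler_wpM2r ?aT//.
by have [/a_le0->//|/a_gt0/ltW] := leP s 0.
Qed.

Let center := cal_center x0 n0 I0.

Lemma vanishing_center : u x0 = 0.
Proof.
apply: contrapT => u0; have [d1 d10 cen] := center.
have s00 : 0 < enorm (u x0).
  by rewrite lt_neqAle enorm_ge0 andbT eq_sym; apply/eqP => /enorm_eq0.
pose s0 := enorm (u x0) / 2; have sp : 0 < s0 by rewrite divr_gt0.
pose U := [set x | eball x0 d1 x /\ s0 < enorm (u x)].
have Uw : U `<=` w by move=> x [/cen[]].
have oU : open U.
  rewrite openE => x [xd1 sx]; rewrite /interior.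
  have n1 : nbhs x (eball x0 d1) by apply: open_nbhs_nbhs; split => //; exact: open_eball.
  have ce : {for x, continuous (fun x => enorm (u x))}.
    by apply: (continuous_comp (cu (Uw _ (conj xd1 sx)))); exact: continuous_enorm.
  have n2 : nbhs x [set y | s0 < enorm (u y)].
    have := ce [set r | s0 < r]; apply.
    by apply: open_nbhs_nbhs; split => //; exact: open_gt.
  by apply: filterS2 n1 n2 => y; split.
have Ux0 : U x0.
  by split; [rewrite /eball/= subrr enorm0|rewrite /s0; lra].
have mU : measurable U by exact: open_measurable_rV.
have Uoo : (mu U < +oo)%E.
  apply: le_lt_trans (measure_le_norm_lty n (`|x0| + cal_radius n I)); apply: le_measure; rewrite ?inE//.
    by apply: closed_measurable_rV; exact: closed_le_norm.
  by move=> x /Uw/wM.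
(* The factor 1/10 is the surplus granted by [cal_core] where [Y <= eps], which includes the ball of
   radius [d1]. *)
pose c0 := a s0 ^+ 2 / 10.
have c00 : 0 < c0 by rewrite divr_gt0// exprn_gt0// a_gt0.
pose c (x : 'rV[R]_n) : R := c0 * \1_U x.
have [K [cK Kw] [J J1 edgeJ]] := edge.
pose jk (k : nat) := J + k%:R.
have Jk k : J <= jk k by rewrite lerDl.
have jk1 k : 1 <= jk k by exact: le_trans J1 (Jk k).
have [cpsi ppsi] := Ck_cal_pot x0 n0 I0; have [cX dX] := Ck_cal_field x0 n0 I0.
have [D dD] := cal_div_bounded x0 n0 I0.
have D0 : 0 <= D.
  by apply: le_trans (dD x0 _); rewrite ?normr_ge0// /eball/= subrr enorm0 cal_radius_gt0.
have [C C0 gainC] := gain_ge n a_le0 a_gt0 aA QF Q_le0 HF H_le0 H_gt0 QPF HPF q0 W_bounds D0.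
have ig k : mu.-integrable w (EFin \o gn (jk k)).
  apply: (integrable_gain a_le0 a_gt0 aA QF HF H_le0 H_gt0 QPF HPF W_bounds mW ow wM cpsi ppsi cX dX su uq).
  exact: jk1.
have ig0 k : \int[mu]_(x in w) gn (jk k) x <= 0.
  apply: (integral_gain_le0 a_le0 a_gt0 aA QF HF H_le0 H_gt0 QPF HPF W_bounds mW ow wM cpsi ppsi cX dX su uq min _ cK Kw).
    exact: jk1.
  exact: edgeJ.
have cU x : w x -> 0 <= c x <= c0.
  by move=> _; rewrite /c indicE; case: (x \in U); rewrite ?mulr0 ?mulr1 ?lexx ?(ltW c00).
have mc : measurable_fun w c.
  by apply: measurable_funM => //; apply: measurable_funTS; exact: measurable_indic.
have ic : mu.-integrable w (EFin \o c).
  apply: (@bounded_integrable _ _ w _ mw wM c c0 mc) => x /cU/andP[h1 h2].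
  by rewrite ger0_norm.
have iG : mu.-integrable w (EFin \o (fun x => C * (1 + enorm (G x) ^+ 2))).
  apply: (@eq_integrable _ _ _ mu _ mw (fun x => C%:E * (1 + (enorm (G x) ^+ 2)%:E))%E).
    by move=> x _; rewrite -EFinD -EFinM.
  apply: integrableZl => //; apply: integrableD => //.
    by apply: (@bounded_integrable _ _ w _ mw wM (cst 1) 1) => // x _; rewrite normr1.
  apply: (integrable_enorm_sq ow) => i l.
  by have [_ _ /(_ l)] := su i.
have lower k x : w x -> - (C * (1 + enorm (G x) ^+ 2)) <= gn (jk k) x.
  by move=> wx; apply: gainC; [exact: jk1|exact: uq|exact: cal_field_le1|exact: dD].
(* Three regions: the core, where [psi <= 0], then |u| below the barrier, then |u| above it. The
   threshold depends on [x], which pointwise convergence allows. *)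
have eventually x e : w x -> 0 < e -> exists2 J', 1 <= J' & forall j, J' <= j -> c x - e <= gn j x.
  move=> wx e0; have X1 : enorm (X x) <= 1 by exact: cal_field_le1.
  have ux := uq wx; have uxq : 0 <= enorm (u x) <= q by rewrite enorm_ge0.
  have [px|px] := leP (psi x) 0.
    have [J' J'1 HJ'] := gain_core a_le0 a_gt0 aA a_lc QF Q_le0 HF H_le0 H_gt0 QPF HPF W0 W_drop (d x) px ux X1 e0.
    exists J' => // j jJ'; apply: le_trans (HJ' j (G x) jJ').
    rewrite lerD2r.
    have [k0 k1] := cal_core n0 I0 T0 TI34 wx px.
    have dm : 0 <= Num.max (d x) 0 by rewrite le_max lexx orbT.
    have h1 := ler_wpM2l dm (QT uxq).
    have a2 := sqr_ge0 (a (enorm (u x))).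
    have h2 : 0 <= a (enorm (u x)) ^+ 2 * ((1 - enorm (X x) ^+ 2) / 2 - Num.max (d x) 0 * T) by exact: mulr_ge0.
    rewrite /c indicE; have [xU|xU] := boolP (x \in U); last by rewrite mulr0; lra.
    rewrite mulr1; move: xU => /set_mem [xd1 sx].
    have [_ _ Ye] := cen x xd1.
    have h3 := ler_wpM2l a2 (k1 Ye).
    have h4 : a s0 ^+ 2 <= a (enorm (u x)) ^+ 2.
      have b0 := ltW (a_gt0 sp); have b1 : a s0 <= a (enorm (u x)) by apply: a_nd; exact: ltW.
    by rewrite lerXn2r// nnegrE// (le_trans b0).
    rewrite /c0 -/X -/d in h3 *; lra.
  have -> : c x = 0.
    rewrite /c indicE memNset ?mulr0// => -[/cen[_ + _] _].
    by rewrite leNgt px.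
  rewrite sub0r; have dx : d x <= 0 by exact: cal_div_above.
  have [uH|uH] := ltP (enorm (u x)) (H (psi x)).
    have [J' J'1 HJ'] := gain_below n a_nd a_le0 a_gt0 aA QF HF H_gt0 QPF HPF W px uH e0.
    by exists J' => // j jJ'; exact: HJ'.
  have [J' J'1 HJ'] := gain_above a_nd a_le0 a_gt0 aA a_lc QF Q_le0 HF H_le0 H_gt0 QPF HPF W_drop px uH ux X1 dx e0.
  by exists J' => // j jJ'; exact: HJ'.
have ev x e : w x -> 0 < e -> exists k0, forall k, (k0 <= k)%N -> c x - e <= gn (jk k) x.
  move=> wx e0; have [J' J'1 HJ'] := eventually x e wx e0.
  exists (Num.bound J') => k k0; apply: HJ'.
  have J'0 : 0 <= J' by exact: le_trans J'1.
  apply: (@le_trans _ _ k%:R); last by rewrite /jk lerDr; exact: le_trans J1.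
  by apply: (le_trans (ltW (archi_boundP J'0))); rewrite ler_nat.
have := liminf_integral_le0 mw ig iG ic (fun x wx => (andP (cU x wx)).1) lower ev ig0.
apply/negP; rewrite -ltNge.
have -> : \int[mu]_(x in w) c x = c0 * fine (mu U).
  rewrite /Rintegral/= (_ : (\int[mu]_(x in w) (c x)%:E)%E = (c0%:E * mu U)%E).
    by rewrite -[mu U]fineK//= ge0_fin_numE.
  under eq_integral do rewrite EFinM.
  rewrite ge0_integralZl//; last 2 first.
  - by apply/measurable_EFinP; apply: measurable_funTS; exact: measurable_indic.
  - by rewrite lee_fin ltW.
  by rewrite integral_indic// setIidl.
rewrite mulr_gt0// fine_gt0// Uoo andbT.
exact: measure_open_gt0 oU Ux0.
Qed.

End vanishing.

(** * The speed attached to [Wrad] *)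

Section radial_speed.
Context {R : realType}.
Local Notation mu := (@lebesgue_measure R : {sigma_finite_measure set (measurableTypeR R) -> \bar R}).
Variables (Wrad : R -> R) (q : R).
Hypotheses (q0 : 0 < q) (Wrad_0 : Wrad 0 = 0)
  (Wrad_nondecreasing : forall r s, 0 <= r -> r <= s -> s <= q -> Wrad r <= Wrad s)
  (Wrad_lsc : lsc_on `[0, q]%classic Wrad)
  (Wrad_gt0 : forall s, 0 < s <= q -> 0 < Wrad s)
  (Iq_finite : (I_ Wrad q < +oo)%E).

(** Set to 0 on the left and frozen beyond [q], it is nondecreasing and bounded on the whole line,
    as the profiles require, and its inverse has a primitive that tends to infinity. *)
Definition radial_speed (s : R) : R := if s <= 0 then 0 else Num.sqrt (2 * Wrad (Num.min s q)).
Local Notation a := radial_speed.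

Lemma radial_speed_le0 s : s <= 0 -> a s = 0.
Proof. by rewrite /a => ->. Qed.

Let min_q s : 0 < s -> 0 < Num.min s q <= q.
Proof. by move=> s0; rewrite lt_min s0 q0 ge_min lexx orbT. Qed.

Lemma radial_speed_gt0 s : 0 < s -> 0 < a s.
Proof.
by move=> s0; rewrite /a (leNgt s 0) s0/= sqrtr_gt0 mulr_gt0// Wrad_gt0// min_q.
Qed.

Lemma radial_speed_homo : {homo a : s t / s <= t}.
Proof.
move=> s t st; have [s0|s0] := leP s 0.
  rewrite radial_speed_le0//; have [t0|/radial_speed_gt0/ltW//] := leP t 0.
  by rewrite radial_speed_le0.
have t0 := lt_le_trans s0 st.
rewrite /a (leNgt s 0) (leNgt t 0) s0 t0/= ler_wsqrtr// ler_wpM2l//.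
have /andP[h1 h2] := min_q s0; have /andP[h3 h4] := min_q t0.
apply: Wrad_nondecreasing => //; first exact: ltW.
by rewrite le_min !ge_min st lexx orbT.
Qed.

Lemma radial_speed_q s : q <= s -> a s = a q.
Proof.
by move=> qs; rewrite /a (leNgt s 0) (leNgt q 0) q0 (lt_le_trans q0 qs)/= minxx min_r.
Qed.

Lemma radial_speed_le s : a s <= a q.
Proof.
have [/radial_speed_homo//|/ltW/radial_speed_q->//] := leP s q.
Qed.

Lemma radial_speed_sq s : 0 <= s <= q -> a s ^+ 2 / 2 = Wrad s.
Proof.
move=> /andP[]; rewrite le_eqVlt => /predU1P[<- _|s0 sq].
  by rewrite radial_speed_le0// Wrad_0 expr0n mul0r.
have W0 : 0 < Wrad s by rewrite Wrad_gt0// s0.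
rewrite /a (leNgt s 0) s0/= min_l// sqr_sqrtr ?mulr_ge0 ?(ltW W0)//.
by rewrite mulrAC mulfV// mul1r.
Qed.

(** Lower semicontinuity of [Wrad] at [s] gives the bound on the side of [[0, q]]; beyond [q] the
    speed is constant. *)
Lemma radial_speed_left (s e : R) : 0 < s -> 0 < e ->
  exists2 d, 0 < d & forall t, s - d < t -> t <= s -> a s - e <= a t.
Proof.
move=> s0 e0; have [qs|sq] := ltP q s.
  exists (s - q); first by rewrite subr_gt0.
  move=> t; rewrite opprB addrC subrK => qt _.
  by rewrite !radial_speed_q ?(ltW qs) ?(ltW qt)// lerBlDr lerDl ltW.
have sI : 0 <= s <= q by rewrite (ltW s0).
have b0 := radial_speed_gt0 s0.
(* Reduced so that [a s - e1] is nonnegative and the comparison of squares can be undone. *)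
pose e1 := Num.min e (a s).
have e10 : 0 < e1 by rewrite lt_min e0.
have e1e : e1 <= e by rewrite ge_min lexx.
have e1b : e1 <= a s by rewrite ge_min lexx orbT.
pose r := (a s ^+ 2 - (a s - e1) ^+ 2) / 2.
have r0 : 0 < r by rewrite divr_gt0// (_ : _ - _ = e1 * (a s + (a s - e1)));
  [rewrite mulr_gt0//; lra|ring].
have sI' : `[0, q]%classic s by rewrite /= in_itv.
have [V /nbhs_ballP[d /= d0 dV] HV] := lsc_onE Wrad_lsc sI' r0.
exists (Num.min d s); first by rewrite lt_min d0.
move=> t; rewrite ltrBlDr -ltrBlDl lt_min => /andP[td ts] st.
have t0 : 0 < t by lra.
have tI : 0 <= t <= q by rewrite (ltW t0) (le_trans st).
have : Wrad s - r < Wrad t.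
  apply: HV; last by rewrite /= in_itv.
  by apply: dV; rewrite /ball/= ger0_norm ?subr_ge0//; lra.
rewrite -(radial_speed_sq sI) -(radial_speed_sq tI) /r => h.
apply: (@le_trans _ _ (a s - e1)); first by lra.
have at0 := ltW (radial_speed_gt0 t0).
rewrite -ler_sqr ?nnegrE ?subr_ge0//; lra.
Qed.

Let aE s : 0 < s <= q -> (a s)^-1 = (Num.sqrt 2)^-1 * (Num.sqrt (Wrad s))^-1.
Proof.
by move=> /andP[s0 sq]; rewrite /a (leNgt s 0) s0/= min_l// sqrtrM// invfM.
Qed.

Let measurable_inv : measurable_fun (`]0, q]%classic : set (measurableTypeR R)) (fun s : R => (a s)^-1).
Proof.
apply: (measurability (@RGenCInfty.G R)) => [|/= _ [_] [r] -> <-].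
  exact: RGenCInfty.measurableE.
apply: is_interval_measurable => s t [/=]; rewrite !in_itv/= !andbT.
move=> /andP[s0 sq] rs [/andP[t0 tq] rt] v /andP[sv vt].
have v0 := lt_le_trans s0 sv.
rewrite !in_itv/= andbT v0 (le_trans vt)//; split => //; apply: le_trans rt _.
by rewrite lef_pV2 ?posrE ?radial_speed_gt0// radial_speed_homo.
Qed.

Let integralE : (\int[mu]_(s in `]0%R, q]) ((a s)^-1)%:E = (Num.sqrt 2)^-1%:E * I_ Wrad q)%E.
Proof.
rewrite /I_ -ge0_integralZl//=.
  by apply: eq_integral => s; rewrite inE/= in_itv/= => sq; rewrite aE// EFinM.
apply/measurable_EFinP.
apply: (@eq_measurable_fun _ _ _ _ (`]0, q]%classic : set (measurableTypeR R)) (fun s : R => Num.sqrt 2 * (a s)^-1)).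
  move=> s; rewrite inE/= in_itv/= => sq; have s2 : Num.sqrt 2 != 0 :> R by rewrite sqrtr_eq0 -ltNge.
  by rewrite aE// mulVKf.
by apply: measurable_funM => //; exact: measurable_cst.
Qed.

Lemma integrable_radial_speed : mu.-integrable `]0, q] (EFin \o (fun s : R => (a s)^-1)).
Proof.
apply/integrableP; split; first exact/measurable_EFinP.
rewrite (_ : (\int[_]_(_ in _) _)%E = (\int[mu]_(s in `]0%R, q]) ((a s)^-1)%:E)%E).
  by rewrite integralE lte_mul_pinfty// lee_fin invr_ge0.
apply: eq_integral => s; rewrite inE/= in_itv/= => /andP[s0 _].
by rewrite ger0_norm// invr_ge0 ltW// radial_speed_gt0.
Qed.

Lemma Iq_fin_num : I_ Wrad q \is a fin_num.
Proof.
rewrite ge0_fin_numE//; apply: integral_ge0 => s _.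
by rewrite lee_fin.
Qed.

Lemma integral_radial_speed :
  \int[mu]_(s in `]0%R, q]) (a s)^-1 = fine (I_ Wrad q) / Num.sqrt 2.
Proof. by rewrite /Rintegral integralE fineM// ?Iq_fin_num// mulrC. Qed.

End radial_speed.

(** * Reduction to the centre of a ball contained in [Omega] *)

Theorem theorem2p4 (R : realType) (n m : nat) (q : R)
  (W : 'rV[R]_m -> R) (Wrad : R -> R) (W0 : 'rV[R]_m -> R)
  (Omega : set 'rV[R]_n) (u ut : 'rV[R]_n -> 'rV[R]_m)
  (n_gt0 : (0 < n)%N) (m_gt0 : (0 < m)%N) (q_gt0 : 0 < q)
  (* (H1) *)
  (W_ge0 : forall z, cball0 q z -> 0 <= W z)
  (W_at0 : W 0 = 0)
  (* (H2) *)
  (W_lsc : lsc_on (cball0 q) W)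
  (W_bounded : exists M, forall z, cball0 q z -> W z <= M)
  (* (H3) *)
  (W_split : forall z, cball0 q z -> W z = Wrad (enorm z) + W0 z)
  (Wrad_ge0 : forall s, 0 <= s <= q -> 0 <= Wrad s)
  (Wrad_nondecreasing : forall r s, 0 <= r -> r <= s -> s <= q ->
    Wrad r <= Wrad s)
  (Wrad_lsc : lsc_on `[0, q] Wrad)
  (W0_ge0 : forall z, cball0 q z -> 0 <= W0 z)
  (W0_rays : forall (xi : 'rV[R]_m) r s, enorm xi = 1 ->
    0 <= r -> r <= s -> s <= q -> W0 (r *: xi) <= W0 (s *: xi))
  (* (H4) *)
  (Wrad_gt0 : forall s, 0 < s <= q -> 0 < Wrad s)
  (Iq_finite : (I_ Wrad q < +oo)%E)
  (Omega_open : open Omega)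
  (u_W12loc : W12loc Omega u)
  (u_bounded : ae_bounded Omega q u)
  (u_minimizer : local_minimizer W q Omega u)
  (* [ut] is the continuous representative of [u] *)
  (ut_continuous : {within Omega, continuous ut})
  (ut_eq_u : {ae lebesgue_rV n, forall x, Omega x -> ut x = u x}) :
  forall x, Omega x ->
    ((4 * n%:R + Num.sqrt 2)%:E * I_ Wrad q <= dist_boundary Omega x)%E ->
    ut x = 0.
Proof.
have e0 : enorm (0 : 'rV[R]_m) = 0 by exact: enorm0.
have b0 : cball0 q (0 : 'rV[R]_m) by rewrite /cball0/= e0 ltW.
(* Both terms of the splitting of [W] are nonnegative at 0 and their sum is [W 0 = 0]. *)
have Wrad_0 : Wrad 0 = 0.
  have h1 : 0 <= Wrad 0 by apply: Wrad_ge0; rewrite lexx ltW.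
  have h2 := W0_ge0 _ b0; have := W_split _ b0; rewrite W_at0 e0; lra.
pose a := radial_speed Wrad q.
have a_nd : {homo a : s t / s <= t} := radial_speed_homo q_gt0 Wrad_nondecreasing Wrad_gt0.
have a_le0 : forall s, s <= 0 -> a s = 0 := @radial_speed_le0 R Wrad q.
have a_gt0 : forall s, 0 < s -> 0 < a s := radial_speed_gt0 q_gt0 Wrad_gt0.
have a_ge0 s : 0 <= a s by have [/a_le0->//|/a_gt0/ltW] := leP s 0.
have a_sq s : 0 <= s <= q -> a s ^+ 2 / 2 = Wrad s := radial_speed_sq Wrad_0 Wrad_gt0 (s := s).
pose mu1 := @lebesgue_measure R : {sigma_finite_measure set (measurableTypeR R) -> \bar R}.
have ia : mu1.-integrable `]0, q] (EFin \o (fun s : R => (a s)^-1)).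
  exact: integrable_radial_speed.
have [H [HF H_le0 H_gt0]] := calibration_profile q_gt0 a_nd a_le0 a_gt0 (radial_speed_q Wrad q_gt0) ia.
have TE : \int[mu1]_(s in `]0, q]) (a s)^-1 = fine (I_ Wrad q) / Num.sqrt 2.
  exact: integral_radial_speed.
rewrite TE; set I := fine (I_ Wrad q); set T := I / Num.sqrt 2 => HT aT.
have s2 : 0 < Num.sqrt 2 :> R by rewrite sqrtr_gt0.
have T0 : 0 < T.
  rewrite ltNge; apply/negP => T0; have := aT q; rewrite lexx ltW// => /(_ isT).
  by rewrite leNgt (le_lt_trans _ q_gt0)// mulr_le0_ge0.
have I0 : 0 < I by move: T0; rewrite /T pmulr_lgt0 ?invr_gt0.
have TI : T ^+ 2 <= I ^+ 2 / 2 by rewrite /T expr_div_n sqr_sqrtr.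
have [Q QF Q_le0] := nondecreasing_primitive a_nd a_le0.
have Q_nd : {homo Q : s t / s <= t} by exact: monotone_primitive_homo QF a_ge0.
(* A second primitive, here and for [H], so that the averages [qreg] and [phi] are difference
   quotients. *)
have [||QP QPF _] := @nondecreasing_primitive R (Q \o Num.sqrt).
- by move=> s t st; apply: Q_nd; rewrite ler_wsqrtr.
- by move=> s s0; rewrite /= ler0_sqrtr// Q_le0.
have H_nd : {homo H : s t / s <= t} by apply: (monotone_primitive_homo HF) => s; exact: a_ge0.
have [HP HPF _] := nondecreasing_primitive H_nd H_le0.
pose W' := cutball q W.
have W'E z : enorm z <= q -> W' z = W z by rewrite /W' /cutball => ->.
have [M WM] := W_bounded.
have W'_bounds z : enorm z <= q -> 0 <= W' z <= M.
  by move=> zq; rewrite W'E// W_ge0// WM.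
have W'_drop (z : 'rV[R]_m) c : enorm z <= q -> 0 <= c <= 1 ->
    (a (enorm z) ^+ 2 - a (c * enorm z) ^+ 2) / 2 <= W' z - W' (c *: z).
  move=> zq /andP[c0 c1].
  have zc : c * enorm z <= enorm z by rewrite ler_piMl// enorm_ge0.
  have czE : enorm (c *: z) = c * enorm z by exact: enormZ.
  have czq : enorm (c *: z) <= q by rewrite czE (le_trans zc).
  rewrite !W'E// !W_split// mulrBl czE !a_sq ?enorm_ge0 ?mulr_ge0 ?enorm_ge0 ?(le_trans zc)//.
  have [z0|z0] := eqVneq z 0; first by rewrite z0 scaler0; lra.
  have ez : 0 < enorm z.
    by rewrite lt_neqAle enorm_ge0 andbT eq_sym; apply: contra z0 => /eqP/enorm_eq0->.
  (* The radial parts give the squares of the speed exactly; [W0] can only decrease when [z] is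
     shortened along its ray. *)
  have := @W0_rays ((enorm z)^-1 *: z) (c * enorm z) (enorm z).
  rewrite enormZ ?invr_ge0 ?enorm_ge0// mulVf ?gt_eqF// !scalerA mulfK ?gt_eqF// mulfV ?gt_eqF// scale1r.
  by move=> /(_ erefl); rewrite mulr_ge0 ?enorm_ge0// zc zq => /(_ isT isT isT); lra.
have mW' : measurable_fun setT W' by exact: measurable_cutball.
have cut x : Omega x -> {for x, continuous ut}.
  move=> Ox; move: ut_continuous; rewrite continuous_open_subspace// => /(_ x).
  by apply; rewrite inE.
have utq x : Omega x -> enorm (ut x) <= q.
  move=> Ox; rewrite leNgt; apply/negP => qx.
  (* The bound holds almost everywhere and [ut] is continuous: a violation would occupy a nonempty
     open set, which has positive measure. *)
  pose U := [set y | Omega y /\ q < enorm (ut y)].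
  have oU : open U.
    rewrite openE => y [Oy qy]; rewrite /interior.
    have n1 : nbhs y Omega by exact: open_nbhs_nbhs.
    have ce : {for y, continuous (fun x => enorm (ut x))}.
      by apply: (continuous_comp (cut _ Oy)); exact: continuous_enorm.
    have n2 : nbhs y [set y | q < enorm (ut y)].
      have := ce [set r | q < r]; apply.
      by apply: open_nbhs_nbhs; split => //; exact: open_gt.
    by apply: filterS2 n1 n2 => z; split.
  have /ae_null[N [mN N0 HN]] : {ae lebesgue_rV n, forall x, Omega x -> enorm (ut x) <= q}.
    apply: filterS2 ut_eq_u u_bounded => z h1 h2 Oz.
    by rewrite h1// h2.
  have := measure_open_gt0 oU (conj Ox qx).
  rewrite ltNge; apply/negP; rewrite negbK -N0.
  apply: le_measure; rewrite ?inE//; first exact: open_measurable_rV.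
  move=> y [Oy qy]; apply: contrapT => Ny.
  by have := HN _ Oy Ny; rewrite leNgt qy.
move=> x0 Ox0.
have IE : I_ Wrad q = I%:E by rewrite fineK// Iq_fin_num.
rewrite IE -EFinM; set Rd := _ * I => dRd.
have BO : eball x0 Rd `<=` Omega by exact: dist_boundary_eball dRd.
set r := cal_radius n I.
have rR : r < Rd by exact: cal_radius_lt.
have r0 : 0 < r by exact: cal_radius_gt0.
(* The weak gradient is taken on the larger ball [B], because [weak_sob] needs room around the
   closure of [w]; the strict inequality of [cal_radius_lt] provides it. *)
pose r2 := (r + Rd) / 2.
have r2R : r2 < Rd by rewrite /r2; lra.
have rr2 : r < r2 by rewrite /r2; lra.
pose w := eball x0 r; pose B := eball x0 r2.
have ow : open w by exact: open_eball.
have oB : open B by exact: open_eball.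
have mw : measurable w by exact: open_measurable_rV.
have mB : measurable B by exact: open_measurable_rV.
have KB : ecball x0 r `<=` B by move=> y yr; exact: le_lt_trans rr2.
have ecO : ecball x0 r2 `<=` Omega by move=> y yr; apply: BO; exact: le_lt_trans r2R.
have BOm : B `<=` Omega by move=> y /eballW/ecO.
have clB : closure B `<=` Omega by move=> y /closure_eball/ecO.
have wB : w `<=` B by move=> y /eballW/KB.
have clw : closure w `<=` Omega by move=> y /closure_eball/KB/BOm.
have BM y : B y -> `|y| <= `|x0| + r2 by move=> /eballW; exact: ecball_norm.
have wM y : w y -> `|y| <= `|x0| + r by move=> /eballW; exact: ecball_norm.
have mut i : measurable_fun B (component i ut).
  apply: open_continuous_measurable_rV => // y; rewrite inE => By.
  exact: continuous_comp (cut _ (BOm _ By)) (@coord_continuous R 1 m ord0 i (ut y)).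
have aeB D : D `<=` Omega -> {ae lebesgue_rV n, forall x, D x -> u x = ut x}.
  by move=> DO; apply: filterS ut_eq_u => y h /DO/h.
have [G uG] := u_W12loc _ oB (bounded_eball x0 r2) clB.
have [wG _ LG] := W12_gradient_ae mB (aeB _ BOm) mut uG.
have su i : sob w (component i ut) (fun l => entry i l G).
  apply: (@weak_sob R n w B (ecball x0 r) _ _ (`|x0| + r2) q) => //.
  - exact: eballW.
  - exact: compact_ecball.
  - move=> y; rewrite inE => By.
    exact: continuous_comp (cut _ (BOm _ By)) (@coord_continuous R 1 m ord0 i (ut y)).
  - move=> y By; apply: le_trans (utq _ (BOm _ By)).
    exact: coord_le_enorm.
  - by move=> j; exact: LG.
  - by move=> g j tg; have [_ _] := wG i j; apply.
have [Gu' [_ L2u _]] := u_W12loc _ ow (bounded_eball x0 r) clw.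
have mu_ i : measurable_fun w (component i u) by have [] := L2u i.
apply: (vanishing_center a_nd a_le0 a_gt0 (radial_speed_le q_gt0 Wrad_nondecreasing Wrad_gt0) (radial_speed_left q_gt0 Wrad_0 Wrad_lsc Wrad_gt0) QF Q_le0 HF H_le0 H_gt0 QPF HPF (ltW q_gt0) _ W'_bounds mW' W'_drop n_gt0 I0 (ltW T0) TI HT aT _ su).
- by rewrite W'E ?e0 ?(ltW q_gt0).
- by move=> y /wB/BOm/cut.
- by move=> y /wB/BOm/utq.
move=> xi xi0 vq Gv wGv.
(* Minimality is known for [u] and [W], while the competitor is built from [ut] and [cutball q W];
   gradients and energies are carried over outside null sets. *)
have uut := aeB _ (subset_trans wB BOm).
have utu : {ae lebesgue_rV n, forall x, w x -> ut x = u x}.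
  by apply: filterS uut => y h wy; rewrite h.
have mxi i : measurable_fun w (component i xi).
  by have [Gxi [_ L2xi _] _] := xi0; have [] := L2xi i.
have wGu : weak_gradient w u G.
  apply: (weak_gradient_ae mw utu mu_).
  by have [] := sob_W12_gradient ow wM su.
have vE : {ae lebesgue_rV n, forall x, w x -> ut x + xi x = u x + xi x}.
  by apply: filterS utu => y h /h->.
have wGv' : weak_gradient w (fun x => u x + xi x) Gv.
  apply: (weak_gradient_ae mw vE _ wGv) => i.
  rewrite (_ : component i _ = component i u \+ component i xi); last first.
    by apply/funext => y; rewrite /component mxE.
  exact: measurable_funD.
have vq' : ae_bounded w q (fun x => u x + xi x).
  by apply: filterS vE => y h wy; rewrite -h// vq.
have := u_minimizer _ ow (bounded_eball x0 r) (@lipschitz_boundary_eball _ _ x0 r r0) clw _ _ xi0 erefl vq' _ _ wGu wGv'.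
rewrite (@energy_ae _ _ _ W W' w u ut); last first.
  by apply: filterS uut => y h wy; rewrite h// W'E// utq//; apply/BOm/wB.
rewrite (@energy_ae _ _ _ W W' w (fun x => u x + xi x) (fun x => ut x + xi x))//.
by apply: filterS vE => y h wy; rewrite -h// W'E// vq.
Qed.
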